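(* Let $n\ge 2$ be an even integer and let $\mu\ge 0$, $\nu^2\ge 0$ be constants. Assume $f\in\mathcal{C}^{\frac{n}{2}+1}([0,\infty)\times\mathbb{R}^n)$, $u_0\in\mathcal{C}^{\frac{n}{2}+2}(\mathbb{R}^n)$ and $u_1\in\mathcal{C}^{\frac{n}{2}+1}(\mathbb{R}^n)$. Then a representation formula for the (classical) solution $u$ of the Cauchy problem $$\begin{cases} u_{tt}-\Delta u+\frac{\mu}{1+t}u_t+\frac{\nu^2}{(1+t)^2}u=f(t,x), & x\in\mathbb{R}^n,\ t>0,\\ u(0,x)=u_0(x), & x\in\mathbb{R}^n,\\ u_t(0,x)=u_1(x), & x\in\mathbb{R}^n,\end{cases}$$ is given by $$\begin{aligned} u(t,x)&=(1+t)^{-\frac{\mu}{2}}w[u_0](t,x)+\frac{1}{2^{\sqrt{\delta}-1}}\int_0^t w[u_0](s,x)\,K_0(t,0;s;\mu,\nu^2)\,\mathrm{d}s\\ &\quad+\frac{1}{2^{\sqrt{\delta}-1}}\int_0^t w[u_1+\mu\,u_0](s,x)\,K_1(t,0;s;\mu,\nu^2)\,\mathrm{d}s\\ &\quad+\frac{1}{2^{\sqrt{\delta}-1}}\int_0^t\int_0^{t-b}w[f](s,x;b)\,E(t,0;b,s;\mu,\nu^2)\,\mathrm{d}s\,\mathrm{d}b,\end{aligned}$$ that is, the function $u$ defined by this formula is the solution of the Cauchy problem. Here, for a function $\varphi=\varphi(x)$ on $\mathbb{R}^n$ and for $f=f(t,x)$, $$w[\varphi](t,x)=\frac{1}{n!!}\,\frac{\partial}{\partial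 t}\Big(\frac1t\frac{\partial}{\partial t}\Big)^{\frac{n-2}{2}}\left(t^{n}\,\frac{1}{|B_t(x)|}\int_{B_t(x)}\frac{\varphi(z)}{(t^2-|z-x|^2)^{1/2}}\,\mathrm{d}z\right),\qquad w[f](t,x;b)=w[f(b,\cdot)](t,x).$$
   Context: Set $\delta=(\mu-1)^2-4\nu^2$; if $\delta<0$, $\sqrt{\delta}$ means $i\sqrt{-\delta}$, and powers of positive reals with complex exponents are $a^{c}=e^{c\log a}$. $\mathsf{F}(\alpha,\beta;\gamma;z)$ denotes Gauss' hypergeometric function (power series for $|z|<1$). For $t,b\ge 0$ and $x,y\in\mathbb{R}$ (real scalars, with $|y-x|<t+b+2$), the kernels are $$E(t,x;b,y;\mu,\nu^2)=(1+t)^{-\frac{\mu}{2}+\frac{1-\sqrt{\delta}}{2}}(1+b)^{\frac{\mu}{2}+\frac{1-\sqrt{\delta}}{2}}\big((t+b+2)^2-(y-x)^2\big)^{\frac{\sqrt{\delta}-1}{2}}\,\mathsf{F}\Big(\tfrac{1-\sqrt{\delta}}{2},\tfrac{1-\sqrt{\delta}}{2};1;\tfrac{(t-b)^2-(y-x)^2}{(t+b+2)^2-(y-x)^2}\Big),$$ $$K_0(t,x;y;\mu,\nu^2)=-\frac{\partial}{\partial b}E(t,x;b,y;\mu,\nu^2)\Big|_{b=0},\qquad K_1(t,x;y;\mu,\nu^2)=E(t,x;0,y;\mu,\nu^2).$$ $B_t(x)$ is the ball of radius $t$ centred at $x$ in $\mathbb{R}^n$, $|B_t(x)|$ its Lebesgue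 measure, and $j!!=j(j-2)\cdots2$ for even $j\ge2$. The function $w[\varphi]$ is the solution of the free wave equation $w_{tt}-\Delta w=0$ with data $w(0,x)=\varphi(x)$, $w_t(0,x)=0$; the formula for it holds for $t>0$ and $w[\varphi](0,x)=\varphi(x)$. Solutions are understood in the classical (pointwise) sense. *)

(* Defs.v *)
From HB Require Import structures.
From mathcomp Require Import all_boot all_order all_algebra.
From mathcomp Require Import all_classical all_reals all_analysis.
From mathcomp Require Import complex.

Set Implicit Arguments.
Unset Strict Implicit.
Unset Printing Implicit Defensive.

Import Order.TTheory GRing.Theory Num.Theory numFieldNormedType.Exports.

Local Open Scope classical_set_scope.
Local Open Scope ring_scope.
Local Open Scope complex_scope.

Section LebesgueMeasureRn.
Variable R : realType.

Local Notation T := (measurableTypeR R).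
Local Notation leb1 :=
  (@lebesgue_measure R : {sigma_finite_measure set T -> \bar R}).

Section step.
Variables (n : nat) (m : {sigma_finite_measure set (n.-tuple T) -> \bar R}).

Definition cons_pair (p : T * n.-tuple T) : n.+1.-tuple T :=
  [tuple of p.1 :: p.2].

Lemma measurable_cons_pair : measurable_fun [set: T * n.-tuple T] cons_pair.
Proof. exact: measurable_cons. Qed.

Definition lebesgue_step : set (n.+1.-tuple T) -> \bar R :=
  pushforward (leb1 \x m)%E cons_pair.

Let step0 : lebesgue_step set0 = 0%E.
Proof. by rewrite /lebesgue_step /pushforward preimage_set0 measure0. Qed.

Let step_ge0 A : (0 <= lebesgue_step A)%E.
Proof. by rewrite /lebesgue_step /pushforward measure_ge0. Qed.

Let step_sigma_additive : semi_sigma_additive lebesgue_step.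
Proof.
have mc := measurable_cons_pair.
move=> F mF tF mUF; rewrite /lebesgue_step /pushforward preimage_bigcup.
apply: measure_semi_sigma_additive.
- by move=> k; rewrite -[X in measurable X]setTI; exact: mc.
- apply/trivIsetP => /= i j _ _ ij; rewrite -preimage_setI.
  by move/trivIsetP : tF => /(_ _ _ _ _ ij) ->//; rewrite preimage_set0.
- by rewrite -preimage_bigcup -[X in measurable X]setTI; exact: mc.
Qed.

HB.instance Definition _ := isMeasure.Build _ _ _ lebesgue_step
  step0 step_ge0 step_sigma_additive.

Lemma lebesgue_step_cons (A : set T) (B : set (n.-tuple T)) :
  measurable A -> measurable B ->
  lebesgue_step [set z | A (thead z) /\ B [tuple of behead z]] =
  (leb1 A * m B)%E.
Proof.
move=> mA mB; rewrite -product_measure1E// /lebesgue_step /pushforward.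
congr (_ _); apply/seteqP; split => -[x z] /=.
- rewrite theadE => -[Ax]; rewrite [X in B X](_ : _ = z)//.
  by apply/val_inj.
- move=> [Ax Bz]; rewrite theadE; split => //.
  by rewrite [X in B X](_ : _ = z)//; apply/val_inj.
Qed.

Let step_sigma_finite : sigma_finite setT lebesgue_step.
Proof.
have /sigma_finiteP[F [TF ndF Foo]] := sigma_finiteT leb1.
have /sigma_finiteP[G [TG ndG Goo]] := sigma_finiteT m.
exists (fun k => [set z | F k (thead z) /\ G k [tuple of behead z]]).
  apply/esym; rewrite -subTset => z _.
  have : setT (thead z) by []. rewrite TF => -[i _ Fi].
  have : setT [tuple of behead z] by []. rewrite TG => -[j _ Gj].
  exists (maxn i j) => //=; split.
    by move: Fi; exact/subsetPset/ndF/leq_maxl.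
  by move: Gj; exact/subsetPset/ndG/leq_maxr.
move=> k; have [mF Fk] := Foo k; have [mG Gk] := Goo k; split.
  apply: measurableI.
    rewrite -[X in measurable X]setTI.
    exact: (@measurable_tnth _ T n.+1 ord0).
  rewrite -[X in measurable X]setTI.
  exact: (@measurable_behead _ T n).
by rewrite lebesgue_step_cons// lte_mul_pinfty// ge0_fin_numE.
Qed.

HB.instance Definition _ := Measure_isSigmaFinite.Build _ _ _ lebesgue_step
  step_sigma_finite.

End step.

(* Lebesgue measure on R^n, as the n-fold product of [lebesgue_measure];
   R^n is represented by tuples here because 'rV_n carries no measurable
   structure. *)
Fixpoint lebesgue_Rn (n : nat) :
    {sigma_finite_measure set (n.-tuple T) -> \bar R} :=
  match n with
  | 0 => \d_([tuple] : 0.-tuple T)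
  | k.+1 => lebesgue_step (lebesgue_Rn k)
  end.

Lemma lebesgue_Rn_box n (A : 'I_n -> set T) : (forall i, measurable (A i)) ->
  lebesgue_Rn n [set z | forall i, A i (tnth z i)] =
  (\prod_(i < n) leb1 (A i))%E.
Proof.
elim: n A => [|n ih] A mA.
  rewrite big_ord0 /= diracE mem_set//= => -[].
  by [].
rewrite big_ord_recl -ih// -lebesgue_step_cons//.
  congr (_ _); apply/seteqP; split => z /=.
    move=> Az; split; first exact: (Az ord0).
    move=> i; have := Az (lift ord0 i).
    by rewrite {1}(tuple_eta z) tnthS.
  move=> [A0 Az] i; have [->//|i0] := eqVneq i ord0.
  have [j ->] : exists j, i = lift ord0 j.
    by case: (unliftP ord0 i) i0 => [j ->|->]; [exists j|rewrite eqxx].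
  by have := Az j; rewrite (tuple_eta z) tnthS; congr (A _ (tnth _ _)); apply/val_inj.
rewrite [X in measurable X](_ : _ =
  \bigcap_(i in [set: 'I_n]) ((@tnth n T ^~ i) @^-1` A (lift ord0 i))).
  apply: fin_bigcap_measurable => // i _.
  by rewrite -[X in measurable X]setTI; exact: measurable_tnth.
apply/seteqP; split => z /= h i; first by move=> _; exact: h.
exact: (h i Logic.I).
Qed.

End LebesgueMeasureRn.

Section Smoothness.
Variables (R : realType) (V : normedModType R).

(* C^k on D: every iterated directional derivative of order at most k exists
   in the interior of D and extends continuously to D. For D = setT this is
   the usual C^k(V). *)
Fixpoint Ck (k : nat) (D : set V) (g : V -> R) : Prop :=
  {within D, continuous g} /\
  match k with
  | 0 => True
  | k'.+1 => forall v : V, exists2 h : V -> R,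
      Ck k' D h & forall x, (D°)%classic x -> is_derive x v g (h x)
  end.

End Smoothness.

Section ComplexTools.
Variable R : realType.
Implicit Types (g : R -> R[i]) (a : R) (c z : R[i]).

Definition cexp z : R[i] :=
  (expR (complex.Re z))%:C * (cos (complex.Im z) +i* sin (complex.Im z)).

(* a ^ c for a > 0 *)
Definition cpow a c : R[i] := cexp (c * (ln a)%:C).

Definition csqrt a : R[i] :=
  if 0 <= a then (Num.sqrt a)%:C else 0 +i* Num.sqrt (- a).

Definition cderive1 g a : R[i] :=
  derive1 (fun s => complex.Re (g s)) a +i*
  derive1 (fun s => complex.Im (g s)) a.

Definition cintegral (D : set R) g : R[i] :=
  (\int[lebesgue_measure]_(s in D) complex.Re (g s)) +i*
  (\int[lebesgue_measure]_(s in D) complex.Im (g s)).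

Definition pochhammer (c : R[i]) (k : nat) : R[i] := \prod_(i < k) (c + i%:R).

(* The limit is taken in R[i]^o, which carries the usual topology of the
   complex plane; R[i] itself is not declared as a topological space. *)
Definition hyp2F1 (al be ga z : R[i]) : R[i] :=
  limn (series (fun k : nat =>
    (pochhammer al k * pochhammer be k) / (pochhammer ga k * k`!%:R) * z ^+ k
      : R[i]^o)).

End ComplexTools.

Section Kernels.
Variable R : realType.
Implicit Types t x b y : R.

(* nu2 is the constant nu^2 *)
Definition delta (mu nu2 : R) : R := (mu - 1) ^+ 2 - 4 * nu2.

Definition kernelE (mu nu2 : R) t x b y : R[i] :=
  let sd := csqrt (delta mu nu2) in
  cpow (1 + t) (- (mu / 2)%:C + (1 - sd) / 2) *
  cpow (1 + b) ((mu / 2)%:C + (1 - sd) / 2) *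
  cpow ((t + b + 2) ^+ 2 - (y - x) ^+ 2) ((sd - 1) / 2) *
  hyp2F1 ((1 - sd) / 2) ((1 - sd) / 2) 1
    (((t - b) ^+ 2 - (y - x) ^+ 2) / ((t + b + 2) ^+ 2 - (y - x) ^+ 2))%:C.

(* The formula for [kernelE] is smooth in b near 0, so that the two-sided
   derivative is also the one-sided derivative from b >= 0. *)
Definition kernelK0 (mu nu2 : R) t x y : R[i] :=
  - cderive1 (fun b => kernelE mu nu2 t x b y) 0.

Definition kernelK1 (mu nu2 : R) t x y : R[i] := kernelE mu nu2 t x 0 y.

End Kernels.

Fixpoint double_factorial (m : nat) : nat :=
  match m with
  | k.+2 => (m * double_factorial k)%N
  | _ => 1
  end.

Section Wave.
Variables (R : realType) (n : nat).
Local Notation Rn := ('rV[R]_n).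
Implicit Types (x : Rn) (phi : Rn -> R) (f u : R -> Rn -> R) (t b s : R).

(* The norm of 'rV_n in the library is the sup norm. *)
Definition enorm x : R := Num.sqrt (\sum_(i < n) x 0 i ^+ 2).

Definition rV_of_tuple (z : n.-tuple (measurableTypeR R)) : Rn :=
  \row_i tnth z i.

Definition eball x t : set (n.-tuple (measurableTypeR R)) :=
  [set z | enorm (rV_of_tuple z - x) < t].

Definition ball_mean phi t x : R :=
  (fine (lebesgue_Rn R n (eball x t)))^-1 *
  \int[lebesgue_Rn R n]_(z in eball x t)
    (phi (rV_of_tuple z) / Num.sqrt (t ^+ 2 - enorm (rV_of_tuple z - x) ^+ 2)).

Definition wave phi t x : R :=
  if t == 0 then phi x else
  ((double_factorial n)%:R)^-1 *
  derive1 (iter ((n - 2) %/ 2) (fun (g : R -> R) r => r^-1 * derive1 g r)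
    (fun r => r ^+ n * ball_mean phi r x)) t.

Definition solution_formula (mu nu2 : R) f (u0 u1 : Rn -> R) t x : R[i] :=
  let c := 1 / cpow 2 (csqrt (delta mu nu2) - 1) in
  ((1 + t) `^ (- (mu / 2)) * wave u0 t x)%:C
  + c * cintegral `[0, t]
          (fun s => (wave u0 s x)%:C * kernelK0 mu nu2 t 0 s)
  + c * cintegral `[0, t]
          (fun s => (wave (fun z => u1 z + mu * u0 z) s x)%:C
                    * kernelK1 mu nu2 t 0 s)
  + c * cintegral `[0, t] (fun b => cintegral `[0, t - b]
          (fun s => (wave (f b) s x)%:C * kernelE mu nu2 t 0 b s)).

Definition half_space : set (R * Rn) := [set p | 0 <= p.1].

Definition laplacian phi x : R :=
  \sum_(i < n) 'D_(delta_mx 0 i) ('D_(delta_mx 0 i) phi) x.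

(* Values of f and u at negative times play no role. *)
Definition classical_solution (mu nu2 : R) f (u0 u1 : Rn -> R) u : Prop :=
  [/\ Ck 2 half_space (fun p => u p.1 p.2),
      forall t x, 0 < t ->
        derive1 (derive1 (u ^~ x)) t - laplacian (u t) x + mu / (1 + t) * derive1 (u ^~ x) t
        + nu2 / (1 + t) ^+ 2 * u t x = f t x,
      forall x, u 0 x = u0 x
    & forall x, h^-1 * (u h x - u 0 x) @[h --> 0^'+] --> u1 x].

End Wave.

(* Main.v *)
(* Write m = mu/2 and kap = (1 - delta)/4. Substituting u = (1+t)^(-m) U removes the first-order
   term and leaves U_tt - Lap U + kap (1+t)^(-2) U = F. With
     X = ((1+t)^2 + (1+b)^2 - s^2) / (2 (1+t) (1+b)),
   the kernel E is 2^(sqrt delta - 1) (1+t)^(-m) (1+b)^m G(t,s,b), where G = leg(X) and leg is the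
   solution with leg(1) = 1 of the Legendre equation (X^2-1) y'' + 2 X y' + kap y = 0; in
   particular G is real even if sqrt delta is imaginary. G is the Riemann function of
   d_tt - d_ss + kap (1+t)^(-2). If W solves the free wave equation and K one of the kernels G_s and
   m G + G_b, then W(t-b,x) - int_0^(t-b) W(s,x) K(t,s) ds solves the transformed equation; an
   integration by parts in s turns G_s into the kernel of the formula, and Duhamel's principle gives
   the source term.

   In even dimension n the formula for W comes from descent: integrating
   phi(z) / sqrt(t^2 - |z-x|^2) over a ball amounts to averaging phi over half-spheres of R^(n+1).
   These averages satisfy the Euler-Poisson-Darboux equation with parameter n, and the first-order
   operators r d_r + (k-1) lower the parameter k by 2 until r times the result solves the
   wave equation.

   For uniqueness, the half-sphere averages of the difference of two solutions are radial
   solutions of the equation in n+1 space variables, so the energy in the light cone with vertex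
   (Tm, x0) satisfies a Gronwall inequality. A classical solution is only smooth up to t = 0, and the
   time s = log t makes it a smooth function on the whole space. *)

(* Two obstacles shape the development. Derivatives are directional and pointwise, so neither
   linearity in the direction nor differentiation under an integral comes for free; the predicate
   [PC] therefore carries joint continuity in parameter, direction and point, and is stable under
   sums, products, affine substitutions and integrals. Moreover the functions in the formula make
   sense only for t >= 0 or inside a light cone; they are extended to the whole space ([posext],
   [Num.max b 0]), differentiated there, and the equations are checked in the physical region only.

   The orders of smoothness are forced: with n = 2 h + 2, lowering the parameter from n to 2 costs h
   derivatives, and h + 2 leave a C^2 solution; u0 needs one more because its wave W is already a
   time derivative. The factor 2^(sqrt delta - 1) comes from (t+b+2)^2 - (t-b)^2 = 4 (1+t) (1+b).
   The datum u1 + mu u0 appears because the part built from u0 alone starts with velocity - mu u0. G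
   is real because its equation has real coefficients and its regular solution is fixed by the value
   at the singular point X = 1. *)
Require Import Defs.
From mathcomp Require Import all_boot all_order all_algebra.
From mathcomp Require Import all_classical all_reals all_analysis.
From mathcomp Require Import complex measurable_realfun.
From mathcomp Require Import ring lra.
Set Implicit Arguments.
Unset Strict Implicit.
Unset Printing Implicit Defensive.
Import Order.TTheory GRing.Theory Num.Theory numFieldNormedType.Exports.
Local Open Scope classical_set_scope.
Local Open Scope ring_scope.

(** * Directional derivatives and integrals depending on parameters *)

Section DirectionalDerivatives.
Variables (R : realType) (E : normedModType R).
Implicit Types (F G : E -> R) (p v : E).

Lemma dv_ext F G p v d : F =1 G -> is_derive p v F d -> is_derive p v G d.
Proof. by move=> /funext ->. Qed.

Lemma dv_eq F p v d d' : is_derive p v F d -> d = d' -> is_derive p v F d'.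
Proof. by move=> h <-. Qed.

Lemma dv_unique F p v d d' : is_derive p v F d -> is_derive p v F d' -> d = d'.
Proof. by move=> [_ <-] [_ <-]. Qed.

Lemma dv_cst (c : R) p v : is_derive p v (fun _ : E => c) 0.
Proof. exact: is_derive_cst. Qed.

Lemma dv_add F G p v a b : is_derive p v F a -> is_derive p v G b ->
  is_derive p v (fun q => F q + G q) (a + b).
Proof. exact: is_deriveD. Qed.

Lemma dv_opp F p v a : is_derive p v F a -> is_derive p v (fun q => - F q) (- a).
Proof. exact: is_deriveN. Qed.

Lemma dv_sub F G p v a b : is_derive p v F a -> is_derive p v G b ->
  is_derive p v (fun q => F q - G q) (a - b).
Proof. exact: is_deriveB. Qed.

Lemma dv_mul F G p v a b : is_derive p v F a -> is_derive p v G b ->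
  is_derive p v (fun q => F q * G q) (a * G p + F p * b).
Proof.
move=> Fa Gb; have := is_deriveM Fa Gb.
rewrite /GRing.scale /= => h; apply: (dv_eq (d := F p * b + G p * a)) => //.
by rewrite addrC (mulrC a).
Qed.

Lemma dv_scale F p v a (c : R) : is_derive p v F a ->
  is_derive p v (fun q => c * F q) (c * a).
Proof.
by move=> Fa; apply: (dv_eq (dv_mul (dv_cst c p v) Fa)); rewrite mul0r add0r.
Qed.

Lemma dv_sum (I : Type) (r : seq I) (F : I -> E -> R) (d : I -> R) p v :
  (forall i, is_derive p v (F i) (d i)) ->
  is_derive p v (fun q => \sum_(i <- r) F i q) (\sum_(i <- r) d i).
Proof.
move=> h; elim: r => [|i r ih].
  rewrite big_nil; apply: dv_ext (dv_cst 0 p v) => q; by rewrite big_nil.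
rewrite big_cons; apply: dv_ext (dv_add (h i) ih) => q; by rewrite big_cons.
Qed.

(** Reduces a derivative in a normed space to one in a single real variable at 0. Later changes of
    variables (affine maps, slices, shifts) only rewrite the argument of [F] in this form. *)
Lemma dv_lineE F p v d : is_derive p v F d <->
  is_derive (0 : R) 1 (fun h : R => F (p + h *: v)) d.
Proof.
have E1 : (fun h : R => h^-1 *: ((F \o shift p) (h *: v) - F p)) =
   (fun h : R => h^-1 *: (((fun h : R => F (p + h *: v)) \o shift (0:R)) (h *: (1:R)) -
   F (p + 0 *: v))).
  apply/funext => h /=; rewrite scale0r addr0 addr0 /GRing.scale /= mulr1.
  by rewrite (addrC _ p).
split=> -[h1 h2]; split.
- by rewrite /derivable -E1.
- by rewrite /derive -E1.
- by rewrite /derivable E1.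
- by rewrite /derive E1.
Qed.

End DirectionalDerivatives.

Section MVT.
Variables (R : realType).

Lemma dv_line (E : normedModType R) (F : E -> R) p v d (s : R) : is_derive (p + s *: v) v F d ->
  is_derive s 1 (fun h : R => F (p + h *: v)) d.
Proof.
move=> /dv_lineE h; apply/dv_lineE; apply: dv_ext h => k /=.
by rewrite [k *: (1:R)]mulr1 scalerDl addrA.
Qed.

Lemma dv_comp (E : normedModType R) (g : R -> R) (F : E -> R) p v a b :
  is_derive (F p) 1 g a -> is_derive p v F b ->
  is_derive p v (fun q => g (F q)) (a * b).
Proof.
move=> ga /dv_lineE Fb; apply/dv_lineE.
apply: (is_derive1_comp _ Fb) => /=; by rewrite scale0r addr0.
Qed.

Lemma dv_id (x : R) : is_derive x 1 (fun y : R => y) 1.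
Proof. exact: is_derive_id. Qed.

Lemma dv_cont (f : R -> R) (x d : R) : is_derive x 1 f d -> {for x, continuous f}.
Proof. by move=> [/derivable1_diffP/differentiable_continuous]. Qed.

Lemma dv_scaledir (E : normedModType R) (F : E -> R) p v d (c : R) :
  is_derive p v F d -> is_derive p (c *: v) F (c * d).
Proof.
move=> /dv_lineE h; apply/dv_lineE.
have hc : is_derive (0:R) 1 (fun s : R => c * s) (c * 1) by apply: dv_scale; exact: dv_id.
apply: (@dv_ext _ _ (fun s => (fun h => F (p + h *: v)) (c * s))).
  by move=> s /=; rewrite scalerA (mulrC c).
have h0 : is_derive (c * 0 : R) 1 (fun h : R => F (p + h *: v)) d by rewrite mulr0.
by apply: (dv_eq (dv_comp h0 hc)); rewrite mulr1 mulrC.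
Qed.

Lemma MVT01 (f df : R -> R) : (forall s : R, 0 <= s <= 1 -> is_derive s 1 f (df s)) ->
  exists2 c, 0 <= c <= 1 & f 1 - f 0 = df c.
Proof.
move=> fd.
have [||c c01 ->] := @MVT_segment R f df 0 1 ler01.
- by move=> x; rewrite in_itv/= => /andP[x0 x1]; apply: fd; rewrite !ltW.
- apply: derivable_within_continuous => x; rewrite in_itv/= => x01.
  by have [] := fd x x01.
- by exists c; [move: c01; rewrite in_itv|rewrite subr0 mulr1].
Qed.

(** The derivative is used in the one direction [v] only, and the segment is parametrized by the
    unit interval so that [h] may have either sign. *)
Lemma MVT_line (E : normedModType R) (F dF : E -> R) (p v : E) (h : R) :
  (forall s : R, 0 <= s <= 1 -> is_derive (p + (s * h) *: v) v F (dF (p + (s * h) *: v))) ->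
  exists2 c, 0 <= c <= 1 & F (p + h *: v) - F p = h * dF (p + (c * h) *: v).
Proof.
move=> Fd.
have [s s01|c c01] := @MVT01 (fun s => F (p + s *: (h *: v)))
  (fun s => h * dF (p + (s * h) *: v)).
  by apply: dv_line; rewrite scalerA; apply: dv_scaledir; exact: Fd.
by rewrite scale1r scale0r addr0 => ->; exists c.
Qed.

Lemma dvP (E : normedModType R) (F : E -> R) p v d :
  is_derive p v F d <->
  (forall e, 0 < e -> \forall h \near (0:R), h != 0 ->
     `|h^-1 * (F (p + h *: v) - F p) - d| <= e).
Proof.
have EE : (fun h : R => h^-1 *: ((F \o shift p) (h *: v) - F p)) =
  (fun h : R => h^-1 * (F (p + h *: v) - F p)).
  by apply/funext => h /=; rewrite (addrC _ p).
split.
- move=> [h1 h2] e e0.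
  have : (h^-1 *: ((F \o shift p) (h *: v) - F p)) @[h --> (0:R)^'] --> d.
    by rewrite -h2; exact: h1.
  rewrite EE => /cvgrPdist_le/(_ _ e0) h3.
  have h4 : nbhs (0:R) (fun h : R => h != 0 ->
    `|d - h^-1 * (F (p + h *: v) - F p)| <= e) by exact: h3.
  by apply: filterS h4 => h hh h0; rewrite distrC; exact: hh.
- move=> H.
  have h3 : (h^-1 *: ((F \o shift p) (h *: v) - F p)) @[h --> (0:R)^'] --> d.
    rewrite EE; apply/cvgrPdist_le => e e0; have := H e e0.
    rewrite /dnbhs /within /prop_near1/= => H0.
    by apply: (@filterS R (nbhs (0:R)) _ _ _ _ H0) => h hh h0; rewrite distrC; exact: hh.
  by split; [apply/cvg_ex; exists d|apply/cvg_lim].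
Qed.

End MVT.

(** * Global continuity, with a syntax-directed tactic for it *)

Section GlobalContinuity.
Variables (R : realType) (T : topologicalType).
Implicit Types f g : T -> R.

Lemma ct_cst (U : topologicalType) (c : U) : continuous (fun _ : T => c).
Proof. by move=> x; exact: cst_continuous. Qed.

Lemma ct_id : continuous (fun x : T => x).
Proof. by move=> x; exact: cvg_id. Qed.

Lemma ct_add f g : continuous f -> continuous g -> continuous (fun x => f x + g x).
Proof. by move=> cf cg x; apply: continuousD; [exact: cf|exact: cg]. Qed.

Lemma ct_opp f : continuous f -> continuous (fun x => - f x).
Proof. by move=> cf x; apply: continuousN; exact: cf. Qed.

Lemma ct_sub f g : continuous f -> continuous g -> continuous (fun x => f x - g x).
Proof. by move=> cf cg x; apply: continuousB; [exact: cf|exact: cg]. Qed.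

Lemma ct_mul f g : continuous f -> continuous g -> continuous (fun x => f x * g x).
Proof. by move=> cf cg x; apply: continuousM; [exact: cf|exact: cg]. Qed.

Lemma ct_exp f n : continuous f -> continuous (fun x => f x ^+ n).
Proof.
move=> cf; elim: n => [|n ih].
  by rewrite (_ : (fun x => _) = (fun=> 1)); [exact: ct_cst|apply/funext => x; rewrite expr0].
rewrite (_ : (fun x => _) = (fun x => f x * f x ^+ n)); first exact: ct_mul.
by apply/funext => x; rewrite exprS.
Qed.

Lemma ct_comp (U V : topologicalType) (F : U -> V) (a : T -> U) :
  continuous F -> continuous a -> continuous (fun x => F (a x)).
Proof. by move=> cF ca x; apply: (@continuous_comp _ _ _ a F); [exact: ca|exact: cF]. Qed.

Lemma ct_pair (U V : topologicalType) (a : T -> U) (b : T -> V) :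
  continuous a -> continuous b -> continuous (fun x => (a x, b x)).
Proof. by move=> ca cb x; apply: cvg_pair; [exact: ca|exact: cb]. Qed.

Lemma ct_comp2 (U V W : topologicalType) (F : U -> V -> W) (a : T -> U) (b : T -> V) :
  continuous (fun q : U * V => F q.1 q.2) ->
  continuous a -> continuous b -> continuous (fun x => F (a x) (b x)).
Proof.
move=> cF ca cb; apply: (@ct_comp _ _ (fun q : U * V => F q.1 q.2) (fun x => (a x, b x))) => //.
exact: ct_pair.
Qed.

Lemma ct_fst (U V : topologicalType) (a : T -> U * V) : continuous a -> continuous (fun x => (a x).1).
Proof. by move=> ca; apply: ct_comp => // x; exact: cvg_fst. Qed.

Lemma ct_snd (U V : topologicalType) (a : T -> U * V) : continuous a -> continuous (fun x => (a x).2).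
Proof. by move=> ca; apply: ct_comp => // x; exact: cvg_snd. Qed.

Lemma ct_sum (I : Type) (r : seq I) (F : I -> T -> R) : (forall i, continuous (F i)) ->
  continuous (fun x => \sum_(i <- r) F i x).
Proof.
move=> h; elim: r => [|i r ih].
  by rewrite (_ : (fun x => _) = (fun=> 0)); [exact: ct_cst|apply/funext => x; rewrite big_nil].
rewrite (_ : (fun x => _) = (fun x => F i x + \sum_(i <- r) F i x)); first exact: ct_add.
by apply/funext => x; rewrite big_cons.
Qed.

Lemma ct_addE (E : normedModType R) (f g : T -> E) :
  continuous f -> continuous g -> continuous (fun x => f x + g x).
Proof. by move=> cf cg x; apply: continuousD; [exact: cf|exact: cg]. Qed.

Lemma ct_scaleE (E : normedModType R) (f : T -> R) (g : T -> E) :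
  continuous f -> continuous g -> continuous (fun x => f x *: g x).
Proof. by move=> cf cg x; apply: continuousZ; [exact: cf|exact: cg]. Qed.

Lemma ct_cos f : continuous f -> continuous (fun x => cos (f x)).
Proof. by move=> cf; apply: ct_comp => //; exact: continuous_cos. Qed.

Lemma ct_sin f : continuous f -> continuous (fun x => sin (f x)).
Proof. by move=> cf; apply: ct_comp => //; exact: continuous_sin. Qed.

End GlobalContinuity.

(** A hook of [ctn1], redefined once [hemi] and [embed0] have continuity lemmas. *)
Ltac ctn_ext := fail.

Ltac ctn1 := cbv beta;
  match goal with
  | |- forall y, continuous_at y (fun _ => ?c) => exact: (@ct_cst _ _ c)
  | |- forall y, continuous_at y (fun x => GRing.add (@?a x) (@?b x)) =>
      first [apply: (@ct_add _ _ a b) | apply: (@ct_addE _ _ _ a b)]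
  | |- forall y, continuous_at y (fun x => GRing.opp (@?a x)) => apply: (@ct_opp _ _ a)
  | |- forall y, continuous_at y (fun x => GRing.mul (@?a x) (@?b x)) =>
      apply: (@ct_mul _ _ a b)
  | |- forall y, continuous_at y (fun x => GRing.exp (@?a x) ?n) =>
      apply: (@ct_exp _ _ a n)
  | |- forall y, continuous_at y (fun x => GRing.scale (@?a x) (@?b x)) =>
      apply: (@ct_scaleE _ _ _ a b)
  | |- forall y, continuous_at y (fun x => cos (@?a x)) => apply: (@ct_cos _ _ a)
  | |- forall y, continuous_at y (fun x => sin (@?a x)) => apply: (@ct_sin _ _ a)
  | |- forall y, continuous_at y (fun x => fst (@?a x)) => apply: (@ct_fst _ _ _ a)
  | |- forall y, continuous_at y (fun x => snd (@?a x)) => apply: (@ct_snd _ _ _ a)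
  | |- forall y, continuous_at y (fun x => pair (@?a x) (@?b x)) =>
      apply: (@ct_pair _ _ _ a b)
  | |- forall y, continuous_at y (fun x => x) => exact: ct_id
  | |- forall y, continuous_at y (@fst _ _) => exact: (ct_fst (@ct_id _))
  | |- forall y, continuous_at y (@snd _ _) => exact: (ct_snd (@ct_id _))
  | |- forall y, continuous_at y (pair _) => exact: (ct_pair (@ct_cst _ _ _) (@ct_id _))
  | |- _ => ctn_ext
  | H : forall y, continuous_at y ?f |- forall y, continuous_at y ?f => exact H
  | |- _ => assumption
  end.

Ltac ctn := repeat ctn1.

(** * Oriented integrals over segments of the line *)

Section OrientedIntegral.
Variable R : realType.
Implicit Types (g h F G : R -> R) (a b c x y : R).
Local Notation mu := (@lebesgue_measure R).

(** The sign for [b < a] makes the integral of a continuous function differentiable in its end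
    points on the whole line, so that an upper limit such as [p.1 - b] may become negative. *)
Definition oint a b g : R :=
  if a <= b then \int[mu]_(s in `[a, b]) g s else - \int[mu]_(s in `[b, a]) g s.

Lemma continuous_integrable g a b : continuous g -> mu.-integrable `[a, b] (EFin \o g).
Proof.
move=> cg; apply: continuous_compact_integrable; first exact: segment_compact.
exact: continuous_subspaceT.
Qed.

Lemma ointE a b g : a <= b -> oint a b g = \int[mu]_(s in `[a, b]) g s.
Proof. by rewrite /oint => ->. Qed.

Lemma oint_shift g a y : continuous g -> a <= y -> a <= 0 ->
  oint 0 y g = \int[mu]_(s in `[a, y]) g s - \int[mu]_(s in `[a, 0]) g s.
Proof.
move=> cg ay a0; rewrite /oint; have [y0|y0] := leP 0 y.
  rewrite (@Rintegral_itvB _ g (BLeft a) (BRight y) 0) ?bnd_simp//; last first.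
    exact: continuous_integrable.
  rewrite Rintegral_itv_obnd_cbnd//.
  apply: integrableS (continuous_integrable 0 y cg) => //.
  by apply: subset_itvr; rewrite bnd_simp.
rewrite -opprB (@Rintegral_itvB _ g (BLeft a) (BRight 0) y) ?bnd_simp//; last 2 first.
- exact: continuous_integrable.
- exact: ltW.
rewrite Rintegral_itv_obnd_cbnd//.
apply: integrableS (continuous_integrable y 0 cg) => //.
by apply: subset_itvr; rewrite bnd_simp.
Qed.

Lemma oint0_derive g x : continuous g -> is_derive x 1 (fun y => oint 0 y g) (g x).
Proof.
(* With [a] below both 0 and [x], the oriented integral is a difference of two integrals from [a],
   and the fundamental theorem applies at the interior point [x]. *)
move=> cg; pose a := Num.min x 0 - 1.
have ax : a < x.
  by rewrite /a; have [x0|x0] := leP x 0; lra.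
have a0 : a <= 0 by rewrite /a; have [x0|x0] := leP x 0; lra.
have x1 : x < x + 1 by rewrite ltrDl.
have [d1 d2] := @continuous_FTC1_closed R g a x (x + 1) x1
  (continuous_integrable a (x+1) cg) ax (cg x).
pose I (y : R) := \int[mu]_(s in `[a, y]) g s.
have IE y : a <= y -> oint 0 y g = I y - I 0 by move=> ay; exact: oint_shift.
have D : is_derive x 1 I (g x) by exact: (DeriveDef d1 (etrans (esym (derive1E _ _)) d2)).
have H : is_derive x 1 (fun y => I y - I 0) (g x - 0).
  exact: (dv_sub D (dv_cst _ _ _)).
rewrite subr0 in H; move: I IE D H => I IE _ H.
apply/dvP => e e0; have /dvP/(_ e e0) H' := H.
have N : \forall k \near (0:R), a < x + k.
  have : \forall k \near (0:R), `|k| < x - a.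
    by apply: (@nbhs0_lt _ R^o); rewrite subr_gt0.
  apply: filterS => k; rewrite ltr_norml => /andP[k1 _]; lra.
apply: filterS2 N H' => k ak Hk k0.
rewrite !IE//; first exact: Hk.
- exact: ltW.
- by apply/ltW; rewrite [k *: _]mulr1.
Qed.

(** Chasles' relation, linearity, substitution and integration by parts below all follow from this
    by exhibiting an antiderivative, without returning to the measure. *)
Lemma oint_FTC G g a b : continuous g -> (forall x, is_derive x 1 G (g x)) ->
  oint a b g = G b - G a.
Proof.
move=> cg dG.
have H c d : c < d -> \int[mu]_(s in `[c, d]) g s = G d - G c.
  move=> cd; rewrite /Rintegral (@continuous_FTC2 _ g G)//.
  - exact: continuous_subspaceT.
  - split.
    + by move=> x _; have [] := dG x.
    + by apply: cvg_at_right_filter; exact: (dv_cont (dG c)).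
    + by apply: cvg_at_left_filter; exact: (dv_cont (dG d)).
  - by move=> x _; rewrite derive1E; have [_ ->] := dG x.
rewrite /oint; case: ltgtP => [ab|ba|->].
- exact: H.
- by rewrite H// opprB.
- by rewrite set_itv1 Rintegral_set1 subrr.
Qed.

Lemma oint_chasles g a b : continuous g -> oint a b g = oint 0 b g - oint 0 a g.
Proof.
by move=> cg; apply: (@oint_FTC (fun y => oint 0 y g)) => // x; exact: oint0_derive.
Qed.

Lemma oint_derive g a x : continuous g -> is_derive x 1 (fun y => oint a y g) (g x).
Proof.
move=> cg; have := dv_sub (oint0_derive x cg) (dv_cst (oint 0 a g) x 1).
by rewrite subr0; apply: dv_ext => y; rewrite (oint_chasles a)//.
Qed.

Lemma oint_cat g a b c : continuous g -> oint a b g + oint b c g = oint a c g.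
Proof. by move=> cg; rewrite (oint_chasles a b cg) (oint_chasles b c cg) (oint_chasles a c cg); ring. Qed.

Lemma oint_aa g a : oint a a g = 0.
Proof. by rewrite /oint lexx set_itv1 Rintegral_set1. Qed.

Lemma oint_opp_swap g a b : continuous g -> oint a b g = - oint b a g.
Proof. by move=> cg; rewrite (oint_chasles a b cg) (oint_chasles b a cg); ring. Qed.

Lemma oint_add g h a b : continuous g -> continuous h ->
  oint a b (fun s => g s + h s) = oint a b g + oint a b h.
Proof.
move=> cg ch; have c1 : continuous (fun s => g s + h s).
  by ctn.
rewrite (oint_FTC a b c1 (fun x => dv_add (oint_derive a x cg) (oint_derive a x ch))).
by rewrite !oint_aa addr0 subr0.
Qed.

Lemma oint_scale g k a b : continuous g -> oint a b (fun s => k * g s) = k * oint a b g.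
Proof.
move=> cg; have c1 : continuous (fun s => k * g s).
  by move=> x; apply: continuousM; [exact: cst_continuous|exact: cg].
rewrite (oint_FTC a b c1 (fun x => dv_scale k (oint_derive a x cg))).
by rewrite !oint_aa mulr0 subr0.
Qed.

Lemma oint_opp g a b : continuous g -> oint a b (fun s => - g s) = - oint a b g.
Proof.
move=> cg; rewrite -mulN1r -oint_scale//; congr oint.
by apply/funext => x; rewrite mulN1r.
Qed.

Lemma oint_sub g h a b : continuous g -> continuous h ->
  oint a b (fun s => g s - h s) = oint a b g - oint a b h.
Proof.
move=> cg ch; rewrite (@oint_add g (fun s => - h s))// ?oint_opp// => x.
by apply: continuousN; exact: ch.
Qed.

Lemma oint_cst k a b : oint a b (fun=> k) = k * (b - a).
Proof.
have c1 : continuous (fun _ : R => k * 1) by move=> x; exact: cst_continuous.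
by have := oint_FTC a b c1 (fun x => dv_scale k (dv_id x)); rewrite mulr1 mulrBr.
Qed.

Lemma eq_oint g h a b : (forall s, Num.min a b <= s <= Num.max a b -> g s = h s) ->
  oint a b g = oint a b h.
Proof.
rewrite /oint => e; case: ifPn => [ab|]; [|rewrite -ltNge => ba; congr -%R];
  apply: eq_Rintegral => s; rewrite inE/= in_itv/= => sab; apply: e.
- by rewrite min_l// max_r.
- by rewrite min_r ?max_l// ltW.
Qed.

Lemma oint_subst g u v a b : continuous g -> continuous v ->
  (forall x, is_derive x 1 u (v x)) ->
  oint (u a) (u b) g = oint a b (fun s => g (u s) * v s).
Proof.
move=> cg cv du.
have c1 : continuous (fun s => g (u s) * v s).
  move=> x; apply: continuousM; last exact: cv.
  by apply: (continuous_comp (dv_cont (du x))); exact: cg.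
by rewrite (oint_FTC a b c1 (fun x => dv_comp (oint_derive (u a) (u x) cg) (du x)))
  oint_aa subr0.
Qed.

Lemma oint_ibp (F G f g : R -> R) a b : continuous f -> continuous g ->
  (forall x, is_derive x 1 F (f x)) -> (forall x, is_derive x 1 G (g x)) ->
  oint a b (fun s => F s * g s) =
  F b * G b - F a * G a - oint a b (fun s => f s * G s).
Proof.
move=> cf cg dF dG.
have cF : continuous F by move=> x; exact: (dv_cont (dF x)).
have cG : continuous G by move=> x; exact: (dv_cont (dG x)).
have c1 : continuous (fun s => F s * g s).
  by move=> x; apply: continuousM; [exact: cF|exact: cg].
have c2 : continuous (fun s => f s * G s).
  by move=> x; apply: continuousM; [exact: cf|exact: cG].
have c3 : continuous (fun s => f s * G s + F s * g s).
  by ctn.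
by rewrite -(oint_FTC a b c3 (fun x => dv_mul (dF x) (dG x))) (oint_add _ _ c2 c1); ring.
Qed.

Lemma ler_oint g h a b : a <= b -> continuous g -> continuous h ->
  (forall s, a <= s <= b -> g s <= h s) -> oint a b g <= oint a b h.
Proof.
move=> ab cg ch gh; rewrite !ointE//; apply: le_Rintegral => //.
- exact: continuous_integrable.
- exact: continuous_integrable.
Qed.

Lemma oint_ge0 g a b : a <= b -> (forall s, a <= s <= b -> 0 <= g s) -> 0 <= oint a b g.
Proof. by move=> ab gh; rewrite ointE//; apply: Rintegral_ge0 => x /=; rewrite in_itv; exact: gh. Qed.

Lemma ler_norm_oint g a b M : continuous g ->
  (forall s, Num.min a b <= s <= Num.max a b -> `|g s| <= M) ->
  `|oint a b g| <= M * `|b - a|.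
Proof.
move=> cg; wlog ab : a b / a <= b => [H|].
  move=> gM; have [ab|ba] := leP a b; first exact: H.
  rewrite oint_opp_swap// normrN distrC; apply: H; first exact: ltW.
  by move=> s; rewrite minC maxC; exact: gM.
rewrite min_l// max_r// => gM; rewrite (ger0_norm (_ : 0 <= b - a)) ?subr_ge0//.
rewrite -oint_cst ler_norml -oint_opp; last by move=> x; exact: cst_continuous.
by apply/andP; split; apply: ler_oint => //; do ?[by move=> x; exact: cst_continuous];
  move=> s sab; have := gM s sab; rewrite ler_norml => /andP[].
Qed.

End OrientedIntegral.

(** * Dependence of integrals on parameters, linearity in the direction, symmetry of second
    derivatives *)

Section ParameterIntegral.
Variable R : realType.

(** Compactness of the segment: finitely many of the neighbourhoods [U] cover it, so the local
    conditions on [t] hold simultaneously. *)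
Lemma near_segment (T : Type) (F : set_system T) {FF : Filter F} (a b : R)
    (P : T -> R -> Prop) :
  (forall s : R, exists2 U : set R, nbhs s U & \forall t \near F, forall s', U s' -> P t s') ->
  \forall t \near F, forall s : R, Num.min a b <= s <= Num.max a b -> P t s.
Proof.
move=> H; have := @segment_compact R (Num.min a b) (Num.max a b).
move=> /compact_near_coveringP/(_ T F P FF) K.
have : \forall t \near F, `[Num.min a b, Num.max a b] `<=` P t.
  apply: K => s _; have [U sU tU] := H s.
  by exists (U, [set t | forall s', U s' -> P t s']) => //= -[s' t] /= [Us' +]; exact.
by apply: filterS => t tP s sab; apply: tP; rewrite /= in_itv.
Qed.

Lemma continuous_oint (T : topologicalType) (F : T -> R -> R) (a b : R) :
  continuous (fun q : T * R => F q.1 q.2) ->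
  continuous (fun l => oint a b (F l)).
Proof.
move=> cF l.
have cFl k : continuous (F k) by apply: (ct_comp2 cF); ctn.
apply/cvgrPdist_le => e e0.
(* The summand 1 covers the case [a = b]. *)
pose d := e / (`|b - a| + 1).
have d0 : 0 < d by rewrite divr_gt0// ltr_wpDl.
have : \forall k \near l, forall s : R, Num.min a b <= s <= Num.max a b -> `|F l s - F k s| <= d.
  apply: near_segment => s.
  have /cvgrPdist_le/(_ (d / 2)) := cF (l, s).
  rewrite divr_gt0// => /(_ isT) [[A B] /= [lA sB] AB].
  have Al := nbhs_singleton lA.
  exists B => //; apply: filterS lA => k Ak s' Bs'.
  have h1 := AB (k, s') (conj Ak Bs').
  have h2 := AB (l, s') (conj Al Bs').
  rewrite /= in h1 h2; move: h1 h2; rewrite !ler_norml => /andP[? ?] /andP[? ?].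
  by apply/andP; split; lra.
apply: filterS => k Hk; rewrite -oint_sub//.
apply: (le_trans (@ler_norm_oint R _ a b d _ _)) => //.
  by apply: ct_sub; exact: cFl.
by rewrite /d mulrAC ler_pdivrMr ?ltr_wpDl// ler_pM2l// lerDl.
Qed.

Lemma continuous_oint_end (T : topologicalType) (F : T -> R -> R) (a b : T -> R) :
  continuous (fun q : T * R => F q.1 q.2) -> continuous a -> continuous b ->
  continuous (fun l => oint (a l) (b l) (F l)).
Proof.
move=> cF ca cb.
have cFl k : continuous (F k) by apply: (ct_comp2 cF); ctn.
(* The affine substitution from [0, 1] moves the end points into the integrand, where they are
   ordinary parameters. *)
have -> : (fun l => oint (a l) (b l) (F l)) =
  (fun l => oint 0 1 (fun s => F l (a l + s * (b l - a l)) * (b l - a l))).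
  apply/funext => l.
  have du (x : R) : is_derive x 1 (fun s : R => a l + s * (b l - a l)) (b l - a l).
    apply: dv_eq (dv_add (dv_cst (a l) x 1) (dv_mul (dv_id x) (dv_cst (b l - a l) x 1))) _.
    by ring.
  rewrite -(oint_subst 0 1 (cFl l) _ du); first by rewrite mul0r mul1r addr0 addrC subrK.
  by move=> x; exact: cst_continuous.
have ca1 : continuous (fun q : T * R => a q.1) by apply: ct_comp ca _; ctn.
have cb1 : continuous (fun q : T * R => b q.1) by apply: ct_comp cb _; ctn.
apply: continuous_oint; apply: ct_mul; last by ctn.
by apply: (ct_comp2 cF); ctn.
Qed.

Lemma near_small2 (E : normedModType R) (A : set E) (p v w : E) : nbhs p A ->
  \forall h \near (0:R), forall c c' : R, 0 <= c <= 1 -> 0 <= c' <= 1 ->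
    A (p + (c * h) *: v + (c' * h) *: w).
Proof.
move=> /nbhs_ballP[r /= r0 rA].
have : \forall h \near (0:R), `|h| < r / (`|v| + `|w| + 1).
  by apply: (@nbhs0_lt _ R^o); rewrite divr_gt0// ltr_wpDl// addr_ge0.
apply: filterS => h hr c c' /andP[c0 c1] /andP[c'0 c'1]; apply: rA.
rewrite -ball_normE /ball_/= -addrA opprD addNKr normrN.
rewrite ltr_pdivlMr ?ltr_wpDl// ?addr_ge0// in hr.
apply: le_lt_trans hr; apply: (le_trans (ler_normD _ _)).
rewrite (normrZ (c * h) v) (normrZ (c' * h) w) (normrM c h) (normrM c' h).
rewrite (ger0_norm c0) (ger0_norm c'0).
have h0 : 0 <= `|h| by [].
apply: (@le_trans _ _ (`|h| * `|v| + `|h| * `|w|)); last by rewrite -mulrDr ler_wpM2l// lerDl.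
by apply: lerD; rewrite ler_wpM2r// ler_piMl.
Qed.

Lemma near_small (E : normedModType R) (A : set E) (p v : E) : nbhs p A ->
  \forall h \near (0:R), forall c : R, 0 <= c <= 1 -> A (p + (c * h) *: v).
Proof.
move=> /(near_small2 v 0); apply: filterS => h H c c01.
have := H c 0 c01; rewrite lexx ler01 => /(_ isT).
by rewrite mul0r scale0r addr0.
Qed.

(** The increment is split into a step along [v] followed by one along [w]; the mean value theorem
    on each leg and continuity of the two derivatives at [p] give the limit. No differentiability in
    the sense of Fréchet is assumed. *)
Lemma dv_diradd (E : normedModType R) (F Dv Dw : E -> R) (p v w : E) :
  (\forall q \near p, is_derive q v F (Dv q)) ->
  (\forall q \near p, is_derive q w F (Dw q)) ->
  {for p, continuous Dv} -> {for p, continuous Dw} ->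
  is_derive p (v + w) F (Dv p + Dw p).
Proof.
move=> dv dw cv cw; apply/dvP => e e0.
have /cvgrPdist_le/(_ (e / 2)) := cv; rewrite divr_gt0// => /(_ isT) nv.
have /cvgrPdist_le/(_ (e / 2)) := cw; rewrite divr_gt0// => /(_ isT) nw.
have N : \forall q \near p, (is_derive q v F (Dv q) /\ is_derive q w F (Dw q)) /\
    (`|Dv p - Dv q| <= e / 2 /\ `|Dw p - Dw q| <= e / 2).
  by apply: filterI; apply: filterI.
have := near_small2 v w N; apply: filterS => h H h0.
have h1 c : 0 <= c <= 1 -> is_derive (p + (c * h) *: v) v F (Dv (p + (c * h) *: v)) /\
    `|Dv p - Dv (p + (c * h) *: v)| <= e / 2.
  move=> c01; have := H c 0 c01; rewrite lexx ler01 => /(_ isT).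
  by rewrite mul0r scale0r addr0 => -[[? ?] [? ?]].
have h2 c : 0 <= c <= 1 -> is_derive (p + h *: v + (c * h) *: w) w F (Dw (p + h *: v + (c * h) *: w)) /\
    `|Dw p - Dw (p + h *: v + (c * h) *: w)| <= e / 2.
  move=> c01; have := H 1 c; rewrite lexx ler01 mul1r => /(_ isT c01).
  by move=> -[[? ?] [? ?]].
have [|c c01 E1] := @MVT_line R E F Dv p v h; first by move=> c c01; have [] := h1 c c01.
have [|c' c'01 E2] := @MVT_line R E F Dw (p + h *: v) w h.
  by move=> c' c'01; have [] := h2 c' c'01.
have [_ b1] := h1 c c01; have [_ b2] := h2 c' c'01.
have -> : F (p + h *: (v + w)) - F p = h * (Dw (p + h *: v + (c' * h) *: w) + Dv (p + (c * h) *: v)).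
  by rewrite mulrDr -E1 -E2 scalerDr addrA; ring.
rewrite mulrA mulVf// mul1r; move: b1 b2; rewrite !ler_norml => /andP[? ?] /andP[? ?].
by apply/andP; split; lra.
Qed.

(** The second difference over a small parallelogram with sides [h *: v] and [h *: w] is, by two
    mean value theorems in either order, [h ^+ 2] times a value of [Dvw] and times a value of [Dwv].
    A single side length [h] is enough for each [e]. *)
Lemma schwarz (E : normedModType R) (F Dv Dw Dvw Dwv : E -> R) (p v w : E) :
  (\forall q \near p, is_derive q v F (Dv q)) ->
  (\forall q \near p, is_derive q w F (Dw q)) ->
  (\forall q \near p, is_derive q w Dv (Dvw q)) ->
  (\forall q \near p, is_derive q v Dw (Dwv q)) ->
  {for p, continuous Dvw} -> {for p, continuous Dwv} ->
  Dvw p = Dwv p.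
Proof.
move=> dv dw dvw dwv cvw cwv; apply/eqP; rewrite -subr_eq0 -normr_le0.
apply/ler_addgt0Pl => e e0; rewrite addr0.
have /cvgrPdist_le/(_ (e / 2)) := cvw; rewrite divr_gt0// => /(_ isT) nvw.
have /cvgrPdist_le/(_ (e / 2)) := cwv; rewrite divr_gt0// => /(_ isT) nwv.
have N : \forall q \near p, ((is_derive q v F (Dv q) /\ is_derive q w F (Dw q)) /\
      (is_derive q w Dv (Dvw q) /\ is_derive q v Dw (Dwv q))) /\
    (`|Dvw p - Dvw q| <= e / 2 /\ `|Dwv p - Dwv q| <= e / 2).
  by do !apply: filterI.
have [r /= r0 H] := near_small2 v w N.
pose h := r / 2.
have h0 : h != 0 by rewrite gt_eqF// divr_gt0.
have hr : ball_ [eta Num.Def.normr] (0:R) r h by rewrite /ball_/= sub0r normrN ger0_norm /h; lra.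
have {}H := H h hr.
have i01 : 0 <= (1:R) <= 1 by rewrite ler01 lexx.
have i00 : 0 <= (0:R) <= 1 by rewrite ler01 lexx.
have [c1 c101 E1] : exists2 c, 0 <= c <= 1 &
   (F (p + h *: v + h *: w) - F (p + h *: v)) - (F (p + h *: w) - F p) =
   h * (Dv (p + (c * h) *: v + h *: w) - Dv (p + (c * h) *: v)).
  have [|c c01 Ec] := @MVT_line R E (fun q => F (q + h *: w) - F q)
     (fun q => Dv (q + h *: w) - Dv q) p v h.
    move=> c c01; have [[[d1 _] _] _] := H c 1 c01 i01.
    have [[[d2 _] _] _] := H c 0 c01 i00.
    rewrite mul0r scale0r addr0 in d2; rewrite mul1r in d1.
    apply: dv_sub d2.
    move/dv_lineE in d1; apply/dv_lineE; apply: dv_ext d1 => k /=; congr F.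
    by rewrite addrAC.
  by exists c => //; rewrite -Ec addrAC; ring.
have [c2 c201 E2] : exists2 c, 0 <= c <= 1 &
   (F (p + h *: v + h *: w) - F (p + h *: w)) - (F (p + h *: v) - F p) =
   h * (Dw (p + (c * h) *: w + h *: v) - Dw (p + (c * h) *: w)).
  have [|c c01 Ec] := @MVT_line R E (fun q => F (q + h *: v) - F q)
     (fun q => Dw (q + h *: v) - Dw q) p w h.
    move=> c c01; have [[[_ d1] _] _] := H 1 c i01 c01.
    have [[[_ d2] _] _] := H 0 c i00 c01.
    rewrite mul0r scale0r addr0 in d2; rewrite mul1r addrAC in d1.
    apply: dv_sub d2.
    move/dv_lineE in d1; apply/dv_lineE; apply: dv_ext d1 => k /=; congr F.
    by rewrite -!addrA; congr (_ + _); congr (_ + _); exact: addrC.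
  by exists c => //; rewrite -Ec (addrAC p); ring.
have [c3 c301 E3] : exists2 c, 0 <= c <= 1 &
    Dv (p + (c1 * h) *: v + h *: w) - Dv (p + (c1 * h) *: v) =
    h * Dvw (p + (c1 * h) *: v + (c * h) *: w).
  apply: (@MVT_line R E Dv Dvw) => c c01.
  by have [[_ [d _]] _] := H c1 c c101 c01.
have [c4 c401 E4] : exists2 c, 0 <= c <= 1 &
    Dw (p + (c2 * h) *: w + h *: v) - Dw (p + (c2 * h) *: w) =
    h * Dwv (p + (c2 * h) *: w + (c * h) *: v).
  apply: (@MVT_line R E Dw Dwv) => c c01.
  by have [[_ [_ d]] _] := H c c2 c01 c201; rewrite addrAC.
have E5 : Dvw (p + (c1 * h) *: v + (c3 * h) *: w) = Dwv (p + (c4 * h) *: v + (c2 * h) *: w).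
  apply: (mulfI h0); apply: (mulfI h0); rewrite -E3 -E1 (addrAC p ((c4 * h) *: v)) -E4 -E2; ring.
have [_ [b1 _]] := H c1 c3 c101 c301; have [_ [_ b2]] := H c4 c2 c401 c201.
rewrite E5 in b1; move: b1 b2; rewrite !ler_norml => /andP[? ?] /andP[? ?].
by apply/andP; split; lra.
Qed.

(** The mean value theorem replaces the difference quotient by [dF s] at an intermediate point,
    which by compactness is close to [dF s p] uniformly in [s]. *)
Lemma oint_derive_param (E : normedModType R) (F dF : R -> E -> R) (p v : E) (a b : R) :
  (\forall q \near p, forall s, is_derive q v (F s) (dF s q)) ->
  (forall s, {for (s, p), continuous (fun r : R * E => dF r.1 r.2)}) ->
  (\forall q \near p, continuous (F ^~ q)) ->
  is_derive p v (fun q => oint a b (F ^~ q)) (oint a b (dF ^~ p)).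
Proof.
move=> dFd cdF cF; apply/dvP => e e0.
have cdp : continuous (dF ^~ p).
  move=> s; apply: (@continuous_comp _ _ _ (fun s => (s, p)) (fun r : R * E => dF r.1 r.2)).
    by apply: ct_pair; ctn.
  exact: cdF.
pose d := e / (`|b - a| + 1).
have d0 : 0 < d by rewrite divr_gt0// ltr_wpDl.
have small (A : set E) : nbhs p A ->
    \forall h \near (0:R), forall c : R, 0 <= c <= 1 -> A (p + (c * h) *: v).
  by move=> pA; apply: near_small.
have unif : \forall h \near (0:R), forall s : R, Num.min a b <= s <= Num.max a b ->
    h != 0 -> `|h^-1 * (F s (p + h *: v) - F s p) - dF s p| <= d.
  apply: (@near_segment R (nbhs (0:R)) _ a b
    (fun h s => h != 0 -> `|h^-1 * (F s (p + h *: v) - F s p) - dF s p| <= d)) => s.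
  have /cvgrPdist_le/(_ (d / 2)) := cdF s.
  rewrite divr_gt0// => /(_ isT) [[A B] /= [sA pB] AB].
  exists A => //; near=> h => s' As' h0.
  have [|c c01 ->] := @MVT_line R E (F s') (dF s') p v h.
    move=> c c01.
    have : forall c : R, 0 <= c <= 1 -> forall s, is_derive (p + (c * h) *: v) v (F s) (dF s (p + (c * h) *: v)).
      by near: h; exact: (small _ dFd).
    exact.
  rewrite mulrA mulVf// mul1r.
  have Bc : B (p + (c * h) *: v) by move: c c01; near: h; exact: small.
  have h1 := AB (s', p + (c * h) *: v) (conj As' Bc).
  have h2 := AB (s', p) (conj As' (nbhs_singleton pB)).
  rewrite /= in h1 h2; move: h1 h2; rewrite !ler_norml => /andP[? ?] /andP[? ?].
  by apply/andP; split; lra.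
near=> h => h0.
have ch : continuous (F ^~ (p + h *: v)).
  have : forall c : R, 0 <= c <= 1 -> continuous (F ^~ (p + (c * h) *: v)).
    by near: h; exact: (small _ cF).
  by move=> /(_ 1); rewrite ler01 lexx mul1r; exact.
have cp : continuous (F ^~ p) by exact: nbhs_singleton cF.
have c1 : continuous (fun s => F s (p + h *: v) - F s p).
  by ctn.
have c2 : continuous (fun s => h^-1 * (F s (p + h *: v) - F s p)).
  by ctn.
rewrite -oint_sub// -oint_scale// -oint_sub//.
apply: (le_trans (@ler_norm_oint R _ a b d _ _)).
- by ctn.
- move=> s sab; move: h0; move: s sab; near: h; exact: unif.
- by rewrite /d mulrAC ler_pdivrMr ?ltr_wpDl// ler_pM2l// lerDl.
Unshelve. all: by end_near.
Qed.

End ParameterIntegral.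

(** * Smooth families of functions *)

Section ParametrizedSmoothness.
Variable R : realType.

(* [PC k F]: the functions [F l] are of class C^k, and all iterated directional
   derivatives are jointly continuous in the parameter [l], the directions and the point;
   directions are treated as additional parameters. *)
Fixpoint PC (E : normedModType R) (k : nat) (T : topologicalType) (F : T -> E -> R)
    {struct k} : Prop :=
  continuous (fun q : T * E => F q.1 q.2) /\
  match k with
  | 0 => True
  | k'.+1 => exists2 dF : T * E -> E -> R,
      (forall l v p, is_derive p v (F l) (dF (l, v) p)) & PC k' dF
  end.

Section Closure.
Variable E : normedModType R.
Implicit Types T : topologicalType.

Lemma PC_cont k T (F : T -> E -> R) : PC k F -> continuous (fun q : T * E => F q.1 q.2).
Proof. by case: k => [|k] []. Qed.

Lemma PC_S k T (F : T -> E -> R) : PC k.+1 F -> PC k F.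
Proof.
elim: k T F => [|k ih] T F [cF [dF h PdF]]; first by [].
by split => //; exists dF => //; exact: ih.
Qed.

Lemma PC_le k j T (F : T -> E -> R) : (j <= k)%N -> PC k F -> PC j F.
Proof.
move=> jk; rewrite -(subnKC jk); elim: (k - j)%N => [|m ih]; first by rewrite addn0.
by rewrite addnS => /PC_S.
Qed.

Lemma PC_ext k T (F G : T -> E -> R) : (forall l p, F l p = G l p) -> PC k F -> PC k G.
Proof. by move=> FG; rewrite (_ : F = G)//; apply/funext => l; apply/funext => p. Qed.

(** Derivatives being unique, any explicit formula for them inherits the smoothness. *)
Lemma PC_der k T (F : T -> E -> R) (dF : T * E -> E -> R) : PC k.+1 F ->
  (forall l v p, is_derive p v (F l) (dF (l, v) p)) -> PC k dF.
Proof.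
move=> [cF [dF' h PdF]] h'; apply: PC_ext PdF => -[l v] p.
exact: dv_unique (h l v p) (h' l v p).
Qed.

Lemma PC_cst k T (c : T -> R) : continuous c -> PC k (fun l (_ : E) => c l).
Proof.
elim: k T c => [|k ih] T c cc; (split; first by apply: ct_comp cc _; ctn) => //.
by exists (fun _ _ => 0); [move=> l v p; exact: dv_cst|apply: ih; exact: ct_cst].
Qed.

Lemma PC_add k T (F G : T -> E -> R) : PC k F -> PC k G -> PC k (fun l p => F l p + G l p).
Proof.
elim: k T F G => [|k ih] T F G [cF hF] [cG hG]; (split; first by ctn) => //.
case: hF hG => [dF dFE PF] [dG dGE PG].
exists (fun l p => dF l p + dG l p); first by move=> l v p; exact: dv_add.
exact: ih.
Qed.

End Closure.

(** [B l] is the linear part of the affine map [A l]. The derivative of the composition along [v] is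
    that of [F] along [B l v], again a family of the same form because directions count as
    parameters; hence the induction on [k]. *)
Lemma PC_affine (E E' : normedModType R) k (T T' : topologicalType) (F : T -> E -> R)
    (r : T' -> T) (A B : T' -> E' -> E) :
  continuous r -> continuous (fun q : T' * E' => A q.1 q.2) ->
  continuous (fun q : T' * E' => B q.1 q.2) ->
  (forall l p (h : R) v, A l (p + h *: v) = A l p + h *: B l v) ->
  PC k F -> PC k (fun l p => F (r l) (A l p)).
Proof.
elim: k T T' F r A B => [|k ih] T T' F r A B cr cA cB AB [cF hF].
  split => //; apply: (ct_comp2 cF) => //; apply: ct_comp cr _; ctn.
split; first by apply: (ct_comp2 cF) => //; apply: ct_comp cr _; ctn.
case: hF => dF dFE PF.
exists (fun l p => dF (r l.1, B l.1 l.2) (A l.1 p)).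
  move=> l v p; have /dv_lineE h := dFE (r l) (B l v) (A l p); apply/dv_lineE.
  by apply: dv_ext h => s; rewrite AB.
apply: (ih _ _ dF (fun l : T' * E' => (r l.1, B l.1 l.2)) (fun l : T' * E' => A l.1) (fun l : T' * E' => B l.1)) => //.
- by ctn; [apply: ct_comp cr _; ctn].
- by apply: (ct_comp2 cA); ctn.
- by apply: (ct_comp2 cB); ctn.
Qed.

Lemma PC_reparam (E : normedModType R) k (T T' : topologicalType) (F : T -> E -> R) (r : T' -> T) :
  continuous r -> PC k F -> PC k (fun l p => F (r l) p).
Proof. by move=> cr; apply: (PC_affine cr (A := fun _ p => p) (B := fun _ v => v)) => //; ctn. Qed.

Section Composition.
Variable E : normedModType R.
Implicit Types T : topologicalType.

Lemma PC_mul k T (F G : T -> E -> R) : PC k F -> PC k G -> PC k (fun l p => F l p * G l p).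
Proof.
elim: k T F G => [|k ih] T F G PF PG; (split;
  first by apply: ct_mul; [exact: PC_cont PF|exact: PC_cont PG]) => //.
have [_ [dF dFE PdF]] := PF; have [_ [dG dGE PdG]] := PG.
exists (fun l p => dF l p * G l.1 p + F l.1 p * dG l p).
  by move=> l v p; apply: dv_mul.
have c1 : continuous (fun l : T * E => l.1) by ctn.
apply: PC_add; apply: ih => //.
- by apply: (PC_reparam c1); exact: PC_S.
- by apply: (PC_reparam c1); exact: PC_S.
Qed.

Lemma PC_scale k T (c : T -> R) (F : T -> E -> R) : continuous c -> PC k F ->
  PC k (fun l p => c l * F l p).
Proof. by move=> cc PF; apply: PC_mul => //; exact: PC_cst. Qed.

Lemma PC_opp k T (F : T -> E -> R) : PC k F -> PC k (fun l p => - F l p).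
Proof.
move=> PF; apply: (@PC_ext _ _ _ (fun l p => (-1) * F l p)).
  by move=> l p; rewrite mulN1r.
by apply: (@PC_scale _ _ (fun=> -1)) => //; exact: ct_cst.
Qed.

Lemma PC_sub k T (F G : T -> E -> R) : PC k F -> PC k G -> PC k (fun l p => F l p - G l p).
Proof. by move=> PF PG; apply: PC_add => //; exact: PC_opp. Qed.

Lemma PC_sum k T (I : Type) (r : seq I) (F : I -> T -> E -> R) :
  (forall i, PC k (F i)) -> PC k (fun l p => \sum_(i <- r) F i l p).
Proof.
move=> h; elim: r => [|i r ih].
  apply: (@PC_ext _ _ _ (fun _ _ => 0)); first by move=> l p; rewrite big_nil.
  by apply: PC_cst; exact: ct_cst.
apply: (@PC_ext _ _ _ (fun l p => F i l p + \sum_(i <- r) F i l p)).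
  by move=> l p; rewrite big_cons.
exact: PC_add.
Qed.

Lemma PC_exp k T (F : T -> E -> R) n : PC k F -> PC k (fun l p => F l p ^+ n).
Proof.
move=> PF; elim: n => [|n ih].
  apply: (@PC_ext _ _ _ (fun _ _ => 1)); first by move=> l p; rewrite expr0.
  by apply: PC_cst; exact: ct_cst.
apply: (@PC_ext _ _ _ (fun l p => F l p * F l p ^+ n)); first by move=> l p; rewrite exprS.
exact: PC_mul.
Qed.

Lemma PC_linear k T (f : E -> R) : continuous f ->
  (forall p (h : R) v, f (p + h *: v) = f p + h * f v) -> PC k (fun (_ : T) p => f p).
Proof.
move=> cf fl; have cf2 : continuous (fun q : T * E => f q.2) by apply: ct_comp cf _; ctn.
case: k => [|k]; split => //.
exists (fun l _ => f l.2); last by apply: PC_cst.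
move=> l v p; apply/dv_lineE.
have H := dv_add (dv_cst (f p) (0:R) 1) (dv_mul (dv_id (0:R)) (dv_cst (f v) (0:R) 1)).
apply: dv_eq; first by apply: dv_ext H => h; rewrite fl.
by ring.
Qed.

(** The set [I] admits functions that are smooth on a part of the line only, such as powers or sums
    of power series; [PC_outer] composes them with families taking values in [I]. *)
Fixpoint smooth1 (k : nat) (I : set R) (g : R -> R) : Prop :=
  (forall x, I x -> {for x, continuous g}) /\
  match k with
  | 0 => True
  | k'.+1 => exists2 g' : R -> R, (forall x, I x -> is_derive x 1 g (g' x)) & smooth1 k' I g'
  end.

Lemma PC_outer k T (I : set R) (g : R -> R) (F : T -> E -> R) :
  smooth1 k I g -> (forall l p, I (F l p)) -> PC k F -> PC k (fun l p => g (F l p)).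
Proof.
elim: k T g F => [|k ih] T g F sg IF PF; (split;
  first by move=> q; apply: (@continuous_comp _ _ _ (fun q : T * E => F q.1 q.2) g);
    [exact: PC_cont PF q|exact: sg.1]) => //.
have [_ [dF dFE PdF]] := PF; have [_ [g' g'E sg']] := sg.
exists (fun l p => g' (F l.1 p) * dF l p).
  by move=> l v p; apply: dv_comp => //; exact: g'E.
have c1 : continuous (fun l : T * E => l.1) by ctn.
by apply: PC_mul => //; apply: ih => //; apply: (PC_reparam c1); exact: PC_S.
Qed.

Lemma PC_oint_derive T (F : T * R -> E -> R) (dF : (T * R) * E -> E -> R) a b l v p :
  PC 1 F -> (forall l v p, is_derive p v (F l) (dF (l, v) p)) ->
  is_derive p v (fun q => oint a b (fun s => F (l, s) q))
                (oint a b (fun s => dF ((l, s), v) p)).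
Proof.
move=> PF h; have cF := PC_cont PF; have cdF := PC_cont (PC_der PF h).
apply: (@oint_derive_param R E (fun s q => F (l, s) q) (fun s q => dF ((l, s), v) q)).
- by apply: filterE => q s; exact: h.
- move=> s; have := @ct_comp2 (R * E)%type _ _ _ dF (fun r => (l, r.1, v)) snd cdF.
  by apply; ctn.
- apply: filterE => q; apply: (ct_comp2 cF); ctn.
Qed.

(** The variable of integration is one more parameter, so that a derivative under the integral is an
    integral of the same kind. *)
Lemma PC_oint k T (F : T * R -> E -> R) a b : PC k F ->
  PC k (fun l p => oint a b (fun s => F (l, s) p)).
Proof.
elim: k T F => [|k ih] T F PF; (split;
  first by apply: continuous_oint; apply: (ct_comp2 (PC_cont PF)); ctn) => //.
have [_ [dF dFE PdF]] := PF.
exists (fun l p => oint a b (fun s => dF ((l.1, s), l.2) p)).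
  by move=> l v p; apply: PC_oint_derive => //; apply: PC_le PF.
have c1 : continuous (fun q : (T * E) * R => ((q.1.1, q.2), q.1.2)) by ctn.
exact: (ih _ (fun (q : (T * E) * R) p => dF ((q.1.1, q.2), q.1.2) p) (PC_reparam c1 PdF)).
Qed.

Lemma PC_contp k T (F : T -> E -> R) l : PC k F -> continuous (F l).
Proof. by move=> PF; apply: (ct_comp2 (PC_cont PF)); ctn. Qed.

Lemma PC_dir_add T (F : T -> E -> R) dF l v w p : PC 1 F ->
  (forall l v p, is_derive p v (F l) (dF (l, v) p)) ->
  dF (l, v + w) p = dF (l, v) p + dF (l, w) p.
Proof.
move=> PF h; have PdF := PC_der PF h.
apply: dv_unique (h l (v + w) p) _; apply: dv_diradd.
- by apply: filterE => q; exact: h.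
- by apply: filterE => q; exact: h.
- exact: PC_contp PdF _.
- exact: PC_contp PdF _.
Qed.

Lemma PC_schwarz T (F : T -> E -> R) dF d2F l v w p : PC 2 F ->
  (forall l v p, is_derive p v (F l) (dF (l, v) p)) ->
  (forall l v p, is_derive p v (dF l) (d2F (l, v) p)) ->
  d2F ((l, v), w) p = d2F ((l, w), v) p.
Proof.
move=> PF h1 h2; have Pd := PC_der (PC_der PF h1) h2.
apply: (@schwarz R E (F l) (dF (l, v)) (dF (l, w)) (d2F ((l, v), w)) (d2F ((l, w), v)) p v w);
  do ?[by apply: filterE => q]; exact: PC_contp Pd _.
Qed.

End Composition.

(** Chain rule without Fréchet differentiability: the mean value theorem on the chord from [g t] to
    [g (t + h)] takes the difference quotient of [g] as its direction, and joint continuity of [D]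
    in direction and point gives the limit. *)
Lemma dv_curve (E : normedModType R) (F : E -> R) (D : E -> E -> R) (g : R -> E) (t : R) (g' : E) :
  (forall v q, is_derive q v F (D v q)) ->
  continuous (fun r : E * E => D r.1 r.2) ->
  is_derive t 1 g g' -> is_derive t 1 (fun s => F (g s)) (D g' (g t)).
Proof.
move=> dF cD dg; apply/dvP => e e0.
have cg : {for t, continuous g}.
  by have [/derivable1_diffP/differentiable_continuous] := dg.
have /cvgrPdist_le/(_ e e0) [[A B] /= [vA pB] AB] := cD (g', g t).
have /nbhs_ballP[r /= r0 rB] := pB.
have N1 : \forall h \near (0:R), h != 0 -> A (h^-1 *: (g (t + h) - g t)).
  have [d1 d2] := dg.
  have : (h^-1 *: ((g \o shift t) (h *: 1) - g t)) @[h --> (0:R)^'] --> g' by rewrite -d2; exact: d1.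
  move=> /(_ A vA) N.
  have N2 : nbhs (0:R) (fun h : R => h != 0 -> A (h^-1 *: ((g \o shift t) (h *: 1) - g t))) by exact: N.
  by apply: filterS N2 => h hh h0; have := hh h0; rewrite /= [h *: (1:R)]mulr1 (addrC h t).
have N2 : \forall h \near (0:R), `|g t - g (t + h)| < r.
  have cg2 : {for 0, continuous (fun h : R => g (t + h))}.
    apply: (@continuous_comp _ _ _ (fun h : R => t + h) g); last by rewrite addr0.
    by apply: ct_add; ctn.
  have /cvgrPdist_lt/(_ r r0) := cg2; by rewrite addr0.
apply: filterS2 N1 N2 => h hA hr h0.
pose w := h^-1 *: (g (t + h) - g t).
have gE : g (t + h) = g t + h *: w by rewrite /w scalerA mulfV// scale1r (addrC (g t)) subrK.
have [c /andP[c0 c1] E1] := @MVT_line R E F (D w) (g t) w h (fun _ _ => dF _ _).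
rewrite [h *: _]mulr1 gE E1 mulrA mulVf// mul1r distrC.
apply: (AB (w, g t + (c * h) *: w)); split => /=; first exact: hA.
apply: rB; rewrite -ball_normE /ball_/= opprD addNKr normrN.
apply: le_lt_trans hr; rewrite gE opprD addNKr normrN -scalerA normrZ ger0_norm//.
by rewrite ler_piMl.
Qed.

End ParametrizedSmoothness.

(** * Integrals over half-spheres *)

Section Hemisphere.
Variable R : realType.

Lemma ct_rV (T : topologicalType) m (f : T -> 'rV[R]_m) :
  (forall j, continuous (fun x => f x 0 j)) -> continuous f.
Proof.
move=> cf x; apply/cvg_ballP => e e0.
have : \forall y \near x, forall j, ball (f x 0 j) e (f y 0 j).
  apply: filter_forall => j; have /cvg_ballP/(_ e e0) := cf j x; exact.
by apply: filterS => y Hy; split => // i j; rewrite (ord1 i).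
Qed.

Lemma ct_coord (T : topologicalType) m (f : T -> 'rV[R]_m) j :
  continuous f -> continuous (fun x => f x 0 j).
Proof.
by move=> cf; apply: (ct_comp (F := fun y : 'rV[R]_m => y 0 j)) => //; exact: coord_continuous.
Qed.

Definition embed0 n (y : 'rV[R]_n) : 'rV[R]_n.+1 :=
  \row_j (if unlift ord0 j is Some i then y 0 i else 0).

Lemma embed0D n (y z : 'rV[R]_n) : embed0 (y + z) = embed0 y + embed0 z.
Proof. by apply/rowP => j; rewrite !mxE; case: unliftP => [i _|_]; rewrite ?mxE ?addr0. Qed.

Lemma embed0Z n (a : R) (y : 'rV[R]_n) : embed0 (a *: y) = a *: embed0 y.
Proof. by apply/rowP => j; rewrite !mxE; case: unliftP => [i _|_]; rewrite ?mxE ?mulr0. Qed.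

Lemma embed0_delta n (i : 'I_n) : embed0 (delta_mx 0 i) = delta_mx 0 (lift ord0 i).
Proof.
apply/rowP => j; rewrite !mxE; case: unliftP => [k ->|->].
  by rewrite !mxE !eqxx (inj_eq lift_inj).
by rewrite !eqxx (negbTE (neq_lift _ _)).
Qed.

Lemma ct_embed0 (T : topologicalType) n (f : T -> 'rV[R]_n) :
  continuous f -> continuous (fun x => embed0 (f x)).
Proof.
move=> cf; apply: ct_rV => j.
have [i ji|ji] := unliftP ord0 j.
  rewrite (_ : (fun x => _) = (fun x => f x 0 i)); first exact: ct_coord.
  by apply/funext => x; rewrite mxE ji liftK.
rewrite (_ : (fun x => _) = (fun=> 0)); first exact: ct_cst.
by apply/funext => x; rewrite mxE ji unlift_none.
Qed.

(** Iterated down to dimension 0 this produces the point (sin th1, cos th1 sin th2, ...) of the unit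
    ball; the product of all the cosines is the remaining, nonnegative coordinate of the
    half-sphere. *)
Definition hemi n (th : R) (y : 'rV[R]_n) : 'rV[R]_n.+1 :=
  sin th *: delta_mx 0 ord0 + cos th *: embed0 y.

Lemma ct_hemi (T : topologicalType) n (th : T -> R) (f : T -> 'rV[R]_n) :
  continuous th -> continuous f -> continuous (fun x => hemi (th x) (f x)).
Proof. by move=> ct cf; apply: ct_addE; apply: ct_scaleE; ctn; exact: ct_embed0. Qed.

Ltac ctn_ext ::= match goal with
  | |- forall y, continuous_at y (fun x => hemi (@?a x) (@?b x)) => apply: (@ct_hemi _ _ a b)
  | |- forall y, continuous_at y (fun x => embed0 (@?b x)) => apply: (@ct_embed0 _ _ b)
  | |- forall y, continuous_at y (hemi _) => exact: (ct_hemi (@ct_cst _ _ _) (@ct_id _))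
  | |- forall y, continuous_at y (@embed0 _) => exact: (ct_embed0 (@ct_id _))
  end.

(* [hemiL g] is the integral of [g y / sqrt (1 - |y|^2)] over the unit ball of R^n, i.e. of
   [g] over a half-sphere of R^(n+1), written in spherical coordinates. *)
Fixpoint hemiL (n : nat) : ('rV[R]_n -> R) -> R :=
  match n with
  | 0 => fun g => g 0
  | n'.+1 => fun g => oint (- (pi / 2)) (pi / 2)
      (fun th => cos th ^+ n' * hemiL (fun y => g (hemi th y)))
  end.

Lemma continuous_hemiL n (T : topologicalType) (F : T -> 'rV[R]_n -> R) :
  continuous (fun q : T * 'rV[R]_n => F q.1 q.2) -> continuous (fun l => hemiL (F l)).
Proof.
elim: n T F => [|n ih] T F cF; first by apply: (ct_comp2 cF); ctn.
apply: continuous_oint => /=; apply: ct_mul; first by ctn.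
apply: (ih _ (fun q y => F q.1 (hemi q.2 y))).
by apply: (ct_comp2 cF); ctn.
Qed.

Lemma ct_hemi_integrand n (g : 'rV[R]_n.+1 -> R) : continuous g ->
  continuous (fun th => cos th ^+ n * hemiL (fun y => g (hemi th y))).
Proof.
move=> cg; apply: ct_mul; first by ctn.
apply: (continuous_hemiL (F := fun th y => g (hemi th y))).
by apply: (ct_comp cg); ctn.
Qed.

Lemma ct_hemi2 n (g : 'rV[R]_n.+1 -> R) th : continuous g ->
  continuous (fun y => g (hemi th y)).
Proof. by move=> cg; apply: (ct_comp cg); apply: ct_hemi; ctn. Qed.

Lemma hemiL_add n (f g : 'rV[R]_n -> R) : continuous f -> continuous g ->
  hemiL (fun y => f y + g y) = hemiL f + hemiL g.
Proof.
elim: n f g => [//|n ih] f g cf cg /=.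
rewrite -oint_add; try exact: ct_hemi_integrand.
by congr oint; apply/funext => th; rewrite ih ?mulrDr//; exact: ct_hemi2.
Qed.

Lemma hemiL_scale n (f : 'rV[R]_n -> R) k : continuous f ->
  hemiL (fun y => k * f y) = k * hemiL f.
Proof.
elim: n f => [//|n ih] f cf /=.
rewrite -oint_scale; last exact: ct_hemi_integrand.
by congr oint; apply/funext => th; rewrite ih 1?mulrCA//; exact: ct_hemi2.
Qed.

Lemma hemiL_sub n (f g : 'rV[R]_n -> R) : continuous f -> continuous g ->
  hemiL (fun y => f y - g y) = hemiL f - hemiL g.
Proof.
move=> cf cg; rewrite -(mulN1r (hemiL g)) -hemiL_scale// -hemiL_add//; last by ctn.
by congr hemiL; apply/funext => y; rewrite mulN1r.
Qed.

Definition hemiL1 n : R := @hemiL n (fun=> 1).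

Lemma hemiL_cst n (k : R) : @hemiL n (fun=> k) = k * hemiL1 n.
Proof.
rewrite /hemiL1 -hemiL_scale; last exact: ct_cst.
by congr hemiL; apply/funext => y; rewrite mulr1.
Qed.

Lemma PC_hemiL (E : normedModType R) n k (T : topologicalType) (F : T * 'rV[R]_n -> E -> R) :
  PC k F -> PC k (fun l p => hemiL (fun y => F (l, y) p)).
Proof.
elim: n T F => [|n ih] T F PF.
  by apply: (@PC_reparam _ _ _ _ _ F (fun l : T => (l, 0)) _ PF); ctn.
apply: (@PC_oint _ _ _ _ (fun lt p => cos lt.2 ^+ n * hemiL (fun y => F (lt.1, hemi lt.2 y) p))).
apply: PC_scale; first by ctn.
apply: (ih _ (fun q p => F (q.1.1, hemi q.1.2 q.2) p)).
apply: (@PC_reparam _ _ _ _ _ F (fun q : (T * R) * 'rV[R]_n => (q.1.1, hemi q.1.2 q.2)) _ PF).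
by ctn.
Qed.

Lemma PC_hemiL_derive (E : normedModType R) n (T : topologicalType)
    (F : T * 'rV[R]_n -> E -> R) (dF : (T * 'rV[R]_n) * E -> E -> R) l v p :
  PC 1 F -> (forall l v p, is_derive p v (F l) (dF (l, v) p)) ->
  is_derive p v (fun q => hemiL (fun y => F (l, y) q))
                (hemiL (fun y => dF ((l, y), v) p)).
Proof.
elim: n T F dF l v p => [|n ih] T F dF l v p PF h; first exact: h.
have PF2 : PC 1 (fun (q : (T * R) * 'rV[R]_n) p => F (q.1.1, hemi q.1.2 q.2) p).
  apply: (@PC_reparam _ _ _ _ _ F (fun q : (T * R) * 'rV[R]_n => (q.1.1, hemi q.1.2 q.2)) _ PF).
  by ctn.
apply: (@PC_oint_derive _ _ T (fun lt p => cos lt.2 ^+ n * hemiL (fun y => F (lt.1, hemi lt.2 y) p))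
  (fun q p => cos q.1.2 ^+ n * hemiL (fun y => dF ((q.1.1, hemi q.1.2 y), q.2) p))).
  apply: PC_scale; first by ctn.
  exact: (PC_hemiL PF2).
move=> lt w q /=; apply: dv_scale.
apply: (ih _ (fun q p => F (q.1.1, hemi q.1.2 q.2) p)
   (fun q p => dF ((q.1.1.1, hemi q.1.1.2 q.1.2), q.2) p)) => //.
Qed.

Lemma PC1_R (T : topologicalType) (F D : T -> R -> R) :
  continuous (fun q : T * R => F q.1 q.2) -> continuous (fun q : T * R => D q.1 q.2) ->
  (forall l (t : R), is_derive t 1 (F l) (D l t)) -> PC 1 (E := R^o) F.
Proof.
move=> cF cD h; split => //; exists (fun l t => l.2 * D l.1 t).
  by move=> l v p; have := dv_scaledir v (h l p); rewrite [v *: _]mulr1.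
split => //; apply: ct_mul; first by ctn.
by apply: (ct_comp2 cD); ctn.
Qed.

Lemma hemiL_derive n (F D : 'rV[R]_n -> R -> R) (t : R) :
  continuous (fun q : 'rV[R]_n * R => F q.1 q.2) ->
  continuous (fun q : 'rV[R]_n * R => D q.1 q.2) ->
  (forall l (t : R), is_derive t 1 (F l) (D l t)) ->
  is_derive t 1 (fun s => hemiL (fun y => F y s)) (hemiL (fun y => D y t)).
Proof.
move=> cF cD h.
have PF : PC 1 (E := R^o) (fun l : R * 'rV[R]_n => F l.2).
  apply: (PC_reparam (r := snd)); first by ctn.
  exact: PC1_R cF cD h.
have := @PC_hemiL_derive R^o n R (fun l => F l.2) (fun l t => l.2 * D l.1.2 t) 0 1 t PF.
rewrite /= (_ : hemiL (fun y => 1 * D y t) = hemiL (fun y => D y t)); first last.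
  by congr hemiL; apply/funext => y; rewrite mul1r.
by apply => l v p; have := dv_scaledir v (h l.2 p); rewrite [v *: _]mulr1.
Qed.

Lemma dv_scalev (E : normedModType R) (f : R -> R) (t d : R) (v : E) :
  is_derive t 1 f d -> is_derive t 1 (fun s => f s *: v) (d *: v).
Proof.
move=> [d1 d2].
have cv : (h^-1 *: ((f \o shift t) (h *: (1:R)) - f t)) @[h --> (0:R)^'] --> d.
  by rewrite -d2; exact: d1.
have H : (h^-1 *: (((fun s => f s *: v) \o shift t) (h *: (1:R)) - f t *: v)) @[h --> (0:R)^']
    --> d *: v.
  have E1 : (fun h : R => h^-1 *: (((fun s => f s *: v) \o shift t) (h *: (1:R)) - f t *: v)) =
      (fun h : R => (h^-1 *: ((f \o shift t) (h *: (1:R)) - f t)) *: v).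
    by apply/funext => h /=; rewrite -scalerBl scalerA.
  by rewrite E1; exact: (cvgZr_tmp cv).
by split; [apply/cvg_ex; eexists; exact: H|exact/cvg_lim].
Qed.

Lemma dv_addv (E : normedModType R) (f g : R -> E) (t : R) (a b : E) :
  is_derive t 1 f a -> is_derive t 1 g b -> is_derive t 1 (fun s => f s + g s) (a + b).
Proof. exact: is_deriveD. Qed.

Lemma dv_exp (E : normedModType R) (f : E -> R) p v d n : is_derive p v f d ->
  is_derive p v (fun q => f q ^+ n) (n%:R * f p ^+ n.-1 * d).
Proof.
move=> fd; elim: n => [|n ih].
  by rewrite mul0r mul0r; apply: dv_ext (dv_cst 1 p v) => q; rewrite expr0.
apply: dv_eq; first by apply: dv_ext (dv_mul fd ih) => q; rewrite exprS.
rewrite -natr1; case: n ih => [|n] ih /=; first by rewrite expr0; ring.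
by rewrite exprS; ring.
Qed.

(** The open interval matters: the identity behind [hemiL_harm] divides by [cos th], which vanishes
    at both ends. *)
Lemma eq_oint_oo (f g : R -> R) a b : a < b -> continuous f -> continuous g ->
  (forall s, a < s < b -> f s = g s) -> oint a b f = oint a b g.
Proof.
move=> ab cf cg fg; apply/eqP; rewrite -subr_eq0 -oint_sub//.
have c1 : continuous (fun s => f s - g s) by ctn.
have [||c] := @MVT R (fun y => oint a y (fun s => f s - g s)) (fun s => f s - g s) a b ab.
- by move=> x _; exact: oint_derive.
- apply: continuous_subspaceT => x; exact: (dv_cont (oint_derive a x c1)).
rewrite in_itv/= => cab; rewrite oint_aa subr0 => ->.
by rewrite fg// subrr mul0r.
Qed.

(** The derivatives are kept as functions of their directions because the radial terms below take
    the point itself as a direction. *)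
Definition C2data n (g : 'rV[R]_n -> R) (D1 : 'rV[R]_n -> 'rV[R]_n -> R)
    (D2 : 'rV[R]_n -> 'rV[R]_n -> 'rV[R]_n -> R) :=
  [/\ continuous g,
      forall v p, is_derive p v g (D1 v p),
      forall v w p, is_derive p w (D1 v) (D2 v w p),
      continuous (fun q : 'rV[R]_n * 'rV[R]_n => D1 q.1 q.2)
    & continuous (fun q : ('rV[R]_n * 'rV[R]_n) * 'rV[R]_n => D2 q.1.1 q.1.2 q.2)].

Section SecondDerivative.
Variables (n : nat) (g : 'rV[R]_n -> R) (D1 : 'rV[R]_n -> 'rV[R]_n -> R)
  (D2 : 'rV[R]_n -> 'rV[R]_n -> 'rV[R]_n -> R).
Hypothesis H : C2data g D1 D2.

Lemma C2_cD1 v : continuous (D1 v).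
Proof. by have [_ _ _ c _] := H; apply: (ct_comp2 c); ctn. Qed.

Lemma C2_cD2 v w : continuous (D2 v w).
Proof.
have [_ _ _ _ c] := H.
by apply: (ct_comp c (a := fun p => ((v, w), p))); apply: (ct_pair (@ct_cst _ _ _) (@ct_id _)).
Qed.

Lemma C2_D1D v w p : D1 (v + w) p = D1 v p + D1 w p.
Proof.
have [_ d1 d2 _ _] := H.
apply: dv_unique (d1 (v + w) p) _; apply: dv_diradd;
  do ?[by apply: filterE => q; exact: d1]; exact: C2_cD1.
Qed.

Lemma C2_D1Z a v p : D1 (a *: v) p = a * D1 v p.
Proof. by have [_ d1 d2 _ _] := H; apply: dv_unique (d1 _ p) _; apply: dv_scaledir. Qed.

Lemma C2_D2Dr u v w p : D2 u (v + w) p = D2 u v p + D2 u w p.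
Proof.
have [_ d1 d2 _ _] := H.
apply: dv_unique (d2 u (v + w) p) _; apply: dv_diradd;
  do ?[by apply: filterE => q; exact: d2]; exact: C2_cD2.
Qed.

Lemma C2_D2Zr a u v p : D2 u (a *: v) p = a * D2 u v p.
Proof. by have [_ d1 d2 _ _] := H; apply: dv_unique (d2 _ _ p) _; apply: dv_scaledir. Qed.

Lemma C2_D2Dl u v w p : D2 (u + v) w p = D2 u w p + D2 v w p.
Proof.
have [_ d1 d2 _ _] := H.
apply: dv_unique (d2 (u + v) w p) _; apply: dv_ext (dv_add (d2 u w p) (d2 v w p)) => q.
by rewrite C2_D1D.
Qed.

Lemma C2_D2Zl a u w p : D2 (a *: u) w p = a * D2 u w p.
Proof.
have [_ d1 d2 _ _] := H.
apply: dv_unique (d2 (a *: u) w p) _; apply: dv_ext (dv_scale a (d2 u w p)) => q.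
by rewrite C2_D1Z.
Qed.

End SecondDerivative.

Lemma C2data_hemi n (g : 'rV[R]_n.+1 -> R) D1 D2 th : C2data g D1 D2 ->
  C2data (fun y => g (hemi th y)) (fun v y => cos th * D1 (embed0 v) (hemi th y))
    (fun v w y => cos th ^+ 2 * D2 (embed0 v) (embed0 w) (hemi th y)).
Proof.
move=> H; have [cg d1 d2 c1 c2] := H.
have hE (y v : 'rV[R]_n) (h : R) : hemi th (y + h *: v) = hemi th y + h *: (cos th *: embed0 v).
  by rewrite /hemi embed0D embed0Z scalerDr !scalerA (mulrC h) addrA.
split.
- exact: ct_hemi2.
- move=> v p; rewrite -(C2_D1Z H); apply/dv_lineE.
  have /dv_lineE := d1 (cos th *: embed0 v) (hemi th p); apply: dv_ext => h.
  by rewrite hE.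
- move=> v w p; rewrite expr2 -mulrA -(C2_D2Zr H); apply: dv_scale; apply/dv_lineE.
  have /dv_lineE := d2 (embed0 v) (cos th *: embed0 w) (hemi th p); apply: dv_ext => h.
  by rewrite hE.
- by apply: ct_mul; ctn; apply: (ct_comp2 c1); ctn.
- apply: ct_mul; ctn.
  apply: (ct_comp c2 (a := fun q : ('rV[R]_n * 'rV[R]_n) * 'rV[R]_n =>
    ((embed0 q.1.1, embed0 q.1.2), hemi th q.2))); ctn.
Qed.

Definition hemi' n (th : R) (y : 'rV[R]_n) : 'rV[R]_n.+1 :=
  cos th *: delta_mx 0 ord0 + (- sin th) *: embed0 y.

Lemma hemi_derive n (th : R) (y : 'rV[R]_n) :
  is_derive th 1 (fun t => hemi t y) (hemi' th y).
Proof.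
have H1 := dv_scalev (delta_mx 0 ord0 : 'rV[R]_n.+1) (is_derive_sin th).
have H2 := dv_scalev (embed0 y) (is_derive_cos th).
have H := dv_addv H1 H2.
exact: H.
Qed.

(* In the coordinates [hemi th y] the operator below is the spherical Laplacian, which is
   the sum of a total derivative in [th] and of the same operator in [y]. *)
Theorem hemiL_harm n (g : 'rV[R]_n -> R) D1 D2 : C2data g D1 D2 ->
  hemiL (fun y => \sum_(i < n) D2 (delta_mx 0 i) (delta_mx 0 i) y - D2 y y y - n%:R * D1 y y) = 0.
Proof.
elim: n g D1 D2 => [|n ih] g D1 D2 H.
  rewrite /= big_ord0 (_ : D2 0 0 0 = 0) ?mul0r ?subrr//.
  by rewrite -(scale0r (0 : 'rV[R]_0)) (C2_D2Zr H) mul0r.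
have [cg d1 d2 c1 c2] := H.
pose e0 : 'rV[R]_n.+1 := delta_mx 0 ord0.
pose Q (Y : 'rV[R]_n.+1) := \sum_(i < n.+1) D2 (delta_mx 0 i) (delta_mx 0 i) Y - D2 Y Y Y - n.+1%:R * D1 Y Y.
(* The flux in the variable [th]: the second factor is the derivative of [g (hemi th y)] in [th],
   and [dK] is the derivative of the product. *)
pose K (y : 'rV[R]_n) (th : R) := cos th ^+ n *
  (cos th * D1 e0 (hemi th y) - sin th * D1 (embed0 y) (hemi th y)).
pose dK (y : 'rV[R]_n) (th : R) :=
  n%:R * cos th ^+ n.-1 * (- sin th) *
    (cos th * D1 e0 (hemi th y) - sin th * D1 (embed0 y) (hemi th y)) +
  cos th ^+ n *
   ((- sin th * D1 e0 (hemi th y) + cos th * D2 e0 (hemi' th y) (hemi th y)) -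
    (cos th * D1 (embed0 y) (hemi th y) + sin th * D2 (embed0 y) (hemi' th y) (hemi th y))).
have dD v y (th : R) : is_derive th 1 (fun t => D1 v (hemi t y)) (D2 v (hemi' th y) (hemi th y)).
  have cv : continuous (fun r : 'rV[R]_n.+1 * 'rV[R]_n.+1 => D2 v r.1 r.2).
    by apply: (ct_comp c2 (a := fun r : 'rV[R]_n.+1 * 'rV[R]_n.+1 => ((v, r.1), r.2))); ctn.
  exact: (dv_curve (fun w q => d2 v w q) cv (hemi_derive th y)).
have dKE y (th : R) : is_derive th 1 (K y) (dK y th).
  apply: dv_mul; first exact: dv_exp (is_derive_cos th).
  by apply: dv_sub; apply: dv_mul.
have cD1 (T : topologicalType) (a b : T -> 'rV[R]_n.+1) : continuous a -> continuous b ->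
    continuous (fun x => D1 (a x) (b x)) by exact: ct_comp2.
have cD2 (T : topologicalType) (a b c : T -> 'rV[R]_n.+1) : continuous a -> continuous b ->
    continuous c -> continuous (fun x => D2 (a x) (b x) (c x)).
  move=> ca cb cc.
  by apply: (ct_comp c2 (a := fun x => ((a x, b x), c x))); ctn.
have cH (T : topologicalType) (a : T -> R) (b : T -> 'rV[R]_n) : continuous a -> continuous b ->
    continuous (fun x => hemi' (a x) (b x)).
  by move=> ca cb; rewrite /hemi'; ctn.
have cK : continuous (fun q : 'rV[R]_n * R => K q.1 q.2).
  by rewrite /K; repeat first [progress ctn | apply: cD1].
have cdK : continuous (fun q : 'rV[R]_n * R => dK q.1 q.2).
  by rewrite /dK; repeat first [progress ctn | apply: cD1 | apply: cD2 | apply: cH].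
have cQ : continuous Q.
  rewrite /Q; repeat first [progress ctn | apply: cD1 | apply: cD2].
  by apply: ct_sum => i; apply: cD2; ctn.
pose G (th : R) := hemiL (fun y => dK y th).
have cG : continuous G.
  by apply: (continuous_hemiL (F := fun th y => dK y th)); apply: (ct_comp2 cdK); ctn.
have pi2 : - (pi / 2) < pi / 2 :> R by have := @pi_gt0 R; lra.
have -> : hemiL Q = oint (- (pi / 2)) (pi / 2) G.
  apply: eq_oint_oo => //; first exact: ct_hemi_integrand.
  move=> th thp; have c0 : cos th != 0.
    by rewrite gt_eqF// cos_gt0_pihalf.
  have H' := C2data_hemi th H.
  have ih' := ih _ _ _ H'.
  set Qn := (fun y : 'rV[R]_n => _) in ih'.
  have cQn : continuous Qn.
    rewrite /Qn; repeat first [progress ctn | apply: cD1 | apply: cD2].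
    by apply: ct_sum => i; repeat first [progress ctn | apply: cD2].
  rewrite -hemiL_scale; last exact: ct_hemi2.
  (* The second summand is the operator of the lower dimension for the slice at [th], whose integral
     vanishes by induction; only the total derivative [dK] remains. *)
  transitivity (hemiL (fun y => dK y th + cos th ^+ n * (cos th ^- 2) * Qn y)).
    congr hemiL; apply/funext => y.
    rewrite /Q /dK /Qn big_ord_recl.
    have -> : hemi th y = sin th *: e0 + cos th *: embed0 y by [].
    have -> : hemi' th y = cos th *: e0 + (- sin th) *: embed0 y by [].
    have -> : \sum_(i < n) cos th ^+ 2 * D2 (embed0 (delta_mx 0 i)) (embed0 (delta_mx 0 i)) (sin th *: e0 + cos th *: embed0 y) =
       cos th ^+ 2 * \sum_(i < n) D2 (delta_mx 0 (lift ord0 i)) (delta_mx 0 (lift ord0 i)) (sin th *: e0 + cos th *: embed0 y).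
      by rewrite mulr_sumr; apply: eq_bigr => i _; rewrite !embed0_delta.
    set S := \sum_(i < n) _.
    rewrite !(C2_D2Dr H, C2_D2Dl H, C2_D1D H, C2_D2Zl H, C2_D2Zr H, C2_D1Z H).
    rewrite -/e0; set Y := sin th *: e0 + cos th *: embed0 y.
    have cs := cos2Dsin2 th.
    have nE : n%:R * cos th ^+ n.-1 = n%:R * cos th ^+ n / cos th.
      by case: (n) => [|m]; rewrite ?mul0r//= exprSr mulrA mulfK.
    rewrite nE -natr1.
    have -> : cos th ^- 2 = (cos th)^-1 * (cos th)^-1 by rewrite expr2 invfM.
    have s2 : sin th * sin th = 1 - cos th * cos th.
      by rewrite -cs !expr2; ring.
    set c := cos th in c0 s2 *; set s := sin th in s2 *.
    set N := n%:R; set cn := c ^+ n.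
    set A := D2 e0 e0 Y; set B1 := D2 e0 (embed0 y) Y; set B2 := D2 (embed0 y) e0 Y.
    set C := D2 (embed0 y) (embed0 y) Y; set a := D1 e0 Y; set b := D1 (embed0 y) Y.
    apply/eqP; rewrite -subr_eq0; apply/eqP.
    (* The difference of the two sides is a multiple of 1 - cos^2 - sin^2; isolating this factor
       leaves a rational identity for [field]. *)
    transitivity (cn * (A + C + N * b / c) * (1 - c * c - s * s)); last by rewrite s2; ring.
    by field.
  rewrite hemiL_add//; last first.
  - by ctn.
  - by apply: (ct_comp2 cdK); ctn.
  by rewrite hemiL_scale// ih' mulr0 addr0.
have cdKt (th : R) : is_derive th 1 (fun t => hemiL (fun y => K y t)) (G th).
  exact: hemiL_derive cK cdK _.
rewrite (oint_FTC _ _ cG cdKt).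
suff K0 th : cos th = 0 -> hemiL (fun y => K y th) = 0.
  by rewrite !K0 ?subrr// ?cosN cos_pihalf.
move=> c0; rewrite (_ : (fun y => _) = fun=> 0); first by rewrite hemiL_cst mul0r.
(* For [n > 0] the factor [cos th ^+ n] vanishes. For [n = 0] it is 1, but then [y] has no
   coordinates and both remaining terms vanish. *)
apply/funext => y; rewrite /K c0; have [n0|n0] := posnP n; last first.
  by rewrite expr0n gtn_eqF// mul0r.
rewrite (_ : embed0 y = 0); first by rewrite -(scale0r (0 : 'rV[R]_n.+1)) (C2_D1Z H); ring.
apply/rowP => j; rewrite !mxE; case: unliftP => [k _|//].
by have := ltn_ord k; rewrite {2}n0.
Qed.

End Hemisphere.

(** Outside their section the lemmas take [R] as a further argument, hence the repetition. *)
Ltac ctn_ext ::= match goal with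
  | |- forall y, continuous_at y (fun x => hemi (@?a x) (@?b x)) => apply: (@ct_hemi _ _ _ a b)
  | |- forall y, continuous_at y (fun x => embed0 (@?b x)) => apply: (@ct_embed0 _ _ _ b)
  | |- forall y, continuous_at y (hemi _) => exact: (ct_hemi (@ct_cst _ _ _) (@ct_id _))
  | |- forall y, continuous_at y (@embed0 _ _) => exact: (ct_embed0 (@ct_id _))
  end.

(** * From the spaces C^k of the statement to parametrized families *)

Section CkPC.
Variables (R : realType).

Lemma PC_Ck (V : normedModType R) k (T : topologicalType) (F : T -> V -> R) l (D : set V) :
  PC k F -> Ck k D (F l).
Proof.
elim: k T F l => [|k ih] T F l PF; (split;
  first by apply: continuous_subspaceT; exact: PC_contp PF) => //.
have [_ [dF dFE PdF]] := PF.
by move=> v; exists (dF (l, v)); [exact: ih|move=> x _; exact: dFE].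
Qed.

Lemma within_comp (T U : topologicalType) (D : set U) (g : U -> R) (c : T -> U) :
  {within D, continuous g} -> continuous c -> (forall x, D (c x)) ->
  continuous (fun x => g (c x)).
Proof.
move=> /subspace_continuousP cg cc Dc x A /(cg _ (Dc x)).
move=> H; have N : nbhs x (fun y => D (c y) -> A (g (c y))) by exact: (cc x _ H).
by apply: filterS N => y; apply; exact: Dc.
Qed.

Variable n : nat.
Local Notation V := 'rV[R]_n.

Lemma half_space_interior (p : R * V) : 0 < p.1 -> ((half_space (n := n))°)%classic p.
Proof.
case: p => t x /= t0.
have N : \forall s \near t, 0 < s by exact: lt_nbhsr.
exists ([set s | 0 < s], setT); first by split => //=; exact: filterT.
by move=> [s y] /= [s0 _]; rewrite /half_space/=; exact: ltW.
Qed.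

Lemma ct_maxr (T : topologicalType) (f : T -> R) : continuous f ->
  continuous (fun x => Num.max (f x) 0).
Proof.
by move=> cf x; apply: continuous_max; [exact: cf|exact: cst_continuous].
Qed.

Lemma Ck_slice (g h : R * V -> R) v : Ck 0 (half_space (n := n)) g ->
  (forall x, ((half_space (n := n))°)%classic x -> is_derive x (0, v) g (h x)) ->
  forall b x, 0 < b -> is_derive x v (fun y => g (b, y)) (h (b, x)).
Proof.
move=> _ dg b x b0.
have /dv_lineE H := dg (b, x) (half_space_interior (p := (b, x)) b0).
apply/dv_lineE; apply: dv_ext H => s /=.
have -> : (b, x) + s *: ((0:R), v) = (b + s *: (0:R), x + s *: v) by [].
by rewrite scaler0 addr0.
Qed.

Lemma dv_sum_dirs (E : normedModType R) (I : Type) (r : seq I) (F : E -> R) (e : I -> E)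
    (H : I -> E -> R) (c : I -> R) :
  (forall i x, is_derive x (e i) F (H i x)) -> (forall i, continuous (H i)) ->
  forall x, is_derive x (\sum_(i <- r) c i *: e i) F (\sum_(i <- r) c i * H i x).
Proof.
move=> dF cH; elim: r => [|i r ih] x.
  rewrite !big_nil; apply/dv_lineE.
  by apply: dv_ext (dv_cst (F x) (0:R) 1) => h; rewrite scaler0 addr0.
rewrite !big_cons.
apply: (@dv_diradd R E F (fun x => c i * H i x) (fun x => \sum_(i <- r) c i * H i x)).
- by apply: filterE => q; apply: dv_scaledir; exact: dF.
- by apply: filterE => q; exact: ih.
- by apply: ct_mul; [exact: ct_cst|exact: cH].
- by apply: ct_sum => j; apply: ct_mul; [exact: ct_cst|exact: cH].
Qed.

(** For [b > 0] the mean value theorem bounds the error of the difference quotient by the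
    oscillation of [H], uniformly in [b]; the bound survives the limit at the boundary, where no
    derivative is given. *)
Lemma dv_limit (E : normedModType R) (F H : R -> E -> R) x v :
  continuous (fun q : R * E => F q.1 q.2) -> continuous (fun q : R * E => H q.1 q.2) ->
  (forall b y, 0 < b -> is_derive y v (F b) (H b y)) -> is_derive x v (F 0) (H 0 x).
Proof.
move=> cF cH dF; apply/dvP => e e0.
have /cvgrPdist_le/(_ e e0) [[A B] /= [A0 Bx] AB] := cH (0, x).
have := near_small v Bx; apply: filterS => h Bh h0.
pose f b := h^-1 * (F b (x + h *: v) - F b x) - H 0 x.
have cf : continuous (fun b => `|f b|).
  have c1 : continuous f by rewrite /f; ctn; apply: (ct_comp2 cF); ctn.
  by move=> b; apply: (@continuous_comp _ _ _ f (fun r => `|r|)); [exact: c1|exact: norm_continuous].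
have near_le : \forall b \near (0:R)^'+, `|f b| <= e.
  have N1 : \forall b \near (0:R)^'+, A b by apply: cvg_within.
  near=> b.
  have b0 : 0 < b by near: b; exact: nbhs_right_gt.
  have Ab : A b by near: b.
  have [c c01 E1] := @MVT_line R E (F b) (H b) x v h (fun _ _ => dF b _ b0).
  rewrite /f E1 mulrA mulVf// mul1r distrC.
  by apply: (AB (b, x + (c * h) *: v)); split => //=; exact: Bh.
apply: (@cvgr_to_le _ _ _ _ (fun b => `|f b|) _ _ _ near_le).
by apply: cvg_at_right_filter; exact: cf.
Unshelve. all: by end_near.
Qed.

(** Time is a parameter here, frozen at 0 for negative values, and only space derivatives are taken.
    [Ck] supplies each directional derivative separately, without continuity in the direction;
    therefore the coordinate derivatives are chosen once and the others are their linear
    combinations. *)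
Lemma Ck_half_PC k (g : R * V -> R) : Ck k (half_space (n := n)) g ->
  PC k (fun (b : R) (x : V) => g (Num.max b 0, x)).
Proof.
elim: k g => [|k ih] g Cg.
  split => //; apply: (within_comp Cg.1 (c := fun q : R * V => (Num.max q.1 0, q.2))).
    by apply: ct_pair; [apply: ct_maxr|]; ctn.
  by move=> x; rewrite /half_space/= le_max lexx orbT.
have cg : continuous (fun q : R * V => g (Num.max q.1 0, q.2)).
  apply: (within_comp Cg.1 (c := fun q : R * V => (Num.max q.1 0, q.2))).
    by apply: ct_pair; [apply: ct_maxr|]; ctn.
  by move=> x; rewrite /half_space/= le_max lexx orbT.
split => //.
have /choice[h hP] : forall i : 'I_n, exists h : R * V -> R,
    Ck k (half_space (n := n)) h /\
    forall x, ((half_space (n := n))°)%classic x -> is_derive x (0, delta_mx 0 i) g (h x).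
  by move=> i; have [_ /(_ (0, delta_mx 0 i))[h h1 h2]] := Cg; exists h.
have Ph i := ih _ (hP i).1.
exists (fun (q : R * V) (x : V) => \sum_(i < n) q.2 0 i * h i (Num.max q.1 0, x)); last first.
  apply: PC_sum => i; apply: PC_scale; first by apply: ct_coord; ctn.
  by apply: (PC_reparam (r := fst)) (Ph i); ctn.
have pos (b : R) (x v : V) : 0 < b ->
    is_derive x v (fun y : V => g (b, y)) (\sum_(i < n) v 0 i * h i (b, x)).
  move=> b0; rewrite {1}(row_sum_delta v); apply: (dv_sum_dirs _ (H := fun i y => h i (b, y))).
    by move=> i y; apply: Ck_slice => //; [exact: (conj Cg.1 I)|exact: (hP i).2].
  move=> i; have := PC_contp (l := b) (Ph i); by rewrite max_l ?ltW.
move=> b v x /=; have [b0|b0] := ltP 0 b; first exact: pos.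
have := @dv_limit V (fun b y => g (Num.max b 0, y))
  (fun b y => \sum_(i < n) v 0 i * h i (Num.max b 0, y)) x v cg.
rewrite maxxx; apply.
  apply: ct_sum => i; apply: ct_mul; first exact: ct_cst.
  exact: (PC_cont (Ph i)).
by move=> c y c0; rewrite max_l ?ltW//; exact: pos.
Qed.

Lemma Ck_setT_half k (g : V -> R) : Ck k [set: V] g ->
  Ck k (half_space (n := n)) (fun p => g p.2).
Proof.
elim: k g => [|k ih] g Cg.
  split => //; apply: continuous_subspaceT.
  by apply: (within_comp Cg.1 (c := fun q : R * V => q.2)) => //; ctn.
split.
  apply: continuous_subspaceT.
  by apply: (within_comp Cg.1 (c := fun q : R * V => q.2)) => //; ctn.
move=> v; have [_ /(_ v.2)[h h1 h2]] := Cg.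
exists (fun p => h p.2); first exact: ih.
move=> x _; have /dv_lineE H : is_derive x.2 v.2 g (h x.2).
  by apply: h2; rewrite interiorT.
by apply/dv_lineE; apply: dv_ext H => s.
Qed.

Lemma Ck_setT_PC k (g : V -> R) (T : topologicalType) : Ck k [set: V] g ->
  PC k (fun (_ : T) x => g x).
Proof.
move=> /Ck_setT_half/Ck_half_PC H.
by apply: (PC_reparam (r := fun _ : T => 0)) H; ctn.
Qed.

Lemma smooth1_expR k : smooth1 k [set: R] expR.
Proof.
elim: k => [|k ih]; (split; first by move=> x _; exact: continuous_expR) => //.
by exists expR => // x _; exact: is_derive_expR.
Qed.

(** The time [expR p.1] never leaves the interior of the half space, so all directions of space-time
    are available. As before, derivatives are linear combinations of the coordinate ones; the time
    direction carries the factor [expR p.1]. *)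
Lemma Ck_half_exp_PC k (g : R * V -> R) (T : topologicalType) :
  Ck k (half_space (n := n)) g ->
  PC k (fun (_ : T) (p : R * V) => g (expR p.1, p.2)).
Proof.
elim: k g T => [|k ih] g T Cg.
  split => //; apply: (within_comp Cg.1 (c := fun q : T * (R * V) => (expR q.2.1, q.2.2))).
    by apply: ct_pair; [apply: (ct_comp (@continuous_expR R))|]; ctn.
  by move=> x; rewrite /half_space/= expR_ge0.
have cg : continuous (fun q : T * (R * V) => g (expR q.2.1, q.2.2)).
  apply: (within_comp Cg.1 (c := fun q : T * (R * V) => (expR q.2.1, q.2.2))).
    by apply: ct_pair; [apply: (ct_comp (@continuous_expR R))|]; ctn.
  by move=> x; rewrite /half_space/= expR_ge0.
split => //.
have /choice[h hP] : forall v : R * V, exists h : R * V -> R,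
    Ck k (half_space (n := n)) h /\
    forall x, ((half_space (n := n))°)%classic x -> is_derive x v g (h x).
  by move=> v; have [_ /(_ v)[h h1 h2]] := Cg; exists h.
have Ph v U := ih _ U (hP v).1.
pose D (v p : R * V) := v.1 * (expR p.1 * h (1, 0) (expR p.1, p.2)) +
  \sum_(i < n) v.2 0 i * h (0, delta_mx 0 i) (expR p.1, p.2).
have PD : PC k (fun (q : T * (R * V)) p => D q.2 p).
  apply: PC_add.
    apply: PC_scale; first by ctn.
    apply: PC_mul; last exact: Ph.
    apply: (PC_outer (I := setT)) => //; first exact: smooth1_expR.
    by apply: PC_linear => //; ctn.
  by apply: PC_sum => i; apply: PC_scale => //; apply: ct_coord; ctn.
exists (fun q p => D q.2 p) => // _ v p /=.
have int (q : R * V) : ((half_space (n := n))°)%classic (expR q.1, q.2).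
  by apply: half_space_interior; exact: expR_gt0.
have vE : v.1 *: ((1 : R), (0 : V)) + \sum_(i < n) v.2 0 i *: ((0 : R), (delta_mx 0 i : V)) = v.
  rewrite (_ : \sum_(i < n) _ = (0, v.2)).
    case: (v) => a b; have -> : a *: ((1 : R), (0 : V)) = (a *: (1:R), a *: (0 : V)) by [].
    have -> : (a *: (1:R), a *: (0 : V)) + ((0:R), b) = (a *: (1:R) + 0, a *: (0 : V) + b) by [].
    by rewrite [a *: (1:R)]mulr1 scaler0 addr0 add0r.
  rewrite [X in (0, X)](row_sum_delta v.2); elim/big_ind2: _ => //.
    by move=> x1 x2 y1 y2 -> ->; rewrite -[LHS]/(0 + 0, x1 + y1) addr0.
  by move=> i _; rewrite -[LHS]/(v.2 0 i *: (0 : R), v.2 0 i *: (delta_mx 0 i : V)) scaler0.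
have chv w : continuous (fun p : R * V => h w (expR p.1, p.2)).
  exact: (PC_contp (l := 0) (Ph w R)).
have cD1 : continuous (fun p : R * V => expR p.1 * h (1, 0) (expR p.1, p.2)).
  by apply: ct_mul; [apply: (ct_comp (@continuous_expR R))|]; ctn.
have H : is_derive p (v.1 *: ((1 : R), (0 : V)) + \sum_(i < n) v.2 0 i *: ((0 : R), (delta_mx 0 i : V)))
    (fun p : R * V => g (expR p.1, p.2)) (D v p).
  apply: (@dv_diradd R _ (fun p : R * V => g (expR p.1, p.2))
     (fun p => v.1 * (expR p.1 * h (1, 0) (expR p.1, p.2)))
     (fun p => \sum_(i < n) v.2 0 i * h (0, delta_mx 0 i) (expR p.1, p.2))).
  - apply: filterE => q; apply: dv_scaledir; apply/dv_lineE.
    have /dv_lineE H0 := (hP (1, 0)).2 _ (int q).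
    have H1 : is_derive (expR q.1) 1 (fun t : R => g (t, q.2)) (h (1, 0) (expR q.1, q.2)).
      apply/dv_lineE; apply: dv_ext H0 => s.
      by rewrite -[X in g X = _]/(expR q.1 + s *: (1:R), q.2 + s *: (0 : V)) scaler0 addr0.
    have H2 : is_derive (0:R) 1 (fun s : R => expR (q.1 + s)) (expR q.1 * 1).
      apply: dv_comp; first by rewrite addr0; exact: is_derive_expR.
      by have := dv_add (dv_cst q.1 (0:R) 1) (dv_id (0:R)); rewrite add0r.
    have H3 : is_derive (expR (q.1 + 0)) 1 (fun t : R => g (t, q.2)) (h (1, 0) (expR q.1, q.2)).
      by rewrite addr0.
    have H4 := @dv_comp R R^o (fun t => g (t, q.2)) (fun s => expR (q.1 + s)) 0 1 _ _ H3 H2.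
    apply: (dv_eq (d := h (1, 0) (expR q.1, q.2) * (expR q.1 * 1))).
      apply: dv_ext H4 => s.
      by rewrite -[X in _ = g (expR X.1, X.2)]/(q.1 + s *: (1:R), q.2 + s *: (0 : V)) /= scaler0 addr0 [s *: (1:R)]mulr1.
    by rewrite mulr1 mulrC.
  - apply: filterE => q.
    apply: (dv_sum_dirs _ (H := fun i (p : R * V) => h (0, delta_mx 0 i) (expR p.1, p.2))) => // i x.
    have /dv_lineE H0 := (hP (0, delta_mx 0 i)).2 _ (int x).
    apply/dv_lineE; apply: dv_ext H0 => s.
    rewrite -[X in g X = _]/(expR x.1 + s *: (0:R), x.2 + s *: (delta_mx 0 i : V)).
    rewrite -[X in _ = g (expR X.1, X.2)]/(x.1 + s *: (0:R), x.2 + s *: (delta_mx 0 i : V)) /=.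
    by rewrite scaler0 !addr0.
  - have c1 : continuous (fun p : R * V => v.1 * (expR p.1 * h (1, 0) (expR p.1, p.2))).
      by apply: ct_mul => //; exact: ct_cst.
    exact: c1.
  - by apply: ct_sum => i; apply: ct_mul; ctn.
by rewrite vE in H.
Qed.

End CkPC.

(** * Lebesgue integrals over balls *)

Section BallIntegral.
Variable R : realType.
Local Notation T := (measurableTypeR R).
Local Notation leb1 := (@lebesgue_measure R).

(** Induction on the dimension: rounding the first coordinate down to a multiple of 1/(k+1) leaves,
    on each of countably many slabs, a continuous function of the other coordinates; [phi] is the
    pointwise limit. *)
Lemma measurable_continuous_rV n (phi : 'rV[R]_n -> R) : continuous phi ->
  measurable_fun [set: n.-tuple T] (fun z => phi (rV_of_tuple z)).
Proof.
elim: n phi => [|n ih] phi cphi.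
  rewrite (_ : (fun z => _) = (fun=> phi 0)); first exact: measurable_cst.
  by apply/funext => z; congr phi; apply/rowP => -[].
pose psi (s : R) (z : n.-tuple T) := phi (s *: delta_mx 0 ord0 + embed0 (rV_of_tuple z)).
have mpsi s : measurable_fun [set: n.-tuple T] (psi s).
  by apply: (ih (fun y => phi (s *: delta_mx 0 ord0 + embed0 y))); apply: (ct_comp cphi); ctn.
have phiE (z : n.+1.-tuple T) : phi (rV_of_tuple z) = psi (thead z) [tuple of behead z].
  congr phi; apply/rowP => j; rewrite !mxE.
  have [i ->|->] := unliftP ord0 j.
    rewrite eq_sym (negbTE (neq_lift _ _)) andbF mulr0 add0r mxE.
    by have {1}-> := tuple_eta z; rewrite tnthS.
  by rewrite !eqxx mulr1 addr0.
have mth : measurable_fun [set: n.+1.-tuple T] (fun z => thead z : R).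
  exact: (@measurable_tnth _ T n.+1 ord0).
have mbe := @measurable_behead _ T n.
pose fl (k : nat) (s : R) : R := (Num.floor (k.+1%:R * s))%:~R / k.+1%:R.
apply: (measurable_fun_cvg (h := fun k z => psi (fl k (thead z)) [tuple of behead z])).
  move=> k _ B mB; rewrite setTI.
  have -> : (fun z : n.+1.-tuple T => psi (fl k (thead z)) [tuple of behead z]) @^-1` B =
     \bigcup_(j : int) ([set z : n.+1.-tuple T | j%:~R <= k.+1%:R * thead z < (j + 1)%:~R] `&`
        (fun z : n.+1.-tuple T => psi (j%:~R / k.+1%:R) [tuple of behead z]) @^-1` B).
    apply/seteqP; split => z /=.
      move=> Bz; exists (Num.floor (k.+1%:R * thead z)) => //; split => //.
      exact: floor_itv.
    by move=> [j _ [/= /floor_def jE Bz]]; rewrite /fl jE.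
  apply: countable_bigcupT_measurable => // j; apply: measurableI.
    have m1 : measurable_fun [set: n.+1.-tuple T] (fun z => k.+1%:R * (thead z : R)).
      exact: measurable_funM.
    have := m1 measurableT `[j%:~R, (j + 1)%:~R[%classic (measurable_itv _).
    rewrite setTI; congr measurable; apply/seteqP; split => z /=; by rewrite in_itv.
  have := measurableT_comp (mpsi (j%:~R / k.+1%:R)) mbe.
  by move=> /(_ measurableT B mB); rewrite setTI.
move=> z _; rewrite phiE.
have cpsi : continuous (fun s => psi s [tuple of behead z]).
  by apply: (ct_comp cphi); ctn.
apply: (@cvg_comp _ _ _ (fun k => fl k (thead z)) (fun s => psi s [tuple of behead z])); last exact: cpsi.
apply/cvgrPdist_le => e e0.
have := @near_infty_natSinv_lt R (PosNum e0); apply: filterS => k /= ke.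
rewrite /fl; have /andP[h1 h2] := floor_itv (k.+1%:R * (thead z : R)).
set m := Num.floor _ in h1 h2 *.
have k0 : 0 < k.+1%:R :> R by [].
have -> : thead z - m%:~R / k.+1%:R = (k.+1%:R * thead z - m%:~R) / k.+1%:R :> R.
  by field; rewrite gt_eqF.
rewrite intrD in h2.
rewrite ger0_norm; last by rewrite divr_ge0// subr_ge0.
by rewrite ler_pdivrMr//; apply: (@le_trans _ _ 1); [lra|rewrite -ler_pdivrMr// div1r ltW].
Qed.

(** Under z = x + t sin th the function [G] may blow up at the ends of the interval while [g] stays
    continuous. The substitution is made on closed subintervals, and monotone convergence exhausts
    the open one. *)
Lemma ge0_sin_subst (x t : R) (G g : R -> R) : 0 < t ->
  (forall z, x - t < z < x + t -> {for z, continuous G}) ->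
  (forall z, x - t < z < x + t -> 0 <= G z) -> continuous g ->
  (forall th, - (pi / 2) < th < pi / 2 -> G (x + t * sin th) * (t * cos th) = g th) ->
  (\int[leb1]_(z in `](x - t)%R, (x + t)%R[) (G z)%:E = (oint (- (pi / 2)) (pi / 2) g)%R%:E)%E.
Proof.
move=> t0 cG G0 cg Gg.
have p0 : 0 < pi / 2 :> R by have := @pi_gt0 R; lra.
pose u (th : R) := x + t * sin th.
(* [harmonic k] is 1/(k+1); halving it keeps [a 0] positive while [a k] increases to pi/2. *)
pose a (k : nat) : R := pi / 2 * (1 - @harmonic R k / 2).
have a_cvg : a @ \oo --> pi / 2.
  have h1 : (1 - @harmonic R k / 2) @[k --> \oo] --> (1 - 0 * 2^-1 : R).
    by apply: cvgB; [exact: cvg_cst|apply: cvgM; [exact: cvg_harmonic|exact: cvg_cst]].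
  have h2 : (pi / 2 * (1 - @harmonic R k / 2)) @[k --> \oo] --> (pi / 2 * (1 - 0 * 2^-1) : R).
    by apply: cvgM; [exact: cvg_cst|exact: h1].
  by rewrite mul0r subr0 mulr1 in h2; exact: h2.
have a_rng k : 0 < a k < pi / 2.
  have h0 : 0 < @harmonic R k by rewrite /harmonic invr_gt0.
  have h1 : @harmonic R k <= 1 by rewrite /harmonic invf_le1// ler1n.
  apply/andP; split; first by rewrite /a mulr_gt0//; lra.
  rewrite /a -[ltRHS]mulr1 ltr_pM2l//; lra.
have a_mono i j : (i <= j)%N -> a i <= a j.
  move=> ij; rewrite /a ler_pM2l// lerB// ler_pM2r// /harmonic lef_pV2 ?posrE// ler_nat//.
have sin_smono (b c : R) : - (pi / 2) <= b <= pi / 2 -> - (pi / 2) <= c <= pi / 2 ->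
    b < c -> u b < u c.
  by move=> hb hc bc; rewrite /u ltrD2l ltr_pM2l// ltr_sin// in_itv.
have sin_mono (b c : R) : - (pi / 2) <= b <= pi / 2 -> - (pi / 2) <= c <= pi / 2 ->
    b <= c -> u b <= u c.
  move=> hb hc; rewrite le_eqVlt => /orP[/eqP -> //|bc]; exact/ltW/sin_smono.
have up : u (pi / 2) = x + t by rewrite /u sin_pihalf mulr1.
have un : u (- (pi / 2)) = x - t by rewrite /u sinN sin_pihalf mulrN1.
have u_rng (b : R) : - (pi / 2) < b < pi / 2 -> x - t < u b < x + t.
  by move=> /andP[b1 b2]; rewrite -up -un !sin_smono//; lra.
pose F k := `[u (- a k), u (a k)]%classic.
have Fsub k z : F k z -> x - t < z < x + t.
  rewrite /F/= in_itv/= => /andP[z1 z2]; have /andP[a1 a2] := a_rng k.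
  have /andP[h1 _] := u_rng (- a k) ltac:(lra).
  have /andP[_ h2] := u_rng (a k) ltac:(lra).
  by rewrite (lt_le_trans h1 z1) (le_lt_trans z2 h2).
have FE : \bigcup_k F k = `]x - t, x + t[%classic.
  apply/seteqP; split => z.
    by move=> [k _ /Fsub]; rewrite /= in_itv.
  rewrite /= in_itv/= => /andP[z1 z2].
  pose w := (z - x) / t.
  have w1 : -1 < w by rewrite /w ltr_pdivlMr//; lra.
  have w2 : w < 1 by rewrite /w ltr_pdivrMr//; lra.
  have uw : u (asin w) = z.
    by rewrite /u asinK ?in_itv/= ?ltW// /w; field; rewrite gt_eqF.
  have h1 : asin w < pi / 2 by apply: asin_ltpi2; rewrite ltW.
  have h2 : - (pi / 2) < asin w by apply: asin_gtNpi2; rewrite w1 ltW.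
  have h3 : `|asin w| < pi / 2 by rewrite ltr_norml h2.
  have [k ak] : exists k, `|asin w| < a k.
    have /cvgrPdist_lt/(_ (pi / 2 - `|asin w|)) := a_cvg.
    rewrite subr_gt0 => /(_ h3) [N _ /(_ N (leqnn N)) /= hN]; exists N.
    by move: hN; rewrite ltr_norml => /andP[_]; lra.
  exists k => //; rewrite /F/= in_itv/= -uw; move: ak; rewrite ltr_norml => /andP[k1 k2].
  by have /andP[? ?] := a_rng k; apply/andP; split; apply: sin_mono; lra.
have du (th : R) : is_derive th 1 u (t * cos th).
  apply: dv_eq (dv_add (dv_cst x th 1) (dv_scale t (is_derive_sin th))) _.
  by rewrite add0r.
have u'E : u^`()%classic = (fun th => t * cos th).
  by apply/funext => th; rewrite derive1E; have [_ ->] := du th.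
have cu' : continuous u^`()%classic by rewrite u'E; ctn.
pose A (y : R) := oint 0 y g.
have dA (y : R) : is_derive y 1 A (g y) by exact: oint0_derive.
have cA : continuous A by move=> y; exact: (dv_cont (dA y)).
have cGF k : {within F k, continuous G}.
  by apply: continuous_in_subspaceT => z; rewrite inE => /Fsub/cG.
have FI k : (\int[leb1]_(z in F k) (G z)%:E = (A (a k) - A (- a k))%R%:E)%E.
  have /andP[k1 k2] := a_rng k.
  have kk : - a k < a k by lra.
  rewrite /F (integration_by_substitution_increasing (ltW kk)).
  - transitivity (\int[leb1]_(th in `[(- a k)%R, (a k)%R]) (g th)%:E)%E.
      apply: eq_integral => th; rewrite inE/= in_itv/= => /andP[th1 th2].
      rewrite -[X in X%:E = _]/(G (u th) * (u^`()%classic th)) u'E.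
      by congr EFin; apply: Gg; lra.
    rewrite (@continuous_FTC2 _ g A)//.
    + exact: continuous_subspaceT.
    + split.
      * by move=> y _; have [] := dA y.
      * by apply: cvg_at_right_filter; exact: cA.
      * by apply: cvg_at_left_filter; exact: cA.
    + by move=> y _; rewrite derive1E; have [_ ->] := dA y.
  - by move=> b c; rewrite !in_itv/= => /andP[? ?] /andP[? ?]; apply: sin_smono; lra.
  - by move=> y _; exact: cu'.
  - by apply/cvg_ex; eexists; apply: cvg_at_right_filter; exact: cu'.
  - by apply/cvg_ex; eexists; apply: cvg_at_left_filter; exact: cu'.
  - split.
    + by move=> y _; have [] := du y.
    + by apply: cvg_at_right_filter; exact: (dv_cont (du _)).
    + by apply: cvg_at_left_filter; exact: (dv_cont (du _)).
  - exact: cGF.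
have mono : {homo F : i j / (i <= j)%N >-> (i <= j)%O}.
  move=> i j ij; apply/subsetPset => z; rewrite /F/= !in_itv/= => /andP[z1 z2].
  have /andP[? ?] := a_rng i; have /andP[? ?] := a_rng j; have := a_mono _ _ ij => aij.
  by rewrite (le_trans _ z1) ?(le_trans z2)//; apply: sin_mono; lra.
have := @ge0_nondecreasing_set_cvg_integral _ T R F (fun z => (G z)%:E) leb1 mono.
rewrite FE => H.
have H1 : (\int[leb1]_(z in F k) (G z)%:E @[k --> \oo] --> \int[leb1]_(z in `](x - t)%R, (x + t)%R[) (G z)%:E)%E.
  apply: H.
  - by move=> k; exact: measurable_itv.
  - move=> k; apply/measurable_EFinP.
    by apply: subspace_continuous_measurable_fun => //; exact: measurable_itv.
  - by move=> k z /Fsub/G0; rewrite lee_fin.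
have H2 : (\int[leb1]_(z in F k) (G z)%:E @[k --> \oo] --> (A (pi / 2) - A (- (pi / 2)))%R%:E)%E.
  have E : (fun k => \int[leb1]_(z in F k) (G z)%:E)%E = (fun k => (A (a k) - A (- a k))%R%:E).
    by apply/funext => k; exact: FI.
  rewrite E; apply/cvg_EFin; first exact: nearW.
  apply: cvgB; first by apply: (cvg_comp _ _ a_cvg); exact: cA.
  apply: (@cvg_comp _ _ _ (fun k => - a k) A); last exact: cA.
  by apply: cvgN.
rewrite (oint_chasles _ _ cg) -/(A _) -/(A _).
exact: (cvg_unique _ H1 H2).
Qed.

Definition sqn n (v : 'rV[R]_n) : R := \sum_(i < n) v 0 i ^+ 2.

Lemma sqn_ge0 n (v : 'rV[R]_n) : 0 <= sqn v.
Proof. by apply: sumr_ge0 => i _; exact: sqr_ge0. Qed.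

Lemma enorm_sq n (v : 'rV[R]_n) : enorm v ^+ 2 = sqn v.
Proof. by rewrite /enorm sqr_sqrtr// sqn_ge0. Qed.

Lemma enorm_lt n (v : 'rV[R]_n) t : 0 < t -> (enorm v < t) = (sqn v < t ^+ 2).
Proof.
by move=> t0; rewrite -enorm_sq ltr_pXn2r// ?nnegrE ?sqrtr_ge0// ltW.
Qed.

Lemma ct_sqn n : continuous (@sqn n).
Proof. by apply: ct_sum => i; apply: ct_exp; apply: ct_coord; ctn. Qed.

Definition tl n (x : 'rV[R]_n.+1) : 'rV[R]_n := \row_i x 0 (lift ord0 i).

Lemma hd_tl n (x : 'rV[R]_n.+1) : x = x 0 ord0 *: delta_mx 0 ord0 + embed0 (tl x).
Proof.
apply/rowP => j; rewrite !mxE; case: unliftP => [i ->|->].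
  by rewrite eq_sym (negbTE (neq_lift _ _)) andbF mulr0 add0r mxE.
by rewrite !eqxx mulr1 addr0.
Qed.

Lemma sqn_cons n (s : R) (y : 'rV[R]_n) : sqn (s *: delta_mx 0 ord0 + embed0 y) = s ^+ 2 + sqn y.
Proof.
rewrite /sqn big_ord_recl; congr (_ + _).
  by rewrite !mxE unlift_none !eqxx mulr1 addr0.
apply: eq_bigr => i _; rewrite !mxE liftK eq_sym (negbTE (neq_lift _ _)) andbF.
by rewrite mulr0 add0r.
Qed.

Lemma sqn_consB n (s : R) (y : 'rV[R]_n) (x : 'rV[R]_n.+1) :
  sqn (s *: delta_mx 0 ord0 + embed0 y - x) = (s - x 0 ord0) ^+ 2 + sqn (y - tl x).
Proof.
rewrite -sqn_cons {1}(hd_tl x) opprD addrACA -scalerBl.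
by congr (sqn (_ + _)); rewrite -[- embed0 _]scaleN1r -embed0Z -embed0D scaleN1r.
Qed.

Lemma rV_cons n (s : T) (z : n.-tuple T) :
  rV_of_tuple (cons_pair (s, z)) = s *: delta_mx 0 ord0 + embed0 (rV_of_tuple z) :> 'rV[R]_n.+1.
Proof.
apply/rowP => j; rewrite !mxE; case: unliftP => [i ->|->].
  by rewrite eq_sym (negbTE (neq_lift _ _)) andbF mulr0 add0r mxE tnthS.
by rewrite !eqxx mulr1 addr0.
Qed.

Lemma hemiL_ge0 n (g : 'rV[R]_n -> R) : (forall y, 0 <= g y) -> 0 <= hemiL g.
Proof.
have pi2 : - (pi / 2) <= pi / 2 :> R by have := @pi_gt0 R; lra.
elim: n g => [|n ih] g g0 //=; apply: oint_ge0 => // th thp.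
by rewrite mulr_ge0// ?ih// exprn_ge0// cos_ge0_pihalf.
Qed.

Lemma measurable_eball n (x : 'rV[R]_n) t : measurable (eball x t).
Proof.
have [t0|t0] := ltP 0 t; last first.
  rewrite (_ : eball x t = set0)//; apply/seteqP; split => z //=.
  by move=> /lt_le_trans/(_ t0); rewrite ltNge sqrtr_ge0.
have c1 : continuous (fun y : 'rV[R]_n => sqn (y - x)).
  by apply: (ct_comp (@ct_sqn n)); apply: ct_addE; ctn.
have := measurable_continuous_rV c1 measurableT (measurable_itv `]-oo, (t ^+ 2)%R[).
rewrite setTI; congr measurable; apply/seteqP; split => z /=;
  by rewrite in_itv/= /eball/= enorm_lt.
Qed.

Definition slice_radius (t s : R) : R := Num.sqrt (t ^+ 2 - s ^+ 2).

Lemma slice_radius_gt0 t s : 0 < t -> - t < s < t -> 0 < slice_radius t s.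
Proof.
move=> t0 /andP[s1 s2]; rewrite sqrtr_gt0.
have -> : t ^+ 2 - s ^+ 2 = (t - s) * (t + s) by ring.
by apply: mulr_gt0; lra.
Qed.

Lemma slice_radius_sq t s : 0 < t -> - t < s < t -> slice_radius t s ^+ 2 = t ^+ 2 - s ^+ 2.
Proof.
move=> t0 st; have := slice_radius_gt0 t0 st; rewrite /slice_radius sqrtr_gt0 => h.
by rewrite sqr_sqrtr// ltW.
Qed.

Lemma slice_radius_sin t th : 0 < t -> - (pi / 2) < th < pi / 2 ->
  slice_radius t (t * sin th) = t * cos th.
Proof.
move=> t0 thp; have c0 : 0 < cos th by exact: cos_gt0_pihalf.
rewrite /slice_radius (_ : t ^+ 2 - _ = (t * cos th) ^+ 2); last first.
  by rewrite !exprMn -[X in X - _]mulr1 -(cos2Dsin2 th); ring.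
by rewrite sqrtr_sqr ger0_norm// mulr_ge0// ltW.
Qed.

Lemma ct_slice_radius t : continuous (slice_radius t).
Proof. by apply: (ct_comp (@sqrt_continuous R)); ctn. Qed.

Lemma eball_cons n (x : 'rV[R]_n.+1) t (s : T) (z : n.-tuple T) : 0 < t ->
  - t < s - x 0 ord0 < t ->
  eball x t (cons_pair (s, z)) = eball (tl x) (slice_radius t (s - x 0 ord0)) z.
Proof.
move=> t0 st; rewrite /eball/= rV_cons !enorm_lt//; last exact: slice_radius_gt0.
by rewrite sqn_consB slice_radius_sq// ltrBrDl.
Qed.

Lemma eball_cons_out n (x : 'rV[R]_n.+1) t (s : T) (z : n.-tuple T) : 0 < t ->
  eball x t (cons_pair (s, z)) -> - t < s - x 0 ord0 < t.
Proof.
move=> t0; rewrite /eball/= rV_cons enorm_lt// sqn_consB => h.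
have := sqn_ge0 (rV_of_tuple z - tl x); set a := s - _ in h *; move=> q0.
have : a ^+ 2 < t ^+ 2 by lra.
by rewrite -real_normK ?num_real// ltr_pXn2r// ?nnegrE ?ltW// ltr_norml.
Qed.

(** Tonelli's theorem slices the ball at height s. A slice is a ball of radius rho with rho^2 = t^2
    - (s - x_0)^2, and the square root in the integrand is the one belonging to that smaller ball,
    so the induction hypothesis applies; s = x_0 + t sin th then produces one more angle of
    [hemiL]. *)
Theorem ge0_ball_integral n (phi : 'rV[R]_n -> R) (x : 'rV[R]_n) t : 0 < t ->
  continuous phi -> (forall y, 0 <= phi y) ->
  (\int[lebesgue_Rn R n]_(z in eball x t)
     (phi (rV_of_tuple z) / Num.sqrt (t ^+ 2 - enorm (rV_of_tuple z - x) ^+ 2))%R%:E =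
   (t ^+ n / t * hemiL (fun y => phi (x + t *: y)))%R%:E)%E.
Proof.
elim: n phi x t => [|n ih] phi x t t0 cphi phi0.
  have eT : eball x t = [set: 0.-tuple T].
    by apply/seteqP; split => // z _; rewrite /eball/= enorm_lt// /sqn big_ord0 exprn_gt0.
  have x0 (y : 'rV[R]_0) : y = 0 by apply/rowP => -[].
  rewrite eT integral_dirac//; last first.
    rewrite (_ : (fun z => _) = (fun=> (phi (rV_of_tuple [tuple]) / Num.sqrt (t ^+ 2 - enorm (rV_of_tuple [tuple] - x) ^+ 2))%:E)); first exact: measurable_cst.
    by apply/funext => z; rewrite [z]tuple0.
  rewrite diracE mem_set// mul1e /=.
  rewrite enorm_sq /sqn big_ord0 subr0 sqrtr_sqr ger0_norm ?ltW// expr0.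
  by congr EFin; rewrite mulrC mul1r; congr (_ * phi _); rewrite [LHS]x0 [RHS]x0.
have mD := measurable_eball x t.
pose q (z : n.+1.-tuple T) := phi (rV_of_tuple z) / Num.sqrt (t ^+ 2 - enorm (rV_of_tuple z - x) ^+ 2).
have c1 : continuous (fun y : 'rV[R]_n.+1 => t ^+ 2 - sqn (y - x)).
  by apply: ct_sub; ctn; apply: (ct_comp (@ct_sqn _)); apply: ct_addE; ctn.
have mq : measurable_fun (eball x t) q.
  (* Inside the ball the reciprocal square root is the power with exponent -1/2, a measurable
     function on the whole line. *)
  have m1 : measurable_fun [set: n.+1.-tuple T] (fun z => phi (rV_of_tuple z) *
     (powR (t ^+ 2 - sqn (rV_of_tuple z - x)) (- 2^-1))).
    apply: measurable_funM; first exact: measurable_continuous_rV.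
    by apply: (measurableT_comp (measurable_powR _)); exact: measurable_continuous_rV c1.
  apply: (eq_measurable_fun (fun z => phi (rV_of_tuple z) *
     (powR (t ^+ 2 - sqn (rV_of_tuple z - x)) (- 2^-1)))).
    move=> z; rewrite inE /eball/= enorm_lt// => zt; rewrite /q enorm_sq powRN.
    by rewrite powR12_sqrt// subr_ge0 ltW.
  exact: measurable_funTS.
rewrite integral_mkcond; set f := _ \_ _.
have mf : measurable_fun [set: n.+1.-tuple T] f.
  have mq' : measurable_fun (eball x t) (EFin \o q) by exact/measurable_EFinP.
  by apply/(measurable_restrictT _ mD).
have f0 z : (0 <= f z)%E.
  by rewrite /f patchE; case: ifP => // _; rewrite lee_fin mulr_ge0// invr_ge0 sqrtr_ge0.
have -> : (\int[lebesgue_Rn R n.+1]_z f z = \int[leb1 \x lebesgue_Rn R n]_p f (cons_pair p))%E.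
  have := ge0_integral_pushforward (@measurable_cons_pair R n) (leb1 \x lebesgue_Rn R n)%E measurableT mf.
  by rewrite preimage_setT; apply => y _; exact: f0.
rewrite fubini_tonelli1; last 2 first.
- exact: (measurableT_comp mf (@measurable_cons_pair R n)).
- by move=> p; exact: f0.
pose rho (s : R) := slice_radius t (s - x 0 ord0).
pose G (s : R) := rho s ^+ n / rho s * hemiL (fun y => phi (s *: delta_mx 0 ord0 + embed0 (tl x + rho s *: y))).
have rng (s : R) : (x 0 ord0 - t < s < x 0 ord0 + t) = (- t < s - x 0 ord0 < t).
  by apply/idP/idP => /andP[? ?]; apply/andP; split; lra.
transitivity (\int[leb1]_(s in `](x 0 ord0 - t)%R, (x 0 ord0 + t)%R[) (G s)%:E)%E.
  rewrite [RHS]integral_mkcond; apply: eq_integral => s _; rewrite patchE /fubini_F.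
  case: ifPn => [|sI].
    rewrite inE/= in_itv/= rng => st.
    have rho0 : 0 < rho s by exact: slice_radius_gt0.
    rewrite /G -(ih (fun y => phi (s *: delta_mx 0 ord0 + embed0 y)) (tl x) (rho s) rho0).
    - rewrite [RHS]integral_mkcond; apply: eq_integral => z _.
      rewrite /f !patchE; have -> : (cons_pair (s, z) \in eball x t) = (z \in eball (tl x) (rho s)).
        by apply/idP/idP; rewrite !inE eball_cons.
      case: ifPn => // _; rewrite rV_cons !enorm_sq sqn_consB slice_radius_sq//.
      by congr ((_ / Num.sqrt _)%:E); ring.
    - by apply: (ct_comp cphi); ctn.
    - by move=> y; exact: phi0.
  apply: integral0_eq => z _; rewrite /f patchE; case: ifPn => // /set_mem zb.
  by case/negP: sI; rewrite inE/= in_itv/= rng; exact: eball_cons_out zb.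
have cr : continuous rho by apply: (ct_comp (@ct_slice_radius t)); ctn.
rewrite (@ge0_sin_subst _ _ _ (fun th => (t ^+ n) * (cos th ^+ n * hemiL (fun y => phi (x + t *: hemi th y)))))//.
- rewrite oint_scale; last first.
    have := @ct_hemi_integrand R n (fun y => phi (x + t *: y)); apply.
    by apply: (ct_comp cphi); ctn.
  by congr EFin; rewrite exprS (mulrC t) mulfK ?gt_eqF.
- move=> s st; apply: continuousM; last first.
    have c3 : continuous (fun s : R => hemiL (fun y : 'rV[R]_n => phi (s *: delta_mx 0 ord0 + embed0 (tl x + rho s *: y)))).
      apply: (continuous_hemiL (F := fun (s : R) (y : 'rV[R]_n) => phi (s *: delta_mx 0 ord0 + embed0 (tl x + rho s *: y)))).
      have cr1 : continuous (fun q : R * 'rV[R]_n => rho q.1) by apply: (ct_comp cr); ctn.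
      by apply: (ct_comp cphi); ctn.
    exact: c3.
  have c2 : continuous (fun s : R => rho s ^+ n) by ctn.
  apply: continuousM; first exact: c2.
  apply: continuousV; last exact: cr.
  by rewrite gt_eqF// slice_radius_gt0// -rng.
- move=> s st; rewrite mulr_ge0//; last by apply: hemiL_ge0.
  by rewrite divr_ge0// ?exprn_ge0// sqrtr_ge0.
- apply: ct_mul; first exact: ct_cst.
  apply: (@ct_hemi_integrand R n (fun y => phi (x + t *: y))).
  by apply: (ct_comp cphi); ctn.
- move=> th thp; rewrite /G /rho addrAC subrr add0r slice_radius_sin//.
  have tc : t * cos th != 0 by rewrite mulf_neq0 ?gt_eqF// cos_gt0_pihalf.
  rewrite mulrAC divfK// exprMn mulrA; congr (_ * hemiL _).
  apply/funext => y; congr phi; rewrite [in RHS](hd_tl x) /hemi embed0D embed0Z !scalerDr !scalerA.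
  by rewrite scalerDl addrACA.
Qed.

(** The volume of the unit ball in the recursive form that slicing produces; see
    [lebesgue_eball]. *)
Fixpoint ball_vol (n : nat) : R :=
  if n is n'.+1 then oint (- (pi / 2)) (pi / 2) (fun th => cos th ^+ n) * ball_vol n' else 1.

Theorem lebesgue_eball n (x : 'rV[R]_n) t : 0 < t ->
  lebesgue_Rn R n (eball x t) = (t ^+ n * ball_vol n)%R%:E.
Proof.
elim: n x t => [|n ih] x t t0.
  rewrite (_ : eball x t = setT); last first.
    by apply/seteqP; split => // z _; rewrite /eball/= enorm_lt// /sqn big_ord0 exprn_gt0.
  by rewrite /= diracE mem_set//= mulr1.
have mD := measurable_eball x t.
have mC : measurable (cons_pair (R:=R) (n:=n) @^-1` eball x t).
  by rewrite -[X in measurable X]setTI; exact: measurable_cons_pair.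
have -> : lebesgue_Rn R n.+1 (eball x t) = (leb1 \x lebesgue_Rn R n)%E (cons_pair (R:=R) (n:=n) @^-1` eball x t) by [].
rewrite /product_measure1.
pose rho (s : R) := slice_radius t (s - x 0 ord0).
have rng (s : R) : (x 0 ord0 - t < s < x 0 ord0 + t) = (- t < s - x 0 ord0 < t).
  by apply/idP/idP => /andP[? ?]; apply/andP; split; lra.
transitivity (\int[leb1]_(s in `](x 0 ord0 - t)%R, (x 0 ord0 + t)%R[) (rho s ^+ n * ball_vol n)%R%:E)%E.
  rewrite [RHS]integral_mkcond; apply: eq_integral => s _; rewrite patchE /=.
  case: ifPn => [|sI].
    rewrite inE/= in_itv/= rng => st.
    rewrite -(ih (tl x)); last exact: slice_radius_gt0.
    congr (lebesgue_Rn R n _); apply/seteqP; split => z; rewrite /xsection/= inE/= -eball_cons//.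
  rewrite (_ : xsection _ _ = set0) ?measure0//; apply/seteqP; split => z //=.
  rewrite /xsection/= inE/= => zb.
  by case/negP: sI; rewrite inE/= in_itv/= rng; exact: eball_cons_out zb.
have cr : continuous rho by apply: (ct_comp (@ct_slice_radius t)); ctn.
have v0 m : 0 <= ball_vol m.
  have pi2 : - (pi / 2) <= pi / 2 :> R by have := @pi_gt0 R; lra.
  elim: m => [|m v0] /=; first exact: ler01.
  by rewrite mulr_ge0//; apply: oint_ge0 => // th thp; rewrite exprn_ge0// cos_ge0_pihalf.
rewrite (@ge0_sin_subst _ _ _ (fun th => (t ^+ n.+1 * ball_vol n) * cos th ^+ n.+1))//.
- rewrite oint_scale; last by ctn.
  by congr EFin; rewrite /=; ring.
- have c1 : continuous (fun s : R => rho s ^+ n * ball_vol n) by ctn.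
  by move=> s st; exact: c1.
- by move=> s st; rewrite mulr_ge0// exprn_ge0// sqrtr_ge0.
- by ctn.
- move=> th thp; rewrite /rho addrAC subrr add0r slice_radius_sin// exprMn !exprS; ring.
Qed.

Definition wallis (m : nat) : R := oint (- (pi / 2)) (pi / 2) (fun th => cos th ^+ m).

Lemma wallis0 : wallis 0 = pi.
Proof.
rewrite /wallis (_ : (fun th => _) = (fun=> 1)); last by apply/funext => th; rewrite expr0.
by rewrite oint_cst; field.
Qed.

(** Integration by parts of cos^(m+1) against cos; the boundary terms vanish because cos(pi/2) =
    0. *)
Lemma wallisS m : wallis m.+2 * m.+2%:R = m.+1%:R * wallis m.
Proof.
have c1 : continuous (fun th : R => cos th) by ctn.
have c2 : continuous (fun th : R => m.+1%:R * cos th ^+ m * - sin th) by ctn.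
have c3 : continuous (fun th : R => cos th ^+ m) by ctn.
have c4 : continuous (fun th : R => cos th ^+ m.+2) by ctn.
have := @oint_ibp R _ _ _ _ (- (pi / 2)) (pi / 2) c2 c1
  (fun th => dv_exp m.+1 (is_derive_cos th)) (@is_derive_sin R).
rewrite cosN cos_pihalf !expr0n/= !mul0r subrr sub0r.
rewrite (_ : (fun s : R => cos s ^+ m.+1 * cos s) = (fun th => cos th ^+ m.+2)); last first.
  by apply/funext => th; rewrite [RHS]exprS mulrC.
rewrite (_ : (fun s : R => m.+1%:R * cos s ^+ m * - sin s * sin s) =
   (fun th => m.+1%:R * (cos th ^+ m.+2 - cos th ^+ m))); last first.
  apply/funext => th.
  have E : sin th ^+ 2 = 1 - cos th ^+ 2 by rewrite -(cos2Dsin2 th); ring.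
  have -> : m.+1%:R * cos th ^+ m * - sin th * sin th = - (m.+1%:R * cos th ^+ m * (sin th ^+ 2)).
    by ring.
  by rewrite E !exprS expr0; ring.
rewrite oint_scale; last by ctn.
rewrite oint_sub// -/(wallis m.+2) -/(wallis m) => H.
have -> : m.+2%:R = m.+1%:R + 1 :> R by rewrite -natr1.
by rewrite mulrDr mulr1 {2}H; ring.
Qed.

(** [ge0_ball_integral] is for nonnegative functions, so positive and negative parts are treated
    separately; both are continuous. *)
Lemma ball_meanE n (phi : 'rV[R]_n -> R) (x : 'rV[R]_n) t : 0 < t -> continuous phi ->
  ball_mean phi t x = (t ^+ n * ball_vol n)^-1 * (t ^+ n / t * hemiL (fun y => phi (x + t *: y))).
Proof.
move=> t0 cphi; rewrite /ball_mean lebesgue_eball//=; congr (_ * _).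
pose pp (y : 'rV[R]_n) : R := Num.max (phi y) 0; pose pn (y : 'rV[R]_n) : R := Num.max (- phi y) 0.
have cpp : continuous pp by exact: ct_maxr.
have cpn : continuous pn by apply: ct_maxr; ctn.
have pp0 y : 0 <= pp y by rewrite /pp le_max lexx orbT.
have pn0 y : 0 <= pn y by rewrite /pn le_max lexx orbT.
have phiE y : phi y = pp y - pn y.
  by rewrite /pp /pn; case: (leP (phi y) 0) => h; [rewrite max_l|rewrite max_r]; lra.
have cA (g : 'rV[R]_n -> R) : continuous g -> continuous (fun y : 'rV[R]_n => g (x + (t : R) *: y)).
  by move=> cg; apply: (ct_comp cg); ctn.
rewrite (_ : (fun y => phi (x + t *: y)) = (fun y => pp (x + t *: y) - pn (x + t *: y))); last first.
  by apply/funext => y; exact: phiE.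
rewrite hemiL_sub; [|exact: (cA _ cpp)|exact: (cA _ cpn)].
rewrite mulrBr -[RHS]/(fine (_%:E)) EFinB.
rewrite -(ge0_ball_integral x t0 cpp pp0) -(ge0_ball_integral x t0 cpn pn0).
rewrite /Rintegral; congr fine; rewrite integralE; congr (_ - _)%E; apply: eq_integral => z _.
  rewrite funeposE /pp -EFin_max; congr EFin; rewrite maxr_pMl ?mul0r//.
rewrite funenegE /pn -EFinN -EFin_max; congr EFin; rewrite maxr_pMl ?mul0r ?mulNr//.
Qed.

Lemma wallis1 : wallis 1 = 2.
Proof.
rewrite /wallis (@oint_FTC R sin).
- by rewrite sinN sin_pihalf; ring.
- by ctn.
Qed.

Lemma wallis_gt0 m : 0 < wallis m.
Proof.
suff [] : 0 < wallis m /\ 0 < wallis m.+1 by [].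
elim: m => [|m [h1 h2]]; first by rewrite wallis0 wallis1 pi_gt0.
by split => //; rewrite -(pmulr_lgt0 _ (ltr0Sn R m.+1)) wallisS mulr_gt0.
Qed.

Lemma ball_vol_gt0 n : 0 < ball_vol n.
Proof. by elim: n => [|n ih] //=; rewrite mulr_gt0// -/(wallis n.+1) wallis_gt0. Qed.

(** [hemiL1] is the product of the Wallis integrals of index 0 to n-1 and [ball_vol] that of index 1
    to n, so the two sides share all their factors. *)
Lemma hemiL1_wallis n : hemiL1 R n * wallis n = pi * ball_vol n.
Proof.
elim: n => [|n ih]; first by rewrite wallis0 /hemiL1 /= mul1r mulr1.
have -> : hemiL1 R n.+1 = hemiL1 R n * wallis n.
  by rewrite /hemiL1 /= -/(hemiL1 R n) -oint_scale; [congr oint; apply/funext => th; rewrite mulrC|ctn].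
by rewrite ih /= -/(wallis n.+1); ring.
Qed.

Lemma wallis_even n : ~~ odd n ->
  wallis n * (double_factorial n)%:R = pi * (double_factorial n.-1)%:R.
Proof.
elim/ltn_ind: n => -[_ _|[//|n ih]]; first by rewrite wallis0.
rewrite /= negbK => en; have := ih n (ltnW (ltnSn _)) en => {}ih.
have dfS : double_factorial n.+1 = (n.+1 * double_factorial n.-1)%N by case: (n).
rewrite -[X in pi * X]/((double_factorial n.+1)%:R) dfS !natrM mulrA wallisS -mulrA ih; ring.
Qed.

(** The ratio n!!/(n-1)!! between half-sphere and ball: this is where the n!! in the formula for w
    comes from. *)
Lemma hemiL1_even n : ~~ odd n ->
  hemiL1 R n * (double_factorial n.-1)%:R = ball_vol n * (double_factorial n)%:R.
Proof.
move=> en; have p0 : pi != 0 :> R by rewrite gt_eqF// pi_gt0.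
apply: (mulfI p0); rewrite mulrCA -wallis_even// !mulrA hemiL1_wallis; ring.
Qed.

End BallIntegral.

(** * The free wave equation *)

Section DirectionalOperator.
Variables (R : realType) (E : normedModType R).

(** Sealing the derivative behind an opaque proof keeps simplification and unification from
    unfolding it into a limit. *)
Fact dd_subproof : {D : E -> (E -> R) -> E -> R | forall v F p, D v F p = 'D_v F p}.
Proof. by exists (fun v F p => 'D_v F p). Qed.
Definition dd : E -> (E -> R) -> E -> R := sval dd_subproof.

Lemma ddE v F p : dd v F p = 'D_v F p. Proof. exact: (svalP dd_subproof). Qed.

Local Notation "''dd_' v f" := (dd v f) (at level 10, v at next level, f at next level).

Lemma dvE (F : E -> R) p v d : is_derive p v F d -> 'dd_v F p = d.
Proof. by move=> H; rewrite ddE; exact: derive_val. Qed.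

Lemma PC_isD k (T : topologicalType) (F : T -> E -> R) l v p : PC k.+1 F ->
  is_derive p v (F l) ('dd_v (F l) p).
Proof. by move=> [_ [dF H _]]; rewrite (dvE (H l v p)). Qed.

Lemma PC_D k (T : topologicalType) (F : T -> E -> R) : PC k.+1 F ->
  PC k (fun (lv : T * E) p => 'dd_(lv.2) (F lv.1) p).
Proof. by move=> H; apply: (PC_der H) => l v p; exact: PC_isD H. Qed.

Lemma PC_Dv k (T : topologicalType) (F : T -> E -> R) v : PC k.+1 F ->
  PC k (fun l p => 'dd_v (F l) p).
Proof.
move=> H; apply: (PC_reparam (r := fun l : T => (l, v)) _ (PC_D H)).
by apply: ct_pair; [exact: ct_id|exact: ct_cst].
Qed.

Lemma D_schwarz k (T : topologicalType) (F : T -> E -> R) l v w p : PC k.+2 F ->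
  'dd_w ('dd_v (F l)) p = 'dd_v ('dd_w (F l)) p.
Proof.
move=> H; have H2 : PC 2 F by apply: PC_le H.
have H1 := PC_D H.
exact: (PC_schwarz (dF := fun lv p => 'dd_(lv.2) (F lv.1) p)
  (d2F := fun lvw p => 'dd_(lvw.2) ('dd_(lvw.1.2) (F lvw.1.1)) p) l v w p H2
  (fun l v p => PC_isD l v p H) (fun lv w p => PC_isD lv w p H1)).
Qed.

End DirectionalOperator.

Notation "''dd_' v f" := (dd v f) (at level 10, v at next level, f at next level).

(** * The Euler-Poisson-Darboux equation for half-sphere averages *)

Section Darboux.
Variables (R : realType) (n : nat).
Local Notation V := 'rV[R]_n.
Local Notation E := (R * V)%type.
Implicit Types (T : topologicalType) (p : E).

Definition et : E := (1, 0).
Definition ex (i : 'I_n) : E := (0, delta_mx 0 i).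
Definition Lap (F : E -> R) (p : E) : R := \sum_(i < n) 'dd_(ex i) ('dd_(ex i) F) p.

Lemma dv_fst p v : is_derive p v (fun q : E => q.1) v.1.
Proof.
apply/dv_lineE.
have H : is_derive (0 : R) 1 (fun h : R => p.1 + h * v.1) v.1.
  have := dv_add (dv_cst p.1 (0 : R) 1) (dv_mul (dv_id (0 : R)) (dv_cst v.1 (0 : R) 1)).
  by rewrite mul1r mulr0 addr0 add0r.
exact: H.
Qed.

Lemma PC_fst k T : PC k (fun (_ : T) (q : E) => q.1).
Proof.
by apply: PC_linear => //; ctn.
Qed.

Lemma PC_Lap k T (F : T -> E -> R) : PC k.+2 F -> PC k (fun l p => Lap (F l) p).
Proof. by move=> H; apply: PC_sum => i; apply: PC_Dv; exact: PC_Dv. Qed.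

(* The Euler-Poisson-Darboux equation. *)
Definition EPD (m : R) (F : E -> R) := forall p,
  p.1 * 'dd_et ('dd_et F) p + m * 'dd_et F p = p.1 * Lap F p.

(* Lowers the parameter of the Euler-Poisson-Darboux equation from m to m - 2. *)
Definition ladder (m : R) T (F : T -> E -> R) l p : R :=
  p.1 * 'dd_et (F l) p + (m - 1) * F l p.

Lemma PC_ladder k m T (F : T -> E -> R) : PC k.+1 F -> PC k (ladder m F).
Proof.
move=> H; apply: PC_add.
  by apply: PC_mul; [exact: PC_fst|exact: PC_Dv].
by apply: PC_scale; [exact: ct_cst|exact: PC_S].
Qed.

Lemma Lap_comm T (F : T -> E -> R) l v p : PC 3 F ->
  is_derive p v (Lap (F l)) (Lap ('dd_v (F l)) p).
Proof.
move=> H; apply: dv_sum => i.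
have E1 : 'dd_(ex i) ('dd_v (F l)) = 'dd_v ('dd_(ex i) (F l)).
  apply/funext => q.
  exact: (D_schwarz l v (ex i) q H).
rewrite E1.
have H2 : PC 2 (fun l => 'dd_(ex i) (F l)) by exact: PC_Dv.
rewrite (D_schwarz l v (ex i) p H2).
have H1 : PC 1 (fun l p => 'dd_(ex i) ('dd_(ex i) (F l)) p).
  by apply: PC_Dv; exact: (PC_Dv (ex i) H).
exact: (PC_isD l v p H1).
Qed.

Lemma Lap_lin1 T (F G : T -> E -> R) (a b : R) l p : PC 2 F -> PC 2 G ->
  Lap (fun q => a * F l q + b * G l q) p = a * Lap (F l) p + b * Lap (G l) p.
Proof.
move=> HF HG; rewrite /Lap !mulr_sumr -big_split; apply: eq_bigr => i _ /=.
have D1 q : is_derive q (ex i) (fun q => a * F l q + b * G l q)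
    (a * 'dd_(ex i) (F l) q + b * 'dd_(ex i) (G l) q).
  exact: (dv_add (dv_scale _ (PC_isD l (ex i) q HF)) (dv_scale _ (PC_isD l (ex i) q HG))).
rewrite (funext (fun q => dvE (D1 q))).
exact: dvE (dv_add (dv_scale _ (PC_isD l (ex i) p (PC_Dv (ex i) HF)))
  (dv_scale _ (PC_isD l (ex i) p (PC_Dv (ex i) HG)))).
Qed.

Lemma Lap_fst T (F : T -> E -> R) l p : PC 2 F ->
  Lap (fun q => q.1 * F l q) p = p.1 * Lap (F l) p.
Proof.
move=> H; rewrite /Lap mulr_sumr; apply: eq_bigr => i _.
have D1 (G : T -> E -> R) : PC 1 G -> forall q,
    is_derive q (ex i) (fun q => q.1 * G l q) (q.1 * 'dd_(ex i) (G l) q).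
  move=> HG q; apply: dv_eq (dv_mul (dv_fst q (ex i)) (PC_isD l (ex i) q HG)) _.
  by rewrite mul0r add0r.
rewrite (funext (fun q => dvE (D1 F (PC_S H) q))).
exact: dvE (D1 _ (PC_Dv (ex i) H) p).
Qed.

(** Differentiating r F_r + (m - 1) F gives r F_rr + m F_r, the left-hand side of the equation. *)
Lemma ladder_t m T (F : T -> E -> R) l : PC 2 F -> EPD m (F l) ->
  forall p, is_derive p et (ladder m F l) (p.1 * Lap (F l) p).
Proof.
move=> H epd p.
apply: dv_eq (dv_add (dv_mul (dv_fst p et) (PC_isD l et p (PC_Dv et H)))
  (dv_scale (m - 1) (PC_isD l et p H))) _.
by rewrite -epd /=; ring.
Qed.

(** With A = r F_r + (m - 1) F, [ladder_t] gives A_r = r Lap F. Hence r A_rr + (m - 2) A_r = r (r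
    Lap F_r + (m - 1) Lap F) = r Lap A, because the Laplacian acts on space only. *)
Lemma EPD_ladder m T (F : T -> E -> R) l : PC 3 F -> EPD m (F l) ->
  EPD (m - 2) (ladder m F l).
Proof.
move=> H epd p; have H2 := PC_S H.
have E1 := funext (fun q => dvE (ladder_t H2 epd q)).
rewrite E1 (dvE (dv_mul (dv_fst p et) (Lap_comm l et p H))) -/et /=.
rewrite (_ : Lap (ladder m F l) p = p.1 * Lap ('dd_et (F l)) p + (m - 1) * Lap (F l) p).
  by generalize (Lap (F l) p) (Lap ('dd_et (F l)) p) => a b; ring.
have H3 : PC 2 (fun l (q : E) => q.1 * 'dd_et (F l) q).
  by apply: PC_mul; [exact: PC_fst|exact: PC_Dv].
have := Lap_lin1 1 (m - 1) l p H3 H2.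
rewrite (Lap_fst (F := fun l q => 'dd_et (F l) q) l p (PC_Dv et H)) mul1r => <-.
by congr Lap; apply/funext => q; rewrite mul1r.
Qed.

Lemma affine_dv (phi : V -> R) p v (y : V) d :
  is_derive (p.2 + p.1 *: y) (v.2 + v.1 *: y) phi d ->
  is_derive p v (fun q : E => phi (q.2 + q.1 *: y)) d.
Proof.
move/dv_lineE => H; apply/dv_lineE; apply: dv_ext H => h /=; congr phi.
by rewrite scalerDr scalerA scalerDl; rewrite addrACA.
Qed.

(** The average is not normalised, and it is defined for every real radius, hence smooth across
    radius 0. *)
Definition sphm T (phi : T -> V -> R) l p : R := hemiL (fun y => phi l (p.2 + p.1 *: y)).

Lemma PC_sphere k T T' (phi : T -> V -> R) (r : T' -> T) (a : T' -> V) :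
  continuous r -> continuous a -> PC k phi ->
  PC k (fun l (p : E) => phi (r l) (p.2 + p.1 *: a l)).
Proof.
move=> cr ca H.
apply: (PC_affine (r := r) (A := fun l (p : E) => p.2 + p.1 *: a l)
  (B := fun l (p : E) => p.2 + p.1 *: a l) _ _ _ _ H) => //.
- by apply: ct_addE; ctn; apply: (ct_comp ca); ctn.
- by apply: ct_addE; ctn; apply: (ct_comp ca); ctn.
- by move=> l p h v /=; rewrite scalerDr scalerA scalerDl addrACA.
Qed.

Lemma PC_sphm k T (phi : T -> V -> R) : PC k phi -> PC k (sphm phi).
Proof.
move=> H; apply: (PC_hemiL (F := fun ly p => phi ly.1 (p.2 + p.1 *: ly.2))).
by apply: (PC_sphere (r := fst) (a := snd)) => //; ctn.
Qed.

Lemma sphm_D T (phi : T -> V -> R) l p v : PC 1 phi ->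
  is_derive p v (sphm phi l) (hemiL (fun y => 'dd_(v.2 + v.1 *: y) (phi l) (p.2 + p.1 *: y))).
Proof.
move=> H.
apply: (PC_hemiL_derive (F := fun ly p => phi ly.1 (p.2 + p.1 *: ly.2))
  (dF := fun lyv p => 'dd_(lyv.2.2 + lyv.2.1 *: lyv.1.2) (phi lyv.1.1) (p.2 + p.1 *: lyv.1.2))).
  by apply: (PC_sphere (r := fst) (a := snd)) => //; ctn.
by move=> [l' y] v' p' /=; apply: affine_dv; exact: PC_isD H.
Qed.

Lemma sphm_D2 T (phi : T -> V -> R) l p v w : PC 2 phi ->
  is_derive p w ('dd_v (sphm phi l)) (hemiL (fun y => 'dd_(w.2 + w.1 *: y)
    ('dd_(v.2 + v.1 *: y) (phi l)) (p.2 + p.1 *: y))).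
Proof.
move=> H; rewrite (funext (fun q => dvE (sphm_D l q v (PC_S H)))).
have H1 := PC_D H.
apply: (PC_hemiL_derive (F := fun ly p => 'dd_(v.2 + v.1 *: ly.2) (phi ly.1) (p.2 + p.1 *: ly.2))
  (dF := fun lyv p => 'dd_(lyv.2.2 + lyv.2.1 *: lyv.1.2)
     ('dd_(v.2 + v.1 *: lyv.1.2) (phi lyv.1.1)) (p.2 + p.1 *: lyv.1.2))).
  apply: (PC_sphere (r := fun ly : T * V => (ly.1, v.2 + v.1 *: ly.2)) (a := snd) _ _ H1); ctn.
move=> [l' y] v' p' /=; apply: (@affine_dv ('dd_(v.2 + v.1 *: y) (phi l'))).
exact: (PC_isD (l', v.2 + v.1 *: y) _ _ H1).
Qed.

Lemma sphm_Dt T (phi : T -> V -> R) l p : PC 1 phi ->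
  'dd_et (sphm phi l) p = hemiL (fun y => 'dd_y (phi l) (p.2 + p.1 *: y)).
Proof.
move=> H; rewrite (dvE (sphm_D l p et H)).
apply: (congr1 (@hemiL R n)); apply/funext => y.
have -> : et.2 + et.1 *: y = y by rewrite /= scale1r add0r.
by [].
Qed.

Lemma sphm_Dtt T (phi : T -> V -> R) l p : PC 2 phi ->
  'dd_et ('dd_et (sphm phi l)) p = hemiL (fun y => 'dd_y ('dd_y (phi l)) (p.2 + p.1 *: y)).
Proof.
move=> H; rewrite (dvE (sphm_D2 l p et et H)).
apply: (congr1 (@hemiL R n)); apply/funext => y.
have -> : et.2 + et.1 *: y = y by rewrite /= scale1r add0r.
by [].
Qed.

Lemma sphm_Lap T (phi : T -> V -> R) l p : PC 2 phi ->
  Lap (sphm phi l) p = \sum_(i < n) hemiL (fun y =>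
    'dd_(delta_mx 0 i) ('dd_(delta_mx 0 i) (phi l)) (p.2 + p.1 *: y)).
Proof.
move=> H; apply: eq_bigr => i _.
rewrite (dvE (sphm_D2 l p (ex i) (ex i) H)).
apply: (congr1 (@hemiL R n)); apply/funext => y.
have -> : (ex i).2 + (ex i).1 *: y = delta_mx 0 i by rewrite /= scale0r addr0.
by [].
Qed.

Lemma C2data_sphere T (phi : T -> V -> R) l (x : V) (r : R) : PC 2 phi ->
  C2data (fun y => phi l (x + r *: y)) (fun v y => r * 'dd_v (phi l) (x + r *: y))
    (fun v w y => r ^+ 2 * 'dd_w ('dd_v (phi l)) (x + r *: y)).
Proof.
move=> H; have H1 := PC_D H; have H2 := PC_D H1.
have cx T' (f : T' -> V) : continuous f -> continuous (fun q => x + r *: f q).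
  by move=> cf; apply: ct_addE; ctn.
have dvl (g : V -> R) (v p : V) (d : R) : is_derive (x + r *: p) v g d ->
    is_derive p v (fun y => g (x + r *: y)) (r * d).
  move=> Hg; have /dv_lineE H' := dv_scaledir r Hg.
  by apply/dv_lineE; apply: dv_ext H' => h; rewrite scalerDr !scalerA (mulrC h) addrA.
split.
- have cxr : continuous (fun y : V => x + r *: y) by exact: (cx _ _ (@ct_id _)).
  exact: (ct_comp (F := phi l) (PC_contp H) cxr).
- by move=> v p; apply: dvl; exact: PC_isD H.
- move=> v w p; rewrite expr2 -mulrA; apply: dv_scale; apply: dvl.
  exact: (PC_isD (l, v) _ _ H1).
- apply: ct_mul; ctn.
  apply: (ct_comp (PC_cont H1) (a := fun q : V * V => ((l, q.1), x + r *: q.2))).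
  by apply: ct_pair; ctn; apply: cx; ctn.
- apply: ct_mul; ctn.
  apply: (ct_comp (PC_cont H2) (a := fun q : (V * V) * V => (((l, q.1.1), q.1.2), x + r *: q.2))).
  by apply: ct_pair; ctn; apply: cx; ctn.
Qed.

Lemma hemiL_sum (I : Type) (s : seq I) (F : I -> V -> R) : (forall i, continuous (F i)) ->
  hemiL (fun y => \sum_(i <- s) F i y) = \sum_(i <- s) hemiL (F i).
Proof.
move=> cF; elim: s => [|i s ih].
  rewrite big_nil -[RHS](mul0r (hemiL1 R n)) -hemiL_cst.
  by apply: (congr1 (@hemiL R n)); apply/funext => y; rewrite big_nil.
rewrite big_cons -ih -(hemiL_add (cF i) (ct_sum cF)).
by apply: (congr1 (@hemiL R n)); apply/funext => y; rewrite big_cons.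
Qed.

Lemma continuous_eq0 (h : R -> R) : continuous h -> (forall r, r != 0 -> h r = 0) -> h 0 = 0.
Proof.
move=> ch H; apply/eqP; apply/negPn/negP => h0.
have /cvgrPdist_lt/(_ `|h 0|) := ch 0; rewrite normr_gt0 => /(_ h0).
move=> /nbhs_ballP[e /= e0 /(_ (e / 2))].
have e2 : 0 < e / 2 by rewrite divr_gt0.
rewrite /ball/= sub0r normrN gtr0_norm// ltr_pdivrMr// mulr_natr.
have E0 : h (e / 2) = 0 by apply: H; rewrite gt_eqF.
by rewrite E0 subr0 ltxx mulr2n ltrDl => /(_ e0).
Qed.

(** [hemiL_harm] for the function y -> phi (x + r y) is r times the equation. Dividing gives it for
    r <> 0, and continuity for r = 0. *)
Lemma EPD_sphm T (phi : T -> V -> R) l : PC 2 phi -> EPD n%:R (sphm phi l).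
Proof.
move=> H; have HS := PC_sphm H.
have main (r : R) (x : V) : r * (r * 'dd_et ('dd_et (sphm phi l)) (r, x) + n%:R * 'dd_et (sphm phi l) (r, x)
    - r * Lap (sphm phi l) (r, x)) = 0.
  have C := C2data_sphere l x r H; have := hemiL_harm C.
  have [_ _ _ c1 c2] := C.
  rewrite (sphm_Dt l (r, x) (PC_S H)) (sphm_Dtt l (r, x) H) (sphm_Lap l (r, x) H).
  cbv beta iota delta [fst snd].
  have H1 := PC_D H; have H2 := PC_D H1.
  have cx T' (f : T' -> V) : continuous f -> continuous (fun q => x + r *: f q).
    by move=> cf; apply: ct_addE; ctn.
  have d2 (a b : V -> V) : continuous a -> continuous b ->
      continuous (fun y => 'dd_(b y) ('dd_(a y) (phi l)) (x + r *: y)).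
    move=> ca cb; apply: (ct_comp (PC_cont H2) (a := fun y => (((l, a y), b y), x + r *: y))).
    by apply: ct_pair; ctn; apply: cx; ctn.
  have d1 : continuous (fun y : V => 'dd_y (phi l) (x + r *: y)).
    have ca : continuous (fun y : V => ((l, y), x + r *: y)).
      by apply: ct_pair; [ctn|exact: (cx _ _ (@ct_id _))].
    exact: (ct_comp (PC_cont H1) ca).
  have d2y := d2 _ _ (@ct_id _) (@ct_id _).
  have d2i' i := d2 (fun=> delta_mx 0 i) (fun=> delta_mx 0 i) (@ct_cst _ _ _) (@ct_cst _ _ _).
  have d2i i : continuous (fun y : V => r ^+ 2 * 'dd_(delta_mx 0 i) ('dd_(delta_mx 0 i) (phi l)) (x + r *: y)).
    exact: (ct_mul (@ct_cst _ _ _) (d2i' i)).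
  have dS : continuous (fun y : V => \sum_(i < n) r ^+ 2 *
      'dd_(delta_mx 0 i) ('dd_(delta_mx 0 i) (phi l)) (x + r *: y)).
    exact: ct_sum.
  have c3 : continuous (fun y : V => r ^+ 2 * 'dd_y ('dd_y (phi l)) (x + r *: y)) by ctn.
  have c4 : continuous (fun y : V => r * 'dd_y (phi l) (x + r *: y)) by ctn.
  have c5 : continuous (fun y : V => n%:R * (r * 'dd_y (phi l) (x + r *: y))) by ctn.
  have c6 := ct_sub dS c3.
  rewrite (hemiL_sub c6 c5) (hemiL_sub dS c3) (hemiL_scale _ c4) (hemiL_scale _ d1) (hemiL_scale _ d2y).
  have -> : hemiL (fun y : V => \sum_(i < n) r ^+ 2 *
      'dd_(delta_mx 0 i) ('dd_(delta_mx 0 i) (phi l)) (x + r *: y)) = r ^+ 2 *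
      \sum_(i < n) hemiL (fun y => 'dd_(delta_mx 0 i) ('dd_(delta_mx 0 i) (phi l)) (x + r *: y)).
    rewrite hemiL_sum// mulr_sumr; apply: eq_bigr => i _; exact: hemiL_scale (d2i' i).
  move=> /eqP; rewrite subr_eq add0r subr_eq => /eqP E2.
  by rewrite mulrBr (mulrA r r (\sum_i _)) -expr2 E2; ring.
move=> [r x] /=; apply/eqP; rewrite -subr_eq0; apply/eqP.
pose h (r : R) := r * 'dd_et ('dd_et (sphm phi l)) (r, x) + n%:R * 'dd_et (sphm phi l) (r, x)
    - r * Lap (sphm phi l) (r, x).
have h0 (s : R) : s != 0 -> h s = 0 by move=> s0; apply: (mulfI s0); rewrite mulr0 main.
rewrite -[LHS]/(h r); have [->|] := eqVneq r 0; last exact: h0.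
apply: continuous_eq0 h0.
have c1 : continuous (fun s : R => 'dd_et (sphm phi l) (s, x)).
  by apply: (ct_comp (PC_contp (PC_Dv et HS))); ctn.
have c2 : continuous (fun s : R => 'dd_et ('dd_et (sphm phi l)) (s, x)).
  by apply: (ct_comp (PC_contp (PC_Dv et (PC_Dv et HS)))); ctn.
have c3 : continuous (fun s : R => Lap (sphm phi l) (s, x)).
  by apply: (ct_comp (PC_contp (PC_Lap HS))); ctn.
by rewrite /h; ctn.
Qed.

(** Level [j] satisfies the equation with parameter n - 2 j and has used up [j] derivatives of
    [phi]. *)
Fixpoint tower T (phi : T -> V -> R) (j : nat) : T -> E -> R :=
  if j is j'.+1 then ladder (n%:R - 2 * j'%:R) (tower phi j') else sphm phi.

Lemma PC_tower k T (phi : T -> V -> R) j : PC (j + k) phi -> PC k (tower phi j).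
Proof.
elim: j k => [|j ih] k /= H; first exact: PC_sphm.
by apply: PC_ladder; apply: ih; rewrite addnS.
Qed.

Lemma EPD_tower k T (phi : T -> V -> R) j l : PC (j + k.+2) phi ->
  EPD (n%:R - 2 * j%:R) (tower phi j l).
Proof.
elim: j k => [|j ih] k H /=; first by rewrite mulr0 subr0; apply: EPD_sphm; exact: PC_le H.
have -> : n%:R - 2 * j.+1%:R = n%:R - 2 * j%:R - 2 :> R by rewrite -natr1; ring.
apply: EPD_ladder; last by apply: (ih k); apply: PC_S; rewrite -addSn.
by apply: PC_tower; apply: PC_le H; rewrite addSnnS leq_add2l.
Qed.

End Darboux.

(** * The free wave in even dimension and the formula for w *)

Section WaveSolution.
Variables (R : realType) (n h : nat).
Hypothesis nE : n = h.*2.+2.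
Local Notation V := 'rV[R]_n.
Local Notation E := (R * V)%type.
Implicit Types (T : topologicalType) (p : E).

Let en : ~~ odd n. Proof. by rewrite nE /= odd_double. Qed.

Definition wave_cst : R := ((double_factorial n)%:R * ball_vol R n)^-1.

(** The free wave with position 0 and velocity [phi] at time 0. The function w of the statement is
    its time derivative, see [wave_waveS]. *)
Definition waveS T (phi : T -> V -> R) l p : R := wave_cst * (p.1 * tower phi h l p).

Lemma PC_waveS k T (phi : T -> V -> R) : PC (h + k) phi -> PC k (waveS phi).
Proof.
move=> H; apply: PC_scale; first exact: ct_cst.
by apply: PC_mul; [exact: PC_fst|exact: PC_tower].
Qed.

Lemma waveS0 T (phi : T -> V -> R) l x : waveS phi l (0, x) = 0.
Proof. by rewrite /waveS mul0r mulr0. Qed.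

(** After [h] steps the parameter is 2, and (r A)_rr = r A_rr + 2 A_r = r Lap A. *)
Lemma waveS_eq T (phi : T -> V -> R) l p : PC h.+2 phi ->
  'dd_(et R n) ('dd_(et R n) (waveS phi l)) p = Lap (waveS phi l) p.
Proof.
rewrite -addn2 => H.
have HA := PC_tower H.
have D1 q : is_derive q (et R n) (waveS phi l) (wave_cst * (tower phi h l q + q.1 * 'dd_(et R n) (tower phi h l) q)).
  apply: dv_eq (dv_scale wave_cst (dv_mul (dv_fst q (et R n)) (PC_isD l (et R n) q HA))) _.
  by rewrite [(et R n).1]/= mul1r.
rewrite (funext (fun q => dvE (D1 q))).
rewrite (dvE (dv_scale wave_cst (dv_add (PC_isD l (et R n) p HA)
  (dv_mul (dv_fst p (et R n)) (PC_isD l (et R n) p (PC_Dv (et R n) HA)))))).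
have -> : Lap (waveS phi l) p = wave_cst * (p.1 * Lap (tower phi h l) p).
  have H3 : PC 2 (fun l (q : E) => q.1 * tower phi h l q).
    by apply: PC_mul; [exact: PC_fst|].
  have H0 : PC 2 (fun (_ : T) (q : E) => 0 : R) by apply: PC_cst; exact: ct_cst.
  have := Lap_lin1 wave_cst 0 l p H3 H0; rewrite (Lap_fst l p HA) => EL.
  rewrite -[RHS]addr0 -(mul0r (Lap (fun=> 0) p)) -EL.
  by congr Lap; apply/funext => q; rewrite mul0r addr0.
have := @EPD_tower R n 0 T phi h l H p.
have -> : n%:R - 2 * h%:R = 2 :> R by rewrite nE -!natr1 -mul2n natrM; ring.
move=> <-; rewrite [(et R n).1]/= mul1r.
change (fun q => 'dd_(et R n) (tower phi h l) q) with ('dd_(et R n) (tower phi h l)).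
by generalize ('dd_(et R n) ('dd_(et R n) (tower phi h l)) p) ('dd_(et R n) (tower phi h l) p) => a b; ring.
Qed.

Lemma tower0 T (phi : T -> V -> R) j l x :
  tower phi j l (0, x) = (\prod_(i < j) (n%:R - 2 * i%:R - 1)) * hemiL1 R n * phi l x.
Proof.
elim: j => [|j ih].
  rewrite big_ord0 mul1r /= /sphm mulrC -hemiL_cst.
  by apply: (congr1 (@hemiL R n)); apply/funext => y; rewrite /= scale0r addr0.
by rewrite [LHS]/= /ladder mul0r add0r ih big_ord_recr /=; ring.
Qed.

Lemma prod_double_factorial : \prod_(i < h) (n%:R - 2 * i%:R - 1) = (double_factorial n.-1)%:R :> R.
Proof.
rewrite nE /=; elim: h => [|m ih]; first by rewrite big_ord0.
rewrite big_ord_recl doubleS -[RHS]/((m.*2.+3 * double_factorial m.*2.+1)%:R) natrM -ih.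
congr (_ * _); first by rewrite mulr0 -!natr1; ring.
apply: eq_bigr => i _; rewrite /= /bump /= natrD -!natr1; ring.
Qed.

(** At radius 0 the tower multiplies [phi] by (n-1)!! and [hemiL1], which [hemiL1_even] identifies
    with the inverse of [wave_cst]. *)
Lemma waveS_t0 T (phi : T -> V -> R) l x : PC h.+1 phi ->
  'dd_(et R n) (waveS phi l) (0, x) = phi l x.
Proof.
rewrite -[h.+1]addn1 => H; have HA := PC_tower H.
rewrite (dvE (dv_scale wave_cst (dv_mul (dv_fst (0, x) (et R n)) (PC_isD l (et R n) (0, x) HA)))).
rewrite [(et R n).1]/= [(0, x).1]/= mul1r mul0r addr0 tower0 prod_double_factorial.
rewrite (mulrC _ (hemiL1 R n)) hemiL1_even// mulrA (mulrC (ball_vol R n)) mulVf ?mul1r//.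
rewrite mulf_neq0 ?gt_eqF ?ball_vol_gt0// ltr0n.
elim/ltn_ind: (n) => -[|[|m]] ihm //=; rewrite muln_gt0 /=; exact: ihm.
Qed.

Lemma derive1_congr_pos (f g : R -> R) (t : R) : 0 < t -> (forall s, 0 < s -> f s = g s) ->
  derive1 f t = derive1 g t.
Proof.
move=> t0 H; rewrite !derive1E; apply: near_eq_derive.
by near=> s; apply: H; near: s; exact: lt_nbhsr.
Unshelve. all: by end_near. Qed.

(** Applying (1/t) d/dt to t^(2(h-j)+1) A gives t^(2(h-j)-1) (t A' + (2(h-j)+1) A), and 2(h-j)+1 = n
    - 2j - 1 is exactly the constant of the ladder operator at level j. *)
Lemma iter_ball_mean T (phi : T -> V -> R) l x j : (j <= h)%N -> PC h.+1 phi ->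
  forall t, 0 < t ->
  iter j (fun (g : R -> R) r => r^-1 * derive1 g r) (fun r => r ^+ n * ball_mean (phi l) r x) t =
  (ball_vol R n)^-1 * (t ^+ (h - j).*2.+1 * tower phi j l (t, x)).
Proof.
move=> jh H; elim: j jh => [|j ih] jh t t0.
  rewrite /= ball_meanE//; last exact: (PC_contp H).
  rewrite subn0 -/(sphm phi l (t, x)); set A := sphm _ _ _.
  have v0 := ball_vol_gt0 R n; rewrite nE in v0 *; rewrite exprS.
  by field; rewrite !gt_eqF// ?exprn_gt0.
rewrite [LHS]/= (derive1_congr_pos t0 (ih (ltnW jh))).
have HA : PC 1 (tower phi j).
  by apply: PC_tower; apply: PC_le H; rewrite addn1 ltnS ltnW.
have dl : is_derive t 1 (fun s : R => tower phi j l (s, x)) ('dd_(et R n) (tower phi j l) (t, x)).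
  have /dv_lineE HL := PC_isD l (et R n) (t, x) HA; apply/dv_lineE.
  apply: dv_ext HL => s; congr (tower phi j l _).
  by apply/pair_eqP; rewrite /= scaler0 addr0 !eqxx.
have := dv_scale (ball_vol R n)^-1 (dv_mul (dv_exp (h - j).*2.+1 (dv_id t)) dl).
move=> /dvE; rewrite ddE -derive1E => ->.
have [m hE] : exists m, (h - j = m.+1)%N.
  by exists (h - j).-1; rewrite prednK// subn_gt0.
have -> : (h - j.+1 = m)%N by rewrite subnS hE.
rewrite hE doubleS /= /ladder [(t, x).1]/=.
have -> : n%:R - 2 * j%:R - 1 = m.*2.+3%:R :> R.
  have -> : n = (m.*2 + j.*2).+4 by rewrite nE -doubleD; have -> : h = (m.+1 + j)%N by rewrite -hE subnK// ltnW.
  by rewrite -!natr1 natrD -!mul2n !natrM; ring.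
generalize ('dd_(et R n) (tower phi j l) (t, x)) (tower phi j l (t, x)) (ball_vol R n)^-1 => a b v.
by rewrite !exprS; field; rewrite gt_eqF.
Qed.

Theorem wave_waveS T (phi : T -> V -> R) l t x : PC h.+1 phi -> 0 <= t ->
  wave (phi l) t x = 'dd_(et R n) (waveS phi l) (t, x).
Proof.
move=> H; rewrite le_eqVlt => /orP[/eqP <-|t0]; first by rewrite /wave eqxx waveS_t0.
rewrite /wave gt_eqF//.
have -> : ((n - 2) %/ 2 = h)%N by rewrite nE -addn2 addnK divn2 doubleK.
rewrite (derive1_congr_pos t0 (iter_ball_mean l x (leqnn h) H)).
have HA : PC 1 (waveS phi) by apply: PC_waveS; rewrite addn1.
have dl : is_derive t 1 (fun s : R => waveS phi l (s, x)) ('dd_(et R n) (waveS phi l) (t, x)).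
  have /dv_lineE HL := PC_isD l (et R n) (t, x) HA; apply/dv_lineE.
  apply: dv_ext HL => s; congr (waveS phi l _).
  by apply/pair_eqP; rewrite /= scaler0 addr0 !eqxx.
rewrite -(dvE dl) ddE -derive1E.
have -> : (fun s : R => waveS phi l (s, x)) = (fun s => (double_factorial n)%:R^-1 *
    ((ball_vol R n)^-1 * (s ^+ (h - h).*2.+1 * tower phi h l (s, x)))).
  by apply/funext => s; rewrite subnn expr1 /waveS /wave_cst invfM -mulrA.
have dt : is_derive t 1 (fun s : R => tower phi h l (s, x)) ('dd_(et R n) (tower phi h l) (t, x)).
  have HT : PC 1 (tower phi h) by apply: PC_tower; rewrite addn1.
  have /dv_lineE HL := PC_isD l (et R n) (t, x) HT; apply/dv_lineE.
  apply: dv_ext HL => s; congr (tower phi h l _).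
  by apply/pair_eqP; rewrite /= scaler0 addr0 !eqxx.
have D := dv_scale (ball_vol R n)^-1 (dv_mul (dv_exp (h - h).*2.+1 (dv_id t)) dt).
by rewrite !derive1E -!ddE (dvE D) (dvE (dv_scale _ D)).
Qed.

End WaveSolution.

(** * The hypergeometric kernel *)

Section RealPowerSeries.
Variable R : realType.
Implicit Types (c d : nat -> R) (x r : R).

(* The radius of convergence is at least 1. *)
Definition ubc c := forall r, 0 <= r < 1 -> exists M, forall k, `|c k| * r ^+ k <= M.

(** Bernoulli's inequality for q^(-1) = 1 + e. *)
Lemma geometric_mul_bounded (q : R) : 0 <= q < 1 -> exists M, forall k, k.+1%:R * q ^+ k <= M.
Proof.
move=> /andP[q0 q1]; have [->|qn0] := eqVneq q 0.
  by exists 1 => -[|k]; rewrite ?expr0 ?mulr1// expr0n /= mulr0 ler01.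
have qp : 0 < q by rewrite lt_def qn0.
pose e := q^-1 - 1.
have e0 : 0 < e by rewrite subr_gt0 invf_gt1.
exists (e^-1 + 1) => k.
have B : 1 + e *+ k <= (1 + e) ^+ k.
  elim: k => [|k ih]; first by rewrite mulr0n addr0 expr0.
  rewrite exprS mulrSr; apply: (@le_trans _ _ ((1 + e) * (1 + e *+ k))).
    have : 0 <= e *+ k by rewrite mulrn_wge0// ltW.
    by move: (e *+ k) => a a0; nra.
  by rewrite ler_wpM2l// addr_ge0// ltW.
have qe : (1 + e) ^+ k = (q ^+ k)^-1 by rewrite /e addrC subrK exprVn.
rewrite qe in B; have qk : 0 < q ^+ k by exact: exprn_gt0.
have B2 : k.+1%:R * e <= (1 + e) * (q ^+ k)^-1.
  have h1 : k%:R * e <= (q ^+ k)^-1 by rewrite mulr_natl (le_trans _ B)// lerDr.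
  have h2 : 1 <= (q ^+ k)^-1 by rewrite invf_ge1// exprn_ile1// ltW.
  rewrite -natr1 mulrDl mul1r mulrDl mul1r lerD// ler_peMr// ltW//.
have -> : e^-1 + 1 = (1 + e) / e by field; rewrite gt_eqF.
by rewrite ler_pdivlMr// mulrAC -ler_pdivlMr//.
Qed.

(** The factor k + 1 is absorbed by the ratio of [r] to a radius [s] between [r] and 1. *)
Lemma ubc_diffs c : ubc c -> ubc (pseries_diffs c).
Proof.
move=> H r /andP[r0 r1]; pose s := (1 + r) / 2.
have s0 : 0 < s by rewrite /s; lra.
have rs : r < s by rewrite /s; lra.
have s1 : s < 1 by rewrite /s; lra.
have [|M HM] := H s; first by rewrite ltW.
have [|N HN] := @geometric_mul_bounded (r / s).
  by apply/andP; split; [rewrite divr_ge0// ltW|rewrite ltr_pdivrMr ?mul1r].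
have M0 : 0 <= M by apply: le_trans (HM 0%N); rewrite expr0 mulr1.
clearbody s; exists (M * N / s) => k.
rewrite /pseries_diffs normrM ger0_norm//.
have -> : k.+1%:R * `|c k.+1| * r ^+ k = (`|c k.+1| * s ^+ k.+1) * (k.+1%:R * (r / s) ^+ k) / s.
  by rewrite expr_div_n exprS; field; rewrite gt_eqF//= expf_neq0// gt_eqF.
rewrite ler_pM2r ?invr_gt0//; apply: ler_pM => //.
  by rewrite mulr_ge0// exprn_ge0// ltW.
by rewrite mulr_ge0// exprn_ge0// divr_ge0// ltW.
Qed.

Lemma ubc_cvg c x : ubc c -> `|x| < 1 -> cvgn (pseries c x).
Proof.
move=> H x1; pose s := (1 + `|x|) / 2.
have x0 := normr_ge0 x.
have s0 : 0 < s by rewrite /s; lra.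
have rs : `|x| < s by rewrite /s; lra.
have s1 : s < 1 by rewrite /s; lra.
have [|M HM] := H s; first by rewrite ltW.
have M0 : 0 <= M by apply: le_trans (HM 0%N); rewrite expr0 mulr1.
apply: normed_cvg; rewrite /normed_series_of.
have q1 : `| `|x| / s | < 1.
  by rewrite ger0_norm; [rewrite ltr_pdivrMr// mul1r|rewrite divr_ge0// ltW].
apply: (@series_le_cvg R _ (geometric M (`|x| / s))); last exact: is_cvg_geometric_series.
- by move=> k; exact: normr_ge0.
- move=> k; rewrite /geometric /=.
  by rewrite mulr_ge0// exprn_ge0// divr_ge0// ltW.
move=> k; rewrite /geometric /=.
have -> : `|c k * x ^+ k| = `|c k| * s ^+ k * (`|x| / s) ^+ k.
  by clearbody s; rewrite normrM normrX expr_div_n; field; rewrite expf_neq0// gt_eqF.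
by rewrite ler_wpM2r// exprn_ge0// divr_ge0// ltW.
Qed.

Definition PS c x : R := limn (pseries c x).

Lemma dv_PS c x : ubc c -> `|x| < 1 -> is_derive x 1 (PS c) (PS (pseries_diffs c) x).
Proof.
move=> H x1; pose s := (1 + `|x|) / 2.
have x0 := normr_ge0 x.
have s0 : 0 <= s by rewrite /s; lra.
have s1 : `|s| < 1 by rewrite ger0_norm// /s; lra.
apply: (@pseries_snd_diffs _ c s).
- exact: ubc_cvg.
- by apply: ubc_cvg => //; exact: ubc_diffs.
- by apply: ubc_cvg => //; apply: ubc_diffs; exact: ubc_diffs.
- by rewrite (ger0_norm s0) /s; lra.
Qed.

Lemma PSD c d x : ubc c -> ubc d -> `|x| < 1 -> PS (fun k => c k + d k) x = PS c x + PS d x.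
Proof.
move=> Hc Hd x1; rewrite /PS -(lim_seriesD (ubc_cvg Hc x1) (ubc_cvg Hd x1)).
rewrite /pseries; congr (limn (series _)); apply/funext => k.
by apply: etrans (mulrDl _ _ _) _.
Qed.

Lemma PSZ c x a : ubc c -> `|x| < 1 -> PS (fun k => a * c k) x = a * PS c x.
Proof.
move=> Hc x1; rewrite /PS -[RHS]/(a *: (_ : R^o)) -(lim_seriesZ a (ubc_cvg Hc x1)).
rewrite /pseries; congr (limn (series _)); apply/funext => k.
by apply: etrans (esym (mulrA _ _ _)) _.
Qed.

Lemma PS_theta c x : ubc c -> `|x| < 1 ->
  PS (fun k => k%:R * c k) x = x * PS (pseries_diffs c) x.
Proof.
move=> Hc x1; have := pseries_diffs_equiv (ubc_cvg (ubc_diffs Hc) x1) => H.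
apply: cvg_lim => //.
have -> : pseries (fun k => k%:R * c k) x = x *: series (fun i => i%:R * c i * x ^+ i.-1).
  rewrite /pseries/= -seriesZ /series/=; apply/funext => m; apply: eq_bigr => -[|k] _ /=.
    by transitivity (x * (0 * c 0%N * x ^+ 0)) => //; rewrite !mul0r mulr0.
  transitivity (x * (k.+1%:R * c k.+1 * x ^+ k)) => //.
  by rewrite exprS; ring.
by apply: cvgZ; [exact: cvg_cst|exact: H].
Qed.

Lemma ubcD c d : ubc c -> ubc d -> ubc (fun k => c k + d k).
Proof.
move=> Hc Hd r rr; have [M HM] := Hc r rr; have [N HN] := Hd r rr; exists (M + N) => k.
move/andP: rr => [r0 _].
by rewrite (le_trans _ (lerD (HM k) (HN k)))// -mulrDl ler_wpM2r ?exprn_ge0// ler_normD.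
Qed.

Lemma ubcZ a c : ubc c -> ubc (fun k => a * c k).
Proof.
move=> Hc r rr; have [M HM] := Hc r rr; exists (`|a| * M) => k.
by rewrite normrM -mulrA ler_wpM2l.
Qed.

Lemma ubc_theta c : ubc c -> ubc (fun k => k%:R * c k).
Proof.
move=> Hc r rr; have [M HM] := ubc_diffs Hc rr; exists (Num.max M 0) => -[|k].
  by rewrite mul0r normr0 mul0r le_max lexx orbT.
move: (HM k) rr; rewrite /pseries_diffs => Hk /andP[r0 r1].
rewrite le_max exprS mulrCA -(mul1r M) ler_pM ?orTb// ?mulr_ge0// ?exprn_ge0// ltW//.
Qed.

Lemma PS0 c : PS c 0 = c 0%N.
Proof.
apply: cvg_lim => //; rewrite -(cvg_shiftn 1).
rewrite (_ : (fun m => pseries c 0 (m + 1)%N) = fun=> c 0%N); first exact: cvg_cst.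
apply/funext => m; rewrite /pseries/= /series/= addn1 big_nat_recl// expr0 mulr1 big1 ?addr0// => i _.
by rewrite expr0n mulr0.
Qed.

End RealPowerSeries.
Local Open Scope complex_scope.

(** * Complex-valued functions of a real variable, through real and imaginary parts *)

Section ComplexCalculus.
Variable R : realType.
Local Notation C := R[i].
Local Notation Re := complex.Re.
Local Notation Im := complex.Im.
Implicit Types (z w : C) (g h : R -> C) (x : R).

Lemma cReM z w : Re (z * w) = Re z * Re w - Im z * Im w.
Proof. by case: z => a b; case: w. Qed.
Lemma cImM z w : Im (z * w) = Re z * Im w + Im z * Re w.
Proof. by case: z => a b; case: w => c d /=. Qed.
Lemma cReD z w : Re (z + w) = Re z + Re w.
Proof. by case: z => a b; case: w. Qed.
Lemma cImD z w : Im (z + w) = Im z + Im w.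
Proof. by case: z => a b; case: w. Qed.
Lemma cReN z : Re (- z) = - Re z.
Proof. by case: z. Qed.
Lemma cImN z : Im (- z) = - Im z.
Proof. by case: z. Qed.

Lemma complex_eq z w : Re z = Re w -> Im z = Im w -> z = w.
Proof. by case: z => a b; case: w => c d /= -> ->. Qed.

Lemma natC n : n%:R = (n%:R : R)%:C :> C.
Proof. by rewrite rmorph_nat. Qed.

Definition isdC x g (d : C) :=
  is_derive x 1 (fun s => Re (g s)) (Re d) /\ is_derive x 1 (fun s => Im (g s)) (Im d).

Lemma isdC_eq x g d d' : isdC x g d -> d = d' -> isdC x g d'.
Proof. by move=> H <-. Qed.

Lemma isdC_ext x g h d : g =1 h -> isdC x g d -> isdC x h d.
Proof. by move=> /funext ->. Qed.

Lemma isdC_cst x (c : C) : isdC x (fun=> c) 0.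
Proof. by split; exact: dv_cst. Qed.

Lemma isdC_real x (f : R -> R) (d : R) : is_derive x 1 f d -> isdC x (fun s => (f s)%:C) d%:C.
Proof. by move=> H; split => //; exact: dv_cst. Qed.

Lemma isdC_add x g h a b : isdC x g a -> isdC x h b -> isdC x (fun s => g s + h s) (a + b).
Proof.
move=> [g1 g2] [h1 h2]; split.
  by rewrite cReD; apply: dv_ext (dv_add g1 h1) => s; rewrite cReD.
by rewrite cImD; apply: dv_ext (dv_add g2 h2) => s; rewrite cImD.
Qed.

Lemma isdC_mul x g h a b : isdC x g a -> isdC x h b ->
  isdC x (fun s => g s * h s) (a * h x + g x * b).
Proof.
move=> [g1 g2] [h1 h2]; split.
  apply: dv_eq; first by apply: dv_ext (dv_sub (dv_mul g1 h1) (dv_mul g2 h2)) => s; rewrite cReM.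
  by rewrite cReD !cReM; ring.
apply: dv_eq; first by apply: dv_ext (dv_add (dv_mul g1 h2) (dv_mul g2 h1)) => s; rewrite cImM.
by rewrite cImD !cImM; ring.
Qed.

Lemma isdC_scale x g a c : isdC x g a -> isdC x (fun s => c * g s) (c * a).
Proof. by move=> H; apply: isdC_eq (isdC_mul (isdC_cst x c) H) _; rewrite mul0r add0r. Qed.

Lemma isdC_cpow x (u : R -> R) (d : R) c : 0 < u x -> is_derive x 1 u d ->
  isdC x (fun s => cpow (u s) c) ((d / u x)%:C * (c * cpow (u x) c)).
Proof.
move=> ux Hu.
have Hl : is_derive x 1 (fun s => ln (u s)) (d / u x).
  by apply: dv_eq (dv_comp (is_derive1_ln ux) Hu) _; rewrite mulrC.
have He : is_derive x 1 (fun s => expR (Re c * ln (u s))) (expR (Re c * ln (u x)) * (Re c * (d / u x))).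
  exact: dv_comp (is_derive_expR _) (dv_scale (Re c) Hl).
have Hc : is_derive x 1 (fun s => cos (Im c * ln (u s))) (- sin (Im c * ln (u x)) * (Im c * (d / u x))).
  exact: dv_comp (is_derive_cos _) (dv_scale (Im c) Hl).
have Hs : is_derive x 1 (fun s => sin (Im c * ln (u s))) (cos (Im c * ln (u x)) * (Im c * (d / u x))).
  exact: dv_comp (is_derive_sin _) (dv_scale (Im c) Hl).
have E s : cpow (u s) c = (expR (Re c * ln (u s)) * cos (Im c * ln (u s))) +i* (expR (Re c * ln (u s)) * sin (Im c * ln (u s))).
  rewrite /cpow /cexp; apply: complex_eq; rewrite ?cReM ?cImM /= ?cReM ?cImM /=.
    by rewrite !mulr0 !subr0 !add0r mul0r subr0.
  by rewrite !mulr0 !subr0 !add0r mul0r addr0.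
split.
  apply: dv_eq; first by apply: dv_ext (dv_mul He Hc) => s; rewrite E.
  rewrite E cReM !cImM cReM; cbn [complex.Re complex.Im real_complex_def]; cbv beta.
  move: (d / u x) => q; ring.
apply: dv_eq; first by apply: dv_ext (dv_mul He Hs) => s; rewrite E.
rewrite E cImM cImM cReM; cbn [complex.Re complex.Im real_complex_def]; cbv beta.
move: (d / u x) => q; ring.
Qed.

Lemma cpowD (u : R) c d : cpow u (c + d) = cpow u c * cpow u d.
Proof.
rewrite /cpow mulrDl /cexp cReD cImD expRD cosD sinD.
by apply: complex_eq; rewrite !(cReM, cImM) /=; ring.
Qed.

Lemma cpowM (u v : R) c : 0 < u -> 0 < v -> cpow (u * v) c = cpow u c * cpow v c.
Proof.
move=> u0 v0; rewrite /cpow lnM ?posrE// rmorphD mulrDr /cexp cReD cImD expRD cosD sinD.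
by apply: complex_eq; rewrite !(cReM, cImM) /=; ring.
Qed.

Lemma cpow0 (u : R) : cpow u 0 = 1.
Proof.
rewrite /cpow mul0r /cexp /= expR0 cos0 sin0.
by apply: complex_eq; rewrite !(cReM, cImM) /=; ring.
Qed.

Lemma cpowN (u : R) c : cpow u (- c) = (cpow u c)^-1.
Proof.
have H : cpow u c * cpow u (- c) = 1 by rewrite -cpowD subrr cpow0.
have c0 : cpow u c != 0.
  by apply/eqP => e; move: H; rewrite e mul0r => /eqP; rewrite eq_sym oner_eq0.
by apply: (mulfI c0); rewrite H mulfV.
Qed.

Lemma cpow_neq0 (u : R) c : cpow u c != 0.
Proof.
apply/eqP => e; have H : cpow u c * cpow u (- c) = 1 by rewrite -cpowD subrr cpow0.
by move: H; rewrite e mul0r => /eqP; rewrite eq_sym oner_eq0.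
Qed.

Lemma cpow1 c : cpow (1 : R) c = 1.
Proof.
rewrite /cpow ln1 mulr0 /cexp /= expR0 cos0 sin0.
by apply: complex_eq; rewrite !(cReM, cImM) /=; ring.
Qed.

Lemma cpow_real (u r : R) : 0 < u -> cpow u r%:C = (u `^ r)%:C.
Proof.
move=> u0; rewrite /cpow -rmorphM /cexp /= cos0 sin0 /powR gt_eqF//.
by apply: complex_eq; rewrite !(cReM, cImM) /=; ring.
Qed.

Lemma csqrt_sq (a : R) : csqrt a ^+ 2 = a%:C.
Proof.
rewrite /csqrt; case: ifPn => [a0|]; first by rewrite -rmorphXn /= sqr_sqrtr.
rewrite -ltNge => a0; rewrite expr2; have h : Num.sqrt (- a) ^+ 2 = - a by rewrite sqr_sqrtr// oppr_ge0 ltW.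
by apply: complex_eq; rewrite !(cReM, cImM) /= -?expr2 ?h; ring.
Qed.

End ComplexCalculus.

(** * Power series with complex coefficients on the real interval (-1, 1) *)

Section ComplexPowerSeries.
Variable R : realType.
Local Notation C := R[i].
Local Notation Re := complex.Re.
Local Notation Im := complex.Im.
Implicit Types (c d : nat -> C) (x r : R).

Definition ubC c := ubc (fun k => Re (c k)) /\ ubc (fun k => Im (c k)).
Definition FC c x : C := PS (fun k => Re (c k)) x +i* PS (fun k => Im (c k)) x.
Definition diffsC c k : C := k.+1%:R * c k.+1.

Lemma Re_nat n (z : C) : Re (n%:R * z) = n%:R * Re z.
Proof. by rewrite natC cReM /= mul0r subr0. Qed.
Lemma Im_nat n (z : C) : Im (n%:R * z) = n%:R * Im z.
Proof. by rewrite natC cImM /= mul0r addr0. Qed.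

Lemma ubC_diffs c : ubC c -> ubC (diffsC c).
Proof.
move=> [h1 h2]; split.
  rewrite (_ : (fun k => _) = pseries_diffs (fun k => Re (c k))); first exact: ubc_diffs.
  by apply/funext => k; rewrite Re_nat.
rewrite (_ : (fun k => _) = pseries_diffs (fun k => Im (c k))); first exact: ubc_diffs.
by apply/funext => k; rewrite Im_nat.
Qed.

Lemma isdC_FC c x : ubC c -> `|x| < 1 -> isdC x (FC c) (FC (diffsC c) x).
Proof.
move=> [h1 h2] x1; split => /=.
  apply: dv_eq (dv_PS h1 x1) _; congr (PS _ x).
  by apply/funext => k; rewrite Re_nat.
apply: dv_eq (dv_PS h2 x1) _; congr (PS _ x).
by apply/funext => k; rewrite Im_nat.
Qed.

Lemma ubCD c d : ubC c -> ubC d -> ubC (fun k => c k + d k).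
Proof.
move=> [c1 c2] [d1 d2]; split.
  by rewrite (_ : (fun k => _) = (fun k => Re (c k) + Re (d k))); [exact: ubcD|apply/funext => k; rewrite cReD].
by rewrite (_ : (fun k => _) = (fun k => Im (c k) + Im (d k))); [exact: ubcD|apply/funext => k; rewrite cImD].
Qed.

Lemma ubCZ c (a : C) : ubC c -> ubC (fun k => a * c k).
Proof.
move=> [c1 c2]; split.
  rewrite (_ : (fun k => _) = (fun k => Re a * Re (c k) + (- Im a) * Im (c k))).
    by apply: ubcD; exact: ubcZ.
  by apply/funext => k; rewrite cReM; ring.
rewrite (_ : (fun k => _) = (fun k => Re a * Im (c k) + Im a * Re (c k))).
  by apply: ubcD; exact: ubcZ.
by apply/funext => k; rewrite cImM; ring.
Qed.

Lemma ubC_theta c : ubC c -> ubC (fun k => k%:R * c k).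
Proof.
move=> [c1 c2]; split.
  rewrite (_ : (fun k => _) = (fun k => k%:R * Re (c k))); first exact: ubc_theta.
  by apply/funext => k; rewrite Re_nat.
rewrite (_ : (fun k => _) = (fun k => k%:R * Im (c k))); first exact: ubc_theta.
by apply/funext => k; rewrite Im_nat.
Qed.

Lemma FCD c d x : ubC c -> ubC d -> `|x| < 1 -> FC (fun k => c k + d k) x = FC c x + FC d x.
Proof.
move=> [c1 c2] [d1 d2] x1; apply: complex_eq; rewrite ?cReD ?cImD /= -PSD//;
  by congr (PS _ x); apply/funext => k; rewrite ?cReD ?cImD.
Qed.

Lemma FCZ c (a : C) x : ubC c -> `|x| < 1 -> FC (fun k => a * c k) x = a * FC c x.
Proof.
move=> [c1 c2] x1; apply: complex_eq; rewrite ?cReM ?cImM /=.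
  rewrite (_ : (fun k => Re (a * c k)) = (fun k => Re a * Re (c k) + (- Im a) * Im (c k))).
    by rewrite PSD ?PSZ//; [ring|exact: ubcZ|exact: ubcZ].
  by apply/funext => k; rewrite cReM; ring.
rewrite (_ : (fun k => Im (a * c k)) = (fun k => Re a * Im (c k) + Im a * Re (c k))).
  by rewrite PSD ?PSZ//; [exact: ubcZ|exact: ubcZ].
by apply/funext => k; rewrite cImM.
Qed.

Lemma FC_theta c x : ubC c -> `|x| < 1 -> FC (fun k => k%:R * c k) x = x%:C * FC (diffsC c) x.
Proof.
move=> [c1 c2] x1; apply: complex_eq; rewrite ?cReM ?cImM /= mul0r ?subr0 ?addr0.
  rewrite (_ : (fun k => Re (k%:R * c k)) = (fun k => k%:R * Re (c k))).
    rewrite PS_theta//; congr (_ * PS _ x); by apply/funext => k; rewrite Re_nat.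
  by apply/funext => k; rewrite Re_nat.
rewrite (_ : (fun k => Im (k%:R * c k)) = (fun k => k%:R * Im (c k))).
  rewrite PS_theta//; congr (_ * PS _ x); by apply/funext => k; rewrite Im_nat.
by apply/funext => k; rewrite Im_nat.
Qed.

Lemma FC0 c : FC c 0 = c 0%N.
Proof. by apply: complex_eq; rewrite /= PS0. Qed.

(* The topology of [R[i]^o] is that of the modulus, controlled by the real and imaginary parts. *)
Lemma cvgC (u : nat -> C) (l : C) : (fun k => Re (u k)) @ \oo --> Re l ->
  (fun k => Im (u k)) @ \oo --> Im l -> (u : nat -> C^o) @ \oo --> (l : C^o).
Proof.
move=> h1 h2; apply/cvgrPdist_lt => e; rewrite ltcE /= => /andP[/eqP ei er].
have e2 : 0 < Re e / 2 by rewrite divr_gt0.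
move/cvgrPdist_lt/(_ _ e2) : h1 => h1; move/cvgrPdist_lt/(_ _ e2) : h2 => h2.
near=> k; have k1 : `|Re l - Re (u k)| < Re e / 2 by near: k.
have k2 : `|Im l - Im (u k)| < Re e / 2 by near: k.
rewrite normc_def ltcE /= ei eqxx /=.
set a := Re (l - u k); set b := Im (l - u k).
have {}k1 : `|a| < Re e / 2 by rewrite /a cReD cReN.
have {}k2 : `|b| < Re e / 2 by rewrite /b cImD cImN.
rewrite -(ltr_pXn2r (n := 2)) ?nnegrE ?sqrtr_ge0// ?(ltW er)//.
rewrite sqr_sqrtr ?addr_ge0 ?sqr_ge0// -(real_normK (num_real a)) -(real_normK (num_real b)).
have := normr_ge0 a; have := normr_ge0 b; move: (`|a|) (`|b|) k1 k2 => p q k1 k2 p0 q0.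
nra.
Unshelve. all: by end_near. Qed.

Lemma FC_lim c x : ubC c -> `|x| < 1 ->
  limn (series (fun k => c k * x%:C ^+ k : C^o)) = FC c x.
Proof.
move=> [h1 h2] x1.
have E k : x%:C ^+ k = (x ^+ k)%:C :> C by rewrite rmorphXn.
apply: cvg_lim; first exact: norm_hausdorff.
apply: cvgC.
  rewrite (_ : (fun k => _) = pseries (fun k => Re (c k)) x); first exact: ubc_cvg.
  apply/funext => m; rewrite /pseries /series /= (big_morph (@complex.Re R) (@cReD R) (erefl _)).
  by apply: eq_bigr => k _; rewrite E cReM /= mulr0 subr0.
rewrite (_ : (fun k => _) = pseries (fun k => Im (c k)) x); first exact: ubc_cvg.
apply/funext => m; rewrite /pseries /series /= (big_morph (@complex.Im R) (@cImD R) (erefl _)).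
by apply: eq_bigr => k _; rewrite E cImM /= mulr0 add0r.
Qed.

End ComplexPowerSeries.

Lemma dv_inv (R : realType) (E : normedModType R) (F : E -> R) p v d : F p != 0 ->
  is_derive p v F d -> is_derive p v (fun q => (F q)^-1) (- d / F p ^+ 2).
Proof.
move=> h D.
have := dv_comp (@is_deriveV _ id (F p) 1 1 h (dv_id _)) D.
by move=> H; apply: (dv_eq H); rewrite -[_%:A]/(_ * _) mulr1 !mulNr mulrC.
Qed.

(** * Gauss' series F(a, a; 1; x) and its differential equation *)

Section Hypergeometric.
Variable R : realType.
Local Notation C := R[i].
Local Notation Re := complex.Re.
Local Notation Im := complex.Im.

Lemma eventually_noninc_bounded (u : nat -> R) K : (forall k, 0 <= u k) ->
  (forall k, (K <= k)%N -> u k.+1 <= u k) -> exists M, forall k, u k <= M.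
Proof.
move=> u0 H; exists (\sum_(j < K.+1) u j) => k.
have small j : (j <= K)%N -> u j <= \sum_(j < K.+1) u j.
  move=> jK; rewrite (bigD1 (Ordinal (jK : (j < K.+1)%N)))//= lerDl.
  by apply: sumr_ge0 => i _; exact: u0.
have [|Kk] := leqP k K; first exact: small.
apply: (le_trans _ (small K (leqnn K))).
elim: k Kk => // k ih; rewrite ltnS leq_eqVlt => /orP[/eqP <-|Kk]; first exact: H.
by apply: (le_trans (H _ (ltnW Kk))); exact: ih.
Qed.

(** A submultiplicative norm free of square roots, sufficient for bounds on coefficients. *)
Definition L1 (z : C) : R := `|Re z| + `|Im z|.

Lemma L1_ge0 z : 0 <= L1 z. Proof. by rewrite addr_ge0. Qed.

Lemma L1M (z w : C) : L1 (z * w) <= L1 z * L1 w.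
Proof.
rewrite /L1 cReM cImM.
have h1 := ler_normB (Re z * Re w) (Im z * Im w).
have h2 := ler_normD (Re z * Im w) (Im z * Re w).
apply: (le_trans (lerD h1 h2)); rewrite !normrM.
by rewrite le_eqVlt; apply/orP; left; apply/eqP; ring.
Qed.

Lemma L1D (z w : C) : L1 (z + w) <= L1 z + L1 w.
Proof.
rewrite /L1 cReD cImD.
have h1 := ler_normD (Re z) (Re w).
have h2 := ler_normD (Im z) (Im w).
lra.
Qed.

Lemma L1_real (r : R) : 0 <= r -> L1 r%:C = r.
Proof. by move=> r0; rewrite /L1 /= normr0 addr0 ger0_norm. Qed.

Variables (a : C) (kap : R).
Hypothesis a_kap : a * (1 - a) = kap%:C.

Definition hcoef (k : nat) : C :=
  (pochhammer a k * pochhammer a k) / (pochhammer 1 k * k`!%:R).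

Lemma pochhammer1 k : pochhammer (1 : C) k = k`!%:R.
Proof.
rewrite /pochhammer; elim: k => [|k ih]; first by rewrite big_ord0.
by rewrite big_ord_recr /= ih factS natrM nat1r mulrC.
Qed.

Lemma hcoefS k : hcoef k.+1 = (((k.+1%:R : R)^-1)%:C * (a + k%:R)) ^+ 2 * hcoef k.
Proof.
have f0 : k`!%:R != 0 :> C by rewrite pnatr_eq0 -lt0n fact_gt0.
have k0 : k.+1%:R != 0 :> C by rewrite pnatr_eq0.
rewrite /hcoef !pochhammer1 /pochhammer big_ord_recr /= -/(pochhammer a k) factS natrM.
rewrite fmorphV rmorph_nat.
by field; rewrite ?nat1r ?natr1 ?f0 ?k0.
Qed.

Lemma hcoef_rec k : k.+1%:R * (k.+1%:R * hcoef k.+1) = (a + k%:R) ^+ 2 * hcoef k.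
Proof.
have k0 : k.+1%:R != 0 :> C by rewrite pnatr_eq0.
rewrite hcoefS fmorphV rmorph_nat.
by field; rewrite ?nat1r ?natr1 ?k0.
Qed.

(** The ratio of successive coefficients is ((a + k)/(k + 1))^2, which tends to 1; from some [K] on,
    the terms multiplied by r^k no longer increase. *)
Lemma ubC_hcoef : ubC hcoef.
Proof.
suff H : forall r, 0 <= r < 1 -> exists M, forall k, L1 (hcoef k) * r ^+ k <= M.
  split=> r rr; have [M HM] := H r rr; exists M => k; move/andP: rr => [r0 r1];
    apply: le_trans (HM k); rewrite ler_wpM2r ?exprn_ge0// /L1 ?lerDl ?lerDr//.
(* The ratio of coefficients is a square, so [r] is bounded by the square of [s < 1], and it
   suffices that |(a + k)/(k + 1)| s <= 1. *)
move=> r /andP[r0 r1]; pose s := (1 + r) / 2.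
have s0 : 0 < s by rewrite /s; lra.
have s1 : s < 1 by rewrite /s; lra.
have sr : r <= s ^+ 2 by rewrite /s; nra.
have [K HK] : exists K : nat, L1 a / (1 - s) < K%:R.
  exists (Num.bound (L1 a / (1 - s))).
  by rewrite archi_boundP// divr_ge0 ?L1_ge0// subr_ge0 ltW.
apply: (@eventually_noninc_bounded _ K) => k.
  by rewrite mulr_ge0 ?L1_ge0// exprn_ge0.
move=> Kk; rewrite hcoefS.
have hK : L1 a <= k%:R * (1 - s).
  rewrite -ler_pdivrMr ?subr_gt0// (le_trans (ltW HK))// ler_nat//.
set w := _ * (a + _).
have hw : L1 w * s <= 1.
  have h1 : L1 w <= (k.+1%:R)^-1 * (L1 a + k%:R).
    apply: (le_trans (L1M _ _)); rewrite L1_real ?invr_ge0// ler_wpM2l ?invr_ge0//.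
    by apply: (le_trans (L1D _ _)); rewrite natC L1_real.
  apply: (@le_trans _ _ ((k.+1%:R)^-1 * (L1 a + k%:R) * s)).
    by rewrite ler_wpM2r// ltW.
  rewrite -mulrA mulrC ler_pdivrMr// mul1r -natr1.
  have hk : 0 <= k%:R * (1 - s) ^+ 2 by rewrite mulr_ge0// sqr_ge0.
  have hL : L1 a * s <= k%:R * (1 - s) * s by rewrite ler_wpM2r// ltW.
  clearbody s; nra.
have h2 : L1 (w ^+ 2 * hcoef k) <= L1 w ^+ 2 * L1 (hcoef k).
  apply: (le_trans (L1M _ _)); rewrite ler_wpM2r ?L1_ge0//; exact: L1M.
move: (L1 (w ^+ 2 * hcoef k)) (L1_ge0 (w ^+ 2 * hcoef k)) h2 => A A0.
move: (L1 (hcoef k)) (L1_ge0 (hcoef k)) => B B0.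
move: (L1 w) (L1_ge0 w) hw => W W0 hw hA.
rewrite exprS mulrA ler_wpM2r ?exprn_ge0//.
apply: (@le_trans _ _ ((W ^+ 2 * B) * s ^+ 2)); first exact: ler_pM.
by rewrite mulrAC -exprMn ler_piMl// exprn_ile1// mulr_ge0// ltW.
Qed.

Lemma hyp2F1_FC x : `|x| < 1 -> hyp2F1 a a 1 x%:C = FC hcoef x.
Proof. exact: (FC_lim ubC_hcoef). Qed.

Definition hF := FC hcoef.
Definition hF1 := FC (diffsC hcoef).
Definition hF2 := FC (diffsC (diffsC hcoef)).

(** With theta = x d/dx, which multiplies the k-th coefficient by k, the recurrence (k+1)^2 c_(k+1)
    = (k+a)^2 c_k reads d/dx (theta F) = (theta + a)^2 F. *)
Lemma hyp_ode x : `|x| < 1 ->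
  (1 - x%:C) * (hF1 x + x%:C * hF2 x) = 2 * a * (x%:C * hF1 x) + a ^+ 2 * hF x.
Proof.
move=> x1; have u0 := ubC_hcoef; have u1 := ubC_diffs u0; have ut := ubC_theta u0.
have E1 : FC (diffsC (fun k => k%:R * hcoef k)) x = hF1 x + x%:C * hF2 x.
  rewrite /hF1 /hF2 -(FC_theta u1 x1) -FCD//; last exact: ubC_theta.
  by congr (FC _ x); apply/funext => k; rewrite /diffsC -natr1; ring.
have E2 : FC (diffsC (fun k => k%:R * hcoef k)) x =
    x%:C * FC (diffsC (fun k => k%:R * hcoef k)) x + 2 * a * (x%:C * hF1 x) + a ^+ 2 * hF x.
  rewrite /hF /hF1 -(FC_theta ut x1) -(FC_theta u0 x1).
  rewrite -(FCZ (2 * a) ut x1) -(FCZ (a ^+ 2) u0 x1).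
  rewrite -(FCD (ubC_theta ut) (ubCZ (2 * a) ut) x1).
  rewrite -(FCD (ubCD (ubC_theta ut) (ubCZ (2 * a) ut)) (ubCZ (a ^+ 2) u0) x1).
  by congr (FC _ x); apply/funext => k; rewrite /diffsC hcoef_rec; ring.
rewrite E1 in E2; rewrite mulrBl mul1r {1}E2; ring.
Qed.

(** By Pfaff's transformation this is F(a, 1-a; 1; x/(x-1)), a Legendre function. Its equation
    involves [a] only through a(1-a), which is real even when [a] is not. *)
Definition hQ (x : R) : C := cpow (1 - x) a * hF x.
Definition hQ1 (x : R) : C := cpow (1 - x) a * (hF1 x - a * (((1 - x)^-1)%:C * hF x)).

Lemma isdC_cpow1B c (x : R) : x < 1 ->
  isdC x (fun s => cpow (1 - s) c) (- (((1 - x)^-1)%:C * (c * cpow (1 - x) c))).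
Proof.
move=> x1; have h : 0 < 1 - x by rewrite subr_gt0.
apply: isdC_eq (isdC_cpow (u := fun s : R => 1 - s) c h (dv_sub (dv_cst 1 x 1) (dv_id x))) _.
by rewrite sub0r mulNr mul1r rmorphN mulNr.
Qed.

Lemma isdC_inv1B (x : R) : x < 1 ->
  isdC x (fun s => ((1 - s)^-1)%:C) ((1 - x)^-1 ^+ 2)%:C.
Proof.
move=> x1; apply: isdC_real.
have h : 1 - x != 0 by rewrite gt_eqF// subr_gt0.
have D : is_derive x 1 (fun s : R => 1 - s) (0 - 1) by exact: (dv_sub (dv_cst 1 x 1) (dv_id x)).
apply: dv_eq (dv_inv (F := fun s : R => 1 - s) h D) _.
by rewrite sub0r opprK mul1r exprVn.
Qed.

Lemma isdC_hQ x : `|x| < 1 -> isdC x hQ (hQ1 x).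
Proof.
move=> x1; have xlt : x < 1 by apply: le_lt_trans x1; exact: ler_norm.
apply: isdC_eq (isdC_mul (isdC_cpow1B a xlt) (isdC_FC ubC_hcoef x1)) _.
by rewrite -/(hF x) -/(hF1 x) /hQ1; ring.
Qed.

(** The equation of [hQ] in divergence form: (x Q')' = - kap Q / (1-x)^2, with real coefficients. *)
Lemma isdC_zhQ1 x : `|x| < 1 ->
  isdC x (fun s => s%:C * hQ1 s) (- (kap * (1 - x)^-1 ^+ 2)%:C * hQ x).
Proof.
move=> x1; have xlt : x < 1 by apply: le_lt_trans x1; exact: ler_norm.
have D1 := isdC_FC ubC_hcoef x1; have D2 := isdC_FC (ubC_diffs ubC_hcoef) x1.
have Dp := isdC_cpow1B a xlt; have Di := isdC_inv1B xlt.
have Dx := isdC_real (dv_id x).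
have D := isdC_mul Dx (isdC_mul Dp (isdC_add D2 (isdC_scale (-1) (isdC_scale a (isdC_mul Di D1))))).
apply: isdC_eq.
  by apply: isdC_ext D => s; rewrite /hQ1 mulN1r.
have X0 : 1 - x%:C != 0 :> C.
  by rewrite -(rmorph1 (real_complex R)) -rmorphB fmorph_eq0 gt_eqF// subr_gt0.
have iE : ((1 - x)^-1)%:C = (1 - x%:C)^-1 :> C by rewrite fmorphV rmorphB rmorph1.
have E : x%:C * hF2 x = (1 - x%:C)^-1 * (2 * a * (x%:C * hF1 x) + a ^+ 2 * hF x) - hF1 x.
  by rewrite -(hyp_ode x1) mulKf//; ring.
have i2E : ((1 - x)^-1 ^+ 2)%:C = (1 - x%:C)^-1 ^+ 2 :> C by rewrite rmorphXn /= iE.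
have kE : (kap * (1 - x)^-1 ^+ 2)%:C = a * (1 - a) * (1 - x%:C)^-1 ^+ 2 :> C.
  by rewrite rmorphM /= -a_kap i2E.
rewrite -/(hF x) -/(hF1 x) -/(hF2 x) /hQ kE i2E iE.
move: (hF x) (hF1 x) (hF2 x) E (cpow (1 - x) a) => F F1 F2 E p.
transitivity (p * ((F1 - a * ((1 - x%:C)^-1 * F)) - x%:C * (1 - x%:C)^-1 * a * (F1 - a * ((1 - x%:C)^-1 * F))
   + x%:C * F2 - a * x%:C * ((1 - x%:C)^-1 ^+ 2 * F + (1 - x%:C)^-1 * F1))).
  by rewrite rmorph1; ring.
by rewrite E; field.
Qed.

End Hypergeometric.

(** The equation is singular at 0, so the value there is the only datum. In the energy y^2 + w y'^2
    the weight [w] removes y'(0), and its growth is at most exponential. *)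
Lemma legendre_unique (R : realType) (y y1 y2 g : R -> R) (r M : R) : 0 <= r ->
  (forall w, 0 <= w <= r -> is_derive w 1 y (y1 w)) ->
  (forall w, 0 <= w <= r -> is_derive w 1 y1 (y2 w)) ->
  (forall w, 0 <= w <= r -> w * y2 w + y1 w = g w * y w) ->
  (forall w, 0 <= w <= r -> `|g w| <= M) -> y 0 = 0 -> y r = 0.
Proof.
move=> r0 D1 D2 ode gM y0.
pose e (w : R) := y w ^+ 2 + w * y1 w ^+ 2.
pose de (w : R) := 2 * (1 + g w) * y w * y1 w - y1 w ^+ 2.
have De w : 0 <= w <= r -> is_derive w 1 e (de w).
  move=> wr; have d1 := D1 w wr; have d2 := D2 w wr.
  apply: dv_eq (dv_add (dv_exp 2 d1) (dv_mul (dv_id w) (dv_exp 2 d2))) _.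
  rewrite /de !expr1.
  have -> : w * (2%:R * y1 w * y2 w) = 2 * y1 w * (g w * y w - y1 w) by rewrite -ode//; ring.
  by ring.
(* The derivative 2 (1+g) y y' - y'^2 of the energy is at most (1+g)^2 y^2. *)
pose c := (1 + M) ^+ 2.
have M0 : 0 <= M by apply: le_trans (gM 0 _); rewrite ?lexx// normr_ge0.
pose f (s : R) := e (s * r) * expR (- (c * r) * s).
pose df (s : R) := r * (de (s * r) - c * e (s * r)) * expR (- (c * r) * s).
have Df (s : R) : 0 <= s <= 1 -> is_derive s 1 f (df s).
  move=> /andP[s0 s1].
  have sr : 0 <= s * r <= r by rewrite mulr_ge0//= ler_piMl.
  have h1 : is_derive s 1 (fun s : R => s * r) r.
    by apply: dv_eq (dv_mul (dv_id s) (dv_cst r s 1)) _; rewrite mul1r mulr0 addr0.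
  have h2 : is_derive s 1 (fun s : R => e (s * r)) (de (s * r) * r).
    exact: (dv_comp (g := e) (F := fun s : R => s * r) (De _ sr) h1).
  have h3 : is_derive s 1 (fun s : R => expR (- (c * r) * s)) (expR (- (c * r) * s) * (- (c * r) * 1)).
    exact: (dv_comp (is_derive_expR _) (dv_scale _ (dv_id s))).
  by apply: dv_eq (dv_mul h2 h3) _; rewrite /df; ring.
have [s /andP[s0 s1] E] := MVT01 Df.
have sr : 0 <= s * r <= r by rewrite mulr_ge0//= ler_piMl.
have df_le : df s <= 0.
  rewrite /df mulrAC; apply: mulr_ge0_le0; first by rewrite mulr_ge0// expR_ge0.
  have w0 : 0 <= s * r by case/andP: sr.
  have := gM _ sr; rewrite ler_norml => /andP[g1 g2].
  rewrite /de /e /c; move: (s * r) w0 g1 g2 => w w0 g1 g2.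
  move: (g w) (y w) (y1 w) g1 g2 => a p q a1 a2.
  have h1 : 2 * (1 + a) * p * q - q ^+ 2 <= (1 + a) ^+ 2 * p ^+ 2.
    by have := sqr_ge0 ((1 + a) * p - q); nra.
  have h2 : (1 + a) ^+ 2 * p ^+ 2 <= (1 + M) ^+ 2 * p ^+ 2.
    by rewrite ler_wpM2r ?sqr_ge0//; nra.
  have h3 : 0 <= (1 + M) ^+ 2 * (w * q ^+ 2) by apply: mulr_ge0; [exact: sqr_ge0|apply: mulr_ge0 => //; exact: sqr_ge0].
  lra.
have f0 : f 0 = 0 by rewrite /f mul0r /e y0 expr0n /= mul0r addr0 mul0r.
have er : e r <= 0.
  have : f 1 <= 0 by rewrite -E f0 subr0 in df_le.
  by rewrite /f mul1r pmulr_lle0// expR_gt0.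
have : y r ^+ 2 <= 0 by apply: le_trans er; rewrite /e lerDl mulr_ge0// sqr_ge0.
by move=> h; apply/eqP; rewrite -sqrf_eq0 eq_le h sqr_ge0.
Qed.

Section SmoothComplex.
Variable R : realType.
Local Notation C := R[i].
Local Notation Re := complex.Re.
Local Notation Im := complex.Im.

Fixpoint smC (k : nat) (I : set R) (g : R -> C) : Prop :=
  match k with
  | 0 => forall x, I x -> {for x, continuous (fun s => Re (g s))} /\ {for x, continuous (fun s => Im (g s))}
  | k'.+1 => exists2 g' : R -> C, (forall x, I x -> isdC x g (g' x)) & smC k' I g'
  end.

Lemma smC_S k I g : smC k.+1 I g -> smC k I g.
Proof.
elim: k g => [|k ih] g [g' H1 H2]; last by exists g' => //; exact: ih.
by move=> x /H1[h1 h2]; split; apply: dv_cont; eassumption.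
Qed.

Lemma smC_add k I g h : smC k I g -> smC k I h -> smC k I (fun s => g s + h s).
Proof.
elim: k g h => [|k ih] g h.
  move=> Hg Hh x Ix; have [g1 g2] := Hg x Ix; have [h1 h2] := Hh x Ix; split.
    by rewrite (_ : (fun s => _) = (fun s => Re (g s) + Re (h s)));
      [exact: continuousD|apply/funext => s; rewrite cReD].
  by rewrite (_ : (fun s => _) = (fun s => Im (g s) + Im (h s)));
    [exact: continuousD|apply/funext => s; rewrite cImD].
move=> [g' g1 g2] [h' h1 h2]; exists (fun s => g' s + h' s); last exact: ih.
by move=> x Ix; apply: isdC_add; [exact: g1|exact: h1].
Qed.

Lemma smC_mul k I g h : smC k I g -> smC k I h -> smC k I (fun s => g s * h s).
Proof.
elim: k g h => [|k ih] g h.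
  move=> Hg Hh x Ix; have [g1 g2] := Hg x Ix; have [h1 h2] := Hh x Ix; split.
    rewrite (_ : (fun s => _) = (fun s => Re (g s) * Re (h s) - Im (g s) * Im (h s))).
      by apply: continuousB; exact: continuousM.
    by apply/funext => s; rewrite cReM.
  rewrite (_ : (fun s => _) = (fun s => Re (g s) * Im (h s) + Im (g s) * Re (h s))).
    by apply: continuousD; exact: continuousM.
  by apply/funext => s; rewrite cImM.
move=> Hg Hh; move: (Hg) (Hh) => [g' g1 g2] [h' h1 h2].
exists (fun s => g' s * h s + g s * h' s).
  by move=> x Ix; apply: isdC_mul; [exact: g1|exact: h1].
by apply: smC_add; apply: ih => //; exact: smC_S.
Qed.

Lemma smC_cst k I c : smC k I (fun=> c).
Proof.
elim: k c => [|k ih] c; first by move=> x _; split; exact: cvg_cst.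
by exists (fun=> 0) => // x _; exact: isdC_cst.
Qed.

Lemma smC_smooth1 k I g : smC k I g -> smooth1 k I (fun s => Re (g s)).
Proof.
elim: k g => [|k ih] g /=; first by move=> H; split => // x /H[].
move=> [g' H1 H2]; split; first by move=> x /H1[h _]; exact: (dv_cont h).
by exists (fun s => Re (g' s)); [move=> x /H1[]|exact: ih].
Qed.

Definition unit_itv : set R := [set x | `|x| < 1].

Lemma smC_FC k c : ubC c -> smC k unit_itv (FC c).
Proof.
elim: k c => [|k ih] c Hc; last first.
  exists (FC (diffsC c)); first by move=> x x1; exact: isdC_FC.
  by apply: ih; exact: ubC_diffs.
by move=> x x1; have [h1 h2] := isdC_FC Hc x1; split; [exact: (dv_cont h1)|exact: (dv_cont h2)].
Qed.

Lemma smC_cpow1B k c : smC k unit_itv (fun s => cpow (1 - s) c).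
Proof.
have D c' (x : R) : unit_itv x -> isdC x (fun s => cpow (1 - s) c') (- c' * cpow (1 - x) (c' + - 1)).
  move=> x1; have xlt : x < 1 by apply: le_lt_trans x1; exact: ler_norm.
  apply: isdC_eq (isdC_cpow1B c' xlt) _.
  have h : 0 < 1 - x by rewrite subr_gt0.
  have -> : -1 = ((-1 : R)%:C) :> C by rewrite rmorphN1.
  rewrite cpowD cpow_real// powR_inv1 ?(ltW h)//; ring.
elim: k c => [|k ih] c.
  by move=> x /(D c) [h1 h2]; split; [exact: (dv_cont h1)|exact: (dv_cont h2)].
exists (fun x => - c * cpow (1 - x) (c + - 1)); first exact: D.
by apply: smC_mul; [exact: smC_cst|exact: ih].
Qed.

Variables (a : C) (kap : R).
Hypothesis a_kap : a * (1 - a) = kap%:C.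

Lemma smC_hQ k : smC k unit_itv (hQ a).
Proof. by apply: smC_mul; [exact: smC_cpow1B|exact: smC_FC (ubC_hcoef a)]. Qed.

Lemma hQ1_diff x : exists d, `|x| < 1 -> isdC x (hQ1 a) d.
Proof.
case: (ltP `|x| 1) => [x1|x1]; last by exists 0.
have xlt : x < 1 by apply: le_lt_trans x1; exact: ler_norm.
have D1 := isdC_FC (ubC_hcoef a) x1; have D2 := isdC_FC (ubC_diffs (ubC_hcoef a)) x1.
have Dp := isdC_cpow1B a xlt; have Di := isdC_inv1B xlt.
eexists => _.
by apply: isdC_ext (isdC_mul Dp (isdC_add D2 (isdC_scale (-1) (isdC_scale a (isdC_mul Di D1))))) => s; rewrite /hQ1 mulN1r.
Qed.

(* Chosen rather than computed: only the existence of this derivative for |x| < 1 matters. *)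
Definition hQ2 x : C := xget 0 [set d | `|x| < 1 -> isdC x (hQ1 a) d].

Lemma isdC_hQ1 x : `|x| < 1 -> isdC x (hQ1 a) (hQ2 x).
Proof.
have [d Hd] := hQ1_diff x; exact: (@xgetI _ 0 [set d | `|x| < 1 -> isdC x (hQ1 a) d] d Hd).
Qed.

Lemma isdC_unique (x : R) (g : R -> C) (d d' : C) : isdC x g d -> isdC x g d' -> d = d'.
Proof. by move=> [h1 h2] [h3 h4]; apply: complex_eq; [exact: dv_unique h1 h3|exact: dv_unique h2 h4]. Qed.

Lemma hQ_ode x : `|x| < 1 -> x%:C * hQ2 x + hQ1 a x = (- kap * (1 - x)^-1 ^+ 2)%:C * hQ a x.
Proof.
move=> x1.
rewrite (_ : (- kap * (1 - x)^-1 ^+ 2)%:C = - (kap * (1 - x)^-1 ^+ 2)%:C); last by rewrite mulNr rmorphN.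
have := isdC_unique (isdC_mul (isdC_real (dv_id x)) (isdC_hQ1 x1)) (isdC_zhQ1 a_kap x1).
by rewrite rmorph1 mul1r addrC => ->.
Qed.

Lemma hQ0 : hQ a 0 = 1.
Proof.
by rewrite /hQ subr0 cpow1 mul1r /hF FC0 /hcoef /pochhammer !big_ord0 fact0 !mul1r invr1.
Qed.

(** The imaginary part solves the same equation with real coefficients and vanishes at 0, so it
    vanishes on both sides of 0; for negative [x] the equation is reflected first. *)
Lemma Im_hQ x : `|x| < 1 -> Im (hQ a x) = 0.
Proof.
move=> x1; have [x0|x0] := leP 0 x.
  have inI w : 0 <= w <= x -> `|w| < 1.
    by move=> /andP[w0 wx]; rewrite ger0_norm//; apply: le_lt_trans x1; rewrite ger0_norm.
  apply: (@legendre_unique R (fun s => Im (hQ a s)) (fun s => Im (hQ1 a s)) (fun s => Im (hQ2 s))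
    (fun w => - kap * (1 - w)^-1 ^+ 2) x (`|kap| * (1 - x)^-1 ^+ 2) x0).
  - by move=> w /inI h; case: (isdC_hQ a h).
  - by move=> w /inI h; case: (isdC_hQ1 h).
  - move=> w /inI/hQ_ode/(congr1 (@complex.Im R)); rewrite cImD !cImM /= !mul0r !addr0 => ->; ring.
  - move=> w wx; have w1 := inI _ wx; move/andP: wx => [w0 wx].
    have xl : x < 1 by apply: le_lt_trans x1; exact: ler_norm.
    have h : 0 <= (1 - w)^-1 by rewrite invr_ge0; lra.
    rewrite normrM normrN ler_wpM2l// normrX ger0_norm// ler_pXn2r ?nnegrE// ?invr_ge0 ?lef_pV2 ?posrE; lra.
  - by rewrite hQ0.
have inI w : 0 <= w <= - x -> `|- w| < 1.
  by move=> /andP[w0 wx]; rewrite normrN ger0_norm//; apply: le_lt_trans x1; rewrite ltr0_norm.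
have neg (g : R -> R) (w d : R) : is_derive (- w) 1 g d -> is_derive w 1 (fun s : R => g (- s)) (- d).
  by move=> H; apply: dv_eq (dv_comp H (dv_opp (dv_id w))) _; rewrite mulrN1.
rewrite -[x]opprK.
apply: (@legendre_unique R (fun s => Im (hQ a (- s))) (fun s => - Im (hQ1 a (- s))) (fun s => Im (hQ2 (- s)))
    (fun w => kap * (1 + w)^-1 ^+ 2) (- x) `|kap|).
- by rewrite oppr_ge0 ltW.
- by move=> w /inI h0; have [_ h] := isdC_hQ a h0; apply: neg h.
- move=> w /inI h0; have [_ h] := isdC_hQ1 h0; have := dv_opp (neg _ _ _ h); by rewrite opprK.
- move=> w /inI/hQ_ode/(congr1 (@complex.Im R)); rewrite cImD !cImM /= !mul0r !addr0 !opprK => E.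
  by rewrite -[LHS]opprK opprD opprK -mulNr E; ring.
- move=> w /andP[w0 _]; rewrite normrM ler_piMr// normrX exprn_ile1//.
  by rewrite ger0_norm ?invr_ge0; [rewrite invf_le1; lra|lra].
- by rewrite oppr0 hQ0.
Qed.

Definition qr x : R := Re (hQ a x).
Definition qr1 x : R := Re (hQ1 a x).
Definition qr2 x : R := Re (hQ2 x).

Lemma hQ_qr x : `|x| < 1 -> hQ a x = (qr x)%:C.
Proof. by move=> x1; apply: complex_eq => //=; exact: Im_hQ. Qed.

Lemma dv_qr (x : R) : `|x| < 1 -> is_derive x 1 qr (qr1 x).
Proof. by move=> x1; case: (isdC_hQ a x1). Qed.

Lemma dv_qr1 (x : R) : `|x| < 1 -> is_derive x 1 qr1 (qr2 x).
Proof. by move=> x1; case: (isdC_hQ1 x1). Qed.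

Lemma qr_ode x : `|x| < 1 -> x * qr2 x + qr1 x = - kap * (1 - x)^-1 ^+ 2 * qr x.
Proof.
move=> /hQ_ode; rewrite /qr /qr1 /qr2; move: (hQ a x) (hQ1 a x) (hQ2 x) => p q r.
by move=> /(congr1 (@complex.Re R)); rewrite cReD !cReM /= !mul0r !subr0.
Qed.

Lemma qr0 : qr 0 = 1. Proof. by rewrite /qr hQ0. Qed.

Lemma smooth1_qr k : smooth1 k unit_itv qr.
Proof. by apply: smC_smooth1; exact: smC_hQ. Qed.

End SmoothComplex.

(** * The kernel E as a complex constant times a real function *)

Section KernelFormula.
Variables (R : realType) (mu nu2 : R).
Local Notation sd := (csqrt (delta mu nu2)).
(** The common first two parameters of the hypergeometric factor of E. It is not real when delta <
    0, whereas a(1-a) = (1 - delta)/4 always is. *)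
Definition legendre_a : R[i] := (1 - sd) / 2.
Definition legendre_kap : R := (1 - delta mu nu2) / 4.

Lemma legendre_a_kap : legendre_a * (1 - legendre_a) = legendre_kap%:C.
Proof.
rewrite /legendre_a /legendre_kap rmorphM fmorphV rmorphB rmorph1 /= -csqrt_sq.
have -> : 4%:C = 4 :> R[i] by rewrite rmorph_nat.
by field.
Qed.

(** Writing D for the base of the third power in E and z for the argument of F, one has (1 - z) D =
    4 (1+t) (1+b). This trades D^(-a) F for (1 - z)^a F, at the price of the constant 2^(-2a) =
    2^(sqrt delta - 1) and of powers of 1+t and 1+b that cancel those in E. *)
Lemma kernelE_formula t b s : 0 < 1 + t -> 0 < 1 + b -> 0 < (t + b + 2) ^+ 2 - s ^+ 2 ->
  `|((t - b) ^+ 2 - s ^+ 2) / ((t + b + 2) ^+ 2 - s ^+ 2)| < 1 ->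
  kernelE mu nu2 t 0 b s = cpow 2 (sd - 1) *
   ((1 + t) `^ (- (mu / 2)) * (1 + b) `^ (mu / 2) *
    qr legendre_a (((t - b) ^+ 2 - s ^+ 2) / ((t + b + 2) ^+ 2 - s ^+ 2)))%:C.
Proof.
move=> t0 b0 D0 z1; rewrite /kernelE subr0 -/legendre_a.
have -> : (sd - 1) / 2 = - legendre_a by rewrite /legendre_a; field.
have -> : sd - 1 = - legendre_a + - legendre_a by rewrite /legendre_a; field.
rewrite (hyp2F1_FC legendre_a z1) -/(hF legendre_a _).
set z := _ / _ in z1 *.
have -> : ((1 + t) `^ (- (mu / 2)) * (1 + b) `^ (mu / 2) * qr legendre_a z)%:C =
    cpow (1 + t) (- (mu / 2)%:C) * cpow (1 + b) (mu / 2)%:C * hQ legendre_a z.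
  by rewrite (hQ_qr legendre_a_kap z1) -rmorphN !cpow_real// !rmorphM.
rewrite /hQ; set D := (t + b + 2) ^+ 2 - s ^+ 2 in D0 z z1 *.
have z_lt : 0 < 1 - z by rewrite subr_gt0; apply: le_lt_trans z1; exact: ler_norm.
have key : (1 - z) * D = 2 * 2 * ((1 + t) * (1 + b)).
  by rewrite mulrBl mul1r /z divfK ?gt_eqF// /D; ring.
have := congr1 (fun u => cpow u legendre_a) key.
rewrite /= !cpowM ?mulr_gt0// !cpowD !cpowN => E.
have n1 := cpow_neq0 D legendre_a; have n2 := cpow_neq0 2 legendre_a.
move: (cpow (1 - z) _) (cpow D _) (cpow 2 _) (cpow (1 + t) legendre_a) (cpow (1 + b) legendre_a)
  E n1 n2 => p q u v w E n1 n2.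
have -> : p = u * u * (v * w) / q by rewrite -E mulfK.
by field; rewrite n1 n2 cpow_neq0.
Qed.

End KernelFormula.

(** * Powers on the half line, and a positive extension of the identity to the whole line *)

Section OneVariable.
Variable R : realType.

Lemma smooth1_scale k I c (g : R -> R) : smooth1 k I g -> smooth1 k I (fun x => c * g x).
Proof.
elim: k g => [|k ih] g [H1 H2]; split.
- by move=> x Ix; apply: continuousM; [exact: cvg_cst|exact: H1].
- by [].
- by move=> x Ix; apply: continuousM; [exact: cvg_cst|exact: H1].
- move: H2 => [g' D1 D2]; exists (fun x => c * g' x); last exact: ih.
  by move=> x Ix; apply: dv_scale; exact: D1.
Qed.

Lemma near_dv (E : normedModType R) (F G : E -> R) p v d :
  (\forall q \near p, F q = G q) -> is_derive p v F d -> is_derive p v G d.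
Proof.
move=> H /dvP D; apply/dvP => e e0; have := D e e0 => {}D.
have Hp := nbhs_singleton H.
have H2 : \forall h \near (0 : R), F (p + h *: v) = G (p + h *: v).
  have := near_small v H; apply: filterS => h /(_ 1).
  by rewrite mul1r lexx ler01 => /(_ isT).
near=> h => h0; rewrite -Hp -(near H2 h) //; move: h0; near: h; exact: D.
Unshelve. all: by end_near. Qed.

Definition pos_itv : set R := [set x | 0 < x].

Lemma smooth1_powR k p : smooth1 k pos_itv (fun x => x `^ p).
Proof.
elim: k p => [|k ih] p; split => //; try by move=> x x0; exact: (dv_cont (is_derive1_powR p x0)).
exists (fun x => p * x `^ (p - 1)); first by move=> x x0; exact: is_derive1_powR.
exact: smooth1_scale.
Qed.

Lemma smooth1_addid k I c (g : R -> R) : smooth1 k I g -> smooth1 k I (fun x => x + c * g x).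
Proof.
move=> H; have cid (x : R) : {for x, continuous (fun y : R => y)} by [].
case: k H => [|k] [H1 H2]; split => //.
- by move=> x Ix; apply: continuousD; [exact: cid|apply: continuousM; [exact: cvg_cst|exact: H1]].
- by move=> x Ix; apply: continuousD; [exact: cid|apply: continuousM; [exact: cvg_cst|exact: H1]].
move: H2 => [g' D1 D2]; exists (fun x => 1 + c * g' x).
  by move=> x Ix; exact: dv_add (dv_id x) (dv_scale c (D1 x Ix)).
elim: k g' D2 {H1 D1} => [|k ih] g' [H1 H2]; split => //.
- by move=> x Ix; apply: continuousD; [exact: cvg_cst|apply: continuousM; [exact: cvg_cst|exact: H1]].
- by move=> x Ix; apply: continuousD; [exact: cvg_cst|apply: continuousM; [exact: cvg_cst|exact: H1]].
move: H2 => [g2 D1 D2]; exists (fun x => c * g2 x); last exact: smooth1_scale.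
by move=> x Ix; apply: dv_eq (dv_add (dv_cst 1 x 1) (dv_scale c (D1 x Ix))) _; rewrite add0r.
Qed.

(** Its powers with exponent at least 2 are differentiable across the corner at 1/2; each derivative
    lowers the exponent by one. *)
Definition mneg (x : R) : R := Num.min (x - 1 / 2) 0.

Lemma mneg_ge (x : R) : 1 / 2 <= x -> mneg x = 0.
Proof. by move=> h; rewrite /mneg min_r// subr_ge0. Qed.

Lemma mneg_le (x : R) : x <= 1 / 2 -> mneg x = x - 1 / 2.
Proof. by move=> h; rewrite /mneg min_l// subr_le0. Qed.

Lemma dv_mneg j (x : R) : is_derive x 1 (fun y => mneg y ^+ j.+2) (j.+2%:R * mneg x ^+ j.+1).
Proof.
have D (y : R) : is_derive y 1 (fun y : R => (y - 1 / 2) ^+ j.+2) (j.+2%:R * (y - 1 / 2) ^+ j.+1).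
  apply: dv_eq (dv_exp j.+2 (dv_sub (dv_id y) (dv_cst (1 / 2) y 1))) _.
  by rewrite subr0 mulr1.
case: (ltgtP x (1 / 2)) => [h|h|->].
- rewrite mneg_le ?ltW//; apply: near_dv (D x).
  near=> y; rewrite mneg_le//; apply: ltW; near: y; exact: lt_nbhsl.
- rewrite mneg_ge ?ltW// expr0n mulr0; apply: (near_dv _ (dv_cst 0 x 1)).
  near=> y; rewrite mneg_ge ?expr0n//; apply: ltW; near: y; exact: lt_nbhsr.
rewrite mneg_ge// expr0n mulr0; apply/dvP => e e0.
have D0 : is_derive (1 / 2 : R) 1 (fun y : R => (y - 1 / 2) ^+ j.+2) 0.
  by apply: dv_eq (D _) _; rewrite subrr expr0n mulr0.
move/dvP/(_ e e0) : D0; apply: filterS => h hh h0.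
have hE : h%:A = h by rewrite -[LHS]/(h * 1) mulr1.
have E1 : 1 / 2 + h - 1 / 2 = h by ring.
have := hh h0; rewrite hE E1 subrr expr0n /= !subr0 (mneg_ge (lexx _)) expr0n /= subr0 => B.
have [hs|hs] := leP 0 h; first by rewrite mneg_ge ?lerDl// expr0n mulr0 normr0 ltW.
by rewrite mneg_le ?E1// gerDl ltW.
Unshelve. all: by end_near. Qed.

Lemma smooth1_mneg k j : smooth1 k setT (fun x => mneg x ^+ (j + k).+1).
Proof.
have c : continuous mneg.
  rewrite (_ : mneg = (fun x => - Num.max (1 / 2 - x) 0)).
    by apply: ct_opp; apply: ct_maxr; ctn.
  apply/funext => x; have [h|h] := leP x (1 / 2).
    by rewrite mneg_le// max_l; lra.
  by rewrite mneg_ge ?ltW// max_r; lra.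
have cm m : continuous (fun x => mneg x ^+ m) by ctn.
elim: k j => [|k ih] j; split => //; try by move=> x _; exact: cm.
exists (fun x => (j + k).+2%:R * mneg x ^+ (j + k).+1); last exact: smooth1_scale.
by move=> x _; rewrite addnS; exact: dv_mneg.
Qed.

(* Replacing 1 + t by posext (1 + t) makes powers and quotients of 1 + t smooth for every real t,
   without changing them for t >= - 1/2. *)
Definition posext (x : R) : R := x + 32 * mneg x ^+ 6.

Lemma posext_id x : 1 / 2 <= x -> posext x = x.
Proof. by move=> h; rewrite /posext mneg_ge// expr0n mulr0 addr0. Qed.

Lemma posext_gt0 x : 0 < posext x.
Proof.
have [h|h] := leP (1 / 2) x; first by rewrite posext_id//; lra.
rewrite /posext mneg_le ?ltW//; set y := x - 1 / 2.
have -> : x + 32 * y ^+ 6 = 1 / 2 + y + 32 * y ^+ 6 by rewrite /y; ring.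
have y0 : y < 0 by rewrite /y; lra.
have [h1|h1] := ltP (- (1 / 2)) y.
  by apply: ltr_wpDr; [rewrite mulr_ge0// exprn_even_ge0|lra].
(* The constant 32 = 2^5 is chosen so that for y <= -1/2 the term 32 y^6 = - y (- 2 y)^5 is at least
   - y, which keeps the sum above 1/2. The exponent 6 leaves five continuous derivatives. *)
have -> : 32 * y ^+ 6 = - y * (- y * 2) ^+ 5 by ring.
have h2 : 1 <= (- y * 2) ^+ 5 by rewrite exprn_ege1//; lra.
nra.
Qed.

Lemma smooth1_posext k : (k <= 5)%N -> smooth1 k setT posext.
Proof.
move=> k5; apply: smooth1_addid.
by have := @smooth1_mneg k (5 - k); rewrite subnK.
Qed.

End OneVariable.

(** * The Riemann function *)

Section RiemannFunction.
Variables (R : realType) (a : R[i]) (kap : R).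
Hypothesis a_kap : a * (1 - a) = kap%:C.
Local Close Scope complex_scope.

(** Maps the half line x > 0 into the interval of convergence (-1, 1), and X to the argument of the
    hypergeometric function in E. *)
Definition zet (x : R) : R := (x - 1) / (x + 1).

Lemma zet_lt1 x : 0 < x -> `|zet x| < 1.
Proof.
move=> x0; rewrite /zet ltr_norml; apply/andP; split.
  by rewrite ltr_pdivlMr; lra.
by rewrite ltr_pdivrMr; lra.
Qed.

Lemma dv_zet (x : R) : 0 < x -> is_derive x 1 zet (2 / (x + 1) ^+ 2).
Proof.
move=> x0; have h : x + 1 != 0 by rewrite gt_eqF//; lra.
have d1 := dv_sub (dv_id x) (dv_cst 1 x 1); have d2 := dv_add (dv_id x) (dv_cst 1 x 1).
have D : is_derive x 1 zet _ := dv_mul d1 (dv_inv (F := fun y : R => y + 1) h d2).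
apply: (dv_eq D).
by field.
Qed.

Definition leg x : R := qr a (zet x).
Definition dleg x : R := qr1 a (zet x) * (2 / (x + 1) ^+ 2).
Definition ddleg x : R := qr2 a (zet x) * (2 / (x + 1) ^+ 2) ^+ 2 - qr1 a (zet x) * (4 / (x + 1) ^+ 3).

Lemma dv_leg (x : R) : 0 < x -> is_derive x 1 leg (dleg x).
Proof. by move=> x0; exact: dv_comp (dv_qr a (zet_lt1 x0)) (dv_zet x0). Qed.

Lemma dv_dleg (x : R) : 0 < x -> is_derive x 1 dleg (ddleg x).
Proof.
move=> x0; have h : x + 1 != 0 by rewrite gt_eqF//; lra.
have h2 : (x + 1) ^+ 2 != 0 by rewrite expf_neq0.
have d1 := dv_comp (dv_qr1 a (zet_lt1 x0)) (dv_zet x0).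
have d2 := dv_exp 2 (dv_add (dv_id x) (dv_cst 1 x 1)).
have d3 := dv_inv (F := fun y : R => (y + 1) ^+ 2) h2 d2.
have D : is_derive x 1 dleg _ := dv_mul d1 (dv_scale 2 d3).
apply: (dv_eq D).
by rewrite /ddleg expr1; move: (qr1 a (zet x)) (qr2 a (zet x)) => p q; field.
Qed.

Lemma leg_ode x : 0 < x -> (x ^+ 2 - 1) * ddleg x + 2 * x * dleg x + kap * leg x = 0.
Proof.
move=> x0; have h : x + 1 != 0 by rewrite gt_eqF//; lra.
have := qr_ode a_kap (zet_lt1 x0).
have -> : (1 - zet x)^-1 = (x + 1) / 2 by rewrite /zet; field; rewrite h; lra.
rewrite /leg /ddleg /dleg => E.
have {}E : kap * qr a (zet x) = - (4 / (x + 1) ^+ 2) * (zet x * qr2 a (zet x) + qr1 a (zet x)).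
  by rewrite E; field.
rewrite E; move: (qr1 a (zet x)) (qr2 a (zet x)) => p q; rewrite /zet; field.
by rewrite h.
Qed.

Lemma leg1 : leg 1 = 1.
Proof. by rewrite /leg /zet subrr mul0r qr0. Qed.

(** At the singular point X = 1 the Legendre equation degenerates to 2 y' + kap y = 0. *)
Lemma dleg1 : dleg 1 = - (kap / 2).
Proof.
have := leg_ode ltr01; rewrite expr1n subrr mul0r add0r leg1 !mulr1 => /eqP.
by rewrite addr_eq0 => /eqP E; apply: (@mulfI _ 2) => //; rewrite E; field.
Qed.

Local Notation E3 := (R * (R * R))%type.
Implicit Types (q v : E3).

(* The three coordinates are the time t, the radius s and the initial time b. *)
Definition e1 : E3 := (1, (0, 0)).
Definition e2 : E3 := (0, (1, 0)).
Definition e3 : E3 := (0, (0, 1)).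

(** The inner occurrences of [posext] keep the denominators positive, the outer one keeps the
    argument of [leg] in its domain. Quotients are powers with exponent -1, which are smooth on the
    positive half line. *)
Definition cpos q : R :=
  posext (2^-1 * (((posext (1 + q.1) ^+ 2 + posext (1 + q.2.2) ^+ 2 - q.2.1 ^+ 2) *
    posext (1 + q.1) `^ (-1)) * posext (1 + q.2.2) `^ (-1))).

(* A globally smooth extension of leg X0 from the region Om, see riemG_Om. *)
Definition riemG q : R := qr a ((cpos q - 1) * (cpos q + 1) `^ (-1)).

Lemma PC_riemG k (T : topologicalType) : (k <= 5)%N -> PC k (fun (_ : T) q => riemG q).
Proof.
move=> k5.
have lin (f : E3 -> R) : continuous f -> (forall p (h : R) v, f (p + h *: v) = f p + h * f v) ->
    PC k (fun (_ : T) p => f p) by exact: PC_linear.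
have l1 : PC k (fun (_ : T) q => q.1) by apply: lin => //; ctn.
have l2 : PC k (fun (_ : T) q => q.2.1) by apply: lin => //; ctn.
have l3 : PC k (fun (_ : T) q => q.2.2) by apply: lin => //; ctn.
have pst (F : E3 -> R) : PC k (fun (_ : T) q => F q) -> PC k (fun (_ : T) q => posext (F q)).
  by apply: PC_outer; [exact: smooth1_posext|].
have c1 (c : R) : PC k (fun (_ : T) (_ : E3) => c) by apply: PC_cst; ctn.
have inv (F : E3 -> R) : (forall q, 0 < F q) -> PC k (fun (_ : T) q => F q) ->
    PC k (fun (_ : T) q => F q `^ (-1)).
  by move=> F0; apply: (PC_outer (smooth1_powR k (-1))) => _; exact: F0.
have t1 := pst _ (PC_add (c1 1) l1); have t3 := pst _ (PC_add (c1 1) l3).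
have pg (q : E3) : 0 < cpos q by exact: posext_gt0.
have C : PC k (fun (_ : T) q => cpos q).
  apply: (pst (fun q => 2^-1 * (((posext (1 + q.1) ^+ 2 + posext (1 + q.2.2) ^+ 2 - q.2.1 ^+ 2) *
    posext (1 + q.1) `^ (-1)) * posext (1 + q.2.2) `^ (-1)))).
  apply: PC_scale; first by ctn.
  apply: PC_mul; last by apply: inv => // q; exact: posext_gt0.
  apply: PC_mul; last by apply: inv => // q; exact: posext_gt0.
  by apply: PC_sub; [apply: PC_add|]; exact: PC_exp.
apply: (PC_outer (smooth1_qr a k)).
  move=> _ q; have h := zet_lt1 (pg q); have h1 : 0 <= cpos q + 1 by rewrite addr_ge0// ltW.
  by rewrite powR_inv1.
apply: PC_mul; first by apply: PC_sub.
by apply: (inv (fun q => cpos q + 1)) => [q|]; [rewrite addr_gt0|apply: PC_add].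
Qed.

Definition X0 q : R := ((1 + q.1) ^+ 2 + (1 + q.2.2) ^+ 2 - q.2.1 ^+ 2) / (2 * (1 + q.1) * (1 + q.2.2)).

(** The thresholds are those beyond which every occurrence of [posext] in [cpos] is the identity;
    the set is open and contains the light cones. *)
Definition Om q := [/\ - (1 / 2) < q.1, - (1 / 2) < q.2.2 & 1 / 2 < X0 q].

Lemma riemG_Om q : Om q -> riemG q = leg (X0 q).
Proof.
move=> [h1 h2 h3].
have E : cpos q = X0 q.
  rewrite /cpos !(posext_id (x := 1 + _)); [|lra|lra].
  rewrite !powR_inv1; [|lra|lra].
  transitivity (posext (X0 q)); last by rewrite posext_id// ltW.
  by congr posext; rewrite /X0; field; apply/andP; split; lra.
by rewrite /riemG E /leg /zet powR_inv1//; lra.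
Qed.

Lemma dv_fst3 q v : is_derive q v (fun q : E3 => q.1) v.1.
Proof.
apply/dv_lineE.
have H : is_derive (0 : R) 1 (fun h : R => q.1 + h * v.1) v.1.
  have := dv_add (dv_cst q.1 (0 : R) 1) (dv_mul (dv_id (0 : R)) (dv_cst v.1 (0 : R) 1)).
  by rewrite mul1r mulr0 addr0 add0r.
exact: H.
Qed.

Lemma dv_snd1 q v : is_derive q v (fun q : E3 => q.2.1) v.2.1.
Proof.
apply/dv_lineE.
have H : is_derive (0 : R) 1 (fun h : R => q.2.1 + h * v.2.1) v.2.1.
  have := dv_add (dv_cst q.2.1 (0 : R) 1) (dv_mul (dv_id (0 : R)) (dv_cst v.2.1 (0 : R) 1)).
  by rewrite mul1r mulr0 addr0 add0r.
exact: H.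
Qed.

Lemma dv_snd2 q v : is_derive q v (fun q : E3 => q.2.2) v.2.2.
Proof.
apply/dv_lineE.
have H : is_derive (0 : R) 1 (fun h : R => q.2.2 + h * v.2.2) v.2.2.
  have := dv_add (dv_cst q.2.2 (0 : R) 1) (dv_mul (dv_id (0 : R)) (dv_cst v.2.2 (0 : R) 1)).
  by rewrite mul1r mulr0 addr0 add0r.
exact: H.
Qed.

Lemma dv_X0 q v : - (1 / 2) < q.1 -> - (1 / 2) < q.2.2 -> is_derive q v X0
  (v.1 * (1 / (1 + q.2.2) - X0 q / (1 + q.1)) - v.2.1 * (q.2.1 / ((1 + q.1) * (1 + q.2.2)))
   + v.2.2 * (1 / (1 + q.1) - X0 q / (1 + q.2.2))).
Proof.
move=> h1 h2; have g1 : 1 + q.1 != 0 by lra.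
have g2 : 1 + q.2.2 != 0 by lra.
have d1 := dv_add (dv_cst 1 q v) (dv_fst3 q v).
have d2 := dv_snd1 q v.
have d3 := dv_add (dv_cst 1 q v) (dv_snd2 q v).
have g3 : 2 * (1 + q.1) * (1 + q.2.2) != 0 by rewrite !mulf_neq0.
have D := dv_mul (dv_sub (dv_add (dv_exp 2 d1) (dv_exp 2 d3)) (dv_exp 2 d2))
  (dv_inv (F := fun q : E3 => 2 * (1 + q.1) * (1 + q.2.2)) g3 (dv_mul (dv_scale 2 d1) d3)).
have {}D : is_derive q v X0 _ := D.
apply: (dv_eq D); rewrite /X0 !expr1.
by field; rewrite g1 g2.
Qed.

Lemma near_Om q : Om q -> \forall r \near q, Om r.
Proof.
move=> [h1 h2 h3].
have c1 : continuous (fun r : E3 => r.1) by ctn.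
have c3 : continuous (fun r : E3 => r.2.2) by ctn.
have n1 : \forall r \near q, - (1 / 2) < r.1.
  have : nbhs q.1 [set x | - (1 / 2) < x] by exact: lt_nbhsr.
  by move/(c1 q).
have n2 : \forall r \near q, - (1 / 2) < r.2.2.
  have : nbhs q.2.2 [set x | - (1 / 2) < x] by exact: lt_nbhsr.
  by move/(c3 q).
have cX : {for q, continuous X0}.
  apply: continuousM.
    have c : continuous (fun r : E3 => (1 + r.1) ^+ 2 + (1 + r.2.2) ^+ 2 - r.2.1 ^+ 2) by ctn.
    exact: c.
  apply: continuousV; first by rewrite !mulf_neq0//; lra.
  have c : continuous (fun r : E3 => 2 * (1 + r.1) * (1 + r.2.2)) by ctn.
  exact: c.
have n3 : \forall r \near q, 1 / 2 < X0 r.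
  have : nbhs (X0 q) [set x | 1 / 2 < x] by exact: lt_nbhsr.
  by move/cX.
by near=> r; split; [near: r|near: r|near: r].
Unshelve. all: by end_near. Qed.

Lemma near_dd_Om (F G : E3 -> R) q v d : (forall q, Om q -> F q = G q) -> Om q ->
  is_derive q v F d -> is_derive q v G d.
Proof. by move=> H /near_Om O; apply: near_dv; apply: filterS O; exact: H. Qed.

Lemma riemG_dv q v : Om q -> is_derive q v riemG
  (dleg (X0 q) * (v.1 * (1 / (1 + q.2.2) - X0 q / (1 + q.1)) - v.2.1 * (q.2.1 / ((1 + q.1) * (1 + q.2.2)))
   + v.2.2 * (1 / (1 + q.1) - X0 q / (1 + q.2.2)))).
Proof.
move=> O; have [h1 h2 h3] := O.
apply: (near_dd_Om (F := fun q => leg (X0 q))) => //; first by move=> r /riemG_Om.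
have X0p : 0 < X0 q by lra.
exact: dv_comp (dv_leg X0p) (dv_X0 v h1 h2).
Qed.

Lemma riemG_t q : Om q -> dd e1 riemG q = dleg (X0 q) * (1 / (1 + q.2.2) - X0 q / (1 + q.1)).
Proof. by move=> O; rewrite (dvE (riemG_dv e1 O)) /=; ring. Qed.

Lemma riemG_s q : Om q -> dd e2 riemG q = - (dleg (X0 q) * (q.2.1 / ((1 + q.1) * (1 + q.2.2)))).
Proof. by move=> O; rewrite (dvE (riemG_dv e2 O)) /=; ring. Qed.

Lemma riemG_b q : Om q -> dd e3 riemG q = dleg (X0 q) * (1 / (1 + q.1) - X0 q / (1 + q.2.2)).
Proof. by move=> O; rewrite (dvE (riemG_dv e3 O)) /=; ring. Qed.

(** The function X satisfies X_t^2 - X_s^2 = (X^2 - 1)/(1+t)^2 and X_tt - X_ss = 2 X/(1+t)^2, so for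
    leg(X) the equation becomes the Legendre equation divided by (1+t)^2. *)
Lemma riemG_pde q : Om q ->
  dd e1 (dd e1 riemG) q - dd e2 (dd e2 riemG) q + kap * ((1 + q.1) ^- 2 * riemG q) = 0.
Proof.
move=> O; have [h1 h2 h3] := O; have X0p : 0 < X0 q by lra.
have g1 : 1 + q.1 != 0 by lra.
have g2 : 1 + q.2.2 != 0 by lra.
have DX1 := dv_X0 e1 h1 h2; have DX2 := dv_X0 e2 h1 h2.
have DP1 := dv_comp (dv_dleg X0p) DX1; have DP2 := dv_comp (dv_dleg X0p) DX2.
have g3 : (1 + q.1) * (1 + q.2.2) != 0 by rewrite mulf_neq0.
have D1 : is_derive q e1 (dd e1 riemG) (ddleg (X0 q) * (1 / (1 + q.2.2) - X0 q / (1 + q.1)) ^+ 2 +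
    dleg (X0 q) * (X0 q / (1 + q.1) ^+ 2 - (1 / (1 + q.2.2) - X0 q / (1 + q.1)) / (1 + q.1))).
  apply: (near_dd_Om (F := fun q => dleg (X0 q) * (1 / (1 + q.2.2) - X0 q / (1 + q.1)))) => //.
    by move=> r /riemG_t.
  have i2 := dv_scale 1 (dv_inv (F := fun q : E3 => 1 + q.2.2) g2 (dv_add (dv_cst 1 q e1) (dv_snd2 q e1))).
  have i1 := dv_mul DX1 (dv_inv (F := fun q : E3 => 1 + q.1) g1 (dv_add (dv_cst 1 q e1) (dv_fst3 q e1))).
  apply: (dv_eq (dv_mul DP1 (dv_sub i2 i1))).
  rewrite /=; move: (ddleg (X0 q)) (dleg (X0 q)) (X0 q) g1 g2 => A B X; move: (q.1) (q.2.2) => t b g1 g2.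
  by field; rewrite g1 g2.
have D2 : is_derive q e2 (dd e2 riemG) (ddleg (X0 q) * (q.2.1 / ((1 + q.1) * (1 + q.2.2))) ^+ 2
    - dleg (X0 q) * (1 / ((1 + q.1) * (1 + q.2.2)))).
  apply: (near_dd_Om (F := fun q => - (dleg (X0 q) * (q.2.1 / ((1 + q.1) * (1 + q.2.2)))))) => //.
    by move=> r /riemG_s.
  have i1 := dv_mul (dv_add (dv_cst 1 q e2) (dv_fst3 q e2)) (dv_add (dv_cst 1 q e2) (dv_snd2 q e2)).
  have i2 := dv_mul (dv_snd1 q e2) (dv_inv (F := fun q : E3 => (1 + q.1) * (1 + q.2.2)) g3 i1).
  apply: (dv_eq (dv_opp (dv_mul DP2 i2))).
  rewrite /=; move: (ddleg (X0 q)) (dleg (X0 q)) (X0 q) g1 g2 => A B X; move: (q.1) (q.2.2) => t b g1 g2.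
  by field; rewrite g1 g2.
rewrite (dvE D1) (dvE D2) (riemG_Om O).
have E : kap * leg (X0 q) = - ((X0 q ^+ 2 - 1) * ddleg (X0 q) + 2 * X0 q * dleg (X0 q)).
  by apply/eqP; rewrite -addr_eq0 addrC; apply/eqP; exact: leg_ode.
rewrite (mulrCA kap) E; move: (ddleg (X0 q)) (dleg (X0 q)) => A B.
rewrite /X0; move: (q.1) (q.2.2) (q.2.1) g1 g2 => t b s g1 g2.
by field; rewrite g1 g2.
Qed.

End RiemannFunction.

Section Slices.
Variable R : realType.
Local Notation E2 := (R * R)%type.
Local Notation E3 := (R * (R * R))%type.

Definition slice (b : R) (F : E3 -> R) (q : E2) : R := F (q.1, (q.2, b)).

Lemma slice_line (q v : E2) (h b : R) :
  ((q + h *: v).1, ((q + h *: v).2, b)) = (q.1, (q.2, b)) + h *: (v.1, (v.2, 0)) :> E3.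
Proof. by rewrite -[RHS]/(_, (_, b + h * 0)) mulr0 addr0. Qed.

Lemma dv_slice b F (q v : E2) d : is_derive (q.1, (q.2, b)) (v.1, (v.2, 0)) F d ->
  is_derive q v (slice b F) d.
Proof.
move=> /dv_lineE H; apply/dv_lineE; by apply: dv_ext H => h; rewrite /slice slice_line.
Qed.

Lemma PC_slice k (F : E3 -> R) : PC k (fun (_ : R) q => F q) -> PC k (fun (b : R) q => slice b F q).
Proof.
move=> H.
apply: (PC_affine (r := id) (A := fun (b : R) (q : E2) => (q.1, (q.2, b)) : E3)
  (B := fun (_ : R) (q : E2) => (q.1, (q.2, 0)) : E3) _ _ _ _ H).
- exact: ct_id.
- by ctn.
- by ctn.
- by move=> b p h v; exact: slice_line.
Qed.

Lemma dd_slice k b (F : E3 -> R) (v : E2) : PC k.+1 (fun (_ : R) q => F q) ->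
  dd v (slice b F) = slice b (dd (v.1, (v.2, 0)) F).
Proof.
move=> H; apply/funext => q; apply: dvE; apply: dv_slice.
exact: (PC_isD (0 : R) _ _ H).
Qed.

End Slices.

Section VolterraKernels.
Variables (R : realType) (a : R[i]) (kap m : R).
Hypothesis a_kap : a * (1 - a) = (kap%:C)%C.
Local Notation E2 := (R * R)%type.
Local Notation E3 := (R * (R * R))%type.
Local Notation e1 := (e1 R).
Local Notation e2 := (e2 R).
Local Notation e3 := (e3 R).
Local Notation G := (riemG a).

Definition f1 : E2 := (1, 0).
Definition f2 : E2 := (0, 1).
Definition f12 : E2 := (1, 1).

Let PG k : (k <= 5)%N -> PC k (fun (_ : R) q => G q).
Proof. by move=> h; exact: PC_riemG. Qed.

Lemma Om_diag (t b : R) : - (1 / 2) < t -> - (1 / 2) < b ->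
  Om (t, (t - b, b)) /\ X0 (t, (t - b, b)) = 1.
Proof.
move=> h1 h2; have E : X0 (t, (t - b, b)) = 1.
  by rewrite /X0 /=; field; apply/andP; split; lra.
by split => //; split => //; rewrite E; lra.
Qed.

Lemma Om_axis (t b : R) : - (1 / 2) < t -> - (1 / 2) < b -> Om (t, (0, b)).
Proof.
move=> h1 h2; split => //; rewrite /X0 /= expr0n subr0 ltr_pdivlMr; last first.
  by rewrite !mulr_gt0//; lra.
have := sqr_ge0 (1 + t - (1 + b)); have : 0 < (1 + t) * (1 + b) by rewrite mulr_gt0//; lra.
nra.
Qed.

(** Inside the light cone s^2 <= (t-b)^2, which forces X >= 1. *)
Lemma Om_region (t s b : R) : 0 <= b -> 0 <= s <= t - b -> Om (t, (s, b)).
Proof.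
move=> b0 /andP[s0 st]; have t0 : 0 <= t by lra.
split; rewrite /=; [lra|lra|].
rewrite /X0 /= ltr_pdivlMr; last by rewrite !mulr_gt0//; lra.
have : s ^+ 2 <= (t - b) ^+ 2 by rewrite ler_pXn2r// ?nnegrE//; lra.
have : 0 < (1 + t) * (1 + b) by rewrite mulr_gt0//; lra.
nra.
Qed.

(** The coefficient of the equation depends on t alone, so a derivative in a direction without time
    component satisfies the same equation. *)
Lemma riemG_pde_u (u q : E3) : u.1 = 0 -> Om q ->
  dd e1 (dd e1 (dd u G)) q - dd e2 (dd e2 (dd u G)) q + kap * ((1 + q.1) ^- 2 * dd u G q) = 0.
Proof.
move=> u0 O; have [h1 h2 _] := O; have g1 : 1 + q.1 != 0 by lra.
have g12 : (1 + q.1) ^+ 2 != 0 by rewrite expf_neq0.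
have sw v : dd v (dd v (dd u G)) q = dd u (dd v (dd v G)) q.
  rewrite -(D_schwarz (F := fun _ : R => dd v G) 0 u v q (PC_Dv (k := 2) v (PG (k := 3) isT))).
  congr dd; apply/funext => r.
  exact: (D_schwarz (k := 1) (0 : R) u v r (PG (k := 3) isT)).
rewrite !sw.
have Hv v : is_derive q u (dd v (dd v G)) (dd u (dd v (dd v G)) q).
  exact: (PC_isD (k := 0) (0 : R) _ _ (PC_Dv v (PC_Dv v (PG (k := 3) isT)))).
have Hi := dv_inv (F := fun q : E3 => (1 + q.1) ^+ 2) g12 (dv_exp 2 (dv_add (dv_cst 1 q u) (dv_fst3 q u))).
have HG := PC_isD (k := 0) (0 : R) u q (PG (k := 1) isT).
have D := dv_add (dv_sub (Hv e1) (Hv e2)) (dv_scale kap (dv_mul Hi HG)).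
have Z : is_derive q u (fun q : E3 => dd e1 (dd e1 G) q - dd e2 (dd e2 G) q +
    kap * (((1 + q.1) ^+ 2)^-1 * G q)) 0.
  apply: (near_dd_Om (F := fun=> 0)) (dv_cst 0 q u) => // r Or.
  by rewrite -(riemG_pde a_kap Or).
rewrite -[RHS](dv_unique D Z) u0 add0r mulr0 oppr0 mul0r mul0r add0r.
by [].
Qed.

Definition kerB (b : R) (q : E2) : R := slice b (dd e2 G) q.

Lemma PC_kerB : PC 3 kerB.
Proof. by apply: PC_slice; apply: PC_Dv; exact: PG. Qed.

Lemma kerB_pde (b t s : R) : 0 <= b -> 0 <= s <= t - b ->
  dd f1 (dd f1 (kerB b)) (t, s) - dd f2 (dd f2 (kerB b)) (t, s)
  + kap * ((1 + t) ^- 2 * kerB b (t, s)) = 0.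
Proof.
move=> b0 st; have := riemG_pde_u (u := e2) erefl (Om_region b0 st).
have P4 := PC_Dv e2 (PG (k := 4) isT).
rewrite /kerB !(dd_slice b _ P4) !(dd_slice b _ (PC_Dv _ P4)); exact.
Qed.

(** On the characteristic s = t - b one has X = 1, and by [dleg1] the kernel equals (kap/2) (1/(1+b)
    - 1/(1+t)) there. *)
Lemma kerB_diag (b t : R) : 0 <= b -> 0 <= t ->
  is_derive ((t, t - b) : E2) f12 (kerB b) (kap / 2 / (1 + t) ^+ 2).
Proof.
move=> b0 t0; apply/dv_lineE.
have g1 : 1 + t + 0 != 0 by lra.
have D : is_derive (0 : R) 1 (fun h : R => kap / 2 * (1 / (1 + b) - (1 + t + h)^-1)) (kap / 2 / (1 + t) ^+ 2).
  have D0 := dv_inv (F := fun h : R => 1 + t + h) g1 (dv_add (dv_cst (1 + t) (0 : R) 1) (dv_id (0 : R))).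
  apply: (dv_eq (dv_scale (kap / 2) (dv_sub (dv_cst (1 / (1 + b)) (0 : R) 1) D0))).
  by rewrite !addr0; field; lra.
apply: near_dv D; near=> h.
have h1 : - (1 / 2) < h by near: h; apply: lt_nbhsr; lra.
have th : - (1 / 2) < t + h by lra.
have bh : - (1 / 2) < b by lra.
have [HO X1] := Om_diag th bh.
rewrite /kerB /slice.
have -> : ((((t, t - b) : E2) + h *: f12).1, ((((t, t - b) : E2) + h *: f12).2, b)) =
   (t + h, (t + h - b, b)) :> E3.
  rewrite -[LHS]/((t + h * 1, (t - b + h * 1, b)) : E3) mulr1.
  by congr (_, (_, _)); ring.
rewrite (riemG_s a HO) X1 (dleg1 a_kap) /=; field.
by apply/andP; split; lra.
Unshelve. all: by end_near. Qed.

(** G is even in s, so its s-derivative vanishes on the axis. *)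
Lemma kerB_axis (b t : R) : 0 <= b -> 0 <= t -> kerB b (t, 0) = 0.
Proof.
move=> b0 t0; rewrite /kerB /slice (riemG_s a (Om_axis _ _)) /=; lra.
Qed.

(** The derivative at b = 0 of (1+b)^m G; up to constant, weight and sign it is K_0, see
    [kernelK0_ker0]. The dummy argument makes it a family in the sense of [PC]. *)
Definition ker0 (_ : R) (q : E2) : R := m * slice 0 G q + slice 0 (dd e3 G) q.

Lemma PC_ker0 : PC 3 ker0.
Proof.
have z k (F : E3 -> R) : PC k (fun (_ : R) q => F q) -> PC k (fun (_ : R) q => slice 0 F q).
  by move=> /PC_slice H; apply: (PC_reparam (r := fun=> 0) _ H); ctn.
apply: PC_add; last by apply: z; apply: PC_Dv; exact: PG.
by apply: PC_scale; [ctn|apply: z; exact: PG].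
Qed.

Lemma ker0_pde (l t s : R) : 0 <= s <= t ->
  dd f1 (dd f1 (ker0 l)) (t, s) - dd f2 (dd f2 (ker0 l)) (t, s)
  + kap * ((1 + t) ^- 2 * ker0 l (t, s)) = 0.
Proof.
move=> st; have st0 : 0 <= s <= t - 0 by rewrite subr0.
have O := Om_region (lexx 0) st0.
have E1 := riemG_pde a_kap O; have E3 := riemG_pde_u (u := e3) erefl O.
have PA := PG (k := 4) isT; have PB := PC_Dv e3 (PG (k := 4) isT).
have D2 v : dd v (dd v (ker0 l)) (t, s) =
    m * dd (v.1, (v.2, 0)) (dd (v.1, (v.2, 0)) G) (t, (s, 0)) +
    dd (v.1, (v.2, 0)) (dd (v.1, (v.2, 0)) (dd e3 G)) (t, (s, 0)).
  have -> : dd v (ker0 l) = fun q => m * slice 0 (dd (v.1, (v.2, 0)) G) q +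
      slice 0 (dd (v.1, (v.2, 0)) (dd e3 G)) q.
    apply/funext => q; apply: dvE; apply: dv_add; first apply: dv_scale.
      by apply: dv_slice; exact: (PC_isD (0 : R) _ _ PA).
    by apply: dv_slice; exact: (PC_isD (0 : R) _ _ PB).
  apply: dvE; apply: dv_add; first apply: dv_scale.
    apply: (@dv_slice _ _ _ (t, s)).
    exact: (PC_isD (0 : R) _ _ (PC_Dv _ PA)).
  apply: (@dv_slice _ _ _ (t, s)).
  exact: (PC_isD (0 : R) _ _ (PC_Dv _ PB)).
rewrite !D2 /ker0 /slice [(t, s).1]/= [(t, s).2]/= -/e1 -/e2.
rewrite [(t, _).1]/= in E1 E3.
move: (dd e1 (dd e1 G) _) (dd e2 (dd e2 G) _) (dd e1 (dd e1 (dd e3 G)) _)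
  (dd e2 (dd e2 (dd e3 G)) _) (G _) (dd e3 G _) E1 E3 => A B C D F H E1 E3.
transitivity (m * (A - B + kap * ((1 + t) ^- 2 * F)) + (C - D + kap * ((1 + t) ^- 2 * H))).
  by ring.
by rewrite E1 E3 mulr0 addr0.
Qed.

Lemma ker0_diag (l t : R) : 0 <= t -> is_derive ((t, t) : E2) f12 (ker0 l) (kap / 2 / (1 + t) ^+ 2).
Proof.
move=> t0; apply/dv_lineE.
have g1 : 1 + t + 0 != 0 by lra.
have D : is_derive (0 : R) 1 (fun h : R => m - kap / 2 * ((1 + t + h)^-1 - 1)) (kap / 2 / (1 + t) ^+ 2).
  have D0 := dv_inv (F := fun h : R => 1 + t + h) g1 (dv_add (dv_cst (1 + t) (0 : R) 1) (dv_id (0 : R))).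
  apply: (dv_eq (dv_sub (dv_cst m (0 : R) 1) (dv_scale (kap / 2) (dv_sub D0 (dv_cst 1 (0 : R) 1))))).
  by rewrite !addr0; field; lra.
apply: near_dv D; near=> h.
have h1 : - (1 / 2) < h by near: h; apply: lt_nbhsr; lra.
have th : - (1 / 2) < t + h by lra.
have bh : - (1 / 2) < 0 :> R by lra.
have [HO X1] := Om_diag th bh.
rewrite /ker0 /slice.
have -> : ((((t, t) : E2) + h *: f12).1, ((((t, t) : E2) + h *: f12).2, 0)) =
   (t + h, (t + h - 0, 0)) :> E3.
  rewrite -[LHS]/((t + h * 1, (t + h * 1, 0)) : E3) mulr1.
  by congr (_, (_, _)); ring.
rewrite (riemG_b a HO) (riemG_Om a HO) X1 (dleg1 a_kap) leg1 /=; field.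
by lra.
Unshelve. all: by end_near. Qed.

(** Both G and G_b are even in s. For G_b the derivatives in s and b are exchanged, since G_s
    vanishes along the whole axis. *)
Lemma ker0_axis (l t : R) : 0 <= t -> dd f2 (ker0 l) (t, 0) = 0.
Proof.
move=> t0; have PA := PG (k := 4) isT; have PB := PC_Dv e3 (PG (k := 4) isT).
have -> : dd f2 (ker0 l) (t, 0) = m * dd e2 G (t, (0, 0)) + dd e2 (dd e3 G) (t, (0, 0)).
  apply: dvE; apply: dv_add; first apply: dv_scale.
    by apply: (@dv_slice _ _ _ (t, 0)); exact: (PC_isD (0 : R) _ _ PA).
  by apply: (@dv_slice _ _ _ (t, 0)); exact: (PC_isD (0 : R) _ _ PB).
rewrite (riemG_s a (Om_axis _ _)); [|lra|lra].
rewrite [(_, _).2.1]/= mul0r mulr0 oppr0 mulr0 add0r.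
rewrite (D_schwarz (k := 2) (0 : R) e3 e2 _ PA).
apply: dvE; apply/dv_lineE; apply: near_dv (dv_cst 0 _ _); near=> h.
have h1 : - (1 / 2) < h by near: h; apply: lt_nbhsr; lra.
have -> : ((t, (0, 0)) : E3) + h *: e3 = (t, (0, h)).
  by rewrite -[LHS]/((t + h * 0, (0 + h * 0, 0 + h * 1)) : E3) !mulr0 mulr1 !add0r addr0.
rewrite (riemG_s a (Om_axis _ _)) //; last by lra.
by rewrite /= mul0r mulr0 oppr0.
Unshelve. all: by end_near. Qed.

End VolterraKernels.

Lemma oint_sum (R : realType) (I : Type) (s : seq I) (F : I -> R -> R) (x y : R) :
  (forall i, continuous (F i)) ->
  oint x y (fun r => \sum_(i <- s) F i r) = \sum_(i <- s) oint x y (F i).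
Proof.
move=> cF; elim: s => [|i s ih].
  rewrite big_nil -[RHS](mul0r (y - x)) -oint_cst.
  by congr oint; apply/funext => r; rewrite big_nil.
rewrite big_cons -ih -(oint_add _ _ (cF i) (ct_sum cF)).
by congr oint; apply/funext => r; rewrite big_cons.
Qed.

(** * Volterra representation of solutions *)

Section Leibniz.
Variables (R : realType) (n : nat).
Local Notation V := 'rV[R]_n.
Local Notation E := (R * V)%type.
Local Notation et := (et R n).
Implicit Types (T : topologicalType) (p v : E).

Definition moving T (b : T -> R) (U : T * R -> E -> R) (l : T) p : R :=
  oint 0 (p.1 - b l) (fun s => U (l, s) p).

Lemma ct_moving T (b : T -> R) (U : T * R -> E -> R) : continuous b -> PC 0 U ->
  continuous (fun q : T * E => moving b U q.1 q.2).
Proof.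
move=> cb [cU _].
apply: (@continuous_oint_end R (T * E)%type (fun q s => U (q.1, s) q.2) (fun=> 0)
  (fun q => q.2.1 - b q.1)).
- apply: (ct_comp (F := fun q : (T * R) * E => U q.1 q.2) cU (a := fun q => ((q.1.1, q.2), q.1.2))); ctn.
- by ctn.
- by apply: ct_sub; [ctn|apply: (ct_comp cb); ctn].
Qed.

(** The end point and the point [p] are first separated into two variables; the derivative along the
    sum of the two directions is then the boundary term plus the derivative under the integral. *)
Theorem moving_dv T (b : T -> R) (U : T * R -> E -> R) l p v : continuous b -> PC 1 U ->
  is_derive p v (moving b U l)
    (v.1 * U (l, p.1 - b l) p + moving b (fun ls p => dd v (U ls) p) l p).
Proof.
move=> cb HU; have HD := PC_Dv v HU.
pose F (r : R * E) : R := oint 0 r.1 (fun s => U (l, s) r.2).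
pose Dv (r : R * E) : R := v.1 * U (l, r.1) r.2.
pose Dw (r : R * E) : R := oint 0 r.1 (fun s => dd v (U (l, s)) r.2).
have cU q : continuous (fun s => U (l, s) q).
  by apply: (ct_comp (PC_cont HU) (a := fun s : R => ((l, s), q))); ctn.
have D1 r : is_derive r ((v.1, 0) : R * E) F (Dv r).
  have := dv_scaledir v.1 (oint0_derive r.1 (cU r.2)) => /dv_lineE H.
  apply/dv_lineE; apply: dv_ext H => h.
  rewrite /F -[(r + h *: _).1]/(r.1 + h * v.1) -[(r + h *: _).2]/(r.2 + h *: 0).
  by rewrite scaler0 addr0 -[v.1 *: 1]/(v.1 * 1) mulr1.
have D2 r : is_derive r ((0, v) : R * E) F (Dw r).
  have := PC_oint_derive (F := U) (dF := fun lsv p => dd lsv.2 (U lsv.1) p) 0 r.1 l v r.2 HU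
    (fun ls v p => PC_isD ls v p HU) => /dv_lineE H.
  apply/dv_lineE; apply: dv_ext H => h.
  rewrite /F -[(r + h *: _).1]/(r.1 + h * 0) -[(r + h *: _).2]/(r.2 + h *: v).
  by rewrite mulr0 addr0.
have c1 : continuous Dv.
  apply: ct_mul; first by ctn.
  by apply: (ct_comp (PC_cont HU) (a := fun r : R * E => ((l, r.1), r.2))); ctn.
have c2 : continuous Dw.
  apply: (@continuous_oint_end R (R * E)%type (fun r s => dd v (U (l, s)) r.2) (fun=> 0) (fun r => r.1)).
  - by apply: (ct_comp (PC_cont HD) (a := fun q : (R * E) * R => ((l, q.2), q.1.2))); ctn.
  - by ctn.
  - by ctn.
have : is_derive ((p.1 - b l, p) : R * E) ((v.1, 0) + (0, v)) F (Dv (p.1 - b l, p) + Dw (p.1 - b l, p)).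
  have N1 : \forall r \near ((p.1 - b l, p) : R * E), is_derive r ((v.1, 0) : R * E) F (Dv r).
    by near=> r; exact: D1.
  have N2 : \forall r \near ((p.1 - b l, p) : R * E), is_derive r ((0, v) : R * E) F (Dw r).
    by near=> r; exact: D2.
  exact: (dv_diradd N1 N2 (c1 _) (c2 _)).
move=> /dv_lineE H; apply/dv_lineE; apply: dv_ext H => h.
rewrite /F /moving -[(_ + h *: _).1]/(p.1 - b l + h * (v.1 + 0)) -[(_ + h *: _).2]/(p + h *: (0 + v)).
rewrite addr0 add0r -[(p + h *: v).1]/(p.1 + h * v.1).
by rewrite addrAC.
Unshelve. all: by end_near. Qed.

End Leibniz.

Section Volterra.
Variables (R : realType) (n : nat).
Local Notation V := 'rV[R]_n.
Local Notation E := (R * V)%type.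
Local Notation E2 := (R * R)%type.
Local Notation et := (et R n).
Local Notation f1 := (f1 R).
Local Notation f2 := (f2 R).
Local Notation f12 := (f12 R).
Variables (T : topologicalType) (b : T -> R).
Hypothesis cb : continuous b.
Implicit Types (A : T -> E -> R) (B : T -> E2 -> R) (l : T) (p : E).

Definition volt A B l p : R := moving b (fun ls p => A ls.1 (ls.2, p.2) * B ls.1 (p.1, ls.2)) l p.

Lemma PC_volt_integrand k A B : PC k A -> PC k B ->
  PC k (fun (ls : T * R) (p : E) => A ls.1 (ls.2, p.2) * B ls.1 (p.1, ls.2)).
Proof.
move=> HA HB; apply: PC_mul.
  apply: (PC_affine (r := fst) (A := fun (ls : T * R) p => (ls.2, p.2) : E)
    (B := fun (ls : T * R) p => (0, p.2) : E) _ _ _ _ HA); try by ctn.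
  by move=> ls p h v; rewrite -[RHS]/(ls.2 + h * 0, p.2 + h *: v.2) mulr0 addr0.
apply: (PC_affine (r := fst) (A := fun (ls : T * R) (p : E) => (p.1, ls.2) : E2)
    (B := fun (ls : T * R) (p : E) => (p.1, 0) : E2) _ _ _ _ HB); try by ctn.
by move=> ls p h v; rewrite -[RHS]/(p.1 + h * v.1, ls.2 + h * 0) mulr0 addr0.
Qed.

Lemma PC_volt k A B : PC k A -> PC k B -> PC k (volt A B).
Proof.
move=> HA HB.
(* The substitution from [0, 1] gives fixed limits; it is affine in [p], so smoothness of any order
   passes to the integral. *)
pose U (ls : T * R) (p : E) := A ls.1 ((p.1 - b ls.1) * ls.2, p.2) * B ls.1 (p.1, (p.1 - b ls.1) * ls.2).
have HU : PC k U.
  have c1 : continuous (fun q : (T * R) * E => b q.1.1) by apply: (ct_comp cb); ctn.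
  apply: PC_mul.
    apply: (PC_affine (r := fst) (A := fun (ls : T * R) (p : E) => ((p.1 - b ls.1) * ls.2, p.2) : E)
      (B := fun (ls : T * R) (p : E) => (p.1 * ls.2, p.2) : E) _ _ _ _ HA); try by ctn.
    move=> ls p h v; rewrite -[RHS]/((p.1 - b ls.1) * ls.2 + h * (v.1 * ls.2), p.2 + h *: v.2).
    rewrite -[(p + h *: v).1]/(p.1 + h * v.1) -[(p + h *: v).2]/(p.2 + h *: v.2).
    by congr (_, _); ring.
  apply: (PC_affine (r := fst) (A := fun (ls : T * R) (p : E) => (p.1, (p.1 - b ls.1) * ls.2) : E2)
      (B := fun (ls : T * R) (p : E) => (p.1, p.1 * ls.2) : E2) _ _ _ _ HB); try by ctn.
  move=> ls p h v; rewrite -[RHS]/(p.1 + h * v.1, (p.1 - b ls.1) * ls.2 + h * (v.1 * ls.2)).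
  rewrite -[(p + h *: v).1]/(p.1 + h * v.1).
  by congr (_, _); ring.
have H0 := PC_volt_integrand (PC_le (leq0n k) HA) (PC_le (leq0n k) HB).
apply: (PC_ext (F := fun l p => (p.1 - b l) * oint 0 1 (fun s => U (l, s) p))).
  move=> l p; rewrite /volt /moving.
  have cg : continuous (fun s : R => A l (s, p.2) * B l (p.1, s)).
    by apply: (ct_comp (PC_cont H0) (a := fun s : R => ((l, s), p))); ctn.
  have du (x : R) : is_derive x 1 (fun s : R => (p.1 - b l) * s) (p.1 - b l).
    by apply: dv_eq (dv_scale _ (dv_id x)) _; rewrite mulr1.
  have cc : continuous (fun _ : R => p.1 - b l) by ctn.
  have := oint_subst 0 1 cg cc du; rewrite mulr0 mulr1 => ->.
  rewrite -oint_scale; first by congr oint; apply/funext => s; rewrite mulrC.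
  by apply: (ct_comp (PC_cont HU) (a := fun s : R => ((l, s), p))); ctn.
apply: PC_mul; last exact: PC_oint.
apply: PC_sub; first exact: PC_fst.
by apply: PC_cst.
Qed.

Lemma volt_t A B l p : PC 1 A -> PC 1 B -> is_derive p et (volt A B l)
  (A l (p.1 - b l, p.2) * B l (p.1, p.1 - b l) + volt A (fun l => dd f1 (B l)) l p).
Proof.
move=> HA HB; have HI := PC_volt_integrand HA HB.
apply: dv_eq (moving_dv l p et cb HI) _; rewrite [et.1]/= mul1r; congr (_ + _).
rewrite /volt /moving; congr oint; apply/funext => s; apply: dvE.
have d1 : is_derive p et (fun q : E => A l (s, q.2)) 0.
  apply/dv_lineE; apply: dv_ext (dv_cst (A l (s, p.2)) _ _) => h.
  by rewrite -[(p + h *: et).2]/(p.2 + h *: 0) scaler0 addr0.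
have d2 : is_derive p et (fun q : E => B l (q.1, s)) (dd f1 (B l) (p.1, s)).
  have /dv_lineE H := PC_isD l f1 (p.1, s) HB; apply/dv_lineE; apply: dv_ext H => h.
  by rewrite -[(p.1, s) + h *: f1]/(p.1 + h * 1, s + h * 0) mulr0 addr0.
by apply: dv_eq (dv_mul d1 d2) _; rewrite mul0r add0r.
Qed.

Lemma volt_x A B l p i : PC 1 A -> PC 1 B -> is_derive p (ex R i) (volt A B l)
  (volt (fun l => dd (ex R i) (A l)) B l p).
Proof.
move=> HA HB; have HI := PC_volt_integrand HA HB.
apply: dv_eq (moving_dv l p (ex R i) cb HI) _; rewrite [(ex R i).1]/= mul0r add0r.
rewrite /volt /moving; congr oint; apply/funext => s; apply: dvE.
have d1 : is_derive p (ex R i) (fun q : E => A l (s, q.2)) (dd (ex R i) (A l) (s, p.2)).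
  have /dv_lineE H := PC_isD l (ex R i) (s, p.2) HA; apply/dv_lineE; apply: dv_ext H => h.
  by rewrite -[(s, p.2) + h *: ex R i]/(s + h * 0, p.2 + h *: delta_mx 0 i) mulr0 addr0.
have d2 : is_derive p (ex R i) (fun q : E => B l (q.1, s)) 0.
  apply/dv_lineE; apply: dv_ext (dv_cst (B l (p.1, s)) _ _) => h.
  by rewrite -[(p + h *: ex R i).1]/(p.1 + h * 0) mulr0 addr0.
by apply: dv_eq (dv_mul d1 d2) _; rewrite mulr0 addr0.
Qed.

Lemma ct_volt_integrand A B l p : PC 0 A -> PC 0 B -> continuous (fun s : R => A l (s, p.2) * B l (p.1, s)).
Proof.
move=> HA HB; have H0 := PC_volt_integrand HA HB.
by apply: (ct_comp (PC_cont H0) (a := fun s : R => ((l, s), p))); ctn.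
Qed.

Lemma volt_lap A B l p : PC 2 A -> PC 2 B -> Lap (volt A B l) p = volt (fun l => Lap (A l)) B l p.
Proof.
move=> HA HB; rewrite /Lap.
have HB1 := PC_S HB; have HB0 := PC_S HB1.
transitivity (\sum_(i < n) volt (fun l => dd (ex R i) (dd (ex R i) (A l))) B l p).
  apply: eq_bigr => i _.
  have -> : dd (ex R i) (volt A B l) = volt (fun l => dd (ex R i) (A l)) B l.
    by apply/funext => q; apply: dvE; apply: volt_x; exact: PC_S.
  by apply: dvE; apply: volt_x => //; exact: PC_Dv.
have HD i : PC 0 (fun l => dd (ex R i) (dd (ex R i) (A l))) by apply: PC_Dv; exact: PC_Dv.
have HL : PC 0 (fun l => Lap (A l)) by exact: PC_Lap.
rewrite /volt /moving -oint_sum.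
  by congr oint; apply/funext => s; rewrite mulr_suml.
move=> i; have c := ct_volt_integrand (l := l) (p := p) (HD i) HB0.
exact c.
Qed.

Variables (W : T -> E -> R) (K : T -> E2 -> R) (kap : R).
Hypotheses (HW : PC 2 W) (HK : PC 2 K).
Hypothesis wave_eq : forall l p, dd et (dd et (W l)) p = Lap (W l) p.

Let HW1 : PC 1 W := PC_S HW.
Let HK1 : PC 1 K := PC_S HK.

Definition voltS l p : R := W l (p.1 - b l, p.2) - volt W K l p.

Lemma PC_shift k A : PC k A -> PC k (fun l (p : E) => A l (p.1 - b l, p.2)).
Proof.
move=> HA; have c1 : continuous (fun q : T * E => b q.1) by apply: (ct_comp cb); ctn.
apply: (PC_affine (r := id) (A := fun l (p : E) => (p.1 - b l, p.2) : E)
  (B := fun l (p : E) => p) _ _ _ _ HA); try by ctn.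
move=> l p h v; rewrite -[RHS]/(p.1 - b l + h * v.1, p.2 + h *: v.2).
rewrite -[(p + h *: v).1]/(p.1 + h * v.1) -[(p + h *: v).2]/(p.2 + h *: v.2).
by congr (_, _); ring.
Qed.

Lemma shift_dv A l p v : PC 1 A ->
  is_derive p v (fun p : E => A l (p.1 - b l, p.2)) (dd v (A l) (p.1 - b l, p.2)).
Proof.
move=> HA; have /dv_lineE H := PC_isD l v (p.1 - b l, p.2) HA; apply/dv_lineE; apply: dv_ext H => h.
rewrite -[(p.1 - b l, p.2) + h *: v]/(p.1 - b l + h * v.1, p.2 + h *: v.2).
rewrite -[(p + h *: v).1]/(p.1 + h * v.1) -[(p + h *: v).2]/(p.2 + h *: v.2).
by congr (A l (_, _)); ring.
Qed.

Lemma PC_voltS : PC 2 voltS.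
Proof. by apply: PC_sub; [exact: PC_shift|exact: PC_volt]. Qed.

Lemma diag_dv l p : is_derive p et (fun p : E => K l (p.1, p.1 - b l)) (dd f12 (K l) (p.1, p.1 - b l)).
Proof.
have /dv_lineE H := PC_isD l f12 (p.1, p.1 - b l) HK1; apply/dv_lineE; apply: dv_ext H => h.
rewrite -[(p.1, p.1 - b l) + h *: f12]/(p.1 + h * 1, p.1 - b l + h * 1).
rewrite -[(p + h *: et).1]/(p.1 + h * 1).
by congr (K l (_, _)); ring.
Qed.

Lemma voltS_t l p : is_derive p et (voltS l)
  (dd et (W l) (p.1 - b l, p.2) - (W l (p.1 - b l, p.2) * K l (p.1, p.1 - b l) + volt W (fun l => dd f1 (K l)) l p)).
Proof. exact: dv_sub (shift_dv l p et HW1) (volt_t l p HW1 HK1). Qed.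

(** Two integrations by parts in s move d_ss from K to W, where it meets the Laplacian through the
    wave equation. At s = t - b the terms in W_t cancel and those in W add up to -2 W d/dt K(t,
    t-b), which cancels the potential term by the condition on the diagonal; at s = 0 the last
    hypothesis removes what is left. *)
Theorem voltS_eq l p : b l <= p.1 ->
  (forall s, 0 <= s <= p.1 - b l ->
    dd f1 (dd f1 (K l)) (p.1, s) - dd f2 (dd f2 (K l)) (p.1, s) + kap * ((1 + p.1) ^- 2 * K l (p.1, s)) = 0) ->
  is_derive (p.1, p.1 - b l) f12 (K l) (kap / 2 / (1 + p.1) ^+ 2) ->
  dd et (W l) (0, p.2) * K l (p.1, 0) = W l (0, p.2) * dd f2 (K l) (p.1, 0) ->
  dd et (dd et (voltS l)) p - Lap (voltS l) p + kap * ((1 + p.1) ^- 2 * voltS l p) = 0.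
Proof.
move=> bp pde diag bc; set r := p.1 - b l in pde diag *.
have r0 : 0 <= r by rewrite /r subr_ge0.
have HKt : PC 1 (fun l => dd f1 (K l)) by exact: PC_Dv.
have HKs : PC 1 (fun l => dd f2 (K l)) by exact: PC_Dv.
have HKtt : PC 0 (fun l => dd f1 (dd f1 (K l))) by exact: PC_Dv.
have HKss : PC 0 (fun l => dd f2 (dd f2 (K l))) by exact: PC_Dv.
have HWt : PC 1 (fun l => dd et (W l)) by exact: PC_Dv.
have HWtt : PC 0 (fun l => dd et (dd et (W l))) by exact: PC_Dv.
have HK0 := PC_S HK1; have HW0 := PC_S HW1.
have Ett : dd et (dd et (voltS l)) p = dd et (dd et (W l)) (r, p.2) -
    ((dd et (W l) (r, p.2) * K l (p.1, r) + W l (r, p.2) * dd f12 (K l) (p.1, r)) +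
     (W l (r, p.2) * dd f1 (K l) (p.1, r) + volt W (fun l => dd f1 (dd f1 (K l))) l p)).
  rewrite (funext (fun q => dvE (voltS_t l q))); apply: dvE.
  apply: dv_sub; first exact: (shift_dv (A := fun l => dd et (W l)) l p et HWt).
  apply: dv_add; last exact: (volt_t l p HW1 HKt).
  exact: dv_mul (shift_dv l p et HW1) (diag_dv l p).
have EL : Lap (voltS l) p = Lap (W l) (r, p.2) - volt (fun l => Lap (W l)) K l p.
  have H1 := Lap_lin1 1 (-1) l p (PC_shift HW) (PC_volt HW HK).
  rewrite (volt_lap l p HW HK) mul1r mulN1r in H1.
  have <- : Lap (fun q : E => W l (q.1 - b l, q.2)) p = Lap (W l) (r, p.2).
    apply: eq_bigr => i _.
    have -> : dd (ex R i) (fun q : E => W l (q.1 - b l, q.2)) = fun q => dd (ex R i) (W l) (q.1 - b l, q.2).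
      by apply/funext => q; apply: dvE; exact: shift_dv.
    apply: dvE; exact: (shift_dv (A := fun l => dd (ex R i) (W l)) l p _ (PC_Dv _ HW)).
  by rewrite -H1; congr Lap; apply/funext => q; rewrite mul1r mulN1r.
have cI A B : PC 0 A -> PC 0 B -> continuous (fun s : R => A l (s, p.2) * B l (p.1, s)).
  by move=> HA HB; exact: ct_volt_integrand.
have E1 : volt W (fun l => dd f1 (dd f1 (K l))) l p =
    volt W (fun l => dd f2 (dd f2 (K l))) l p - kap * ((1 + p.1) ^- 2 * volt W K l p).
  rewrite /volt /moving mulrA -oint_scale; last exact: (cI W K).
  rewrite -oint_sub; last 2 first.
  - exact: (cI W (fun l => dd f2 (dd f2 (K l)))).
  - exact: (ct_mul (@ct_cst _ _ _) (cI W K HW0 HK0)).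
  apply: eq_oint => s; rewrite -/r min_l// max_r// => sr /=.
  have := pde s sr; move: (dd f1 (dd f1 (K l)) (p.1, s)) (dd f2 (dd f2 (K l)) (p.1, s)) => X Y Z.
  have -> : X = Y - kap * ((1 + p.1) ^- 2 * K l (p.1, s)).
    by apply/eqP; rewrite -subr_eq0 -Z; apply/eqP; ring.
  by ring.
have dsW A (s : R) : PC 1 A -> is_derive s 1 (fun s : R => A l (s, p.2)) (dd et (A l) (s, p.2)).
  move=> HA; have /dv_lineE H := PC_isD l et (s, p.2) HA; apply/dv_lineE; apply: dv_ext H => h.
  by rewrite -[(s, p.2) + h *: et]/(s + h * 1, p.2 + h *: 0) scaler0 addr0.
have dsK B (s : R) : PC 1 B -> is_derive s 1 (fun s : R => B l (p.1, s)) (dd f2 (B l) (p.1, s)).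
  move=> HB; have /dv_lineE H := PC_isD l f2 (p.1, s) HB; apply/dv_lineE; apply: dv_ext H => h.
  by rewrite -[(p.1, s) + h *: f2]/(p.1 + h * 0, s + h * 1) mulr0 addr0.
have csW A : PC 0 A -> continuous (fun s : R => A l (s, p.2)).
  by move=> HA; apply: (ct_comp (PC_cont HA) (a := fun s : R => (l, (s, p.2)))); ctn.
have csK B : PC 0 B -> continuous (fun s : R => B l (p.1, s)).
  by move=> HB; apply: (ct_comp (PC_cont HB) (a := fun s : R => (l, (p.1, s)))); ctn.
have I1 := oint_ibp 0 r (csW _ (PC_S HWt)) (csK _ HKss) (fun s => dsW W s HW1)
  (fun s => dsK (fun l => dd f2 (K l)) s HKs).
have I2 := oint_ibp 0 r (csW _ HWtt) (csK _ (PC_S HKs)) (fun s => dsW (fun l => dd et (W l)) s HWt)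
  (fun s => dsK K s HK1).
have E2 : volt W (fun l => dd f2 (dd f2 (K l))) l p =
    W l (r, p.2) * dd f2 (K l) (p.1, r) - W l (0, p.2) * dd f2 (K l) (p.1, 0) -
    (dd et (W l) (r, p.2) * K l (p.1, r) - dd et (W l) (0, p.2) * K l (p.1, 0) -
     volt (fun l => dd et (dd et (W l))) K l p).
  by rewrite /volt /moving -/r I1 I2.
have E3 : volt (fun l => dd et (dd et (W l))) K l p = volt (fun l => Lap (W l)) K l p.
  by rewrite /volt /moving; congr oint; apply/funext => s; rewrite /= wave_eq.
have E4 : dd f12 (K l) (p.1, r) = dd f1 (K l) (p.1, r) + dd f2 (K l) (p.1, r).
  have -> : f12 = f1 + f2 by rewrite -[RHS]/(1 + 0, 0 + 1) addr0 add0r.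
  have H l' v q : is_derive q v (K l') (dd (l', v).2 (K (l', v).1) q) by exact: PC_isD HK1.
  exact (PC_dir_add (dF := fun lv : T * (R * R) => dd lv.2 (K lv.1)) l f1 f2 (p.1, r) HK1 H).
have E5 := dvE diag.
rewrite Ett EL /voltS -/r E1 E2 E3 wave_eq bc.
move: E4 E5; move: (dd f12 (K l) (p.1, r)) (dd f1 (K l) (p.1, r)) (dd f2 (K l) (p.1, r)) => k12 k1 k2 E4 E5.
have -> : k2 = k12 - k1 by rewrite E4; ring.
rewrite E5.
move: (volt _ K l p) (volt W K l p) (Lap (W l) (r, p.2)) (dd et (W l) (r, p.2)) (W l (r, p.2)) (K l (p.1, r))
  (W l (0, p.2)) (dd f2 (K l) (p.1, 0)) => j1 j2 w2 w1 w0 kk z0 z1.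
have -> : kap / 2 / (1 + p.1) ^+ 2 = kap * (1 + p.1) ^- 2 / 2 by rewrite mulrAC.
move: ((1 + p.1) ^- 2) => tau2.
by field.
Qed.

End Volterra.

(** * Removing the first-order term *)

Section Conjugation.
Variables (R : realType) (n : nat) (mu : R).
Local Notation V := 'rV[R]_n.
Local Notation E := (R * V)%type.
Local Notation et := (et R n).
Local Notation m := (mu / 2).
Implicit Types (T : topologicalType) (p : E).

Definition weight (p : E) : R := posext (1 + p.1) `^ (- m).

Lemma PC_weight k T : (k <= 5)%N -> PC k (fun (_ : T) p => weight p).
Proof.
move=> k5; apply: (PC_outer (smooth1_powR k (- m))) => [_ p|]; first exact: posext_gt0.
apply: (PC_outer (smooth1_posext R k5)) => //.
by apply: PC_add; [apply: PC_cst; ctn|exact: PC_fst].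
Qed.

Lemma weight_id p : - (1 / 2) <= p.1 -> weight p = (1 + p.1) `^ (- m).
Proof. by move=> h; rewrite /weight posext_id//; lra. Qed.

Lemma near_half p : - (1 / 2) < p.1 -> \forall q \near p, - (1 / 2) < q.1.
Proof.
move=> h; have c : continuous (fun q : E => q.1) by ctn.
have : nbhs p.1 [set x | - (1 / 2) < x] by exact: lt_nbhsr.
by move/(c p).
Qed.

Lemma weight_t p : - (1 / 2) < p.1 -> is_derive p et weight (- m / (1 + p.1) * weight p).
Proof.
move=> h; have h1 : 0 < 1 + p.1 by lra.
apply: (near_dv (F := fun q : E => (1 + q.1) `^ (- m))).
  by apply: filterS (near_half h) => q hq; rewrite weight_id// ltW.
have D1 := dv_add (dv_cst 1 p et) (dv_fst p et).
have D := dv_comp (F := fun q : E => 1 + q.1) (is_derive1_powR (- m) h1) D1.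
apply: (dv_eq D); rewrite weight_id ?ltW// powRB; last by rewrite (gt_eqF h1) implybT.
by rewrite powRr1 ?ltW//= add0r mulr1; field; lra.
Qed.

Lemma weight_x p i : is_derive p (ex R i) weight 0.
Proof.
apply/dv_lineE; apply: dv_ext (dv_cst (weight p) _ _) => h.
by rewrite /weight -[(p + h *: ex R i).1]/(p.1 + h * 0) mulr0 addr0.
Qed.

Variables (T : topologicalType) (c : T -> R) (F : T -> E -> R).
Hypotheses (cc : continuous c) (HF : PC 2 F).

Definition conj l p : R := c l * (weight p * F l p).

Lemma PC_conj : PC 2 conj.
Proof. by apply: PC_scale => //; apply: PC_mul => //; exact: PC_weight. Qed.

Lemma conj_t l p : - (1 / 2) < p.1 -> is_derive p et (conj l)
  (c l * (weight p * (dd et (F l) p - m / (1 + p.1) * F l p))).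
Proof.
move=> h; apply: dv_eq (dv_scale (c l) (dv_mul (weight_t h) (PC_isD l et p (PC_S HF)))) _.
by congr (_ * _); rewrite !mulNr; ring.
Qed.

Variable nu2 : R.
Local Notation kap := (legendre_kap mu nu2).

(** With m = mu/2, removing the damping changes nu2 into nu2 + m (1 - m), which equals
    [legendre_kap]. *)
Lemma conj_eq l p : 0 <= p.1 ->
  dd et (dd et (F l)) p - Lap (F l) p + kap * ((1 + p.1) ^- 2 * F l p) = 0 ->
  dd et (dd et (conj l)) p - Lap (conj l) p + mu / (1 + p.1) * dd et (conj l) p
    + nu2 / (1 + p.1) ^+ 2 * conj l p = 0.
Proof.
move=> p0 H; have h : - (1 / 2) < p.1 by lra.
have g : 1 + p.1 != 0 by lra.
have HFt : PC 1 (fun l => dd et (F l)) by exact: PC_Dv.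
have Dtau := dv_inv (F := fun q : E => 1 + q.1) g (dv_add (dv_cst 1 p et) (dv_fst p et)).
have Ett : dd et (dd et (conj l)) p = c l * (weight p * (dd et (dd et (F l)) p
    - 2 * m / (1 + p.1) * dd et (F l) p + m * (m + 1) / (1 + p.1) ^+ 2 * F l p)).
  apply: dvE; apply: (near_dv (F := fun q => c l * (weight q * (dd et (F l) q - m * ((1 + q.1)^-1 * F l q))))).
    apply: filterS (near_half h) => q hq; rewrite (dvE (conj_t l hq)).
    by congr (_ * (_ * (_ - _))); rewrite mulrA.
  have D1 := dv_mul Dtau (PC_isD l et p (PC_S HF)).
  have D2 := dv_sub (PC_isD l et p HFt) (dv_scale m D1).
  apply: (dv_eq (dv_scale (c l) (dv_mul (weight_t h) D2))).
  rewrite [et.1]/= add0r.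
  move: (dd et (dd et (F l)) p) (dd et (F l) p) (F l p) (weight p) (c l) (1 + p.1) g => A B C w d t t0.
  by field.
have EL : Lap (conj l) p = c l * (weight p * Lap (F l) p).
  rewrite /Lap !mulr_sumr; apply: eq_bigr => i _.
  have D1 (G : T -> E -> R) : PC 1 G -> forall q,
      is_derive q (ex R i) (fun q => c l * (weight q * G l q)) (c l * (weight q * dd (ex R i) (G l) q)).
    move=> HG q; apply: dv_eq (dv_scale (c l) (dv_mul (weight_x q i) (PC_isD l (ex R i) q HG))) _.
    by rewrite mul0r add0r.
  have -> : dd (ex R i) (conj l) = fun q => c l * (weight q * dd (ex R i) (F l) q).
    by apply/funext => q; exact: dvE (D1 F (PC_S HF) q).
  exact: dvE (D1 (fun l => dd (ex R i) (F l)) (PC_Dv _ HF) p).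
rewrite Ett EL (dvE (conj_t l h)) /conj.
have HL : Lap (F l) p = dd et (dd et (F l)) p + kap * ((1 + p.1) ^- 2 * F l p).
  by apply/eqP; rewrite -subr_eq0 -oppr_eq0 -H; apply/eqP; ring.
rewrite HL /legendre_kap /delta.
move: (dd et (dd et (F l)) p) (dd et (F l) p) (F l p) (weight p) (c l) (1 + p.1) g => A B C w d t t0.
by field.
Qed.

End Conjugation.

(** * The solutions generated by an initial velocity and by an initial position *)

Section Components.
Variables (R : realType) (n h : nat) (mu nu2 : R).
Hypothesis nE : n = h.*2.+2.
Local Notation V := 'rV[R]_n.
Local Notation E := (R * V)%type.
Local Notation et := (et R n).
Local Notation kap := (legendre_kap mu nu2).
Local Notation a := (legendre_a mu nu2).
Local Notation m := (mu / 2).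
Let a_kap := legendre_a_kap mu nu2.

Section InitialVelocity.
Variables (T : topologicalType) (b : T -> R) (phi : T -> V -> R).
Hypotheses (cb : continuous b) (Hphi : PC h.+2 phi).

Let W := waveS h phi.
Let K l := kerB a (b l).

Let HW : PC 2 W. Proof. by apply: PC_waveS; rewrite addn2. Qed.
Let HK3 : PC 3 K. Proof. exact: PC_reparam cb (PC_kerB a). Qed.
Let HK : PC 2 K. Proof. exact: PC_S. Qed.

(** The constant (1+b)^m compensates the weight (1+t)^(-m) at t = b, so that the velocity at time
    [b l] is exactly [phi l]. The starting time is a function of the parameter: constantly 0 for the
    data, the identity for the source. *)
Definition velS : T -> E -> R := conj mu (fun l => posext (1 + b l) `^ m) (voltS b W K).

Let cpw : continuous (fun l : T => posext (1 + b l) `^ m).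
Proof.
have H : PC 0 (E := R^o) (fun (l : T) (_ : R^o) => posext (1 + b l) `^ m).
  apply: (PC_outer (smooth1_powR 0 m)); first by move=> *; exact: posext_gt0.
  apply: (PC_outer (smooth1_posext R (leq0n 5))); first by [].
  by apply: PC_cst; ctn.
by apply: (ct_comp (PC_cont H) (a := fun l : T => (l, 0))); ctn.
Qed.

Lemma PC_velS : PC 2 velS.
Proof. exact: PC_conj cpw (PC_voltS cb HW HK). Qed.

Lemma velS_eq l p : 0 <= b l <= p.1 ->
  dd et (dd et (velS l)) p - Lap (velS l) p + mu / (1 + p.1) * dd et (velS l) p
    + nu2 / (1 + p.1) ^+ 2 * velS l p = 0.
Proof.
move=> /andP[b0 bp]; apply: conj_eq; first exact: PC_voltS.
  exact: le_trans bp.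
apply: voltS_eq => //.
- by move=> l' q; apply: waveS_eq.
- by move=> s st; exact: kerB_pde.
- by apply: kerB_diag => //; exact: le_trans bp.
(* At s = 0 both the wave and the kernel vanish, so each side of the boundary condition is zero. *)
- by rewrite /W /K waveS0 mul0r kerB_axis// ?mulr0//; exact: le_trans bp.
Qed.

Lemma velS0 l p : p.1 = b l -> velS l p = 0.
Proof.
move=> pb; rewrite /velS /conj /voltS /volt /moving pb subrr oint_aa subr0.
by rewrite /W waveS0 !mulr0.
Qed.

Lemma velS_t0 l p : 0 <= b l -> p.1 = b l -> dd et (velS l) p = phi l p.2.
Proof.
move=> b0 pb; have h2 : - (1 / 2) < p.1 by rewrite pb; lra.
have HV : PC 2 (voltS b W K) by exact: PC_voltS.
rewrite (dvE (conj_t mu _ HV l h2)).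
rewrite (dvE (voltS_t cb HW HK l p)) /voltS /volt /moving pb subrr !oint_aa.
rewrite /W waveS0 waveS_t0//; last exact: PC_S.
rewrite mul0r !subr0 addr0 mulr0 !subr0 weight_id ?(ltW h2)// posext_id; last by lra.
have g : 1 + b l != 0 by rewrite gt_eqF//; lra.
by rewrite pb mulrA -powRD ?g ?implybT// subrr powRr0 mul1r.
Qed.

End InitialVelocity.

Section InitialPosition.
Variable (u0 : V -> R).
Hypothesis Hu0 : PC h.+3 (fun (_ : R) x => u0 x).

Let w := waveS h (fun (_ : R) x => u0 x).
Let W l := dd et (w l).
Let K := ker0 a m.
Let b0 (_ : R) : R := 0.

Let Hw : PC 3 w. Proof. by apply: PC_waveS; rewrite addn3. Qed.
Let HW : PC 2 W. Proof. exact: PC_Dv. Qed.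
Let HK : PC 2 K. Proof. exact: PC_S (PC_ker0 a m). Qed.
Let cb : continuous b0. Proof. exact: ct_cst. Qed.

(** Here the wave is the one with position [u0] and velocity 0, a time derivative of [w]; this is
    the derivative that [u0] must have in excess. *)
Definition posS : R -> E -> R := conj mu (fun=> 1) (voltS b0 W K).

Lemma PC_posS : PC 2 posS.
Proof. by apply: PC_conj; [exact: ct_cst|exact: PC_voltS]. Qed.

Let w_eq l : dd et (dd et (w l)) = Lap (w l).
Proof. by apply/funext => p; apply: waveS_eq => //; exact: PC_S. Qed.

Lemma posS_eq l p : 0 <= p.1 ->
  dd et (dd et (posS l)) p - Lap (posS l) p + mu / (1 + p.1) * dd et (posS l) p
    + nu2 / (1 + p.1) ^+ 2 * posS l p = 0.
Proof.
move=> p0; apply: conj_eq => //; first exact: PC_voltS.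
apply: voltS_eq => //.
- by move=> l' q; rewrite /W w_eq; exact: dvE (Lap_comm l' et q Hw).
- by rewrite /b0 subr0; move=> s st; exact: ker0_pde.
- by rewrite /b0 subr0; exact: ker0_diag.
(* At s = 0 the kernel has zero derivative and W_t = Lap w vanishes, because w is zero at time 0. *)
- rewrite /K ker0_axis// mulr0 /W w_eq /Lap big1 ?mul0r// => i _.
  have E0 (x : V) : dd (ex R i) (w l) (0, x) = 0.
    apply: dvE; apply/dv_lineE; apply: dv_ext (dv_cst 0 _ _) => r.
    by rewrite -[_ + _]/(0 + r * 0, x + r *: delta_mx 0 i) mulr0 addr0 /w waveS0.
  apply: dvE; apply/dv_lineE; apply: dv_ext (dv_cst 0 _ _) => r.
  by rewrite -[_ + _]/(0 + r * 0, p.2 + r *: delta_mx 0 i) mulr0 addr0 E0.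
Qed.

Lemma posS0 l x : posS l (0, x) = u0 x.
Proof.
rewrite /posS /conj /voltS /volt /moving /b0 subrr oint_aa subr0 /W /w waveS_t0//; last first.
  exact: (PC_S (PC_S Hu0)).
by rewrite weight_id /= ?addr0 ?powR1 ?mul1r//; lra.
Qed.

(** One half of the velocity, - m u0, comes from the weight and the other from the kernel, which
    equals m at the origin. This is why the formula feeds u1 + mu u0 to the velocity part. *)
Lemma posS_t0 l x : dd et (posS l) (0, x) = - mu * u0 x.
Proof.
have h2 : - (1 / 2) < (0, x).1 :> R by rewrite /=; lra.
have HV : PC 2 (voltS b0 W K) by exact: PC_voltS.
rewrite (dvE (conj_t mu _ HV l h2)) (dvE (voltS_t cb HW HK l (0, x))).
rewrite /voltS /volt /moving /b0 subrr !oint_aa weight_id ?(ltW h2)//=.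
have -> : dd et (W l) (0, x) = 0.
  rewrite /W w_eq /Lap big1// => i _.
  have E0 (y : V) : dd (ex R i) (w l) (0, y) = 0.
    apply: dvE; apply/dv_lineE; apply: dv_ext (dv_cst 0 _ _) => r.
    by rewrite -[_ + _]/(0 + r * 0, y + r *: delta_mx 0 i) mulr0 addr0 /w waveS0.
  apply: dvE; apply/dv_lineE; apply: dv_ext (dv_cst 0 _ _) => r.
  by rewrite -[_ + _]/(0 + r * 0, x + r *: delta_mx 0 i) mulr0 addr0 E0.
have -> : W l (0, x) = u0 x by rewrite /W /w waveS_t0//; exact: (PC_S (PC_S Hu0)).
have -> : K l (0, 0) = m.
  have [HO X1] := @Om_diag R 0 0 ltac:(lra) ltac:(lra); rewrite subr0 in HO X1.
  rewrite /K /ker0 /slice (riemG_b _ HO) (riemG_Om _ HO) X1 leg1 (dleg1 a_kap) /=; by field.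
by rewrite addr0 powR1; field.
Qed.

End InitialPosition.
End Components.

(** * Duhamel's principle for the source term *)

Section Duhamel.
Variables (R : realType) (n : nat) (mu nu2 : R).
Local Notation V := 'rV[R]_n.
Local Notation E := (R * V)%type.
Local Notation et := (et R n).
Implicit Types (p v w : E).

Definition telegraph (F : E -> R) p : R :=
  dd et (dd et F) p - Lap F p + mu / (1 + p.1) * dd et F p + nu2 / (1 + p.1) ^+ 2 * F p.

Variables (U : R -> E -> R) (phi : R -> V -> R).
Hypothesis HU : PC 2 U.
Hypothesis U_eq : forall s p, 0 <= s <= p.1 -> telegraph (U s) p = 0.
Hypothesis U0 : forall s p, p.1 = s -> U s p = 0.
Hypothesis Ut0 : forall s p, 0 <= s -> p.1 = s -> dd et (U s) p = phi s p.2.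

Definition duhamel p : R := oint 0 p.1 (fun s => U s p).

Let zero (_ : R) : R := 0.
Let cz : continuous zero. Proof. exact: ct_cst. Qed.

Let P1U : PC 1 (fun ls : R * R => U ls.2).
Proof. by apply: (PC_reparam (r := snd)) (PC_S HU); ctn. Qed.

(** The boundary term is absent because [U s] vanishes at its own starting time s. *)
Lemma duhamel_dv p v : is_derive p v duhamel (oint 0 p.1 (fun s => dd v (U s) p)).
Proof.
have := moving_dv (0 : R) p v cz P1U; rewrite /moving /zero /= subr0 U0// mulr0 add0r.
by apply: dv_ext => q; rewrite subr0.
Qed.

Let PDU : PC 1 (fun (lvs : (R * E) * R) p => dd lvs.1.2 (U lvs.2) p).
Proof.
by apply: (PC_reparam (r := fun lvs : (R * E) * R => (lvs.2, lvs.1.2))) (PC_D HU); ctn.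
Qed.

Let zero2 (_ : R * E) : R := 0.
Let cz2 : continuous zero2. Proof. exact: ct_cst. Qed.

(** This time the boundary term survives: in the time direction it is the initial velocity of
    [U p.1], that is, the source. *)
Lemma duhamel_dv2 p v w : is_derive p w (dd v duhamel)
  (w.1 * dd v (U p.1) p + oint 0 p.1 (fun s => dd w (dd v (U s)) p)).
Proof.
rewrite (funext (fun q => dvE (duhamel_dv q v))).
have := moving_dv ((0, v) : R * E) p w cz2 PDU; rewrite /moving /zero2 /= subr0.
by apply: dv_ext => q; rewrite subr0.
Qed.

Lemma PC_duhamel (T : topologicalType) : PC 2 (fun (_ : T) p => duhamel p).
Proof.
suff H : PC 2 (fun (_ : R) p => duhamel p).
  by apply: (PC_reparam (r := fun _ : T => 0 : R)) H; exact: ct_cst.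
have c0 : continuous (fun q : R * E => duhamel q.2).
  rewrite (_ : (fun q => _) = fun q => moving zero (fun ls : R * R => U ls.2) q.1 q.2).
    exact: (ct_moving cz (PC_S P1U)).
  by apply/funext => q; rewrite /moving /zero subr0.
split=> //; exists (fun lv p => oint 0 p.1 (fun s => dd lv.2 (U s) p)).
  by move=> l v p; exact: duhamel_dv.
have M : continuous (fun q : (R * E) * E => oint 0 q.2.1 (fun s => dd q.1.2 (U s) q.2)).
  rewrite (_ : (fun q => _) = fun q => moving zero2
    (fun (lvs : (R * E) * R) p => dd lvs.1.2 (U lvs.2) p) q.1 q.2).
    exact: (ct_moving cz2 (PC_S PDU)).
  by apply/funext => q; rewrite /moving /zero2 subr0.
split=> //; exists (fun lvw p => lvw.2.1 * dd lvw.1.2 (U p.1) p + oint 0 p.1 (fun s => dd lvw.2 (dd lvw.1.2 (U s)) p)).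
  move=> [l v] w p /=; have := duhamel_dv2 p v w.
  by rewrite (funext (fun q => dvE (duhamel_dv q v))).
split=> //; apply: ct_add.
  apply: ct_mul; first by ctn.
  by apply: (ct_comp (PC_cont PDU) (a := fun q : ((R * E) * E) * E => (((0, q.1.1.2), q.2.1), q.2))); ctn.
have PDDU : PC 0 (fun (lvs : ((R * E) * E) * R) p => dd lvs.1.2 (dd lvs.1.1.2 (U lvs.2)) p).
  apply: (PC_reparam (r := fun lvs : ((R * E) * E) * R => ((lvs.1.1, lvs.2), lvs.1.2))) (PC_D PDU); ctn.
have cz3 : continuous (fun _ : (R * E) * E => 0 : R) by exact: ct_cst.
rewrite (_ : (fun q => _) = fun q => moving (fun _ : (R * E) * E => 0)
  (fun (lvs : ((R * E) * E) * R) p => dd lvs.1.2 (dd lvs.1.1.2 (U lvs.2)) p) q.1 q.2).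
  exact: (ct_moving cz3 PDDU).
by apply/funext => q; rewrite /moving subr0.
Qed.

Lemma duhamel_eq p : 0 <= p.1 -> telegraph duhamel p = phi p.1 p.2.
Proof.
move=> p0; rewrite /telegraph (dvE (duhamel_dv2 p et et)) (dvE (duhamel_dv p et)).
have -> : Lap duhamel p = oint 0 p.1 (fun s => Lap (U s) p).
  rewrite /Lap oint_sum; last first.
    move=> i; have H : PC 0 (fun s => dd (ex R i) (dd (ex R i) (U s))) by apply: PC_Dv; exact: PC_Dv.
    by apply: (ct_comp (PC_cont H) (a := fun s : R => (s, p))); ctn.
  by apply: eq_bigr => i _; rewrite (dvE (duhamel_dv2 p _ _)) [(ex R i).1]/= mul0r add0r.
rewrite [et.1]/= mul1r Ut0// /duhamel.
have cs (G : R -> E -> R) : PC 0 G -> continuous (fun s => G s p).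
  by move=> HG; apply: (ct_comp (PC_cont HG) (a := fun s : R => (s, p))); ctn.
have c0 : continuous (fun s => U s p) by apply: cs; exact: PC_S (PC_S HU).
have c1 : continuous (fun s => dd et (U s) p) by apply: (cs (fun s => dd et (U s))); exact: PC_S (PC_Dv et HU).
have c2 : continuous (fun s => dd et (dd et (U s)) p).
  by apply: (cs (fun s => dd et (dd et (U s)))); apply: PC_Dv; exact: PC_Dv.
have c3 : continuous (fun s => Lap (U s) p) by apply: (cs (fun s => Lap (U s))); exact: PC_Lap.
have c4 : continuous (fun s => dd et (dd et (U s)) p - Lap (U s) p) by exact: ct_sub.
have c5 : continuous (fun s => mu / (1 + p.1) * dd et (U s) p) by apply: ct_mul => //; exact: ct_cst.
have c6 : continuous (fun s => nu2 / (1 + p.1) ^+ 2 * U s p) by apply: ct_mul => //; exact: ct_cst.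
have c7 := ct_add c4 c5.
have : oint 0 p.1 (fun s => telegraph (U s) p) = 0.
  rewrite -[RHS](mul0r (p.1 - 0)) -oint_cst.
  by apply: eq_oint => s; rewrite min_l// max_r// => sp; exact: U_eq.
rewrite /telegraph (oint_add _ _ c7 c6) (oint_add _ _ c4 c5) (oint_sub _ _ c2 c3) (oint_scale _ _ _ c1) (oint_scale _ _ _ c0) => Z.
by rewrite -[RHS]addr0 -[X in _ = _ + X]Z !addrA.
Qed.

End Duhamel.

Section TelegraphSum.
Variables (R : realType) (n : nat) (mu nu2 : R).
Local Notation V := 'rV[R]_n.
Local Notation E := (R * V)%type.

Lemma telegraphD (F G : E -> R) p : PC 2 (fun _ : R => F) -> PC 2 (fun _ : R => G) ->
  telegraph mu nu2 (fun q => F q + G q) p = telegraph mu nu2 F p + telegraph mu nu2 G p.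
Proof.
move=> HF HG.
have D1 v : dd v (fun q => F q + G q) = fun q => dd v F q + dd v G q.
  by apply/funext => q; exact: dvE (dv_add (PC_isD (0 : R) v q (PC_S HF)) (PC_isD (0 : R) v q (PC_S HG))).
have D2 v w : dd w (dd v (fun q => F q + G q)) p = dd w (dd v F) p + dd w (dd v G) p.
  by rewrite D1; exact: dvE (dv_add (PC_isD (0 : R) w p (PC_Dv v HF)) (PC_isD (0 : R) w p (PC_Dv v HG))).
rewrite /telegraph !D2 D1 (_ : Lap (fun q => F q + G q) p = Lap F p + Lap G p).
  by ring.
by rewrite /Lap -big_split; apply: eq_bigr => i _; exact: D2.
Qed.

End TelegraphSum.

Section ClassicalForm.
Variables (R : realType) (n : nat) (mu nu2 : R).
Local Notation V := 'rV[R]_n.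
Local Notation E := (R * V)%type.
Local Notation et := (et R n).

Lemma dv_time (F : E -> R) (t : R) (x : V) d : is_derive (t, x) et F d <-> is_derive t 1 (fun s : R => F (s, x)) d.
Proof.
have E0 h : (t, x) + h *: et = (t + h *: 1, x) :> E.
  by rewrite -[LHS]/(t + h * 1, x + h *: 0) scaler0 addr0.
split=> /dv_lineE H; apply/dv_lineE; apply: dv_ext H => h; by rewrite E0.
Qed.

Lemma dv_space (F : E -> R) (t : R) (x y : V) d : is_derive (t, x) (0, y) F d <-> is_derive x y (fun z => F (t, z)) d.
Proof.
have E0 h : (t, x) + h *: (0, y) = (t, x + h *: y) :> E.
  by rewrite -[LHS]/(t + h * 0, x + h *: y) mulr0 addr0.
split=> /dv_lineE H; apply/dv_lineE; apply: dv_ext H => h; by rewrite E0.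
Qed.

Lemma telegraph_classical (F : E -> R) (f : R -> V -> R) (u0 u1 : V -> R) : PC 2 (fun _ : R => F) ->
  (forall p, 0 <= p.1 -> telegraph mu nu2 F p = f p.1 p.2) ->
  (forall x, F (0, x) = u0 x) -> (forall x, dd et F (0, x) = u1 x) ->
  classical_solution mu nu2 f u0 u1 (fun t x => F (t, x)).
Proof.
move=> HF eqF F0 Ft0; have HF1 := PC_S HF.
have dF v p := PC_isD (0 : R) v p HF1.
split.
- have H := PC_Ck (0 : R) (half_space (n := n)) HF.
  rewrite (_ : (fun p => _) = F) //; by apply/funext => -[].
- move=> t x t0; rewrite -(eqF (t, x)) /=; last exact: ltW.
  have E1 : derive1 (fun s : R => F (s, x)) = fun s : R => dd et F (s, x).
    by apply/funext => s; rewrite derive1E -ddE; apply: dvE; apply/dv_time; exact: dF.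
  rewrite /telegraph !E1 derive1E -ddE.
  have -> : dd (1 : R) (fun s : R => dd et F (s, x)) t = dd et (dd et F) (t, x).
    by apply: dvE; apply/dv_time; exact: (PC_isD (0 : R) _ _ (PC_Dv et HF)).
  congr (_ - _ + _ + _); apply: eq_bigr => i _.
  have E2 : 'D_(delta_mx 0 i) (fun z => F (t, z)) = fun z => dd (ex R i) F (t, z).
    by apply/funext => z; rewrite -ddE; apply: dvE; apply/dv_space; exact: dF.
  rewrite E2 -ddE; apply: dvE; apply/dv_space.
  exact: (PC_isD (0 : R) _ _ (PC_Dv (ex R i) HF)).
- by move=> x; exact: F0.
- move=> x; rewrite -Ft0; have /dv_time/dvP H := dF et (0, x).
  apply/cvgrPdist_le => e e0; have := H e e0; rewrite !near_withinE; apply: filterS => r hr r0.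
  have := hr (lt0r_neq0 r0); rewrite add0r -[r%:A]/(r * 1) mulr1.
  by rewrite distrC.
Qed.

End ClassicalForm.

(** * Uniqueness *)

Section LeibnizRule.
Variables (R : realType) (E : normedModType R).

(** The end point may be any differentiable function, here for the radius Tm - e^s of the shrinking
    ball. It is the chain rule [dv_curve] for the integral viewed as a function of end point and
    parameter. *)
Theorem leibniz (U : R -> E -> R) (beta : E -> R) (p v : E) (d : R) : PC 1 U ->
  is_derive p v beta d ->
  is_derive p v (fun q => oint 0 (beta q) (fun s => U s q))
    (d * U (beta p) p + oint 0 (beta p) (fun s => dd v (U s) p)).
Proof.
move=> HU Hb.
pose F (r : R * E) : R := oint 0 r.1 (fun s => U s r.2).
pose D (w : R * E) (r : R * E) : R := w.1 * U r.1 r.2 + oint 0 r.1 (fun s => dd w.2 (U s) r.2).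
have cU q : continuous (fun s => U s q).
  by apply: (ct_comp (PC_cont HU) (a := fun s : R => (s, q))); ctn.
have HD := PC_D HU.
have c1 (w : R * E) : continuous (fun r : R * E => w.1 * U r.1 r.2).
  apply: ct_mul; first by ctn.
  by apply: (ct_comp (PC_cont HU) (a := fun r : R * E => (r.1, r.2))); ctn.
have c2 (w : R * E) : continuous (fun r : R * E => oint 0 r.1 (fun s => dd w.2 (U s) r.2)).
  apply: (@continuous_oint_end R (R * E)%type (fun r s => dd w.2 (U s) r.2) (fun=> 0) (fun r => r.1)).
  - by apply: (ct_comp (PC_cont HD) (a := fun q : (R * E) * R => ((q.2, w.2), q.1.2))); ctn.
  - by ctn.
  - by ctn.
have D1 w r : is_derive r ((w.1, 0) : R * E) F (w.1 * U r.1 r.2).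
  have := dv_scaledir w.1 (oint0_derive r.1 (cU r.2)) => /dv_lineE H.
  apply/dv_lineE; apply: dv_ext H => h.
  rewrite /F -[(r + h *: _).1]/(r.1 + h * w.1) -[(r + h *: _).2]/(r.2 + h *: 0).
  by rewrite scaler0 addr0 -[w.1 *: 1]/(w.1 * 1) mulr1.
have D2 (w r : R * E) : is_derive r ((0, w.2) : R * E) F (oint 0 r.1 (fun s => dd w.2 (U s) r.2)).
  have HU2 : PC 1 (fun ls : R * R => U ls.2) by apply: (PC_reparam (r := snd)) HU; ctn.
  have := PC_oint_derive (F := fun ls : R * R => U ls.2) (dF := fun lsv p => dd lsv.2 (U lsv.1.2) p)
    0 r.1 0 w.2 r.2 HU2 (fun ls v p => PC_isD ls v p HU2) => /dv_lineE H.
  apply/dv_lineE; apply: dv_ext H => h.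
  rewrite /F -[(r + h *: _).1]/(r.1 + h * 0) -[(r + h *: _).2]/(r.2 + h *: w.2).
  by rewrite mulr0 addr0.
have DF (w r : R * E) : is_derive r w F (D w r).
  have -> : w = (w.1, 0) + (0, w.2).
    by rewrite -[RHS]/(w.1 + 0, 0 + w.2) addr0 add0r; case: w.
  have N1 : \forall q \near r, is_derive q ((w.1, 0) : R * E) F (w.1 * U q.1 q.2).
    by near=> q; exact: D1.
  have N2 : \forall q \near r, is_derive q ((0, w.2) : R * E) F (oint 0 q.1 (fun s => dd w.2 (U s) q.2)).
    by near=> q; exact: D2.
  apply: dv_eq (dv_diradd N1 N2 (c1 w _) (c2 w _)) _.
  by rewrite /D -[((w.1, 0) + (0, w.2)).1]/(w.1 + 0) -[((w.1, 0) + (0, w.2)).2]/(0 + w.2) addr0 add0r.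
have cD : continuous (fun q : (R * E) * (R * E) => D q.1 q.2).
  apply: ct_add.
    apply: ct_mul; first by ctn.
    by apply: (ct_comp (PC_cont HU) (a := fun q : (R * E) * (R * E) => (q.2.1, q.2.2))); ctn.
  apply: (@continuous_oint_end R ((R * E) * (R * E))%type (fun r s => dd r.1.2 (U s) r.2.2) (fun=> 0) (fun r => r.2.1)).
  - by apply: (ct_comp (PC_cont HD) (a := fun q : ((R * E) * (R * E)) * R => ((q.2, q.1.1.2), q.1.2.2))); ctn.
  - by ctn.
  - by ctn.
move/dv_lineE : Hb => Hb; apply/dv_lineE.
pose g (h : R) : R * E := beta (p + h *: v) *: (1, 0) + ((0, p) + h *: (0, v)).
have gE h : g h = (beta (p + h *: v), p + h *: v).
  rewrite -[LHS]/(beta (p + h *: v) * 1 + (0 + h * 0), beta (p + h *: v) *: 0 + (p + h *: v)).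
  by rewrite mulr1 mulr0 !addr0 scaler0 add0r.
have Hg : is_derive (0 : R) 1 g (d *: (1, 0) + (0 + 1 *: (0, v))).
  have H0 : is_derive (0 : R) 1 (fun _ : R => (0, p) : R * E) 0.
    exact: (@is_derive_cst R (R^o) (R * E)%type).
  exact: (dv_addv (dv_scalev _ Hb) (dv_addv H0 (dv_scalev _ (dv_id (0 : R))))).
have := dv_curve DF cD Hg; rewrite gE scale0r addr0 => H.
have E1 : d *: (1, 0) + (0 + 1 *: (0, v)) = (d, v) :> R * E.
  rewrite -[LHS]/(d * 1 + (0 + 1 * 0), d *: 0 + (0 + 1 *: v)).
  by rewrite mulr1 mulr0 !addr0 scaler0 !add0r scale1r.
rewrite E1 in H.
by apply: dv_ext H => h; rewrite /F gE.
Unshelve. all: by end_near. Qed.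

End LeibnizRule.

(** * Classical solutions in logarithmic time *)

Section LogTime.
Variables (R : realType) (n : nat) (mu nu2 : R).
Local Notation V := 'rV[R]_n.
Local Notation E := (R * V)%type.
Local Notation et := (et R n).
Variables (f : R -> V -> R) (u0 u1 : V -> R) (v : R -> V -> R).
Hypothesis sol : classical_solution mu nu2 f u0 u1 v.

Definition logt (p : E) : R := v (expR p.1) p.2.

Lemma PC_logt (T : topologicalType) : PC 2 (fun _ : T => logt).
Proof. by case: sol => H _ _ _; exact: (Ck_half_exp_PC T H). Qed.

(** The continuous extension [h] of the time derivative to t = 0 and the one-sided derivative [u1]
    are separate data of a classical solution; the mean value theorem on a short interval from 0
    shows that they agree. *)
Lemma time_derivative : exists h : E -> R,
  [/\ continuous (fun p : E => h (Num.max p.1 0, p.2)),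
      forall (t : R) (x : V), 0 < t -> is_derive t 1 (v ^~ x) (h (t, x))
    & forall x, h (0, x) = u1 x].
Proof.
have [C _ _ lim1] := sol; move: (C) => [Cc /(_ et)[h Hh dh]]; exists h.
have D (t : R) x : 0 < t -> is_derive t 1 (v ^~ x) (h (t, x)).
  by move=> t0; apply/(dv_time (fun p => v p.1 p.2)); apply: dh; exact: half_space_interior.
have ch : continuous (fun p : E => h (Num.max p.1 0, p.2)).
  case: Hh => ch _; apply: (within_comp ch).
    by apply: ct_pair; [apply: ct_maxr|]; ctn.
  by move=> p; rewrite /half_space/= le_max lexx orbT.
split=> // x; apply/eqP; rewrite -subr_eq0 -normr_le0; apply/ler_addgt0Pr => e e0.
rewrite add0r; have e2 : 0 < e / 2 by rewrite divr_gt0.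
have ch0 : continuous (fun t : R => h (Num.max t 0, x)).
  by apply: (ct_comp ch (a := fun t : R => (t, x))); ctn.
have /cvgrPdist_le/(_ _ e2) := ch0 0; rewrite maxxx => /nbhs_ballP[r /= r0 Hr].
have /cvgrPdist_le/(_ _ e2) := lim1 x; rewrite near_withinE => /nbhs_ballP[s /= s0 Hs].
pose t := Num.min r s / 2.
have t0 : 0 < t by rewrite divr_gt0// lt_min r0.
have tr : t < r by rewrite ltr_pdivrMr// (@le_lt_trans _ _ r)// ?ge_min ?lexx// mulr_natr mulr2n ltrDl.
have ts : t < s by rewrite ltr_pdivrMr// (@le_lt_trans _ _ s)// ?ge_min ?lexx ?orbT// mulr_natr mulr2n ltrDl.
have cv : continuous (fun t : R => v (Num.max t 0) x).
  have Cv := within_comp Cc; apply: (Cv _ (fun t : R => (Num.max t 0, x))).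
    by apply: ct_pair; [apply: ct_maxr|]; ctn.
  by move=> y; rewrite /half_space/= le_max lexx orbT.
have [c] : exists2 c, c \in `]0, t[%R & v (Num.max t 0) x - v (Num.max 0 0) x = h (c, x) * (t - 0).
  apply: (@MVT R (fun t => v (Num.max t 0) x)) => //.
    move=> y; rewrite in_itv/= => /andP[y0 _]; apply: near_dv (D y x y0).
    near=> z; rewrite max_l//; apply: ltW; near: z; exact: lt_nbhsr.
  exact: continuous_subspaceT.
rewrite in_itv/= => /andP[c0 ct]; rewrite maxxx max_l ?(ltW t0)// subr0 => Ec.
have h1 : `|u1 x - h (c, x)| <= e / 2.
  have := Hs t; rewrite /ball/= sub0r normrN gtr0_norm// => /(_ ts t0).
  by rewrite Ec mulrCA mulVf ?mulr1// gt_eqF.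
have h2 : `|h (0, x) - h (c, x)| <= e / 2.
  have := Hr c; rewrite /ball/= sub0r normrN gtr0_norm// => /(_ (lt_trans ct tr)).
  by rewrite max_l// ltW.
have -> : h (0, x) - u1 x = (h (0, x) - h (c, x)) - (u1 x - h (c, x)) by ring.
by apply: (le_trans (ler_normB _ _)); rewrite [leRHS](splitr e) lerD.
Unshelve. all: by end_near. Qed.

Lemma logt_t (h : E -> R) (p : E) : (forall (t : R) (x : V), 0 < t -> is_derive t 1 (v ^~ x) (h (t, x))) ->
  dd et logt p = expR p.1 * h (expR p.1, p.2).
Proof.
move=> H; apply: dvE; case: p => s x; apply/dv_time; rewrite /logt /=.
by apply: dv_eq (dv_comp (H _ x (expR_gt0 s)) (is_derive_expR s)) _; rewrite mulrC.
Qed.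

(** With s = log t one has t v_t = D_s and t^2 v_tt = D_ss - D_s; the equation is multiplied by
    t^2. *)
Lemma logt_eq (p : E) : let t := expR p.1 in
  dd et (dd et logt) p - dd et logt p - t ^+ 2 * Lap logt p + mu * t / (1 + t) * dd et logt p
    + nu2 * t ^+ 2 / (1 + t) ^+ 2 * logt p = t ^+ 2 * f t p.2.
Proof.
move=> t; have t0 : 0 < t by exact: expR_gt0.
have [_ /(_ t p.2 t0) eqv _ _] := sol.
have HP := PC_logt R; have HP1 := PC_S HP.
have lnt : ln t = p.1 by rewrite /t expRK.
have D1 (s : R) : 0 < s -> is_derive s 1 (v ^~ p.2) (dd et logt (ln s, p.2) / s).
  move=> s0; apply: (near_dv (F := fun y => logt (ln y, p.2))).
    by near=> y; rewrite /logt /= lnK// posrE; near: y; exact: lt_nbhsr.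
  have H : is_derive (ln s) 1 (fun z : R => logt (z, p.2)) (dd et logt (ln s, p.2)).
    by apply/dv_time; exact: (PC_isD (0 : R) _ _ HP1).
  exact: dv_comp H (is_derive1_ln s0).
have E1 (s : R) : 0 < s -> derive1 (v ^~ p.2) s = dd et logt (ln s, p.2) / s.
  by move=> s0; rewrite derive1E; have [_ ->] := D1 s s0.
have E2 : derive1 (derive1 (v ^~ p.2)) t = (dd et (dd et logt) p - dd et logt p) / t ^+ 2.
  rewrite derive1E -ddE; apply: dvE.
  apply: (near_dv (F := fun y => dd et logt (ln y, p.2) * y^-1)).
    by near=> y; rewrite E1//; near: y; exact: lt_nbhsr.
  have H : is_derive (ln t) 1 (fun z : R => dd et logt (z, p.2)) (dd et (dd et logt) (ln t, p.2)).
    by apply/dv_time; exact: (PC_isD (0 : R) _ _ (PC_Dv et HP)).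
  have tn : t != 0 by rewrite gt_eqF.
  apply: (dv_eq (dv_mul (dv_comp H (is_derive1_ln t0)) (dv_inv (F := fun y : R => y) tn (dv_id t)))).
  rewrite lnt -surjective_pairing; move: (dd et (dd et logt) p) (dd et logt p) => A B.
  by clearbody t; field.
have E3 : laplacian (v t) p.2 = Lap logt p.
  apply: eq_bigr => i _.
  have E4 : 'D_(delta_mx 0 i) (v t) = fun z => dd (ex R i) logt (p.1, z).
    apply/funext => z; rewrite -ddE; apply: dvE; apply/(dv_space logt).
    exact: (PC_isD (0 : R) _ _ HP1).
  rewrite E4 -ddE; apply: dvE; apply/dv_space; rewrite -surjective_pairing.
  exact: (PC_isD (0 : R) _ _ (PC_Dv (ex R i) HP)).
have Ev : v t p.2 = logt p by [].
rewrite E2 E3 E1// lnt -surjective_pairing Ev in eqv.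
rewrite -eqv; move: (dd et (dd et logt) p) (dd et logt p) (Lap logt p) (logt p) => A B L Z.
clearbody t; field; apply/andP; split; lra.
Unshelve. all: by end_near. Qed.

End LogTime.

Section ContinuousFunctions.
Variable R : realType.

Lemma right_limit0 (g : R -> R) (r : R) : continuous g -> 0 < r ->
  (forall s, 0 < s < r -> g s = 0) -> g 0 = 0.
Proof.
move=> cg r0 H; apply/eqP; apply/negPn/negP => h0.
have /cvgrPdist_lt/(_ `|g 0|) := cg 0; rewrite normr_gt0 => /(_ h0).
move=> /nbhs_ballP[e /= e0 He].
pose s := Num.min e r / 2.
have s0 : 0 < s by rewrite divr_gt0// lt_min e0.
have se : s < e by rewrite ltr_pdivrMr// (@le_lt_trans _ _ e)// ?ge_min ?lexx// mulr_natr mulr2n ltrDl.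
have sr : s < r by rewrite ltr_pdivrMr// (@le_lt_trans _ _ r)// ?ge_min ?lexx ?orbT// mulr_natr mulr2n ltrDl.
have := He s; rewrite /ball/= sub0r normrN gtr0_norm// => /(_ se).
have E0 : g s = 0 by apply: H; rewrite s0.
by rewrite E0 subr0 ltxx.
Qed.

Lemma oint_eq0_ge0 (g : R -> R) (r : R) : continuous g -> (forall s, 0 <= s <= r -> 0 <= g s) ->
  oint 0 r g = 0 -> forall s, 0 < s < r -> g s = 0.
Proof.
move=> cg g0 I0 s /andP[s0 sr].
have A0 (x : R) : 0 < x < r -> oint 0 x g = 0.
  move=> /andP[x0 xr].
  have h1 : 0 <= oint 0 x g by apply: oint_ge0 => [|y /andP[y0 yx]]; [exact: ltW|apply: g0; rewrite y0/=; lra].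
  have h2 : 0 <= oint x r g by apply: oint_ge0 => [|y /andP[y0 yx]]; [exact: ltW|apply: g0; lra].
  by have := oint_cat 0 x r cg; rewrite I0; lra.
apply: (dv_unique (oint0_derive s cg)); apply: near_dv (dv_cst 0 s 1); near=> x.
by rewrite A0//; apply/andP; split; near: x; [exact: lt_nbhsr|exact: lt_nbhsl].
Unshelve. all: by end_near. Qed.

Lemma nonincr (g dg : R -> R) (x y : R) : x <= y -> (forall s : R, is_derive s 1 g (dg s)) ->
  (forall s, x <= s <= y -> dg s <= 0) -> g y <= g x.
Proof.
move=> xy D H.
have D1 (s : R) : 0 <= s <= 1 -> is_derive s 1 (fun s : R => g (x + s * (y - x))) (dg (x + s * (y - x)) * (y - x)).
  move=> _; have h1 : is_derive s 1 (fun s : R => x + s * (y - x)) (y - x).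
    by apply: dv_eq (dv_add (dv_cst x s 1) (dv_mul (dv_id s) (dv_cst (y - x) s 1))) _; rewrite mul1r mulr0 addr0 add0r.
  exact: (dv_comp (F := fun s : R => x + s * (y - x)) (D _) h1).
have [c /andP[c0 c1]] := MVT01 D1.
rewrite mul1r mul0r addr0 (addrC x) subrK => E.
have : dg (x + c * (y - x)) * (y - x) <= 0.
  apply: mulr_le0_ge0; last by rewrite subr_ge0.
  by apply: H; nra.
by rewrite -E subr_le0.
Qed.

End ContinuousFunctions.

(** * Energy estimate in a light cone *)

Section Energy.
Variables (R : realType) (n : nat) (mu nu2 : R).
Hypotheses (n0 : (0 < n)%N) (mu0 : 0 <= mu) (nu0 : 0 <= nu2).
Local Notation V := 'rV[R]_n.
Local Notation E := (R * V)%type.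
Local Notation E2 := (R * R)%type.
Local Notation et := (et R n).
Local Notation f1 := (f1 R).
Local Notation f2 := (f2 R).
Variables (D : E -> R) (w h : R -> V -> R).
Hypothesis PD : PC 2 (fun _ : R => D).
Hypothesis D_eq : forall p, let t := expR p.1 in
  dd et (dd et D) p - dd et D p - t ^+ 2 * Lap D p + mu * t / (1 + t) * dd et D p
    + nu2 * t ^+ 2 / (1 + t) ^+ 2 * D p = 0.
Hypothesis Pw : PC 1 w.
Hypothesis Dw : forall p, D p = w (expR p.1) p.2.
Hypothesis w0 : forall x, w 0 x = 0.
Hypothesis ch : continuous (fun p : E => h p.1 p.2).
Hypothesis Dh : forall p, dd et D p = expR p.1 * h (expR p.1) p.2.
Hypothesis h0 : forall x, h 0 x = 0.
Variable x0 : V.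

(** The average around the fixed centre [x0], as a function of logarithmic time and radius only. *)
Definition radial (q : E2) : R := hemiL (fun y : V => D (q.1, x0 + q.2 *: y)).
Local Notation B := radial.

Lemma PC_radial_integrand k (T T' : topologicalType) (F : T -> E -> R) (r : T' -> T) (a : T' -> V) :
  continuous r -> continuous a -> PC k F ->
  PC k (fun l (q : E2) => F (r l) (q.1, x0 + q.2 *: a l)).
Proof.
move=> cr ca HF.
have c1 : continuous (fun q : T' * E2 => a q.1) by apply: (ct_comp ca); ctn.
apply: (PC_affine (r := r) (A := fun l (q : E2) => (q.1, x0 + q.2 *: a l) : E)
  (B := fun l (q : E2) => (q.1, q.2 *: a l) : E) cr _ _ _ HF).
- by apply: ct_pair; [ctn|apply: ct_addE; ctn].
- by apply: ct_pair; ctn.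
move=> l q s v; rewrite -[RHS]/(q.1 + s * v.1, x0 + q.2 *: a l + s *: (v.2 *: a l)).
rewrite -[(q + s *: v).1]/(q.1 + s * v.1) -[(q + s *: v).2]/(q.2 + s * v.2).
by rewrite scalerA scalerDl addrA.
Qed.

Lemma radial_line (F : E -> R) (q v : E2) (y : V) d :
  is_derive (q.1, x0 + q.2 *: y) (v.1, v.2 *: y) F d ->
  is_derive q v (fun q : E2 => F (q.1, x0 + q.2 *: y)) d.
Proof.
move=> /dv_lineE H; apply/dv_lineE; apply: dv_ext H => s; congr F.
rewrite -[LHS]/(q.1 + s * v.1, x0 + q.2 *: y + s *: (v.2 *: y)).
rewrite -[(q + s *: v).1]/(q.1 + s * v.1) -[(q + s *: v).2]/(q.2 + s * v.2).
by rewrite scalerA scalerDl addrA.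
Qed.

Lemma PC_radial : PC 2 (fun _ : R => B).
Proof.
apply: (PC_hemiL (F := fun (ly : R * V) (q : E2) => D (q.1, x0 + q.2 *: ly.2))).
by apply: (PC_radial_integrand (r := fst) (a := snd)) PD; ctn.
Qed.

Lemma radial_dd q v : dd v B q = hemiL (fun y : V => dd (v.1, v.2 *: y) D (q.1, x0 + q.2 *: y)).
Proof.
apply: dvE.
apply: (PC_hemiL_derive (F := fun (ly : R * V) (q : E2) => D (q.1, x0 + q.2 *: ly.2))
  (dF := fun lyv q => dd (lyv.2.1, lyv.2.2 *: lyv.1.2) D (q.1, x0 + q.2 *: lyv.1.2)) (0 : R)).
  by apply: (PC_radial_integrand (r := fst) (a := snd)) (PC_S PD); ctn.
by move=> [l y] v' q' /=; apply: radial_line; exact: (PC_isD (0 : R) _ _ (PC_S PD)).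
Qed.

Lemma radial_dd2 q v u : dd u (dd v B) q =
  hemiL (fun y : V => dd (u.1, u.2 *: y) (dd (v.1, v.2 *: y) D) (q.1, x0 + q.2 *: y)).
Proof.
rewrite (funext (fun q => radial_dd q v)); apply: dvE.
have H1 := PC_D PD.
apply: (PC_hemiL_derive (F := fun (ly : R * V) (q : E2) => dd (v.1, v.2 *: ly.2) D (q.1, x0 + q.2 *: ly.2))
  (dF := fun lyv q => dd (lyv.2.1, lyv.2.2 *: lyv.1.2) (dd (v.1, v.2 *: lyv.1.2) D) (q.1, x0 + q.2 *: lyv.1.2)) (0 : R)).
  by apply: (PC_radial_integrand (r := fun ly : R * V => (0 : R, (v.1, v.2 *: ly.2))) (a := snd)) H1; ctn.
move=> [l y] v' q' /=; apply: (radial_line (F := dd (v.1, v.2 *: y) D)).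
exact: (PC_isD ((0 : R), (v.1, v.2 *: y)) _ _ H1).
Qed.

Local Notation B1 := (dd f1 B).
Local Notation B2 := (dd f2 B).

Let e1E (y : V) : (f1.1, f1.2 *: y) = et. Proof. by rewrite /f1 /= scale0r. Qed.
Let e2E (y : V) : (f2.1, f2.2 *: y) = (0, y) :> E. Proof. by rewrite /f2 /= scale1r. Qed.

(** Averaging commutes with time derivatives and turns the Laplacian into B_rr + (n/r) B_r by
    [EPD_sphm]; the factor [r] avoids the division. *)
Lemma radial_eq (s r : R) : let t := expR s in
  r * (dd f1 B1 (s, r) - B1 (s, r) + mu * t / (1 + t) * B1 (s, r) + nu2 * t ^+ 2 / (1 + t) ^+ 2 * B (s, r))
  = t ^+ 2 * (r * dd f2 B2 (s, r) + n%:R * B2 (s, r)).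
Proof.
move=> t; pose phi (l : R) (x : V) := D (l, x).
have Pphi : PC 2 phi.
  apply: (PC_affine (r := fun _ : R => 0 : R) (A := fun (l : R) (x : V) => (l, x) : E)
    (B := fun (_ : R) (x : V) => (0, x) : E) _ _ _ _ PD); try by ctn.
  by move=> l p g v; rewrite -[RHS]/(l + g * 0, p + g *: v) mulr0 addr0.
have dphi k (F : E -> R) l x y : PC k.+1 (fun _ : R => F) -> dd y (fun z => F (l, z)) x = dd (0, y) F (l, x).
  by move=> HF; apply: dvE; apply/dv_space; exact: (PC_isD (0 : R) _ _ HF).
have dphi2 l x y z : dd z (dd y (phi l)) x = dd (0, z) (dd (0, y) D) (l, x).
  have -> : dd y (phi l) = fun u => dd (0, y) D (l, u) by apply/funext => u; exact: (dphi 1%N D _ _ _ PD).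
  exact: (dphi 0%N _ _ _ _ (PC_Dv _ PD)).
have epd := EPD_sphm s Pphi (r, x0).
have S1 : dd et (sphm phi s) (r, x0) = B2 (s, r).
  rewrite (sphm_Dt s (r, x0) (PC_S Pphi)) radial_dd; apply: (congr1 (@hemiL R n)); apply/funext => y.
  by rewrite (dphi 1%N D _ _ _ PD) e2E.
have S2 : dd et (dd et (sphm phi s)) (r, x0) = dd f2 B2 (s, r).
  rewrite (sphm_Dtt s (r, x0) Pphi) radial_dd2; apply: (congr1 (@hemiL R n)); apply/funext => y.
  by rewrite dphi2 e2E.
have P0 := PC_S PD; have P00 := PC_S P0; have PDt := PC_Dv et PD; have PDtt := PC_Dv et PDt.
have cF (F : E -> R) : PC 0 (fun _ : R => F) -> continuous (fun y : V => F (s, x0 + r *: y)).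
  move=> [cF _]; have c1 := ct_addE (@ct_cst V V x0) (ct_scaleE (@ct_cst V R r) (@ct_id V)).
  have c2 := ct_pair (@ct_cst V R s) c1; have c3 := ct_pair (@ct_cst V R 0) c2.
  exact: (ct_comp cF c3).
have S3 : Lap (sphm phi s) (r, x0) = hemiL (fun y : V => Lap D (s, x0 + r *: y)).
  rewrite (sphm_Lap s (r, x0) Pphi) /Lap hemiL_sum.
    by apply: eq_bigr => i _; apply: (congr1 (@hemiL R n)); apply/funext => y; rewrite dphi2.
  by move=> i; apply: cF; exact: (PC_Dv _ (PC_Dv (ex R i) PD)).
rewrite S1 S2 S3 [(r, x0).1]/= in epd; rewrite epd.
have PL := PC_Lap PD.
have EE : hemiL (fun y : V => dd et (dd et D) (s, x0 + r *: y)) - hemiL (fun y : V => dd et D (s, x0 + r *: y))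
   - t ^+ 2 * hemiL (fun y : V => Lap D (s, x0 + r *: y))
   + mu * t / (1 + t) * hemiL (fun y : V => dd et D (s, x0 + r *: y))
   + nu2 * t ^+ 2 / (1 + t) ^+ 2 * hemiL (fun y : V => D (s, x0 + r *: y)) = 0.
  have k1 := cF _ PDtt; have k2 := cF _ (PC_S PDt); have k3 := cF _ PL; have k4 := cF _ P00.
  have k5 := ct_mul (@ct_cst _ _ (t ^+ 2)) k3.
  have k6 := ct_mul (@ct_cst _ _ (mu * t / (1 + t))) k2.
  have k7 := ct_mul (@ct_cst _ _ (nu2 * t ^+ 2 / (1 + t) ^+ 2)) k4.
  have k8 := ct_sub k1 k2; have k9 := ct_sub k8 k5; have k10 := ct_add k9 k6.
  rewrite -(hemiL_scale _ k3) -(hemiL_scale _ k2) -(hemiL_scale _ k4).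
  rewrite -(hemiL_sub k1 k2) -(hemiL_sub k8 k5) -(hemiL_add k9 k6) -(hemiL_add k10 k7).
  rewrite -(mul0r (hemiL1 R n)) -hemiL_cst; apply: (congr1 (@hemiL R n)); apply/funext => y.
  exact: D_eq.
have T1 : B1 (s, r) = hemiL (fun y : V => dd et D (s, x0 + r *: y)).
  by rewrite radial_dd; apply: (congr1 (@hemiL R n)); apply/funext => y; rewrite e1E.
have T2 : dd f1 B1 (s, r) = hemiL (fun y : V => dd et (dd et D) (s, x0 + r *: y)).
  by rewrite radial_dd2; apply: (congr1 (@hemiL R n)); apply/funext => y; rewrite e1E.
have T3 : B (s, r) = hemiL (fun y : V => D (s, x0 + r *: y)) by [].
rewrite T1 T2 T3; move: EE.
move: (hemiL _) (hemiL _) (hemiL _) (hemiL _) => a b c d /eqP; rewrite -subr_eq0 subr0 => /eqP EE.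
have -> : d - c + mu * t / (1 + t) * c + nu2 * t ^+ 2 / (1 + t) ^+ 2 * a = t ^+ 2 * b.
  by apply/eqP; rewrite -subr_eq0 -EE; apply/eqP; ring.
by rewrite mulrCA.
Qed.

Variable Tm : R.

(* In the time s = log t, the factor expR (- 2 * s) turns the square of the s-derivative into that
   of the t-derivative. *)
Definition edens (r : R) (q : E2) : R :=
  r ^+ n * (expR (- 2 * q.1) * B1 (q.1, r) ^+ 2 + B2 (q.1, r) ^+ 2 + B (q.1, r) ^+ 2).

Let slice1 k (F : E2 -> R) : PC k (fun _ : R => F) -> PC k (fun (r : R) (q : E2) => F (q.1, r)).
Proof.
move=> HF; apply: (PC_affine (r := fun _ : R => 0 : R) (A := fun (r : R) (q : E2) => (q.1, r) : E2)
  (B := fun (_ : R) (q : E2) => (q.1, 0) : E2) _ _ _ _ HF); try by ctn.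
by move=> r p s v; rewrite -[RHS]/(p.1 + s * v.1, r + s * 0) mulr0 addr0.
Qed.

Let dslice1 (F : E2 -> R) (r : R) (q : E2) : PC 1 (fun _ : R => F) ->
  is_derive q f1 (fun q : E2 => F (q.1, r)) (dd f1 F (q.1, r)).
Proof.
move=> HF; have /dv_lineE H := PC_isD (0 : R) f1 (q.1, r) HF; apply/dv_lineE; apply: dv_ext H => s.
by rewrite -[(q.1, r) + s *: f1]/(q.1 + s * 1, r + s * 0) mulr0 addr0.
Qed.

Let dslice2 (F : E2 -> R) (s r : R) : PC 1 (fun _ : R => F) ->
  is_derive r 1 (fun r : R => F (s, r)) (dd f2 F (s, r)).
Proof.
move=> HF; have /dv_lineE H := PC_isD (0 : R) f2 (s, r) HF; apply/dv_lineE; apply: dv_ext H => g.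
by rewrite -[(s, r) + g *: f2]/(s + g * 0, r + g * 1) mulr0 addr0.
Qed.

Let PB1 : PC 1 (fun _ : R => B1). Proof. exact: PC_Dv PC_radial. Qed.
Let PB2 : PC 1 (fun _ : R => B2). Proof. exact: PC_Dv PC_radial. Qed.

Lemma PC_edens : PC 1 edens.
Proof.
apply: PC_mul; first by apply: PC_cst; ctn.
apply: PC_add; last by apply: PC_exp; apply: slice1; exact: PC_S PC_radial.
apply: PC_add; last by apply: PC_exp; exact: slice1.
apply: PC_mul; last by apply: PC_exp; exact: slice1.
apply: (PC_outer (I := setT)) => //; first exact: smooth1_expR.
by apply: PC_scale; [ctn|apply: PC_linear => //; ctn].
Qed.

Definition energy (s : R) : R := oint 0 (Tm - expR s) (fun r => edens r (s, 0)).

Lemma edens_t (s r : R) : dd f1 (edens r) (s, 0) = r ^+ n *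
  (expR (- 2 * s) * (2 * B1 (s, r) * dd f1 B1 (s, r) - 2 * B1 (s, r) ^+ 2)
   + 2 * B2 (s, r) * dd f2 B1 (s, r) + 2 * B (s, r) * B1 (s, r)).
Proof.
have d0 : is_derive ((s, 0) : E2) f1 (fun q : E2 => q.1) 1.
  apply/dv_lineE.
  have H : is_derive (0 : R) 1 (fun g : R => s + g * 1) 1.
    apply: (dv_eq (dv_add (dv_cst s (0 : R) 1) (dv_mul (dv_id (0 : R)) (dv_cst (1 : R) (0 : R) 1)))).
    by rewrite mulr0 addr0 mulr1 add0r.
  exact: H.
have dx : is_derive ((s, 0) : E2) f1 (fun q : E2 => expR (- 2 * q.1)) (expR (- 2 * s) * (- 2 * 1)).
  exact: (dv_comp (F := fun q : E2 => - 2 * q.1) (is_derive_expR _) (dv_scale (- 2) d0)).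
have db1 := dslice1 r (s, 0) PB1; have db2 := dslice1 r (s, 0) PB2.
have db := dslice1 r (s, 0) (PC_S PC_radial).
have D1 := dv_scale (r ^+ n) (dv_add (dv_add (dv_mul dx (dv_exp 2 db1)) (dv_exp 2 db2)) (dv_exp 2 db)).
rewrite (dvE D1) !expr1 [(s, 0).1]/=.
have -> : dd f1 B2 (s, r) = dd f2 B1 (s, r) by exact: (D_schwarz (0 : R) f2 f1 (s, r) PC_radial).
move: (dd f1 B1 (s, r)) (dd f2 B1 (s, r)) (B1 (s, r)) (B2 (s, r)) (B (s, r)) (expR (- 2 * s)) (r ^+ n) => a b c d e f g.
by ring.
Qed.

Definition denergy (s : R) : R := - expR s * edens (Tm - expR s) (s, 0) +
  oint 0 (Tm - expR s) (fun r => dd f1 (edens r) (s, 0)).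

Lemma energy_dv (s : R) : is_derive s 1 energy (denergy s).
Proof.
have d0 : is_derive ((s, 0) : E2) f1 (fun q : E2 => Tm - expR q.1) (- expR s).
  apply/dv_lineE.
  have H : is_derive (0 : R) 1 (fun g : R => Tm - expR (s + g * 1)) (- expR s).
    have d1 := dv_add (dv_cst s (0 : R) 1) (dv_mul (dv_id (0 : R)) (dv_cst (1 : R) (0 : R) 1)).
    have d2 := dv_comp (F := fun g : R => s + g * 1) (is_derive_expR _) d1.
    apply: (dv_eq (dv_sub (dv_cst Tm (0 : R) 1) d2)).
    by rewrite !mulr0 mul0r !addr0 !mulr1 !add0r mulr1.
  exact: H.
have /dv_lineE H := leibniz PC_edens d0; apply/dv_lineE; exact: dv_ext H.
Qed.

Lemma ct_edens (s : R) : continuous (fun r : R => edens r (s, 0)).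
Proof. by apply: (ct_comp (PC_cont PC_edens) (a := fun r : R => (r, (s, 0)))); ctn. Qed.

(** Integrating B_r B_rt by parts leaves a flux through the lateral boundary, which the term from
    the shrinking radius dominates since the cone has unit speed. In the interior the damping has
    the good sign because mu >= 0, and the terms of order zero cost at most 1 + nu2 times the
    energy. The factor [expR s] is dt/ds. *)
Lemma energy_ineq (s : R) : expR s <= Tm -> denergy s <= (1 + nu2) * expR s * energy s.
Proof.
move=> sT; set t := expR s; have t0 : 0 < t by exact: expR_gt0.
have e2E' : expR (- 2 * s) = t ^- 2.
  have -> : - 2 * s = - (s + s) by ring.
  by rewrite expRN expRD expr2.
set rho := Tm - t; have rho0 : 0 <= rho by rewrite subr_ge0.
have cB (F : E2 -> R) : PC 0 (fun _ : R => F) -> continuous (fun r : R => F (s, r)).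
  by move=> HF; apply: (ct_comp (PC_contp (l := (0 : R)) HF) (a := fun r : R => (s, r))); ctn.
have PB := PC_radial.
have cb := cB _ (PC_S (PC_S PB)); have cb1 := cB _ (PC_S PB1); have cb2 := cB _ (PC_S PB2).
have cb11 := cB _ (PC_Dv f1 PB1); have cb12 := cB _ (PC_Dv f2 PB1); have cb22 := cB _ (PC_Dv f2 PB2).
(* By the equation, [r ^+ n * Q r] is the r-derivative of [r ^+ n * B2 (s, r)], written without a
   division by [r]. *)
pose Q (r : R) : R := t ^- 2 * (dd f1 B1 (s, r) - B1 (s, r) + mu * t / (1 + t) * B1 (s, r)
  + nu2 * t ^+ 2 / (1 + t) ^+ 2 * B (s, r)).
have QE (r : R) : r * Q r = r * dd f2 B2 (s, r) + n%:R * B2 (s, r).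
  by rewrite /Q mulrCA radial_eq mulrA mulVf ?mul1r// expf_neq0// gt_eqF.
have cQ : continuous Q by rewrite /Q; ctn.
have dF (r : R) : is_derive r 1 (fun r : R => r ^+ n * B2 (s, r)) (r ^+ n * Q r).
  apply: (dv_eq (dv_mul (dv_exp n (dv_id r)) (dslice2 s r PB2))).
  have -> : r ^+ n = r ^+ n.-1 * r by rewrite -exprSr prednK.
  by rewrite -(mulrA _ r (Q r)) QE; move: (r ^+ n.-1) (B2 (s, r)) (dd f2 B2 (s, r)) => a b c; ring.
have cF : continuous (fun r : R => r ^+ n * Q r) by ctn.
have IBP := oint_ibp 0 rho cF cb12 dF (fun r => dslice2 s r PB1).
rewrite expr0n (gtn_eqF n0) !mul0r subr0 in IBP.
pose g1 (r : R) : R := r ^+ n * (t ^- 2 * (2 * B1 (s, r) * dd f1 B1 (s, r) - 2 * B1 (s, r) ^+ 2) + 2 * B (s, r) * B1 (s, r)).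
pose g2 (r : R) : R := r ^+ n * B2 (s, r) * dd f2 B1 (s, r).
pose g3 (r : R) : R := r ^+ n * Q r * B1 (s, r).
have cg1 : continuous g1 by rewrite /g1; ctn.
have cg2 : continuous g2 by rewrite /g2; ctn.
have cg3 : continuous g3 by rewrite /g3; ctn.
have cg22 : continuous (fun r : R => 2 * g2 r) by ctn.
have cg23 : continuous (fun r : R => 2 * g3 r) by ctn.
have E1 : oint 0 rho (fun r => dd f1 (edens r) (s, 0)) = oint 0 rho g1 + 2 * oint 0 rho g2.
  rewrite -oint_scale// -oint_add//; congr oint; apply/funext => r.
  rewrite edens_t e2E' /g1 /g2; move: (dd f1 B1 (s, r)) (dd f2 B1 (s, r)) (B1 (s, r)) (B2 (s, r)) (B (s, r)) (t ^- 2) (r ^+ n) => a b c d e f g.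
  by ring.
have E2' : oint 0 rho g2 = rho ^+ n * B2 (s, rho) * B1 (s, rho) - oint 0 rho g3 by exact: IBP.
have ce : continuous (fun r : R => edens r (s, 0)) := @ct_edens s.
have cec : continuous (fun r : R => (1 + nu2) * t * edens r (s, 0)) by ctn.
have cg13 : continuous (fun r : R => g1 r - 2 * g3 r) by ctn.
have main : oint 0 rho (fun r => g1 r - 2 * g3 r) <= oint 0 rho (fun r => (1 + nu2) * t * edens r (s, 0)).
  apply: ler_oint => // r /andP[r0 _].
  rewrite /g1 /g3 /Q /edens e2E'.
  move: (dd f1 B1 (s, r)) (B1 (s, r)) (B2 (s, r)) (B (s, r)) (exprn_ge0 n r0) => a b c d; move: (r ^+ n) => k k0.
  rewrite -subr_ge0.
  have -> : (1 + nu2) * t * (k * (t ^- 2 * b ^+ 2 + c ^+ 2 + d ^+ 2)) - (k * (t ^- 2 * (2 * b * a - 2 * b ^+ 2) + 2 * d * b)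
     - 2 * (k * (t ^- 2 * (a - b + mu * t / (1 + t) * b + nu2 * t ^+ 2 / (1 + t) ^+ 2 * d)) * b)) =
     k * ((1 + nu2) * t * c ^+ 2 + 2 * mu / (t * (1 + t)) * b ^+ 2
      + ((1 + nu2) * (b ^+ 2 / t + t * d ^+ 2) - 2 * (1 - nu2 / (1 + t) ^+ 2) * b * d)).
    clearbody t; field; apply/andP; split; lra.
  apply: mulr_ge0 => //; apply: addr_ge0; first apply: addr_ge0.
  - have h1 : 0 <= 1 + nu2 by rewrite addr_ge0.
    exact (mulr_ge0 (mulr_ge0 h1 (ltW t0)) (sqr_ge0 c)).
  - by rewrite mulr_ge0 ?sqr_ge0// divr_ge0 ?mulr_ge0 ?addr_ge0 ?(ltW t0).
  (* So 1 - nu2/(1+t)^2 is at most 1 + nu2 in absolute value, and the mixed product is absorbed by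
     the two squares. *)
  have z1 : 0 <= nu2 / (1 + t) ^+ 2 <= nu2.
    rewrite divr_ge0 ?sqr_ge0//= ler_pdivrMr; last by rewrite exprn_gt0// addr_gt0.
    by rewrite ler_peMr// exprn_ege1// lerDl ltW.
  move: (nu2 / _) z1 => z /andP[z0 z1].
  have -> : b ^+ 2 / t + t * d ^+ 2 = t * ((b / t) ^+ 2 + d ^+ 2) by clearbody t; field; lra.
  have -> : 2 * (1 - z) * b * d = t * (2 * (1 - z) * (b / t) * d) by clearbody t; field; lra.
  rewrite mulrCA -mulrBr mulr_ge0 ?(ltW t0)//; move: (b / t) => y.
  have := sqr_ge0 (y - d); have := sqr_ge0 (y + d); nra.
rewrite /denergy -/t -/rho E1 E2' mulrBr addrCA addrA -addrA.
(* On the lateral boundary the terms complete the square of B_t - B_r, where B_t is [B1] divided by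
   t. *)
have bd : - t * edens rho (s, 0) + 2 * (rho ^+ n * B2 (s, rho) * B1 (s, rho)) <= 0.
  rewrite /edens e2E'; have := exprn_ge0 n rho0; move: (rho ^+ n) (B1 (s, rho)) (B2 (s, rho)) (B (s, rho)) => k b c d k0.
  have -> : - t * (k * (t ^- 2 * b ^+ 2 + c ^+ 2 + d ^+ 2)) + 2 * (k * c * b) = - (k * t * ((b / t - c) ^+ 2 + d ^+ 2)).
    by clearbody t; field; lra.
  by rewrite oppr_le0 !mulr_ge0 ?(ltW t0)// addr_ge0 ?sqr_ge0.
move: main; rewrite oint_sub// (oint_scale _ _ _ cg3) (oint_scale _ _ _ ce) -/(energy s).
move: bd; rewrite /energy -/t -/rho.
move: (oint 0 rho g1) (oint 0 rho g3) (oint 0 rho _) (edens rho (s, 0)) (rho ^+ n * _ * _) => a b c d e.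
lra.
Qed.

Lemma radial_dt (s r : R) : B1 (s, r) = expR s * hemiL (fun y : V => h (expR s) (x0 + r *: y)).
Proof.
rewrite radial_dd -hemiL_scale; last first.
  have c1 := ct_addE (@ct_cst V V x0) (ct_scaleE (@ct_cst V R r) (@ct_id V)).
  exact: (ct_comp ch (ct_pair (@ct_cst V R (expR s)) c1)).
by apply: (congr1 (@hemiL R n)); apply/funext => y; rewrite e1E Dh.
Qed.

Lemma radial_dr (s r : R) : B2 (s, r) = hemiL (fun y : V => dd y (w (expR s)) (x0 + r *: y)).
Proof.
rewrite radial_dd; apply: (congr1 (@hemiL R n)); apply/funext => y; rewrite e2E.
have /dv_space H := PC_isD (0 : R) (0, y) (s, x0 + r *: y) (PC_S PD).
rewrite -(dvE H); congr dd; apply/funext => x; exact: Dw.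
Qed.

(* The energy as a function of t, which is continuous down to t = 0. *)
Definition fenergy (t : R) : R := oint 0 (Tm - t) (fun r => r ^+ n *
  (hemiL (fun y : V => h t (x0 + r *: y)) ^+ 2 + hemiL (fun y : V => dd y (w t) (x0 + r *: y)) ^+ 2
   + hemiL (fun y : V => w t (x0 + r *: y)) ^+ 2)).

Lemma energyE (s : R) : energy s = fenergy (expR s).
Proof.
rewrite /energy /fenergy; congr oint; apply/funext => r; rewrite /edens /= radial_dt radial_dr.
have -> : - 2 * s = - (s + s) by ring.
have -> : B (s, r) = hemiL (fun y : V => w (expR s) (x0 + r *: y)).
  by apply: (congr1 (@hemiL R n)); apply/funext => y; exact: Dw.
have e0 : expR s != 0 by rewrite gt_eqF ?expR_gt0.
rewrite expRN expRD; move: (hemiL _) (hemiL _) (hemiL _) => a b c; move: (expR s) e0 => e e0.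
by field.
Qed.

Lemma ct_fenergy : continuous fenergy.
Proof.
have ca : continuous (fun q : R * R * V => x0 + q.1.2 *: q.2) by apply: ct_addE; ctn.
have c1 : continuous (fun q : R * R => hemiL (fun y : V => h q.1 (x0 + q.2 *: y))).
  apply: (continuous_hemiL (F := fun (q : R * R) (y : V) => h q.1 (x0 + q.2 *: y))).
  by apply: (ct_comp ch (a := fun q : R * R * V => (q.1.1, x0 + q.1.2 *: q.2))); apply: ct_pair => //; ctn.
have c3 : continuous (fun q : R * R => hemiL (fun y : V => w q.1 (x0 + q.2 *: y))).
  apply: (continuous_hemiL (F := fun (q : R * R) (y : V) => w q.1 (x0 + q.2 *: y))).
  apply: (ct_comp (PC_cont (PC_S Pw)) (a := fun q : R * R * V => (q.1.1, x0 + q.1.2 *: q.2))).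
  by apply: ct_pair => //; ctn.
have c2 : continuous (fun q : R * R => hemiL (fun y : V => dd y (w q.1) (x0 + q.2 *: y))).
  apply: (continuous_hemiL (F := fun (q : R * R) (y : V) => dd y (w q.1) (x0 + q.2 *: y))).
  apply: (ct_comp (PC_cont (PC_D Pw)) (a := fun q : R * R * V => ((q.1.1, q.2), x0 + q.1.2 *: q.2))).
  by apply: ct_pair => //; ctn.
apply: (continuous_oint_end (F := fun t r => r ^+ n *
  (hemiL (fun y : V => h t (x0 + r *: y)) ^+ 2 + hemiL (fun y : V => dd y (w t) (x0 + r *: y)) ^+ 2
   + hemiL (fun y : V => w t (x0 + r *: y)) ^+ 2))); by ctn.
Qed.

Lemma fenergy0 : fenergy 0 = 0.
Proof.
rewrite /fenergy [X in oint _ _ X](_ : _ = fun=> 0 * 1); last apply/funext => r.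
  by rewrite oint_scale ?mul0r//; exact: ct_cst.
have Z : @hemiL R n (fun=> 0) = 0 by rewrite hemiL_cst mul0r.
have w0E : w 0 = fun=> 0 by apply/funext => x; exact: w0.
have -> : (fun y : V => h 0 (x0 + r *: y)) = fun=> 0 by apply/funext => y; exact: h0.
have -> : (fun y : V => w 0 (x0 + r *: y)) = fun=> 0 by apply/funext => y; exact: w0.
have -> : (fun y : V => dd y (w 0) (x0 + r *: y)) = fun=> 0.
  by apply/funext => y; rewrite w0E; apply: dvE; exact: dv_cst.
by rewrite Z; ring.
Qed.

Lemma edens_ge0 (s r : R) : 0 <= r -> 0 <= edens r (s, 0).
Proof.
move=> r0; rewrite mulr_ge0 ?exprn_ge0//; apply: addr_ge0; last exact: sqr_ge0.
by apply: addr_ge0; [rewrite mulr_ge0 ?sqr_ge0 ?expR_ge0|exact: sqr_ge0].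
Qed.

Lemma energy_ge0 (s : R) : expR s <= Tm -> 0 <= energy s.
Proof.
move=> sT; apply: oint_ge0; first by rewrite subr_ge0.
by move=> r /andP[r0 _]; exact: edens_ge0.
Qed.

(* Gronwall: the energy times expR (- (1 + nu2) * t) is nonincreasing, and tends to 0 as t -> 0. *)
Lemma energy_eq0 (s : R) : expR s <= Tm -> energy s = 0.
Proof.
move=> sT; pose k := 1 + nu2; have k0 : 0 <= k by rewrite addr_ge0.
pose g (s : R) := energy s * expR (- k * expR s).
have dg (r : R) : is_derive r 1 g ((denergy r - k * expR r * energy r) * expR (- k * expR r)).
  have d1 := dv_comp (F := fun r : R => - k * expR r) (is_derive_expR _) (dv_scale (- k) (is_derive_expR r)).
  apply: (dv_eq (dv_mul (energy_dv r) d1)).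
  by move: (denergy r) (energy r) (expR (- k * expR r)) (expR r) => a b c d; ring.
have gle (t : R) : 0 < t -> t < expR s -> g s <= fenergy t.
  move=> t0 ts; have Et : expR (ln t) = t by rewrite lnK.
  have ls : ln t <= s by rewrite -(expRK s) ler_ln ?posrE ?expR_gt0// ltW.
  have G1 : g s <= g (ln t).
    apply: nonincr ls dg _ => r /andP[_ rs].
    have rT : expR r <= Tm by apply: le_trans sT; rewrite ler_expR.
    by rewrite mulr_le0_ge0 ?expR_ge0// subr_le0; exact: energy_ineq.
  apply: (le_trans G1); rewrite -{2}Et -energyE /g.
  have tT : expR (ln t) <= Tm by rewrite Et; apply: le_trans sT; exact: ltW.
  rewrite ler_piMr ?energy_ge0// expR_le1 mulNr oppr_le0 mulr_ge0 ?expR_ge0//.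
have cF := ct_fenergy.
have ck : continuous (fun t : R => Num.max (g s - fenergy t) 0) by apply: ct_maxr; ctn.
have gs0 : g s <= 0.
  have := right_limit0 ck (expR_gt0 s); rewrite fenergy0 subr0 => H.
  have <- : Num.max (g s) 0 = 0.
    apply: H => t /andP[t0 ts]; apply/max_idPr; rewrite subr_le0; exact: gle.
  by rewrite le_max lexx.
apply/eqP; rewrite eq_le energy_ge0// andbT.
by move: gs0; rewrite /g pmulr_lle0 ?expR_gt0.
Qed.

(** Zero energy forces B = 0 for all small positive radii, hence at radius 0 by continuity; there B
    is D at the centre times the nonzero constant [hemiL1]. *)
Lemma center_eq0 (s : R) : expR s < Tm -> D (s, x0) = 0.
Proof.
move=> sT.
have Z := oint_eq0_ge0 (@ct_edens s) (fun r H => edens_ge0 s (andP H).1) (energy_eq0 (ltW sT)).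
have Z1 (r : R) : 0 < r < Tm - expR s -> B (s, r) = 0.
  move=> rr; have /andP[r0 _] := rr; have /eqP := Z r rr.
  rewrite /edens mulf_eq0 expf_eq0 (gt_eqF r0) andbF/= => /eqP E0; apply/eqP.
  rewrite -sqrf_eq0; apply/eqP; move: E0.
  have := sqr_ge0 (B2 (s, r)); have := sqr_ge0 (B (s, r)).
  have : 0 <= expR (- 2 * s) * B1 (s, r) ^+ 2 by rewrite mulr_ge0 ?expR_ge0 ?sqr_ge0.
  by move: (_ * _) (B2 (s, r) ^+ 2) (B (s, r) ^+ 2) => a b c /=; lra.
have cB : continuous (fun r : R => B (s, r)).
  by apply: (ct_comp (PC_contp (l := (0 : R)) (PC_S (PC_S PC_radial))) (a := fun r : R => (s, r))); ctn.
have T0 : 0 < Tm - expR s by rewrite subr_gt0.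
have /eqP := right_limit0 cB T0 Z1.
have -> : B (s, 0) = D (s, x0) * hemiL1 R n.
  by rewrite -hemiL_cst; apply: (congr1 (@hemiL R n)); apply/funext => y; rewrite /= scale0r addr0.
have L0 : hemiL1 R n != 0.
  apply/eqP => E0; have := hemiL1_wallis R n; rewrite E0 mul0r => /esym/eqP.
  by rewrite mulf_eq0 !gt_eqF ?pi_gt0 ?ball_vol_gt0.
by rewrite mulf_eq0 (negPf L0) orbF => /eqP.
Qed.

End Energy.

Section Uniqueness.
Variables (R : realType) (n : nat) (mu nu2 : R).
Hypotheses (n0 : (0 < n)%N) (mu0 : 0 <= mu) (nu0 : 0 <= nu2).
Local Notation V := 'rV[R]_n.
Local Notation E := (R * V)%type.
Local Notation et := (et R n).

Theorem classical_solution_unique (f : R -> V -> R) (u0 u1 : V -> R) (v1 v2 : R -> V -> R) :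
  classical_solution mu nu2 f u0 u1 v1 -> classical_solution mu nu2 f u0 u1 v2 ->
  forall t x, 0 <= t -> v1 t x = v2 t x.
Proof.
move=> S1 S2 t x; rewrite le_eqVlt => /predU1P[<-|t0].
  by case: S1 => _ _ -> _; case: S2 => _ _ -> _.
have [h1 [ch1 d1 i1]] := time_derivative S1; have [h2 [ch2 d2 i2]] := time_derivative S2.
pose D (p : E) := logt v1 p - logt v2 p.
pose w (b : R) (x : V) := v1 (Num.max b 0) x - v2 (Num.max b 0) x.
pose h (b : R) (x : V) := h1 (Num.max b 0, x) - h2 (Num.max b 0, x).
have P1 := PC_logt S1 R; have P2 := PC_logt S2 R.
have PD : PC 2 (fun _ : R => D) by exact: PC_sub.
have max_exp (p : E) : Num.max (expR p.1) 0 = expR p.1 by apply/max_idPl; exact: expR_ge0.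
have Pw : PC 1 w.
  have [C1 _ _ _] := S1; have [C2 _ _ _] := S2.
  exact: PC_sub (PC_S (Ck_half_PC C1)) (PC_S (Ck_half_PC C2)).
have ddD v : dd v D = fun p => dd v (logt v1) p - dd v (logt v2) p.
  apply/funext => p; apply: dvE; apply: dv_sub.
    exact: (PC_isD (0 : R) _ _ (PC_S P1)).
  exact: (PC_isD (0 : R) _ _ (PC_S P2)).
have ddD2 v p : dd v (dd v D) p = dd v (dd v (logt v1)) p - dd v (dd v (logt v2)) p.
  rewrite ddD; apply: dvE; apply: dv_sub.
    exact: (PC_isD (0 : R) _ _ (PC_Dv v P1)).
  exact: (PC_isD (0 : R) _ _ (PC_Dv v P2)).
have LapD p : Lap D p = Lap (logt v1) p - Lap (logt v2) p.
  by rewrite /Lap -sumrB; apply: eq_bigr => i _; exact: ddD2.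
have D_eq p : let t := expR p.1 in
  dd et (dd et D) p - dd et D p - t ^+ 2 * Lap D p + mu * t / (1 + t) * dd et D p
    + nu2 * t ^+ 2 / (1 + t) ^+ 2 * D p = 0.
  move=> s; have e1 := logt_eq S1 p; have e2 := logt_eq S2 p.
  rewrite ddD2 LapD ddD /D; rewrite -/s in e1 e2; rewrite -(subrr (s ^+ 2 * f s p.2)) -{1}e1 -e2.
  move: (dd et (dd et (logt v1)) p) (dd et (dd et (logt v2)) p) => a b.
  move: (dd et (logt v1) p) (dd et (logt v2) p) (Lap (logt v1) p) (Lap (logt v2) p) => c d e g.
  by move: (mu * s / (1 + s)) (nu2 * s ^+ 2 / (1 + s) ^+ 2) => k l; ring.
have Dw p : D p = w (expR p.1) p.2 by rewrite /w max_exp.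
have Dh p : dd et D p = expR p.1 * h (expR p.1) p.2.
  by rewrite ddD (logt_t p d1) (logt_t p d2) /h max_exp mulrBr.
have w0 y : w 0 y = 0.
  by rewrite /w maxxx; case: S1 => _ _ -> _; case: S2 => _ _ -> _; rewrite subrr.
have h0 y : h 0 y = 0 by rewrite /h maxxx i1 i2 subrr.
have ch : continuous (fun p : E => h p.1 p.2) by apply: ct_sub.
(* Any cone whose vertex lies later than t would do; t + 1 is one. *)
have := center_eq0 n0 mu0 nu0 PD D_eq Pw Dw w0 ch Dh h0 x (Tm := t + 1) (s := ln t).
rewrite lnK ?posrE// ltrDl ltr01 => /(_ isT).
by rewrite /D /logt /= lnK ?posrE// => /subr0_eq.
Qed.

End Uniqueness.

(** * The representation formula *)

Section KernelFormulas.
Variables (R : realType) (mu nu2 : R).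
Local Notation a := (legendre_a mu nu2).
Local Notation m := (mu / 2).
Local Notation C2 := (cpow 2 (csqrt (delta mu nu2) - 1)).
Local Notation G := (riemG a).

Lemma dv_coord2 (F : R * (R * R) -> R) (t s b : R) : PC 1 (fun _ : R => F) ->
  is_derive s 1 (fun s : R => F (t, (s, b))) (dd (e2 R) F (t, (s, b))).
Proof.
move=> HF; have /dv_lineE H := PC_isD (0 : R) (e2 R) (t, (s, b)) HF; apply/dv_lineE; apply: dv_ext H => r.
by rewrite -[_ + _]/(t + r * 0, (s + r * 1, b + r * 0)) !mulr0 !addr0.
Qed.

Lemma dv_coord3 (F : R * (R * R) -> R) (t s b : R) : PC 1 (fun _ : R => F) ->
  is_derive b 1 (fun b : R => F (t, (s, b))) (dd (e3 R) F (t, (s, b))).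
Proof.
move=> HF; have /dv_lineE H := PC_isD (0 : R) (e3 R) (t, (s, b)) HF; apply/dv_lineE; apply: dv_ext H => r.
by rewrite -[_ + _]/(t + r * 0, (s + r * 0, b + r * 1)) !mulr0 !addr0.
Qed.

(** Numerator and denominator of the argument of F are 2 (1+t) (1+b) times X - 1 and X + 1, so the
    argument is [zet] of X. *)
Lemma kernelE_riemG (t b s : R) : Om (t, (s, b)) ->
  kernelE mu nu2 t 0 b s = (C2 * ((1 + t) `^ (- m) * (1 + b) `^ m * G (t, (s, b)))%:C)%C.
Proof.
move=> O; have [/= h1 h2 h3] := O; have X0p : 0 < X0 (t, (s, b)) by lra.
have t1 : 0 < 1 + t by lra.
have b1 : 0 < 1 + b by lra.
have E1 : (t + b + 2) ^+ 2 - s ^+ 2 = 2 * (1 + t) * (1 + b) * (X0 (t, (s, b)) + 1).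
  by rewrite /X0 /=; field; rewrite !gt_eqF.
have E2 : (t - b) ^+ 2 - s ^+ 2 = 2 * (1 + t) * (1 + b) * (X0 (t, (s, b)) - 1).
  by rewrite /X0 /=; field; rewrite !gt_eqF.
have p2 : 0 < 2 * (1 + t) * (1 + b) by rewrite !mulr_gt0.
have E3 : ((t - b) ^+ 2 - s ^+ 2) / ((t + b + 2) ^+ 2 - s ^+ 2) = zet (X0 (t, (s, b))).
  by rewrite E1 E2 /zet -mulf_div divff ?gt_eqF// mul1r.
have D0 : 0 < (t + b + 2) ^+ 2 - s ^+ 2 by rewrite E1 mulr_gt0//; lra.
have Z : `|((t - b) ^+ 2 - s ^+ 2) / ((t + b + 2) ^+ 2 - s ^+ 2)| < 1 by rewrite E3 zet_lt1.
by rewrite (kernelE_formula mu nu2 t1 b1 D0 Z) E3 (riemG_Om a O).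
Qed.

Lemma scale_re (z : R[i]) (r : R) : complex.Re (z * r%:C)%C = complex.Re z * r.
Proof. by case: z => x y /=; rewrite mulr0 subr0. Qed.

Lemma scale_im (z : R[i]) (r : R) : complex.Im (z * r%:C)%C = complex.Im z * r.
Proof. by case: z => x y /=; rewrite mulr0 add0r. Qed.

(** Every kernel is a fixed complex constant times a real function, which reduces complex
    derivatives, and below complex integrals, to real ones. *)
Lemma cderive1_scale (g : R -> R[i]) (z : R[i]) (r : R -> R) (x d : R) :
  (\forall s \near x, g s = (z * (r s)%:C)%C) -> is_derive x 1 r d -> cderive1 g x = (z * d%:C)%C.
Proof.
move=> gE D; apply/eqP; rewrite eq_complex /cderive1 scale_re scale_im /= !derive1E; apply/andP; split; apply/eqP.
  apply: derive_val; apply: near_dv (dv_scale (complex.Re z) D).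
  by apply: filterS gE => s ->; rewrite scale_re.
apply: derive_val; apply: near_dv (dv_scale (complex.Im z) D).
by apply: filterS gE => s ->; rewrite scale_im.
Qed.

Lemma cintegral_scale (g : R -> R[i]) (z : R[i]) (r : R -> R) (t : R) : 0 <= t -> continuous r ->
  (forall s, 0 <= s <= t -> g s = (z * (r s)%:C)%C) -> cintegral `[0, t] g = (z * (oint 0 t r)%:C)%C.
Proof.
move=> t0 cr gE; apply/eqP; rewrite eq_complex /cintegral scale_re scale_im /= -!ointE// -!oint_scale//.
apply/andP; split; apply/eqP; apply: eq_oint => s; rewrite min_l// max_r// => st.
  by rewrite gE// scale_re.
by rewrite gE// scale_im.
Qed.

(** The product rule at b = 0 for (1+b)^m G gives m G + G_b, as (1+b)^m has value 1 and derivative m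
    there; the sign is that of the definition of K_0. *)
Lemma kernelK0_ker0 (t s : R) : 0 <= s <= t ->
  kernelK0 mu nu2 t 0 s = (C2 * (- ((1 + t) `^ (- m) * ker0 a m 0 (t, s)))%:C)%C.
Proof.
move=> st; have O : Om (t, (s, 0)) by apply: Om_region => //; rewrite subr0.
pose r (b : R) : R := (1 + t) `^ (- m) * (posext (1 + b) `^ m * G (t, (s, b))).
have D1 : is_derive (0 : R) 1 (fun b : R => G (t, (s, b))) (dd (e3 R) G (t, (s, 0))).
  by apply: dv_coord3; exact: (PC_riemG a R).
have D2 : is_derive (0 : R) 1 (fun b : R => posext (1 + b) `^ m) m.
  have D0 := dv_add (dv_cst (1 : R) (0 : R) 1) (dv_id (0 : R)).
  have p1 : 0 < 1 + 0 :> R by lra.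
  have D3 : is_derive (0 : R) 1 (fun b : R => (1 + b) `^ m) m.
    apply: (dv_eq (dv_comp (F := fun b : R => 1 + b) (is_derive1_powR m p1) D0)).
    by rewrite addr0 powR1 mulr1 add0r mulr1.
  apply: near_dv D3; near=> b; rewrite posext_id//.
  have : - (1 / 2) < b by near: b; apply: lt_nbhsr; lra.
  lra.
have D : is_derive (0 : R) 1 r ((1 + t) `^ (- m) * ker0 a m 0 (t, s)).
  apply: (dv_eq (dv_scale ((1 + t) `^ (- m)) (dv_mul D2 D1))).
  rewrite /ker0 /slice /= posext_id ?addr0 ?powR1 ?mul1r; last by lra.
  by ring.
have near_r : \forall b \near (0 : R), kernelE mu nu2 t 0 b s = (C2 * (r b)%:C)%C.
  have cc : {for (0 : R), continuous (fun b : R => ((t, (s, b)) : R * (R * R)))}.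
    have c : continuous (fun b : R => ((t, (s, b)) : R * (R * R))) by ctn.
    exact: c.
  have H := cc _ (near_Om O).
  near=> b; have Ob : Om (t, (s, b)) by near: b.
  have [_ /= b2 _] := Ob.
  by rewrite (kernelE_riemG Ob) /r posext_id ?mulrA//; lra.
rewrite /kernelK0 (cderive1_scale near_r D).
by rewrite rmorphN mulrN.
Unshelve. all: by end_near. Qed.

End KernelFormulas.

(** * The three parts of the solution and the formula *)

Section Assembly.
Variables (R : realType) (n h : nat) (mu nu2 : R).
Hypothesis nE : n = h.*2.+2.
Local Notation V := 'rV[R]_n.
Local Notation E := (R * V)%type.
Local Notation et := (et R n).
Local Notation a := (legendre_a mu nu2).
Local Notation m := (mu / 2).
Local Notation G := (riemG a).

(** Integration by parts in s: since G = 1 at s = t - b and the wave vanishes at s = 0, W(t-b) minus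
    the integral of W G_s is the integral of W_s G, and W_s is w of the data. *)
Lemma velS_formula (T : topologicalType) (b : T -> R) (phi : T -> V -> R) l (t : R) x :
  continuous b -> PC h.+2 phi -> 0 <= b l <= t ->
  velS h mu nu2 b phi l (t, x) = oint 0 (t - b l) (fun s => dd et (waveS h phi l) (s, x) *
    ((1 + t) `^ (- m) * (1 + b l) `^ m * G (t, (s, b l)))).
Proof.
move=> cb Hphi /andP[b0 bt]; have t0 : 0 <= t by exact: le_trans bt.
have h1 : - (1 / 2) < t by lra.
have h2 : - (1 / 2) < b l by lra.
have h3 : 1 / 2 <= 1 + b l by lra.
pose W := waveS h phi l; pose g (s : R) := G (t, (s, b l)); pose k := (1 + t) `^ (- m) * (1 + b l) `^ m.
have HW2 : PC 2 (waveS h phi) by apply: PC_waveS; rewrite addn2.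
have HW := PC_S HW2.
have HG2 : PC 2 (fun (_ : R) q => G q) by exact: PC_riemG.
have HG := PC_S HG2.
have dW (s : R) : is_derive s 1 (fun s : R => W (s, x)) (dd et W (s, x)).
  apply/(dv_time W); exact: (PC_isD l et (s, x) HW).
have dg (s : R) : is_derive s 1 g (dd (e2 R) G (t, (s, b l))).
  exact: dv_coord2.
have cW : continuous (fun s : R => dd et W (s, x)).
  by apply: (ct_comp (PC_contp (l := l) (PC_Dv et HW2)) (a := fun s : R => (s, x))); ctn.
have cg : continuous (fun s : R => dd (e2 R) G (t, (s, b l))).
  by apply: (ct_comp (PC_contp (l := (0 : R)) (PC_Dv (e2 R) HG2)) (a := fun s : R => (t, (s, b l)))); ctn.
have cW0 : continuous (fun s : R => W (s, x)) by move=> s; exact: dv_cont (dW s).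
have cg0 : continuous g by move=> s; exact: dv_cont (dg s).
have I := oint_ibp 0 (t - b l) cW cg dW dg.
have [Od X1] := Om_diag h1 h2.
have g1 : g (t - b l) = 1 by rewrite /g (riemG_Om a Od) X1 leg1.
have W0 : W (0, x) = 0 by rewrite /W waveS0.
have -> : (fun s => dd et (waveS h phi l) (s, x) * ((1 + t) `^ (- m) * (1 + b l) `^ m * G (t, (s, b l)))) =
   fun s => k * (dd et W (s, x) * g s).
  by apply/funext => s; rewrite mulrCA.
rewrite oint_scale; last by ctn.
rewrite g1 W0 mul0r mulr1 subr0 in I.
have -> : oint 0 (t - b l) (fun s => dd et W (s, x) * g s) =
  W (t - b l, x) - oint 0 (t - b l) (fun s => W (s, x) * dd (e2 R) G (t, (s, b l))).
  by rewrite I opprB addrCA subrr addr0.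
rewrite /velS /conj /voltS /volt /moving /= weight_id ?(ltW h1)//= posext_id//.
by rewrite mulrA (mulrC (_ `^ m)).
Qed.

Variables (f : R -> V -> R) (u0 u1 : V -> R).
Hypotheses (hf : Ck h.+2 (@half_space R n) (fun p => f p.1 p.2))
  (hu0 : Ck h.+3 [set: V] u0) (hu1 : Ck h.+2 [set: V] u1).

(** Freezing the source at time 0 for negative [b] makes it a continuous family over the whole line
    without changing it for b >= 0. *)
Let fpos (b : R) (x : V) : R := f (Num.max b 0) x.
Let vel (_ : R) (x : V) : R := u1 x + mu * u0 x.
Let zero (_ : R) : R := 0.

Let Pu0 : PC h.+3 (fun (_ : R) x => u0 x). Proof. exact: Ck_setT_PC. Qed.
Let Pf : PC h.+2 fpos. Proof. exact: (Ck_half_PC hf). Qed.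
Let Pvel : PC h.+2 vel.
Proof.
apply: PC_add; first exact: (Ck_setT_PC R hu1).
by apply: PC_scale; [exact: ct_cst|exact: PC_S Pu0].
Qed.
Let cz : continuous zero. Proof. exact: ct_cst. Qed.
Let cid : continuous (@idfun R). Proof. exact: ct_id. Qed.

Let posP := posS h mu nu2 u0 0.
Let velP := velS h mu nu2 zero vel 0.
Let srcP := velS h mu nu2 idfun fpos.

Definition telegraph_solution (p : E) : R := posP p + velP p + duhamel srcP p.

Let Ppos : PC 2 (fun _ : R => posP).
Proof. by apply: (PC_reparam (r := fun _ : R => 0 : R)) (PC_posS mu nu2 Pu0); ctn. Qed.
Let Pvl : PC 2 (fun _ : R => velP).
Proof. by apply: (PC_reparam (r := fun _ : R => 0 : R)) (PC_velS mu nu2 cz Pvel); ctn. Qed.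
Let Psrc : PC 2 srcP. Proof. exact: PC_velS cid Pf. Qed.
Let src0 s p : p.1 = s -> srcP s p = 0.
Proof. by move=> ps; apply: velS0. Qed.
Let src_eq s p : 0 <= s <= p.1 -> telegraph mu nu2 (srcP s) p = 0.
Proof. by move=> sp; exact: (velS_eq mu nu2 nE cid Pf sp). Qed.
Let srct0 s p : 0 <= s -> p.1 = s -> dd et (srcP s) p = fpos s p.2.
Proof. by move=> s0 ps; exact: (velS_t0 mu nu2 nE cid Pf). Qed.
Let Pduh : PC 2 (fun _ : R => duhamel srcP). Proof. exact: (PC_duhamel Psrc src0). Qed.

Lemma telegraph_solution_classical :
  classical_solution mu nu2 f u0 u1 (fun t x => telegraph_solution (t, x)).
Proof.
have P1 : PC 2 (fun _ : R => fun p => posP p + velP p) by exact: PC_add.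
apply: telegraph_classical.
- exact: PC_add.
- move=> p p0; rewrite (telegraphD mu nu2 p P1 Pduh) (telegraphD mu nu2 p Ppos Pvl).
  have -> : telegraph mu nu2 posP p = 0 by exact: (posS_eq mu nu2 nE Pu0 0 p0).
  have -> : telegraph mu nu2 velP p = 0.
    by apply: (velS_eq mu nu2 nE cz Pvel); rewrite /zero lexx.
  rewrite (duhamel_eq Psrc src_eq src0 srct0 p0) !add0r /fpos.
  by congr f; apply/max_idPl.
- move=> x; rewrite /telegraph_solution /posP posS0 // /velP velS0// /duhamel oint_aa !addr0.
  by [].
move=> x; have d1 := PC_isD (0 : R) et (0, x) (PC_S Ppos); have d2 := PC_isD (0 : R) et (0, x) (PC_S Pvl).
rewrite (dvE (dv_add (dv_add d1 d2) (duhamel_dv Psrc src0 (0, x) et))) oint_aa addr0.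
rewrite /posP (posS_t0 mu nu2 nE Pu0) /velP (velS_t0 mu nu2 nE cz Pvel) //= /vel.
by ring.
Qed.

(** Each of the three complex integrals is 2^(sqrt delta - 1) times a real one, which the prefactor
    cancels; the real integrals are those of [posS], [velS_formula] and Duhamel's principle. *)
Lemma telegraph_solution_formula t x : 0 <= t ->
  ((telegraph_solution (t, x))%:C)%C = solution_formula mu nu2 f u0 u1 t x.
Proof.
move=> t0; rewrite /solution_formula /=; set C2 := cpow 2 _.
have C0 : C2 != 0 by exact: cpow_neq0.
have hu : PC h.+1 (fun (_ : R) x => u0 x) by exact: PC_S (PC_S Pu0).
have W0 s : 0 <= s -> wave u0 s x = dd et (waveS h (fun (_ : R) x => u0 x) 0) (s, x).
  by move=> s0; exact: (wave_waveS nE (phi := fun (_ : R) x => u0 x) (0 : R) x hu s0).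
have W1 s : 0 <= s -> wave (fun z => u1 z + mu * u0 z) s x = dd et (waveS h vel 0) (s, x).
  by move=> s0; exact: (wave_waveS nE (phi := vel) (0 : R) x (PC_S Pvel) s0).
have Wf b s : 0 <= b -> 0 <= s -> wave (f b) s x = dd et (waveS h fpos b) (s, x).
  move=> b0 s0; rewrite -(wave_waveS nE b x (PC_S Pf) s0) /fpos.
  by rewrite (max_idPl b0).
have PW (phi : R -> V -> R) l : PC h.+1 phi -> continuous (fun s : R => dd et (waveS h phi l) (s, x)).
  rewrite -(addn1 h) => /(PC_waveS (n := n)) H; have H2 := PC_Dv et H.
  by apply: (ct_comp (PC_contp (l := l) H2) (a := fun s : R => (s, x))); ctn.
have cG (b : R) : continuous (fun s : R => G (t, (s, b))).
  have HG : PC 0 (fun (_ : R) q => G q) by exact: PC_riemG.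
  by apply: (ct_comp (PC_contp (l := (0 : R)) HG) (a := fun s : R => (t, (s, b)))); ctn.
have cK : continuous (fun s : R => ker0 a m 0 (t, s)).
  by apply: (ct_comp (PC_contp (l := (0 : R)) (PC_ker0 a m)) (a := fun s : R => (t, s))); ctn.
have cW0 := PW _ 0 hu; have cW1 := PW _ 0 (PC_S Pvel); have cWf b := PW _ b (PC_S Pf).
rewrite (cintegral_scale (z := C2) (r := fun s => dd et (waveS h (fun (_ : R) x => u0 x) 0) (s, x) *
  - ((1 + t) `^ (- m) * ker0 a m 0 (t, s)))) //; last 2 first.
- by ctn.
- by move=> s st; have /andP[s0 _] := st; rewrite W0// kernelK0_ker0// mulrCA -rmorphM.
rewrite (cintegral_scale (z := C2) (r := fun s => dd et (waveS h vel 0) (s, x) *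
  ((1 + t) `^ (- m) * (1 + 0) `^ m * G (t, (s, 0))))) //; last 2 first.
- by ctn.
- move=> s st; have /andP[s0 _] := st; have O : Om (t, (s, 0)) by apply: Om_region => //; rewrite subr0.
  by rewrite W1// /kernelK1 (kernelE_riemG mu nu2 O) mulrCA -rmorphM.
rewrite (cintegral_scale (z := C2) (r := fun b => srcP b (t, x))) //; last 2 first.
- by apply: (ct_comp (PC_cont Psrc) (a := fun b : R => (b, (t, x)))); ctn.
- move=> b /andP[b0 bt]; rewrite (@cintegral_scale R _ C2 (fun s => dd et (waveS h fpos b) (s, x) *
    ((1 + t) `^ (- m) * (1 + b) `^ m * G (t, (s, b))))).
  + by rewrite /srcP (velS_formula x cid Pf) //= b0.
  + by rewrite subr_ge0.
  + by ctn.
  move=> s st; have /andP[s0 _] := st.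
  by rewrite Wf// (kernelE_riemG mu nu2 (Om_region b0 st)) mulrCA -rmorphM.
rewrite !mul1r !mulKf// -!rmorphD /=; congr (_%:C)%C.
rewrite /telegraph_solution /duhamel /=; congr (_ + _ + _).
  rewrite /posP /posS /conj /voltS /volt /moving /= !subr0 mul1r weight_id /=; last by lra.
  rewrite W0//.
  have -> : (fun s => dd et (waveS h (fun (_ : R) x => u0 x) 0) (s, x) * - ((1 + t) `^ (- m) * ker0 a m 0 (t, s)))
    = fun s => - (1 + t) `^ (- m) * (dd et (waveS h (fun (_ : R) x => u0 x) 0) (s, x) * ker0 a m 0 (t, s)).
    by apply/funext => s; ring.
  rewrite oint_scale; last by ctn.
  by rewrite mulrBr mulNr.
by rewrite /velP (velS_formula x cz Pvel) /zero ?subr0// lexx.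
Qed.

End Assembly.

Theorem theorem1p3 (R : realType) (n : nat) (n_ge2 : (2 <= n)%N)
    (n_even : ~~ odd n) (mu nu2 : R) (mu_ge0 : 0 <= mu) (nu2_ge0 : 0 <= nu2)
    (f : R -> 'rV[R]_n -> R) (u0 u1 : 'rV[R]_n -> R)
    (hf : Ck (n %/ 2 + 1) (@half_space R n) (fun p => f p.1 p.2))
    (hu0 : Ck (n %/ 2 + 2) [set: 'rV[R]_n] u0)
    (hu1 : Ck (n %/ 2 + 1) [set: 'rV[R]_n] u1) :
  exists u : R -> 'rV[R]_n -> R,
    [/\ forall t x, 0 <= t -> (u t x)%:C = solution_formula mu nu2 f u0 u1 t x,
        classical_solution mu nu2 f u0 u1 u
      & forall v : R -> 'rV[R]_n -> R, classical_solution mu nu2 f u0 u1 v ->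
          forall t x, 0 <= t -> v t x = u t x].
Proof.
have [h nE] : exists h, n = h.*2.+2.
  (* The number h = n/2 - 1 of ladder steps also makes n/2 + 1 = h + 2 and n/2 + 2 = h + 3. *)
  by exists (n./2.-1); rewrite -doubleS prednK ?half_gt0// even_halfK.
have n2 : (n %/ 2)%N = h.+1 by rewrite divn2 nE -doubleS doubleK.
rewrite n2 addn1 in hf hu1; rewrite n2 addn2 in hu0.
have S := telegraph_solution_classical mu nu2 nE hf hu0 hu1.
exists (fun t x => telegraph_solution h mu nu2 f u0 u1 (t, x)); split => //.
  by move=> t x t0; exact: telegraph_solution_formula.
move=> v Sv t x t0; apply: (classical_solution_unique _ mu_ge0 nu2_ge0 Sv S) => //.
exact: leq_trans n_ge2.
Qed.
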